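(* Let $(M,g)$ be a globally hyperbolic manifold with regular cosmological time $\tau$, and let $d(\cdot,\cdot;\tau)$ be the null distance of $\tau$. Let $(\gamma_i:[0,b_i)\to M)_{i\in\mathbb{N}}$, $b_i\in\mathbb{R}^+\cup\{\infty\}$, be any sequence of past directed inextendible continuous causal curves so that $\gamma_i(0)\to x\in M$. For each $i$ let $a_i=\lim_{t\to b_i}\big(\tau(\gamma_i(0))-\tau(\gamma_i(t))\big)$ and let $s_i:[0,a_i)\to[0,b_i)$ be the change of parameter with $\tau(\gamma_i(s_i(t)))=\tau(\gamma_i(0))-t$. Let $\gamma:[0,a)\to M$ be the limit curve constructed from the sequence $(\gamma_i\circ s_i)_i$ by the limit-curve construction described in the context (with respect to $d(\cdot,\cdot;\tau)$), and let $(\gamma_{i_k}\circ s_{i_k})_k$ be the subsequence produced by that construction, which $d(\cdot,\cdot;\tau)$-converges uniformly on compacta to $\gamma$. Then 1. both sequences $(L(\gamma_{i_k}\circ s_{i_k}))_k$ and $(a_{i_k})_k$ are bounded above, and 2. $\limsup_k a_{i_k}=a$.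
   Context: Manifolds are smooth, Hausdorff, paracompact; Lorentzian metrics are smooth with signature $(-,+,\dots,+)$ and $M$ is time-oriented. A continuous curve $\gamma:I\to M$ is future directed causal if each $t\in I$ has a neighbourhood $J\subset I$ and a convex normal neighbourhood $U$ of $\gamma(t)$ with $\gamma(J)\subset U$ such that for all $t_1<t_2$ in $J$, $\gamma(t_1)\ne\gamma(t_2)$ and the geodesic in $U$ from $\gamma(t_1)$ to $\gamma(t_2)$ is future directed causal; past directed is dual. A past directed causal $\gamma:[0,b)\to M$ is inextendible if $\gamma(t)$ has no limit in $M$ as $t\to b$. Every causal curve can be reparametrised to be locally Lipschitz in charts, and then on a compact interval its Lorentzian length is $L(\gamma)=\int\sqrt{-g(\gamma',\gamma')}\,dt$; on an arbitrary interval $I$, $L(\gamma)=\sup\{L(\gamma|_{[u,v]}):u,v\in I,\ u<v\}$. $d_L$ is the Lorentzian distance: $d_L(y,x)$ is the supremum of Lorentzian lengths of future directed causal curves from $y$ to $x$ (and $0$ if there are none). The cosmological time is $\tau(x)=\sup\{d_L(y,x):y\in I^-(x)\}$. It is regular if $\tau(x)<\infty$ for all $x\in M$ and $\lim_t\tau(\gamma(t))=0$ along every past directed inextendible causal curve $\gamma$. Null distance: an alternating causal curve is a continuous, piecewise smooth $\beta:[u,v]\to M$ with a finite partition $u=t_1<\dots<t_k=v$ such that each $\beta|_{[t_i,t_{i+1}]}$ is a smooth future or past directed causal curve; $L(\beta;\tau)=\sum_{i=1}^{k-1}|\tau(\beta(t_{i+1}))-\tau(\beta(t_i))|$; and $d(p,q;\tau)=\inf\{L(\beta;\tau):\beta\text{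 an alternating causal curve from }p\text{ to }q\}$. Curves $\beta_k:[0,c_k)\to M$ with $\beta_k(0)\to x$ $d$-converge uniformly on compacta to $\gamma:[0,a)\to M$ if $\gamma(0)=x$ and for all $\delta<a$ there is $N_\delta$ such that $k\ge N_\delta$ implies $c_k>\delta$, and $(\beta_k|_{[0,\delta]})_{k\ge N_\delta}$ converges uniformly to $\gamma|_{[0,\delta]}$ with respect to $d$. Limit-curve construction. Write $d=d(\cdot,\cdot;\tau)$ and $\sigma_i=\gamma_i\circ s_i:[0,a_i)\to M$; these satisfy $d(\sigma_i(t_1),\sigma_i(t_2))=|t_1-t_2|$. Let $\{K_j\}_{j\in\mathbb{N}}$ be a compact exhaustion of $M$ with $x\in K_1$. (i) If some $K_j$ contains the images of all $\sigma_i$ with $i$ large, put $a=\limsup_i a_i$ and $f_i(t)=a_it/a$; by Arzelà–Ascoli choose a subsequence with $a_{i_k}\to a$ and $\sigma_{i_k}\circ f_{i_k}$ converging uniformly on compact sets, with limit $\gamma$. (ii) Otherwise, pass to a subsequence and arrange that $\sigma_i(0)\in K_1$ for all $i$, that every $\sigma_i$ meets every $K_j$, and that $d(K_j,M\setminus K_{j+1})>0$ for all $j$. Let $a_i^j$ be such that $\sigma_i|_{[0,a_i^j]}$ is the connected component of $\sigma_i\cap K_j$ containing $\sigma_i(0)$. With $h_0(i)=i$, inductively for $j\ge1$ put $a^j=\limsup_i a^j_{h_{j-1}(i)}<\infty$ and $f^j_i(t)=a_i^jt/a^j$ on $[0,a^j]$, and use Arzelà–Ascoli to choose a further subsequence,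 indexed by $h_j$, of the one indexed by $h_{j-1}$, with $\lim_i a^j_{h_j(i)}=a^j$ and $\sigma_{h_j(i)}\circ f^j_{h_j(i)}$ converging uniformly on $[0,a^j]$ to a curve $\gamma^j:[0,a^j]\to K_j$. Each $\gamma^j$ is a subcurve of $\gamma^{j+1}$; put $a=\lim_j a^j$, $\gamma(t)=\gamma^j(t)$ for any $j$ with $t<a^j$, and $i_k=h_k(k)$. The resulting $\gamma:[0,a)\to M$ is continuous with $\gamma(0)=x$, $a\in(0,\limsup_i a_i]$, $a\le\limsup_k a_{i_k}$, and $(\sigma_{i_k})_k$ $d$-converges uniformly on compacta to $\gamma$. *)

(* Defs.v *)
From HB Require Import structures.
From mathcomp Require Import all_boot all_order all_algebra.
From mathcomp Require Import all_classical all_reals all_analysis.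

Set Implicit Arguments.
Unset Strict Implicit.
Unset Printing Implicit Defensive.
Import Order.TTheory GRing.Theory Num.Theory.
Import numFieldNormedType.Exports.

Local Open Scope classical_set_scope.
Local Open Scope ring_scope.

Section Preliminaries.
Variable R : realType.

(* C^infinity on an open set U: every iterated directional derivative is
   differentiable (hence continuous) at every point of U. *)
Definition smooth_on (V W : normedModType R) (U : set V) (f : V -> W) :=
  forall (vs : seq V) (x : V), U x ->
    differentiable (foldr (fun v (h : V -> W) => 'D_v h) f vs) x.

Definition paracompact (M : topologicalType) :=
  forall C : set (set M),
    C `<=` open -> \bigcup_(U in C) U = setT ->
    exists D : set (set M),
      [/\ D `<=` open, \bigcup_(V in D) V = setT,
          forall V, D V -> exists2 U, C U & V `<=` U &
          forall p : M, exists2 W, nbhs p W &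
            finite_set [set V | D V /\ V `&` W !=set0] ].

(* [0, b) for b in ]0, +oo], and the filter "t -> b". *)
Definition ico0 (b : \bar R) : set R := [set t | 0 <= t /\ (t%:E < b)%E].

Definition at_end (b : \bar R) : set_system R :=
  if b is r%:E then at_left r else pinfty_nbhs R.

Definition strictly_increasing (h : nat -> nat) := {homo h : i j / (i < j)%N}.

(* Increasing bijections between intervals are homeomorphisms. *)
Definition change_of_parameter (A B : set R) (s : R -> R) :=
  set_bij A B s /\ {in A &, {homo s : t1 t2 / t1 < t2}}.

Definition is_partition (k : nat) (t : nat -> R) (u v : R) :=
  [/\ t 0%N = u, t k = v & forall m, (m < k)%N -> t m < t m.+1].

End Preliminaries.

(* A time-oriented Lorentzian manifold of dimension n+2 on the space M, given
   by an atlas (not necessarily maximal).  Tangent vectors at p are given by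
   their components in a chart around p; the metric and the time orientation
   (a continuous timelike vector field) are given by their components in every
   chart, subject to the tensor transformation rules. *)
Record spacetime (R : realType) (n : nat) (M : topologicalType) := Spacetime {
  chart : Type;
  dom : chart -> set M;
  coord : chart -> M -> 'rV[R]_n.+2;
  param : chart -> 'rV[R]_n.+2 -> M;
  metric : chart -> M -> 'M[R]_n.+2;
  torient : chart -> M -> 'rV[R]_n.+2;

  space_hausdorff : hausdorff_space M;
  space_paracompact : paracompact M;

  dom_cover : forall p, exists i, dom i p;
  dom_open : forall i, open (dom i);
  coord_open : forall i, open (coord i @` dom i);
  coordK : forall i p, dom i p -> param i (coord i p) = p;
  coord_cont : forall i p, dom i p -> {for p, continuous (coord i)};
  param_cont : forall i y, (coord i @` dom i) y ->
    {for y, continuous (param i)};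
  transition_smooth : forall i j,
    smooth_on (coord i @` (dom i `&` dom j)) (coord j \o param i);

  metric_smooth : forall i, smooth_on (coord i @` dom i) (metric i \o param i);
  metric_sym : forall i p, dom i p -> (metric i p)^T = metric i p;
  metric_signature : forall i p, dom i p ->
    exists2 P : 'M[R]_n.+2, P \in unitmx &
      P *m metric i p *m P^T =
      diag_mx (\row_k (if k == ord0 then -1 else 1));
  metric_change : forall i j p, dom i p -> dom j p ->
    forall v w : 'rV[R]_n.+2,
      let T : 'rV[R]_n.+2 -> 'rV[R]_n.+2 :=
        'd (coord j \o param i) (coord i p) in
      v *m metric i p *m w^T = T v *m metric j p *m (T w)^T;

  torient_cont : forall i p, dom i p -> {for p, continuous (torient i)};
  torient_timelike : forall i p, dom i p ->
    (torient i p *m metric i p *m (torient i p)^T) 0 0 < 0;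
  torient_change : forall i j p, dom i p -> dom j p ->
    torient j p = 'd (coord j \o param i) (coord i p) (torient i p)
}.

Section Lorentz.
Variables (R : realType) (n : nat) (M : topologicalType).
Variable S : spacetime R n M.

Local Notation E := 'rV[R]_n.+2.
Local Notation chart := (chart S).

Definition gform (i : chart) (p : M) (v w : E) : R :=
  (v *m metric i p *m w^T) 0 0.

Definition future_causal (i : chart) (p : M) (v : E) : Prop :=
  [/\ v != 0, gform i p v v <= 0 & gform i p (torient i p) v < 0].
Definition past_causal (i : chart) (p : M) (v : E) : Prop :=
  future_causal i p (- v).
Definition future_timelike (i : chart) (p : M) (v : E) : Prop :=
  gform i p v v < 0 /\ gform i p (torient i p) v < 0.

(* Smoothness, on an open subset O of a normed space, of a map into M. *)
Definition smooth_map (V : normedModType R) (O : set V) (c : V -> M) :=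
  (forall t, O t -> {for t, continuous c}) /\
  forall i : chart, smooth_on (O `&` c @^-1` dom i) (coord i \o c).

Definition velocity (i : chart) (c : R -> M) : R -> E := derive1 (coord i \o c).

(* A smooth map on [u, v] is one that extends smoothly to an open set; the
   predicate Q constrains the velocity, endpoints included. *)
Definition smooth_segment (Q : chart -> M -> E -> Prop) (u v : R)
    (beta : R -> M) :=
  exists (O : set R) (c : R -> M),
    [/\ open O, `[u, v] `<=` O, smooth_map O c,
        forall t, t \in `[u, v] -> c t = beta t &
        forall t i, t \in `[u, v] -> dom i (c t) ->
          Q i (c t) (velocity i c t)].

(* Gamma^k_ab = 1/2 g^kl (d_a g_bl + d_b g_al - d_l g_ab) at p, in chart i *)
Definition dmetric (i : chart) (p : M) (a b c : 'I_n.+2) : R :=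
  'D_(delta_mx 0 a) (fun y : E => metric i (param i y) b c) (coord i p).

Definition christoffel (i : chart) (p : M) (k a b : 'I_n.+2) : R :=
  2^-1 * \sum_l invmx (metric i p) k l *
    (dmetric i p a b l + dmetric i p b a l - dmetric i p l a b).

Definition geodesic (O : set R) (c : R -> M) :=
  smooth_map O c /\
  forall (i : chart) (t : R), O t -> dom i (c t) -> forall k : 'I_n.+2,
    derive1 (velocity i c) t 0 k +
    \sum_a \sum_b christoffel i (c t) k a b *
      velocity i c t 0 a * velocity i c t 0 b = 0.

(* U is the diffeomorphic image, under exp_p, of a star-shaped open
   neighbourhood N of 0 in T_p M; T_p M is identified with E by a chart, and e
   is exp_p on N. *)
Definition normal_nbhd (p : M) (U : set M) :=
  exists (i : chart) (N : set E) (e : E -> M) (l : M -> E),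
    [/\ dom i p, open N, N 0 &
        forall v (t : R), N v -> 0 <= t <= 1 -> N (t *: v)] /\
    (forall v, N v ->
       [/\ geodesic [set t : R | N (t *: v)] (fun t => e (t *: v)),
           e 0 = p & velocity i (fun t => e (t *: v)) 0 = v]) /\
    [/\ set_bij N U e, (forall v, N v -> l (e v) = v), smooth_map N e &
        forall j : chart, smooth_on (coord j @` (dom j `&` U)) (l \o param j)].

Definition convex_normal (U : set M) :=
  open U /\ forall p, U p -> normal_nbhd p U.

(* For U convex normal, the geodesic in U from p to q exists and is unique up
   to affine reparametrisation; Q constrains its velocity. *)
Definition geodesic_in (Q : chart -> M -> E -> Prop) (U : set M) (p q : M) :=
  exists (O : set R) (c : R -> M),
    [/\ open O, `[0, 1] `<=` O, geodesic O c & c 0 = p /\ c 1 = q] /\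
    forall t, t \in `[0, 1] ->
      U (c t) /\ forall i, dom i (c t) -> Q i (c t) (velocity i c t).

Definition directed_curve (Q : chart -> M -> E -> Prop) (I : set R)
    (gamma : R -> M) :=
  {within I, continuous gamma} /\
  forall t, I t -> exists (J : set R) (U : set M),
    [/\ J `<=` I, within I (nbhs t) J, convex_normal U, U (gamma t) &
        gamma @` J `<=` U] /\
    forall t1 t2, J t1 -> J t2 -> t1 < t2 ->
      gamma t1 <> gamma t2 /\ geodesic_in Q U (gamma t1) (gamma t2).

Definition future_causal_curve := directed_curve future_causal.
Definition past_causal_curve := directed_curve past_causal.

Definition past_inextendible (b : \bar R) (gamma : R -> M) :=
  past_causal_curve (ico0 b) gamma /\ ~ exists q : M, gamma @ at_end b --> q.

Definition locally_lipschitz_in_charts (I : set R) (c : R -> M) :=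
  forall t (i : chart), I t -> dom i (c t) ->
    exists2 J, within I (nbhs t) J &
      (forall s, (I `&` J) s -> dom i (c s)) /\
      [lipschitz (coord i (c s)) | s in I `&` J].

(* sqrt (- g(c', c')), independent of the chart wherever c is derivable. *)
Definition speed (c : R -> M) (t : R) : R :=
  Num.sqrt (- get [set r | exists i : chart,
    [/\ dom i (c t), derivable (coord i \o c) t 1 &
        r = gform i (c t) (velocity i c t) (velocity i c t)]]).

(* l is the length of gamma on [u, v], computed in some locally Lipschitz
   parametrisation (it does not depend on which). *)
Definition is_length (gamma : R -> M) (u v : R) (l : \bar R) :=
  exists (u' v' : R) (r : R -> R),
    [/\ u' < v', change_of_parameter `[u', v'] `[u, v] r,
        locally_lipschitz_in_charts `[u', v'] (gamma \o r) &
        l = (\int[lebesgue_measure]_(t in `[u', v'])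
               (speed (gamma \o r) t)%:E)%E].

Definition lorentz_length (I : set R) (gamma : R -> M) : \bar R :=
  ereal_sup [set l | exists u v : R, [/\ I u, I v, u < v &
    is_length gamma u v l]].

Definition lorentz_dist (y x : M) : \bar R :=
  ereal_sup ([set 0%E] `|` [set l | exists (u v : R) (beta : R -> M),
    [/\ u < v, future_causal_curve `[u, v] beta, beta u = y, beta v = x &
        l = lorentz_length `[u, v] beta]]).

Definition piecewise (P : R -> R -> (R -> M) -> Prop) (k : nat)
    (t : nat -> R) (u v : R) (beta : R -> M) :=
  [/\ {within `[u, v], continuous beta}, is_partition k t u v &
      forall m, (m < k)%N -> P (t m) (t m.+1) beta].

Definition chron_past (x : M) : set M :=
  [set y | exists (u v : R) (beta : R -> M) (k : nat) (t : nat -> R),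
    [/\ u < v, piecewise (smooth_segment future_timelike) k t u v beta,
        beta u = y & beta v = x]].

Definition causal_le (y x : M) :=
  y = x \/ exists (u v : R) (beta : R -> M),
    [/\ u < v, future_causal_curve `[u, v] beta, beta u = y & beta v = x].

Definition strongly_causal :=
  forall (p : M) (U : set M), nbhs p U ->
    exists V : set M, [/\ nbhs p V, V `<=` U &
      forall (u v : R) (beta : R -> M), u < v ->
        future_causal_curve `[u, v] beta -> V (beta u) -> V (beta v) ->
        beta @` `[u, v] `<=` U].

Definition globally_hyperbolic :=
  strongly_causal /\
  forall p q, compact [set z | causal_le p z /\ causal_le z q].

Definition cosmological_time (x : M) : \bar R :=
  ereal_sup [set lorentz_dist y x | y in chron_past x].

Definition regular_cosmological_time :=
  (forall x, (cosmological_time x < +oo)%E) /\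
  forall (b : \bar R) (gamma : R -> M), (0 < b)%E ->
    past_inextendible b gamma ->
    cosmological_time (gamma t) @[t --> at_end b] --> 0%E.

Definition alternating_segment (u v : R) (beta : R -> M) :=
  smooth_segment future_causal u v beta \/ smooth_segment past_causal u v beta.

(* The infimum of the empty set, i.e. the distance between points that are not
   joined by an alternating causal curve, is +oo. *)
Definition null_dist (tau : M -> R) (p q : M) : \bar R :=
  ereal_inf [set l | exists (u v : R) (beta : R -> M) (k : nat) (t : nat -> R),
    [/\ piecewise alternating_segment k t u v beta, beta u = p, beta v = q &
        l = (\sum_(m < k) `|tau (beta (t m.+1)) - tau (beta (t m))|)%:E]].

End Lorentz.

Section LimitCurve.
Variables (R : realType) (M : topologicalType) (d : M -> M -> \bar R).

Definition unif_cvg_on (A : set R) (f : nat -> R -> M) (g : R -> M) :=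
  forall eps : R, 0 < eps ->
    \forall k \near \oo, forall t, A t -> (d (f k t) (g t) < eps%:E)%E.

Definition compact_exhaustion (K : nat -> set M) :=
  [/\ forall j, compact (K j), forall j, K j `<=` (K j.+1)^° &
      \bigcup_j K j = setT].

(* The data of the construction are curves sigma i : [0, a_ i) -> M and the
   point x; its output is gamma : [0, a) -> M and the index sequence idx. *)
Variables (sigma : nat -> R -> M) (a_ : nat -> R) (x : M).
Variables (gamma : R -> M) (a : \bar R) (idx : nat -> nat).

Definition eventually_contained (K : nat -> set M) :=
  exists j, \forall i \near \oo, sigma i @` ico0 (a_ i)%:E `<=` K j.

Definition limit_curve_contained :=
  [/\ a \is a fin_num, a = limn_esup (fun i => (a_ i)%:E),
      strictly_increasing idx, (a_ (idx k))%:E @[k --> \oo] --> a &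
      forall C : set R, compact C -> C `<=` ico0 a ->
        unif_cvg_on C
          (fun k t => sigma (idx k) (a_ (idx k) * t / fine a)) gamma].

(* e is the preliminary subsequence; alev j i, alim j, gam j, h j stand for
   a_i^j, a^j, gamma^j, h_j, which are used for j >= 1 only, except for
   h 0 = id.  The indices i of alev refer to the sequence sigma \o e. *)
Definition limit_curve_escaping (K : nat -> set M) :=
  exists (e : nat -> nat) (alev : nat -> nat -> R) (h : nat -> nat -> nat)
         (alim : nat -> R) (gam : nat -> R -> M),
    [/\ strictly_increasing e,
        forall i, K 1%N (sigma (e i) 0),
        forall i j, (0 < j)%N ->
          exists2 t, ico0 (a_ (e i))%:E t & K j (sigma (e i) t),
        forall j, (0 < j)%N ->
          (0 < ereal_inf [set d p.1 p.2 | p in K j `*` ~` K j.+1])%E &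
        forall i j, (0 < j)%N ->
          connected_component
            (ico0 (a_ (e i))%:E `&` sigma (e i) @^-1` K j) 0 =
          `[0, alev j i]%classic] /\
    h 0%N = id /\
    (forall j,
      [/\ (alim j.+1)%:E = limn_esup (fun i => (alev j.+1 (h j i))%:E),
          exists2 psi, strictly_increasing psi & h j.+1 = h j \o psi,
          alev j.+1 (h j.+1 i) @[i --> \oo] --> alim j.+1,
          unif_cvg_on `[0, alim j.+1]
            (fun i t => sigma (e (h j.+1 i))
               (alev j.+1 (h j.+1 i) * t / alim j.+1)) (gam j.+1) &
          gam j.+1 @` `[0, alim j.+1] `<=` K j.+1]) /\
    [/\ (alim j)%:E @[j --> \oo] --> a,
        forall j t, (0 < j)%N -> 0 <= t < alim j -> gamma t = gam j t &
        forall k, idx k = e (h k k)].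

Definition limit_curve_construction :=
  exists K : nat -> set M,
    [/\ compact_exhaustion K, K 1%N x &
        (eventually_contained K /\ limit_curve_contained) \/
        (~ eventually_contained K /\ limit_curve_escaping K)].

End LimitCurve.

(* Main.v *)
Require Import Defs.
From HB Require Import structures.
From mathcomp Require Import all_boot all_order all_algebra.
From mathcomp Require Import all_classical all_reals all_analysis.
From mathcomp Require Import measurable_realfun ring lra.
(* Imported again because [coord] is also a name of MathComp's vector.v. *)
Require Import Defs.
Set Implicit Arguments.
Unset Strict Implicit.
Unset Printing Implicit Defensive.
Import Order.TTheory GRing.Theory Num.Theory.
Import numFieldNormedType.Exports.
Local Open Scope classical_set_scope.
Local Open Scope ring_scope.

(* Regularity of tau gives a_i = tau(gamma_i(0)).  Fix z in the chronological future of x.  For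
   large i also gamma_i(0) << z, and extending gamma_i up to z bounds both its length and a_i by
   tau(z).

   In the escaping case |tau(p) - tau(q)| <= d(p, q) gives a_{i_k} -> T := tau(gamma(0)), and a <= T.
   If a < T, the points q^j_k at which sigma_{i_k} leaves K_j have tau >= eps for large j, and
   q^{j+1}_k causally precedes q^j_k.  Let p_j in K_j be their limits along an ultrafilter.  Since
   causal diamonds are compact, p_j << z yields some z' << z with p_{j+1} << z' and z' outside K_j.
   This produces a chain ... << z_2 << z_1 << z_0 leaving every compact set along which
   tau >= eps.  Joining its points gives a past inextendible causal curve along which tau does not
   tend to 0, a contradiction.

   The local facts used (push-up, openness of <<, and the equivalence of the
   causality of continuous curves with a condition that survives concatenation) come from convex balls of the
   exponential map of a single chart, on which Gauss' lemma controls causal curves. *)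

(** * Functions of class C^k *)

(** The limit curve itself is never analysed: only its starting point, the numbers [alim j] and the
    exit points of the approximating curves enter. The limits [p j] of exit points are related only
    causally and [tau] is not known to be continuous, whereas chronology is an open relation. Hence
    the auxiliary chain [z m]: its members can be joined by curves, and each inherits the lower
    bound from some [q m k] in its past, because cosmological time is monotone.

    The obstacle behind most of the text is that a continuous causal curve is defined through
    geodesics in neighbourhoods that vary with the parameter, a condition not visibly stable under
    concatenation. It is traded for a transitive local relation, and the comparison takes convex
    neighbourhoods in which the ends of a smooth causal curve are joined by a causal geodesic. Such
    a neighbourhood must be a diffeomorphic image under the exponential map at each of its points;
    this is why smooth dependence of flows on initial data and smooth inverse functions are
    developed. *)

Section LineDerivatives.
Variables (R : realType) (V : normedModType R).
Implicit Types (f g : V -> R) (x v : V).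

Lemma is_derive_line (W : normedModType R) (f : V -> W) x v (s : R) :
  derivable f (x + s *: v) v ->
  is_derive s (1 : R) (fun t : R => f (x + t *: v)) ('D_v f (x + s *: v)).
Proof.
have E : (fun h : R => h^-1 *: (((fun t : R => f (x + t *: v)) \o shift s) (h *: 1) -
    f (x + s *: v))) =
  (fun h => h^-1 *: ((f \o shift (x + s *: v)) (h *: v) - f (x + s *: v))).
  apply/funext => h /=; congr (_ *: (f _ - _)).
  by rewrite scaler1 scalerDl addrC -addrA; congr (_ + _); rewrite addrC.
by move=> df; split; rewrite /derivable /derive E.
Qed.

Lemma is_derive_scale_dir (W : normedModType R) (f : V -> W) x v (k : R) d :
  is_derive x v f d -> is_derive x (k *: v) f (k *: d).
Proof.
move=> df; have [->|k0] := eqVneq k 0.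
  by rewrite !scale0r; exact: is_derive0.
have H : (fun h => h^-1 *: ((f \o shift x) (h *: (k *: v)) - f x)) @ 0^' --> k *: d.
  have -> : (fun h => h^-1 *: ((f \o shift x) (h *: (k *: v)) - f x)) =
    (fun h => k *: ((h * k)^-1 *: ((f \o shift x) ((h * k) *: v) - f x))).
    apply/funext => h; rewrite /= !scalerA; congr (_ *: _).
    by rewrite invfM mulrCA mulfV// mulr1.
  apply: cvgZ; first exact: cvg_cst.
  have c : (fun h : R => h * k) @ 0^' --> 0^'.
    move=> A /= [e e0 eA].
    exists (e / `|k|) => /=; first by rewrite divr_gt0 ?normr_gt0.
    move=> h /=; rewrite sub0r normrN ltr_pdivlMr ?normr_gt0// -normrM => hk h0.
    by apply: eA; rewrite /= ?sub0r ?normrN// mulf_neq0.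
  have dv : (fun h => h^-1 *: ((f \o shift x) (h *: v) - f x)) @ 0^' --> d.
    have := @ex_derive _ _ _ _ _ _ _ df.
    by rewrite /derivable -(@derive_val _ _ _ _ _ _ _ df).
  exact: (cvg_comp _ _ c dv).
split; first by apply/cvg_ex; exists (k *: d).
exact: cvg_lim.
Qed.

Lemma derive_scale_dir f x v (k : R) :
  derivable f x v -> 'D_(k *: v) f x = k * 'D_v f x.
Proof.
move=> /derivableP df; have H := is_derive_scale_dir k df.
by rewrite (@derive_val _ _ _ _ _ _ _ H).
Qed.

Lemma MVT_line f x v :
  (forall s : R, 0 <= s <= 1 -> derivable f (x + s *: v) v) ->
  exists2 c : R, 0 < c < 1 & f (x + v) - f x = 'D_v f (x + c *: v).
Proof.
move=> df.
have d1 (s : R) : 0 <= s <= 1 -> is_derive s (1 : R) (fun t : R => f (x + t *: v)) ('D_v f (x + s *: v)).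
  by move=> /df; exact: is_derive_line.
have [|||c] := @MVT R (fun t => f (x + t *: v)) (fun s => 'D_v f (x + s *: v)) 0 1.
- by [].
- by move=> s; rewrite in_itv /= => /andP[s0 s1]; apply: d1; rewrite !ltW.
- apply: derivable_within_continuous => s; rewrite in_itv /= => H.
  exact: (@ex_derive _ _ _ _ _ _ _ (d1 _ H)).
rewrite in_itv /= => cI; rewrite scale1r scale0r addr0 subr0 mulr1 => E.
by exists c.
Qed.

End LineDerivatives.

Section Ck.
Variables (R : realType).

(* With the flag [bd] the function and its derivatives are bounded on [U] as well. *)
Definition Ck0 (V : normedModType R) (bd : bool) (U : set V) (f : V -> R) :=
  (forall x, U x -> {for x, continuous f}) /\
  (bd -> exists C : R, forall x, U x -> `|f x| <= C).

(** Only derivatives in fixed directions occur, so that closure properties are inductions on [k]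
    with the sum, product and chain rules. In finite dimension [smooth_on_Ck] and [Ck_smooth_on]
    link the notion for all [k] with [smooth_on]. *)
Fixpoint Ck (V : normedModType R) (bd : bool) (k : nat) (U : set V) (f : V -> R)
    : Prop :=
  Ck0 bd U f /\
  if k is k'.+1 then
    forall v, (forall x, U x -> derivable f x v) /\ Ck bd k' U ('D_v f)
  else True.

Section Closure.
Variables (V : normedModType R) (bd : bool) (U : set V).
Hypothesis oU : open U.
Implicit Types (f g : V -> R) (k : nat).

Lemma Ck_Ck0 k f : Ck bd k U f -> Ck0 bd U f.
Proof. by case: k => [|k] []. Qed.

Lemma Ck_cont k f x : Ck bd k U f -> U x -> {for x, continuous f}.
Proof. by move=> /Ck_Ck0[+ _]; apply. Qed.

Lemma CkS_derivable k f x v : Ck bd k.+1 U f -> U x -> derivable f x v.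
Proof. by move=> [_ /(_ v)[+ _]]; apply. Qed.

Lemma CkS_derive k f v : Ck bd k.+1 U f -> Ck bd k U ('D_v f).
Proof. by move=> [_ /(_ v)[]]. Qed.

Lemma CkW k f : Ck bd k.+1 U f -> Ck bd k U f.
Proof.
elim: k f => [|k ih] f; first by case.
move=> [f0 fS]; split=> // v; have [dv cv] := fS v; split => //.
exact: ih.
Qed.

Lemma Ck_le k l f : (k <= l)%N -> Ck bd l U f -> Ck bd k U f.
Proof.
elim: l => [|l ih]; first by rewrite leqn0 => /eqP ->.
rewrite leq_eqVlt => /orP[/eqP ->//|]; rewrite ltnS => kl /CkW; exact: ih.
Qed.

Lemma near_open f g x : (forall y, U y -> f y = g y) -> U x -> \near x, f x = g x.
Proof. by move=> fg Ux; near do apply: fg; exact: open_nbhs_nbhs. Unshelve. all: by end_near. Qed.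

Lemma Ck0_ext f g : (forall x, U x -> f x = g x) -> Ck0 bd U f -> Ck0 bd U g.
Proof.
move=> fg [cf bf]; split=> [x Ux|/bf[C fC]].
  rewrite /prop_for /continuous_at -(fg _ Ux); apply: cvg_trans (cf _ Ux).
  by apply: near_eq_cvg; exact: near_open.
by exists C => x Ux; rewrite -fg// fC.
Qed.

Lemma Ck_ext k f g : (forall x, U x -> f x = g x) -> Ck bd k U f -> Ck bd k U g.
Proof.
elim: k f g => [|k ih] f g fg [f0 fk]; (split; first exact: Ck0_ext f0) => // v.
have [df cf] := fk v; split=> [x Ux|].
  by apply: near_eq_derivable (df _ Ux); exact: near_open.
apply: ih cf => x Ux; apply: near_eq_derive; exact: near_open.
Qed.

Lemma Ck0_cst c : Ck0 bd U (fun _ => c).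
Proof. by split=> [x _|_]; [exact: cst_continuous|exists `|c|]. Qed.

Lemma Ck_cst k c : Ck bd k U (fun _ => c).
Proof.
elim: k c => [|k ih] c; (split; first exact: Ck0_cst) => // v.
split=> [x _|]; first exact: derivable_cst.
have -> : 'D_v (fun _ : V => c) = (fun _ => 0) by apply/funext => x; rewrite derive_cst.
exact: ih.
Qed.

Lemma Ck_add k f g : Ck bd k U f -> Ck bd k U g -> Ck bd k U (fun x => f x + g x).
Proof.
elim: k f g => [|k ih] f g [[cf bf] df] [[cg bg] dg].
  split=> //; split=> [x Ux|b]; first by apply: continuousD; [exact: cf|exact: cg].
  have [C fC] := bf b; have [D gD] := bg b; exists (C + D) => x Ux.
  by rewrite (le_trans (ler_normD _ _))// lerD ?fC ?gD.
split; first by split=> [x Ux|b];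
  [apply: continuousD; [exact: cf|exact: cg]
  |have [C fC] := bf b; have [D gD] := bg b; exists (C + D) => x Ux;
  by rewrite (le_trans (ler_normD _ _))// lerD ?fC ?gD].
move=> v; have [df1 cdf] := df v; have [dg1 cdg] := dg v; split=> [x Ux|].
  by apply: derivableD; [exact: df1|exact: dg1].
apply: Ck_ext (ih _ _ cdf cdg) => x Ux /=.
by rewrite -[fun x => f x + g x]/(f + g) deriveD//; [exact: df1|exact: dg1].
Qed.

Lemma Ck_mul k f g : Ck bd k U f -> Ck bd k U g -> Ck bd k U (fun x => f x * g x).
Proof.
elim: k f g => [|k ih] f g hf hg; have [cf bf] := Ck_Ck0 hf; have [cg bg] := Ck_Ck0 hg.
  split=> //; split=> [x Ux|b]; first by apply: continuousM; [exact: cf|exact: cg].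
  have [C fC] := bf b; have [D gD] := bg b; exists (C * D) => x Ux.
  by rewrite normrM ler_pM ?fC ?gD.
split; first by split=> [x Ux|b];
  [apply: continuousM; [exact: cf|exact: cg]
  |have [C fC] := bf b; have [D gD] := bg b; exists (C * D) => x Ux;
  by rewrite normrM ler_pM ?fC ?gD].
move=> v; split=> [x Ux|].
  by apply: derivableM; [exact: CkS_derivable hf _|exact: CkS_derivable hg _].
have h1 := ih _ _ (CkW hf) (CkS_derive v hg).
have h2 := ih _ _ (CkW hg) (CkS_derive v hf).
apply: Ck_ext (Ck_add h1 h2) => x Ux /=.
by rewrite -[fun x => f x * g x]/(f * g) deriveM//; [exact: CkS_derivable hf _|exact: CkS_derivable hg _].
Qed.

Lemma Ck_scale k c f : Ck bd k U f -> Ck bd k U (fun x => c * f x).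
Proof. by apply: Ck_mul; exact: Ck_cst. Qed.

Lemma Ck_opp k f : Ck bd k U f -> Ck bd k U (fun x => - f x).
Proof. by move=> /(Ck_scale (-1)); apply: Ck_ext => x _; rewrite mulN1r. Qed.

Lemma Ck_sub k f g : Ck bd k U f -> Ck bd k U g -> Ck bd k U (fun x => f x - g x).
Proof. by move=> hf /Ck_opp; exact: Ck_add. Qed.

Lemma Ck_sum k (I : Type) (r : seq I) (F : I -> V -> R) :
  (forall i, Ck bd k U (F i)) -> Ck bd k U (fun x => \sum_(i <- r) F i x).
Proof.
move=> h; elim: r => [|i r ih].
  by apply: Ck_ext (Ck_cst k 0) => x _; rewrite big_nil.
by apply: Ck_ext (Ck_add (h i) ih) => x _; rewrite big_cons.
Qed.

Lemma Ck_prod k (I : Type) (r : seq I) (F : I -> V -> R) :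
  (forall i, Ck bd k U (F i)) -> Ck bd k U (fun x => \prod_(i <- r) F i x).
Proof.
move=> h; elim: r => [|i r ih].
  by apply: Ck_ext (Ck_cst k 1) => x _; rewrite big_nil.
by apply: Ck_ext (Ck_mul (h i) ih) => x _; rewrite big_cons.
Qed.

Lemma Ck_linear k (f : {linear V -> R}) : continuous f ->
  (bd -> exists C : R, forall x, U x -> `|f x| <= C) -> Ck bd k U f.
Proof.
move=> cf bf; have dl x v : is_derive x v f (f v).
  have df : differentiable f x by exact: linear_differentiable.
  split; first exact: diff_derivable.
  by rewrite deriveE// diff_lin.
have f0 : Ck0 bd U f by split; [move=> x _; exact: cf|exact: bf].
case: k => [//|k]; split=> // v; split=> [x _|]; first exact: (@ex_derive _ _ _ _ _ _ _ (dl x v)).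
by apply: Ck_ext (Ck_cst k (f v)) => x _; rewrite derive_val.
Qed.

End Closure.

Lemma Ck_inv (V : normedModType R) (U : set V) k (f : V -> R) : open U ->
  (forall x, U x -> f x != 0) -> Ck false k U f -> Ck false k U (fun x => (f x)^-1).
Proof.
move=> oU f0; elim: k => [|k ih] hf; have [cf _] := Ck_Ck0 hf.
  split=> //; split=> // x Ux; apply: cvgV; [exact: f0|exact: cf].
split; first by split=> // x Ux; apply: cvgV; [exact: f0|exact: cf].
move=> v; split=> [x Ux|].
  by apply: derivableV; [exact: f0|exact: CkS_derivable hf _].
have h1 := ih (CkW hf).
apply: (Ck_ext oU) (Ck_mul oU (Ck_opp oU (Ck_mul oU h1 h1)) (CkS_derive v hf)) => x Ux /=.
rewrite -[fun x => (f x)^-1]/(fun y => (f y)^-1) deriveV//; [|exact: f0|exact: CkS_derivable hf _].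
by rewrite -expr2 exprVn.
Qed.

Lemma Ck_subset (V : normedModType R) bd k (U U' : set V) (f : V -> R) :
  U' `<=` U -> Ck bd k U f -> Ck bd k U' f.
Proof.
move=> UU'; elim: k f => [|k ih] f [[cf bf] df]; (split; first split).
- by move=> x /UU'; exact: cf.
- by move=> /bf[C fC]; exists C => x /UU'; exact: fC.
- by [].
- by move=> x /UU'; exact: cf.
- by move=> /bf[C fC]; exists C => x /UU'; exact: fC.
- by move=> v; have [d1 d2] := df v; split=> [x /UU'|]; [exact: d1|exact: ih].
Qed.

Lemma Ck_unbound (V : normedModType R) bd k (U : set V) (f : V -> R) :
  Ck bd k U f -> Ck false k U f.
Proof.
elim: k f => [|k ih] f [[cf bf] df]; split=> // v.
by have [d1 d2] := df v; split=> //; exact: ih.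
Qed.

End Ck.

Section C1.
Variable R : realType.

Lemma norm_rV_le p (v : 'rV[R]_p) (c : R) : 0 <= c ->
  (`|v| <= c) <-> (forall i, `|v 0 i| <= c).
Proof.
move=> c0; split=> [vc i|vc].
  apply: le_trans vc; rewrite [leRHS]/Num.Def.normr/= mx_normrE.
  exact: (le_bigmax _ (fun ij => `|v ij.1 ij.2|) (0, i)).
rewrite /Num.Def.normr/= mx_normrE; apply: bigmax_le => // -[i j] _ /=.
by rewrite ord1.
Qed.

Lemma coord_le_norm p (v : 'rV[R]_p) i : `|v 0 i| <= `|v|.
Proof. by move: i; apply/norm_rV_le. Qed.

Lemma near_close (T : topologicalType) (V : normedModType R) (f : T -> V) x (e : R) :
  {for x, continuous f} -> 0 < e -> \forall z \near x, `|f z - f x| <= e.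
Proof.
move=> cf e0; have /cvgrPdist_le /(_ e e0) : f @ x --> f x by exact: cf.
by apply: filterS => z; rewrite distrC.
Qed.

Definition lincomb p (a : 'I_p -> R) (h : 'rV[R]_p) : R := \sum_i h 0 i * a i.

Lemma lincomb_linear p (a : 'I_p -> R) : linear (lincomb a).
Proof.
move=> c u v; rewrite /lincomb /= scaler_sumr -big_split /=.
by apply: eq_bigr => i _; rewrite !mxE mulrDl -mulrA.
Qed.

Lemma continuous_lincomb p (a : 'I_p -> R) : continuous (lincomb a).
Proof.
rewrite /lincomb; elim: (index_enum _) => [|i r ih].
  have -> : (fun h : 'rV[R]_p => \sum_(i <- [::]) h 0 i * a i) = (fun _ => 0).
    by apply/funext => h; rewrite big_nil.
  exact: cst_continuous.
have -> : (fun h : 'rV[R]_p => \sum_(i <- i :: r) h 0 i * a i) =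
  (fun h => h 0 i * a i + \sum_(i <- r) h 0 i * a i).
  by apply/funext => h; rewrite big_cons.
have cc : continuous (fun h : 'rV[R]_p => h 0 i * a i).
  by move=> h; apply: continuousM; [exact: coord_continuous|exact: cst_continuous].
by move=> h; exact: (cvgD (cc h) (ih h)).
Qed.

(* Moving one coordinate at a time and applying the mean value theorem on each step. *)
Lemma C1_increment p (f : 'rV[R]_p -> R) (x y : 'rV[R]_p) (U : set 'rV[R]_p)
    (a : 'I_p -> R) (w : R) :
  (forall z : 'rV[R]_p, (forall i, (x 0 i <= z 0 i <= y 0 i) || (y 0 i <= z 0 i <= x 0 i)) -> U z) ->
  (forall (z : 'rV[R]_p) i, U z -> derivable f z (delta_mx 0 i)) ->
  (forall (z : 'rV[R]_p) i, U z -> `|'D_(delta_mx 0 i) f z - a i| <= w) ->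
  `|f y - f x - lincomb a (y - x)| <= p%:R * w * `|y - x|.
Proof.
move=> Uz df fa.
pose z (k : nat) : 'rV[R]_p := \row_i (if (i < k)%N then y 0 i else x 0 i).
have z0 : z 0%N = x by apply/rowP => i; rewrite mxE ltn0.
have zp : z p = y by apply/rowP => i; rewrite mxE ltn_ord.
suff H k : (k <= p)%N ->
    `|f (z k) - f x - \sum_(i < p | (i < k)%N) (y - x) 0 i * a i| <= k%:R * w * `|y - x|.
  have := H p (leqnn p); rewrite zp /lincomb.
  by rewrite (eq_bigl xpredT)// => i; rewrite ltn_ord.
elim: k => [_|k ih kp].
  by rewrite z0 subrr big_pred0 ?subr0 ?normr0 ?mul0r// => i; rewrite ltn0.
have {ih} := ih (ltnW kp).
pose j := Ordinal kp.
have zS : z k.+1 = z k + (y 0 j - x 0 j) *: delta_mx 0 j.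
  apply/rowP => i; rewrite !mxE /= ltnS leq_eqVlt.
  have [->|ij] := eqVneq i j; first by rewrite /= eqxx ltnn /= mulr1 addrC subrK.
  by have -> : (nat_of_ord i == k) = false;
    [apply/negbTE; apply: contra_neq ij => ik; exact/val_inj|rewrite /= mulr0 addr0].
have Uzk (s : R) : 0 <= s <= 1 -> U (z k + s *: ((y 0 j - x 0 j) *: delta_mx 0 j)).
  move=> /andP[s0 s1]; apply: Uz => i; rewrite !mxE eqxx /=.
  have [->|ij] := eqVneq i j.
    rewrite /= ltnn mulr1; case: (leP (x 0 j) (y 0 j)) => xy; apply/orP; [left|right]; nra.
  rewrite !mulr0 addr0; case: ifP => _; case: (leP (x 0 i) (y 0 i)) => xy; apply/orP;
    by [left; lra|right; lra].
have [|c /andP[c0 c1] E] := @MVT_line R _ f (z k) ((y 0 j - x 0 j) *: delta_mx 0 j).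
  move=> s /Uzk /(df _ j) /derivableP d; exact: (@ex_derive _ _ _ _ _ _ _ (is_derive_scale_dir _ d)).
rewrite -zS in E.
have Uc := Uzk c; rewrite !ltW// in Uc; have {}Uc := Uc isT.
have D : 'D_((y 0 j - x 0 j) *: delta_mx 0 j) f (z k + c *: ((y 0 j - x 0 j) *: delta_mx 0 j)) =
  (y 0 j - x 0 j) *: 'D_(delta_mx 0 j) f (z k + c *: ((y 0 j - x 0 j) *: delta_mx 0 j)).
  exact: (@derive_val _ _ _ _ _ _ _ (is_derive_scale_dir _ (derivableP (df _ j Uc)))).
rewrite D in E.
have S : \sum_(i < p | (i < k.+1)%N) (y - x) 0 i * a i =
   (y - x) 0 j * a j + \sum_(i < p | (i < k)%N) (y - x) 0 i * a i.
  rewrite (bigD1 j)//=; congr (_ + _); apply: eq_bigl => i.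
  rewrite ltnS leq_eqVlt; have [->|ij] := eqVneq i j; first by rewrite /= ltnn andbF.
  have -> : (nat_of_ord i == k) = false by
    apply/negbTE; apply: contra_neq ij => ik; exact/val_inj.
  by rewrite andbT.
rewrite S => ih.
have -> : f (z k.+1) - f x - ((y - x) 0 j * a j + \sum_(i < p | (i < k)%N) (y - x) 0 i * a i)
  = (f (z k) - f x - \sum_(i < p | (i < k)%N) (y - x) 0 i * a i) +
    (y - x) 0 j * ('D_(delta_mx 0 j) f (z k + c *: ((y 0 j - x 0 j) *: delta_mx 0 j)) - a j).
  have := E; rewrite !mxE /GRing.scale /= => E1; rewrite mulrBr -E1; ring.
rewrite (le_trans (ler_normD _ _))// -natr1 mulrDl mul1r mulrDl lerD//.
rewrite normrM mulrC ler_pM// ?fa//; exact: coord_le_norm.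
Qed.

(** On a small ball the partial derivatives are close to their values at [x], which bounds the error
    in [C1_increment]. The tolerance is divided by [p.+1] rather than [p] so as to cover [p = 0]. *)
Lemma C1_differentiable p (U : set 'rV[R]_p) (f : 'rV[R]_p -> R) x : open U ->
  Ck false 1 U f -> U x ->
  differentiable f x /\
  forall v, 'd f x v = \sum_i v 0 i * 'D_(delta_mx 0 i) f x.
Proof.
move=> oU cf Ux.
pose a i := 'D_(delta_mx 0 i) f x.
pose Lm := GRing.isLinear.Build _ _ _ _ _ (lincomb_linear a).
pose L : {linear 'rV[R]_p -> R} := HB.pack (lincomb a) Lm.
have cL : continuous L by exact: continuous_lincomb.
have H : f \o shift x = cst (f x) + (L : 'rV[R]_p -> R) +o_ (0 : 'rV[R]_p) id.
  apply/eqaddoP => _/posnumP[e].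
  have p0 : 0 < p.+1%:R :> R by rewrite ltr0n.
  have nbi i : \forall z \near x, `|'D_(delta_mx 0 i) f z - a i| <= e%:num / p.+1%:R.
    apply: near_close; first exact: Ck_cont (CkS_derive (delta_mx 0 i) cf) Ux.
    by rewrite divr_gt0.
  have nb : \forall z \near x, U z /\ forall i, `|'D_(delta_mx 0 i) f z - a i| <= e%:num / p.+1%:R.
    near=> z; split; first by near: z; exact: open_nbhs_nbhs.
    by near: z; apply: filter_forall => i; exact: nbi.
  have /nbhs_ballP[r /= r0 rH] := nb.
  apply/nbhs_ballP; exists r => //= h; rewrite -ball_normE /= sub0r normrN => hr.
  have -> : (f \o shift x - (cst (f x) + L)) h = f (h + x) - f x - lincomb a (h + x - x).
    by rewrite addrK -[LHS]/(f (h + x) - (f x + lincomb a h)) opprD addrA.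
  have B := @C1_increment p f x (h + x) (ball x r) a (e%:num / p.+1%:R).
  apply: le_trans (B _ _ _) _.
  - move=> z zi; rewrite -ball_normE /= distrC (le_lt_trans _ hr)//.
    apply/norm_rV_le => // i; have := zi i; have := coord_le_norm h i.
    rewrite !mxE; set u := h 0 i; set w := x 0 i; set t := z 0 i.
    move=> uh /orP[] /andP[t1 t2]; apply: le_trans uh; rewrite !ler_norml.
      have u0 : 0 <= u by lra.
      rewrite (ger0_norm u0); lra.
    have u0 : u <= 0 by lra.
    rewrite (ler0_norm u0); lra.
  - move=> z i /rH[Uz _]; exact: CkS_derivable cf Uz.
  - by move=> z i /rH[_].
  - rewrite addrK ler_pM// ?mulr_ge0// ?divr_ge0//.
    rewrite mulrCA ger_pMr// ler_pdivrMr// mul1r ler_nat//.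
have E := diff_unique cL H.
have df : differentiable f x.
  by apply/diff_locallyP; split; [rewrite E; exact: cL|rewrite E].
by split=> // v; rewrite E.
Unshelve. all: by end_near. Qed.

Lemma derive_line0 (V W : normedModType R) (f : V -> W) x v :
  'D_v f x = 'D_1 (fun h : R => f (h *: v + x)) 0.
Proof.
rewrite /derive; set g1 := fun h => _; set g2 := fun h => _.
suff -> : g1 = g2 by [].
by apply/funext => h; rewrite /g1 /g2 /= addr0 scale0r add0r [_%:A]mulr1.
Qed.

(** As [g] is derivable along [v] only, it is first restricted to the line through [x], where
    derivability and differentiability agree. *)
Lemma is_derive_comp (V W Z : normedModType R) (g : V -> W) (f : W -> Z) x v :
  derivable g x v -> differentiable f (g x) ->
  is_derive x v (f \o g) ('d f (g x) ('D_v g x)).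
Proof.
move=> dg df.
have dg1 : differentiable (fun h : R => g (h *: v + x)) 0.
  by apply: (derivable1_diffP _ _).1; exact: (derivable1P _ _ _).1 dg.
have g0 : g (0 *: v + x) = g x by rewrite scale0r add0r.
have df0 : differentiable f (g (0 *: v + x)) by rewrite g0.
have dc : differentiable (f \o (fun h : R => g (h *: v + x))) 0.
  exact: differentiable_comp.
split; first by apply: (derivable1P _ _ _).2; exact: (derivable1_diffP _ _).2 dc.
rewrite derive_line0 -[fun h => _]/(f \o (fun h : R => g (h *: v + x))).
by rewrite deriveE// diff_comp//= g0 [in RHS]derive_line0 deriveE.
Qed.

Lemma continuous_mx (T : topologicalType) p q (g : T -> 'M[R]_(p, q)) x :
  (forall i j, {for x, continuous (fun y => g y i j)}) -> {for x, continuous g}.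
Proof.
move=> gi; apply/cvgrPdist_le => e e0.
have H : \forall y \near x, forall i j, `|g y i j - g x i j| <= e.
  by apply: filter_forall => i; apply: filter_forall => j; exact: near_close (gi i j) e0.
apply: filterS H => y gy; rewrite /Num.Def.normr/= mx_normrE.
by apply: bigmax_le; [exact: ltW|move=> -[i j] _; rewrite !mxE distrC].
Qed.

(** By the chain rule a directional derivative of the composite is a sum of products of a derivative
    of a coordinate of [g] and a partial derivative of [f] composed with [g]. Both factors are one
    order less regular, so induction applies. *)
Lemma Ck_comp (V : normedModType R) bd k p (U : set V) (U' : set 'rV[R]_p)
    (f : 'rV[R]_p -> R) (g : V -> 'rV[R]_p) :
  open U -> open U' -> (forall x, U x -> U' (g x)) ->
  (forall i, Ck bd k U (fun x => g x 0 i)) -> Ck bd k U' f ->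
  Ck bd k U (fun x => f (g x)).
Proof.
move=> oU oU' gU'; elim: k f => [|k ih] f cg cf.
  have [cf0 bf0] := cf; split=> //; case: cf0 => cf0 bf1; split=> [x Ux|b].
    apply: continuous_comp; last by apply: cf0; exact: gU'.
    by apply: continuous_mx => i j; rewrite ord1; exact: Ck_cont (cg j) Ux.
  by have [C fC] := bf1 b; exists C => x Ux; exact/fC/gU'.
have cg' i : Ck bd k U (fun x => g x 0 i) by exact: CkW (cg i).
have [c0 b0] := Ck_Ck0 (ih f cg' (CkW cf)).
split; first by split.
have D v x : U x -> is_derive x v (fun x => f (g x))
    (\sum_i 'D_v (fun x => g x 0 i) x * 'D_(delta_mx 0 i) f (g x)).
  move=> Ux.
  have cf1 : Ck false 1 U' f by apply: Ck_le (Ck_unbound cf).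
  have [df dfE] := C1_differentiable oU' cf1 (gU' _ Ux).
  have dg : derivable g x v.
    by apply/derivable_mxP => i j; rewrite ord1; exact: CkS_derivable (cg j) Ux.
  apply: is_derive_eq (is_derive_comp dg df) _; rewrite dfE.
  by apply: eq_bigr => i _; rewrite derive_mx// mxE.
move=> v; split=> [x Ux|]; first exact: (@ex_derive _ _ _ _ _ _ _ (D v x Ux)).
apply: (Ck_ext oU (f := fun x => \sum_i 'D_v (fun x => g x 0 i) x * 'D_(delta_mx 0 i) f (g x))).
  by move=> x Ux; rewrite (@derive_val _ _ _ _ _ _ _ (D v x Ux)).
apply: Ck_sum => // i; apply: Ck_mul => //; first exact: CkS_derive (cg i).
exact: (ih _ cg' (CkS_derive _ cf)).
Qed.

(** Mean value theorem twice: in direction [a] for the difference of [f] on two opposite sides of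
    the parallelogram, then in direction [b]. *)
Lemma mixed_increment (V : normedModType R) (U : set V) (f : V -> R) x a b :
  open U -> Ck false 2 U f ->
  (forall s t : R, 0 <= s <= 1 -> 0 <= t <= 1 -> U (x + s *: a + t *: b)) ->
  exists s t : R, [/\ 0 <= s <= 1, 0 <= t <= 1 &
   f (x + a + b) - f (x + a) - f (x + b) + f x = 'D_b ('D_a f) (x + s *: a + t *: b)].
Proof.
move=> oU cf UU.
have D (c s : R) : 0 <= s <= 1 -> 0 <= c <= 1 -> is_derive s (1 : R) (fun s : R => f (x + c *: b + s *: a))
    ('D_a f (x + s *: a + c *: b)).
  move=> sI cI; rewrite addrAC; apply: is_derive_line.
  by apply: (CkS_derivable (k := 1)) cf _; rewrite addrAC; exact: UU.
have i01 : 0 <= (0 : R) <= 1 by rewrite lexx ler01.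
have i11 : 0 <= (1 : R) <= 1 by rewrite lexx ler01.
pose phi (s : R) := f (x + 1 *: b + s *: a) - f (x + 0 *: b + s *: a).
have Dphi (s : R) : 0 <= s <= 1 -> is_derive s (1 : R) phi
    ('D_a f (x + s *: a + 1 *: b) - 'D_a f (x + s *: a + 0 *: b)).
  by move=> sI; apply: is_deriveB; exact: D.
have [|||s] := @MVT R phi (fun s => 'D_a f (x + s *: a + 1 *: b) - 'D_a f (x + s *: a + 0 *: b)) 0 1.
- by [].
- by move=> s; rewrite in_itv /= => /andP[s0 s1]; apply: Dphi; rewrite !ltW.
- apply: derivable_within_continuous => s; rewrite in_itv /= => H.
  exact: (@ex_derive _ _ _ _ _ _ _ (Dphi _ H)).
rewrite in_itv /= => /andP[s0 s1] E.
have [t /andP[t0 t1] E2] := @MVT_line R V ('D_a f) (x + s *: a) b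
  (fun t tI => CkS_derivable (k := 0) (CkS_derive a cf) (UU s t (introT andP (conj (ltW s0) (ltW s1))) tI)).
exists s, t; rewrite !ltW//; split=> //; rewrite -E2 subr0 mulr1 in E *.
move: E; rewrite /phi !scale1r !scale0r !addr0 => <-.
rewrite (addrAC x b a); ring.
Qed.

(** The mixed increment over a parallelogram is symmetric in its two sides. Evaluated by
    [mixed_increment] in both orders on a small parallelogram, it equals both second derivatives at
    points near [x], up to the common factor [t * t]. *)
Lemma Ck_schwarz (V : normedModType R) (U : set V) (f : V -> R) x u v :
  open U -> Ck false 2 U f -> U x -> 'D_u ('D_v f) x = 'D_v ('D_u f) x.
Proof.
move=> oU cf Ux; apply/eqP; rewrite -subr_eq0 -normr_eq0 eq_le normr_ge0 andbT.
apply/ler_addgt0Pr => _/posnumP[e]; rewrite add0r.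
have e2 : 0 < e%:num / 2 by rewrite divr_gt0.
have n1 := near_close (Ck_cont (CkS_derive u (CkS_derive v cf)) Ux) e2.
have n2 := near_close (Ck_cont (CkS_derive v (CkS_derive u cf)) Ux) e2.
have n3 : \forall y \near x, U y by exact: open_nbhs_nbhs.
have n123 := @filterI _ _ (nbhs_filter x) _ _ n1 (@filterI _ _ (nbhs_filter x) _ _ n2 n3).
move/nbhs_ballP : n123 => [r /= r0 rH].
(* With this factor the whole parallelogram spanned by [t *: u] and [t *: v] lies within [r / 2] of
   [x]; the summand 1 avoids a zero denominator. *)
pose t := r / (2 * (`|u| + `|v| + 1)).
have N0 : 0 < `|u| + `|v| + 1 by rewrite ltr_wpDl// addr_ge0.
have t0 : 0 < t by rewrite divr_gt0// mulr_gt0.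
have inb (s s' : R) : 0 <= s <= 1 -> 0 <= s' <= 1 -> ball x r (x + s *: (t *: u) + s' *: (t *: v)).
  move=> /andP[s0 s1] /andP[s'0 s'1]; rewrite -ball_normE /= -addrA opprD addNKr normrN.
  rewrite (le_lt_trans (ler_normD _ _))//.
  have N (c : R) (w : V) : 0 <= c -> `|c *: (t *: w)| = c * (t * `|w|).
    by move=> c0; rewrite normrZ normrZ (ger0_norm c0) [X in _ * (X * _)]ger0_norm// ltW.
  rewrite !N//.
  apply: (@le_lt_trans _ _ (t * (`|u| + `|v| + 1))).
    have := normr_ge0 u; have := normr_ge0 v; set A := `|u|; set B := `|v| => A0 B0.
    have : s * (t * A) <= t * A by rewrite ler_piMl// mulr_ge0// ltW.
    have : s' * (t * B) <= t * B by rewrite ler_piMl// mulr_ge0// ltW.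
    by rewrite !mulrDr mulr1; lra.
  rewrite /t invfM mulrA -mulrA mulVf ?gt_eqF// mulr1.
  by rewrite ltr_pdivrMr// ltr_pMr// ltr1n.
have sc w y : U y -> 'D_(t *: w) f y = t * 'D_w f y.
  by move=> Uy; rewrite derive_scale_dir//; exact: CkS_derivable cf Uy.
have sc2 w w' y : U y -> 'D_(t *: w') ('D_(t *: w) f) y = t * (t * 'D_w' ('D_w f) y).
  move=> Uy.
  have -> : 'D_(t *: w') ('D_(t *: w) f) y = 'D_(t *: w') (fun y => t * 'D_w f y) y.
    by apply: near_eq_derive; apply: near_open Uy => // z Uz; exact: sc.
  have d := CkS_derivable (k := 0) (v := w') (CkS_derive w cf) Uy.
  rewrite derive_scale_dir; last exact: derivableZ.
  by rewrite deriveMl.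
have [|s1 [s2 [s1I s2I E1]]] := @mixed_increment V U f x (t *: u) (t *: v) oU cf.
  by move=> s s' sI s'I; have [_ []] := rH _ (inb s s' sI s'I).
have [|s3 [s4 [s3I s4I E2]]] := @mixed_increment V U f x (t *: v) (t *: u) oU cf.
  by move=> s s' sI s'I; rewrite addrAC; have [_ []] := rH _ (inb s' s s'I sI).
have [_ [a2 Ua]] := rH _ (inb s1 s2 s1I s2I).
have [b1 [_ Ub]] := rH _ (inb s4 s3 s4I s3I).
rewrite sc2// in E1; rewrite addrAC in Ub b1; rewrite sc2// in E2.
have E : f (x + t *: u + t *: v) - f (x + t *: u) - f (x + t *: v) + f x =
  f (x + t *: v + t *: u) - f (x + t *: v) - f (x + t *: u) + f x.
  by rewrite (addrAC x (t *: v) (t *: u)) addrAC (addrAC (f _)) ; ring.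
move: E; rewrite E1 E2 => /(mulfI (lt0r_neq0 t0)) /(mulfI (lt0r_neq0 t0)) E.
rewrite E in a2.
clear -a2 b1; move: a2 b1.
set A := 'D_u ('D_v f) (_ + _); set B := 'D_u ('D_v f) x; set C := 'D_v ('D_u f) x.
rewrite -/B; clearbody A B C; rewrite !ler_norml; move=> /andP[? ?] /andP[? ?].
by apply/andP; split; lra.
Qed.

End C1.

Section SmoothOn.
Variable R : realType.

Lemma smooth_on_differentiable (V W : normedModType R) U (f : V -> W) x :
  smooth_on U f -> U x -> differentiable f x.
Proof. by move=> /(_ [::] x). Qed.

Lemma smooth_on_derive (V W : normedModType R) U (f : V -> W) v :
  smooth_on U f -> smooth_on U ('D_v f).
Proof. by move=> sf vs x Ux; have := sf (rcons vs v) x Ux; rewrite foldr_rcons. Qed.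

Lemma smooth_on_Ck (V : normedModType R) p q U (f : V -> 'M[R]_(p, q)) :
  open U -> smooth_on U f -> forall k i j, Ck false k U (fun x => f x i j).
Proof.
move=> oU + k i j; elim: k f => [|k ih] f sf.
  split=> //; split=> // x Ux.
  apply: (@continuous_comp _ _ _ f (fun M => M i j)); last exact: coord_continuous.
  exact: differentiable_continuous (smooth_on_differentiable sf Ux).
have [c0 _] := Ck_Ck0 (ih f sf); split; first by split.
have d v x : U x -> derivable f x v.
  by move=> Ux; apply: diff_derivable; exact: smooth_on_differentiable sf _.
move=> v; split=> [x Ux|]; first exact: (derivable_mxP _ _ _).1 (d v x Ux) i j.
apply: (Ck_ext oU) (ih _ (smooth_on_derive v sf)) => x Ux.
by rewrite derive_mx ?mxE//; exact: d.
Qed.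

Lemma differentiable_mx (V : normedModType R) p q (f : V -> 'M[R]_(p, q)) x :
  (forall i j, differentiable (fun y => f y i j) x) -> differentiable f x.
Proof.
move=> df.
have -> : f = \sum_(i < p) \sum_(j < q) (fun y => f y i j *: delta_mx i j).
  apply/funext => y; rewrite fct_sumE [LHS]matrix_sum_delta; apply: eq_bigr => i _.
  by rewrite fct_sumE.
apply: differentiable_sum => i; apply: differentiable_sum => j.
exact: differentiableZl.
Qed.

(** Phrased as a property of the domain, so that [Ck_smooth_on] serves both row vectors and the
    parameter line [R]. *)
Definition C1_criterion (V : normedModType R) :=
  forall (U : set V) (f : V -> R) x, open U -> Ck false 1 U f -> U x -> differentiable f x.

Lemma C1_criterion_rV p : C1_criterion 'rV[R]_p.
Proof. by move=> U f x oU cf Ux; have [] := C1_differentiable oU cf Ux. Qed.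

Lemma C1_criterion_R : C1_criterion R.
Proof. by move=> U f x oU cf Ux; apply/derivable1_diffP; exact: CkS_derivable cf Ux. Qed.

Lemma Ck_smooth_on (V : normedModType R) p q U (f : V -> 'M[R]_(p, q)) :
  C1_criterion V -> open U -> (forall k i j, Ck false k U (fun x => f x i j)) ->
  smooth_on U f.
Proof.
move=> cV oU + vs x Ux; elim/last_ind: vs f => [|vs v ih] f cf.
  by apply: differentiable_mx => i j; exact: cV (cf 1%N i j) Ux.
rewrite foldr_rcons; apply: ih => k i j.
apply: (Ck_ext oU) (CkS_derive v (cf k.+1 i j)) => y Uy.
rewrite derive_mx ?mxE//; apply/derivable_mxP => i' j'.
exact: CkS_derivable (cf 1%N i' j') Uy.
Qed.

End SmoothOn.

(** * Ordinary differential equations *)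

Section ODETools.
Variable R : realType.

Lemma is_derive_mxP (V : normedModType R) p q (f : V -> 'M[R]_(p, q)) x v d :
  is_derive x v f d <-> forall i j, is_derive x v (fun y => f y i j) (d i j).
Proof.
split=> [[df <-] i j|H].
  by split; [exact: (derivable_mxP _ _ _).1 df i j|rewrite derive_mx// mxE].
have df : derivable f x v.
  by apply/derivable_mxP => i j; exact: (@ex_derive _ _ _ _ _ _ _ (H i j)).
split=> //; rewrite derive_mx//; apply/matrixP => i j; rewrite mxE.
exact: (@derive_val _ _ _ _ _ _ _ (H i j)).
Qed.

Lemma is_derive_continuous (W : normedModType R) (f : R -> W) (t : R) d :
  is_derive t (1 : R) f d -> {for t, continuous f}.
Proof. by move=> [+ _]; move/derivable1_diffP/differentiable_continuous. Qed.

Lemma is_derive_within_continuous (W : normedModType R) (f df : R -> W) (a b : R) :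
  (forall t, a <= t <= b -> is_derive t (1 : R) f (df t)) -> {within `[a, b], continuous f}.
Proof.
move=> H; apply: derivable_within_continuous => t; rewrite in_itv /= => /H h.
exact: (@ex_derive _ _ _ _ _ _ _ h).
Qed.

(** For the maximum norm it suffices that [phi] plus or minus each coordinate of [u] is
    nondecreasing. *)
Lemma mean_value_le q (u du : R -> 'rV[R]_q) (phi dphi : R -> R) (a b : R) :
  a <= b ->
  (forall t, a <= t <= b -> is_derive t (1 : R) u (du t)) ->
  (forall t, a <= t <= b -> is_derive t (1 : R) phi (dphi t)) ->
  (forall t, a <= t <= b -> `|du t| <= dphi t) ->
  `|u b - u a| <= phi b - phi a.
Proof.
move=> ab uD pD le.
have mono (g dg : R -> R) : (forall t, a <= t <= b -> is_derive t (1 : R) g (dg t)) ->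
    (forall t, a <= t <= b -> 0 <= dg t) -> g a <= g b.
  move=> gD g0.
  have [||c] := @MVT_segment R g dg a b ab.
  - by move=> t; rewrite in_itv /= => /andP[t0 t1]; apply: gD; rewrite !ltW.
  - exact: is_derive_within_continuous gD.
  rewrite in_itv /= => cI E; rewrite -subr_ge0 E mulr_ge0 ?g0//.
  by rewrite subr_ge0.
have phi0 : 0 <= phi b - phi a.
  rewrite subr_ge0; apply: mono pD _ => t tI; exact: le_trans (le t tI).
apply/norm_rV_le => // i; rewrite !mxE ler_norml.
have uDi t : a <= t <= b -> is_derive t (1 : R) (fun y => u y 0 i) (du t 0 i).
  by move=> /uD /is_derive_mxP /(_ 0 i).
have lei t : a <= t <= b -> - dphi t <= du t 0 i <= dphi t.
  by move=> tI; rewrite -ler_norml; apply: le_trans (le t tI); exact: coord_le_norm.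
apply/andP; split.
  suff H : phi a + u a 0 i <= phi b + u b 0 i by move: H; move: (phi a) (phi b) (u a 0 i) (u b 0 i) => *; lra.
  apply: (mono (fun t => phi t + u t 0 i) (fun t => dphi t + du t 0 i)) => t tI; first by apply: is_deriveD; [exact: pD|exact: uDi].
  by have /andP[? _] := lei t tI; rewrite -[du t 0 i]opprK subr_ge0 lerNl.
suff H : phi a - u a 0 i <= phi b - u b 0 i by move: H; move: (phi a) (phi b) (u a 0 i) (u b 0 i) => *; lra.
apply: (mono (fun t => phi t - u t 0 i) (fun t => dphi t - du t 0 i)) => t tI; first by apply: is_deriveB; [exact: pD|exact: uDi].
by have /andP[_ ?] := lei t tI; rewrite subr_ge0.
Qed.

Lemma is_derive_mulc (c t : R) : is_derive t (1 : R) (fun s => c * s) c.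
Proof. by apply: is_derive_eq; rewrite /GRing.scale /= mulr1. Qed.

Lemma mean_value_cst q (u du : R -> 'rV[R]_q) (c : R) (a b : R) :
  a <= b -> (forall t, a <= t <= b -> is_derive t (1 : R) u (du t)) ->
  (forall t, a <= t <= b -> `|du t| <= c) -> `|u b - u a| <= c * (b - a).
Proof.
move=> ab uD le; rewrite mulrBr.
apply: (@mean_value_le q u du (fun t => c * t) (fun _ => c) a b) => // t _.
exact: is_derive_mulc.
Qed.

Lemma norm_between (x y z X Y : R) : `|x| <= X -> `|y| <= Y ->
  (x <= z <= y) || (y <= z <= x) -> (`|z| <= X) || (`|z| <= Y).
Proof.
rewrite !ler_norml => /andP[h1 h2] /andP[h3 h4] h5; case: (leP X Y) => XY; apply/orP.
  by right; apply/andP; split; case/orP: h5 => /andP[? ?]; lra.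
by left; apply/andP; split; case/orP: h5 => /andP[? ?]; lra.
Qed.

Lemma is_derive_expR_scale (k t : R) :
  is_derive t (1 : R) (fun s => expR (k * s)) (k * expR (k * t)).
Proof.
have H : is_derive t (1 : R) (fun s => k * s) k.
  exact: is_derive_mulc.
rewrite mulrC; exact: (@is_derive1_comp _ (@expR R) (fun s => k * s) t _ _ (is_derive_expR _) H).
Qed.

(** Let M be the maximum of [g] on [[0, T]]. Integrating the hypothesis against the weight exp(2Lt)
    returns only half of M, which is absorbed on the left; this is why the exponent is 2L and not
    L. *)
Lemma gronwall_pos q (u du : R -> 'rV[R]_q) (L e T : R) :
  0 <= T -> 0 < L -> 0 <= e ->
  (forall t, 0 <= t <= T -> is_derive t (1 : R) u (du t)) ->
  (forall t, 0 <= t <= T -> `|du t| <= L * `|u t| + e) ->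
  forall t, 0 <= t <= T -> `|u t| <= 2 * (`|u 0| + e * T) * expR (2 * L * T).
Proof.
move=> T0 L0 e0 uD le.
pose g t := expR (- (2 * L) * t) * `|u t|.
have cg : {within `[0, T], continuous g}.
  apply: continuous_in_subspaceT => t; rewrite inE/= in_itv /= => tI.
  have c1 := is_derive_continuous (is_derive_expR_scale (- (2 * L)) t).
  have c2 : {for t, continuous (fun s => `|u s|)}.
    by apply: continuous_comp; [exact: is_derive_continuous (uD t tI)|exact: norm_continuous].
  exact: (continuousM c1 c2).
have [c cI gM] := EVT_max T0 cg.
have {}cI : 0 <= c <= T by move: cI; rewrite in_itv.
have {}gM t : 0 <= t <= T -> g t <= g c by move=> tI; apply: gM; rewrite in_itv.
pose M := g c.
have M0 : 0 <= M by rewrite mulr_ge0// expR_ge0.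
have uM t : 0 <= t <= T -> `|u t| <= M * expR (2 * L * t).
  move=> /gM; rewrite /g mulNr expRN ler_pdivrMl ?expR_gt0//.
  by rewrite mulrC.
have B t : 0 <= t <= T -> `|u t - u 0| <= (M / 2 * expR (2 * L * t) + e * t) - (M / 2 * expR (2 * L * 0) + e * 0).
  move=> /andP[t0 tT].
  have sub s : 0 <= s <= t -> 0 <= s <= T by move=> /andP[-> /le_trans]; exact.
  apply: (@mean_value_le q u du (fun s => M / 2 * expR (2 * L * s) + e * s)
    (fun s => M / 2 * (2 * L * expR (2 * L * s)) + e)) => //.
  - by move=> s /sub; exact: uD.
  - move=> s _; apply: is_deriveD.
      have H := is_derive_expR_scale (2 * L) s.
      exact: (@is_deriveZ _ _ _ _ (M / 2) _ _ _ H).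
    exact: is_derive_mulc.
  - move=> s /sub sI; apply: (le_trans (le s sI)); rewrite lerD2r.
    have := uM s sI; set E := expR _; set U := `|u s| => H.
    have -> : M / 2 * (2 * L * E) = L * (M * E) by field.
    by rewrite ler_pM2l.
have Mle : M <= 2 * (`|u 0| + e * T).
  have /andP[c0 cT] := cI.
  have := B c cI; rewrite mulr0 expR0 mulr1 mulr0 addr0 => Bc.
  have uc : `|u c| <= `|u 0| + (M / 2 * expR (2 * L * c) + e * c - M / 2).
    by rewrite -[u c](subrK (u 0)) addrC (le_trans (ler_normD _ _))// lerD2l.
  have E1 : 1 <= expR (2 * L * c) by rewrite -[leLHS]expR0 ler_expR !mulr_ge0// ltW.
  have ME : M * expR (2 * L * c) = `|u c|.
    by rewrite /M /g mulNr expRN mulrAC mulVf ?mul1r// gt_eqF// expR_gt0.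
  have ec : e * c <= e * T by rewrite ler_wpM2l.
  have u0 := normr_ge0 (u 0).
  have eT : 0 <= e * T by rewrite mulr_ge0.
  move: uc ME E1 ec u0 eT M0; clear.
  move: (`|u 0|) (`|u c|) (expR _) (e * c) (e * T) M => a b E x y m.
  move=> uc ME E1 ec u0 eT M0.
  have : 0 <= m * (E - 1) by rewrite mulr_ge0// subr_ge0.
  by rewrite mulrBr mulr1 ME; lra.
move=> t tI; apply: (le_trans (uM t tI)).
have E2 : expR (2 * L * t) <= expR (2 * L * T).
  have /andP[_ tT] := tI; rewrite ler_expR ler_wpM2l//.
  by rewrite mulr_ge0// ltW.
by rewrite ler_pM// expR_ge0.
Qed.

Lemma is_derive_reflect (W : normedModType R) (u : R -> W) (t : R) d :
  is_derive (- t) (1 : R) u d -> is_derive t (1 : R) (fun s => u (- s)) (- d).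
Proof.
move=> H.
have dn : is_derive t (1 : R) (fun s : R => - s) (- 1).
  by have := is_deriveNid t (1 : R).
have du : differentiable u (- t) by apply/derivable1_diffP; exact: (@ex_derive _ _ _ _ _ _ _ H).
have H2 := @is_derive_comp R R R W (fun s : R => - s) u t 1 (@ex_derive _ _ _ _ _ _ _ dn) du.
apply: is_derive_eq H2 _.
rewrite (@derive_val _ _ _ _ _ _ _ dn) linearN; congr (- _).
by rewrite -deriveE//; exact: (@derive_val _ _ _ _ _ _ _ H).
Qed.

Lemma gronwall q (u du : R -> 'rV[R]_q) (L e T : R) :
  0 < L -> 0 <= e ->
  (forall t, `|t| < T -> is_derive t (1 : R) u (du t)) ->
  (forall t, `|t| < T -> `|du t| <= L * `|u t| + e) ->
  forall t, `|t| < T -> `|u t| <= 2 * (`|u 0| + e * T) * expR (2 * L * T).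
Proof.
move=> L0 e0 uD le t tT.
have mono (s : R) : 0 <= s -> s < T -> 2 * (`|u 0| + e * s) * expR (2 * L * s) <= 2 * (`|u 0| + e * T) * expR (2 * L * T).
  move=> s0 /ltW sT; apply: ler_pM.
  - by rewrite !mulr_ge0// addr_ge0// mulr_ge0.
  - exact: expR_ge0.
  - by rewrite ler_pM2l// lerD2l ler_wpM2l.
  - by rewrite ler_expR ler_wpM2l// mulr_ge0// ltW.
have [t0|t0] := leP 0 t.
  rewrite ger0_norm// in tT.
  apply: le_trans (mono t t0 tT).
  apply: (@gronwall_pos q u du L e t) => // [s sI|s sI|]; last by rewrite t0 lexx.
    by apply: uD; move: sI => /andP[s0 st]; rewrite ger0_norm// (le_lt_trans st).
  by apply: le; move: sI => /andP[s0 st]; rewrite ger0_norm// (le_lt_trans st).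
rewrite ltr0_norm// in tT.
have t0' : 0 <= - t by rewrite oppr_ge0 ltW.
apply: le_trans (mono (- t) t0' tT).
have := @gronwall_pos q (fun s => u (- s)) (fun s => - du (- s)) L e (- t) t0' L0 e0.
rewrite oppr0 => H; rewrite -[t in leLHS]opprK; apply: H => [s sI|s sI|].
- by apply: is_derive_reflect; apply: uD; move: sI => /andP[s0 st]; rewrite normrN ger0_norm// (le_lt_trans st).
- by rewrite normrN; apply: le; move: sI => /andP[s0 st]; rewrite normrN ger0_norm// (le_lt_trans st).
- by rewrite t0' lexx.
Qed.

Lemma antiderivative (g : R -> R) (A : R) : 0 < A -> continuous g ->
  exists2 G : R -> R, G 0 = 0 & forall t : R, `|t| < A -> is_derive t (1 : R) G (g t).
Proof.
move=> A0 cg.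
(* The base point [- A] lies to the left of every [t] considered, so the fundamental theorem also
   covers negative [t]; the value at 0 is subtracted afterwards. *)
pose F x := (\int[lebesgue_measure]_(t in [set` `[(- A), x]]) (g t))%R.
have dF t : `|t| < A -> is_derive t (1 : R) F (g t).
  rewrite ltr_norml => /andP[At tA].
  have [||||dF EF] := @continuous_FTC1_closed R g (- A) t A.
  - exact: tA.
  - apply: continuous_compact_integrable; first exact: segment_compact.
    exact: continuous_subspaceT.
  - exact: At.
  - exact: cg.
  by split; [exact: dF|rewrite -derive1E].
exists (fun t => F t - F 0); first by rewrite subrr.
move=> t /dF H; apply: is_derive_eq (is_deriveB H (is_derive_cst (F 0) t (1 : R))) _.
by rewrite subr0.
Qed.

Lemma antiderivative_rV q (g : R -> 'rV[R]_q) (A : R) : 0 < A -> continuous g ->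
  exists2 G : R -> 'rV[R]_q, G 0 = 0 & forall t : R, `|t| < A -> is_derive t (1 : R) G (g t).
Proof.
move=> A0 cg.
have H i : exists G : R -> R, G 0 = 0 /\ forall t : R, `|t| < A -> is_derive t (1 : R) G (g t 0 i).
  have cgi : continuous (fun t => g t 0 i).
    move=> t; apply: (@continuous_comp _ _ _ g (fun M : 'rV[R]_q => M 0 i)); [exact: cg|exact: coord_continuous].
  by have [G G0 GD] := antiderivative A0 cgi; exists G.
pose G i := projT1 (cid (H i)).
have GP i : G i 0 = 0 /\ forall t : R, `|t| < A -> is_derive t (1 : R) (G i) (g t 0 i).
  exact: projT2 (cid (H i)).
exists (fun t => \row_i G i t); first by apply/rowP => i; rewrite !mxE; case: (GP i).
move=> t tA; apply/is_derive_mxP => j i; rewrite ord1.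
have -> : (fun y => (\row_i G i y) 0 i) = G i by apply/funext => y; rewrite mxE.
by case: (GP i) => _; apply.
Qed.

(** The intervals with centre [a n] and radius [2 * K / 2 ^+ n] are nested, and the limit is the
    supremum of their left ends. The explicit rate is what the later iterations rely on. *)
Lemma geometric_cvg (a : nat -> R) (K : R) : 0 <= K ->
  (forall n, `|a n.+1 - a n| <= K / 2 ^+ n) ->
  exists l : R, forall n, `|l - a n| <= 2 * K / 2 ^+ n.
Proof.
move=> K0 aK.
have h (n : nat) : 2 * K / 2 ^+ n.+1 = K / 2 ^+ n.
  by rewrite exprS -mulf_div divff ?mul1r.
have dbl (n : nat) : 2 * K / 2 ^+ n = K / 2 ^+ n + K / 2 ^+ n.
  by rewrite -mulrA mulr_natl mulr2n.
pose lo n := a n - 2 * K / 2 ^+ n; pose hi n := a n + 2 * K / 2 ^+ n.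
have loS n : lo n <= lo n.+1.
  by rewrite /lo h dbl; have := aK n; rewrite ler_norml => /andP[]; set k := K / _; lra.
have hiS n : hi n.+1 <= hi n.
  by rewrite /hi h dbl; have := aK n; rewrite ler_norml => /andP[]; set k := K / _; lra.
have lole m n : (m <= n)%N -> lo m <= lo n.
  elim: n => [|n ih]; first by rewrite leqn0 => /eqP->.
  by rewrite leq_eqVlt => /orP[/eqP->//|]; rewrite ltnS => /ih H; exact: le_trans H (loS n).
have hile m n : (m <= n)%N -> hi n <= hi m.
  elim: n => [|n ih]; first by rewrite leqn0 => /eqP->.
  by rewrite leq_eqVlt => /orP[/eqP->//|]; rewrite ltnS => /ih H; exact: le_trans (hiS n) H.
have k0 n : 0 <= 2 * K / 2 ^+ n by rewrite !mulr_ge0// invr_ge0 exprn_ge0.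
have lohi m n : lo m <= hi n.
  apply: (le_trans (lole _ _ (leq_maxl m n))); apply: (@le_trans _ _ (hi (maxn m n))).
    by rewrite /lo /hi; have := k0 (maxn m n); lra.
  exact: hile (leq_maxr _ _).
exists (sup (range lo)) => n; rewrite ler_norml.
have ub : has_ubound (range lo) by exists (hi 0%N) => _ [m _ <-].
have H1 : lo n <= sup (range lo) by apply: ub_le_sup => //; exists n.
have H2 : sup (range lo) <= hi n by apply: ge_sup => [|_ [m _ <-]//]; exists (lo 0%N), 0%N.
by move: H1 H2; rewrite /lo /hi => H1 H2; apply/andP; split; lra.
Qed.

Lemma geometric_cvg_rV q (a : nat -> 'rV[R]_q) (K : R) : 0 <= K ->
  (forall n, `|a n.+1 - a n| <= K / 2 ^+ n) ->
  exists l : 'rV[R]_q, forall n, `|l - a n| <= 2 * K / 2 ^+ n.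
Proof.
move=> K0 aK.
have H i : exists l : R, forall n, `|l - a n 0 i| <= 2 * K / 2 ^+ n.
  apply: geometric_cvg => // n; apply: le_trans (aK n).
  by have := coord_le_norm (a n.+1 - a n) i; rewrite !mxE.
exists (\row_i projT1 (cid (H i))) => n; apply/norm_rV_le.
  by rewrite !mulr_ge0// invr_ge0 exprn_ge0.
by move=> i; rewrite !mxE; exact: projT2 (cid (H i)) n.
Qed.

Lemma half_pow_small (K e : R) : 0 < e -> exists n : nat, K / 2 ^+ n <= e.
Proof.
move=> e0; exists (Num.bound `|K / e|); rewrite ler_pdivrMr ?exprn_gt0//.
rewrite mulrC -ler_pdivrMr//; apply: le_trans (ler_norm _) _.
apply: (@le_trans _ _ (Num.bound `|K / e|)%:R); first by rewrite ltW// archi_boundP.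
set n := Num.bound _; elim: n => [|n ih]; first by rewrite expr0 ler01.
rewrite -natr1 exprS mulr_natl mulr2n lerD//.
by rewrite exprn_ege1// ler1n.
Qed.

Lemma lipschitz_continuous_at (V W : normedModType R) (f : V -> W) (L : R) (U : set V) x :
  nbhs x U -> (forall y, U y -> `|f x - f y| <= L * `|x - y|) -> {for x, continuous f}.
Proof.
move=> nU fL; apply/cvgrPdist_le => d d0.
have L1 : 0 < `|L| + 1 by rewrite ltr_wpDl.
have nb : nbhs x (ball x (d / (`|L| + 1))) by apply: nbhsx_ballx; rewrite divr_gt0.
apply: (@filterS2 _ _ (nbhs_filter x) _ _ _ _ nU nb) => y Uy.
rewrite -ball_normE /= ltr_pdivlMr// => xy.
apply: (le_trans (fL y Uy)); apply: le_trans (ltW xy).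
rewrite mulrC ler_wpM2l//; apply: le_trans (ler_norm _) _.
by rewrite lerDl.
Qed.

Definition clamp (e t : R) : R := if t < - e then - e else if e < t then e else t.

Lemma clamp_bound e t : 0 <= e -> `|clamp e t| <= e.
Proof.
move=> e0; rewrite ler_norml /clamp; case: ltP => et; first by apply/andP; split; lra.
by case: ltP => H; apply/andP; split; lra.
Qed.

Lemma clamp_id e t : `|t| <= e -> clamp e t = t.
Proof. by rewrite ler_norml /clamp => /andP[a b]; rewrite !ltNge a b. Qed.

Lemma clamp_lipschitz e s t : 0 <= e -> `|clamp e s - clamp e t| <= `|s - t|.
Proof.
move=> e0; have a := ler_norm (s - t); have b := ler_norm (t - s); rewrite distrC in b.
rewrite ler_norml /clamp; move: a b; move: (`|s - t|) => d a b.
by case: (ltP s (- e)) => h1; case: (ltP t (- e)) => h2; try (case: (ltP e s) => h3);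
  try (case: (ltP e t) => h4); apply/andP; split; lra.
Qed.

Lemma clamp_continuous e : 0 <= e -> continuous (clamp e).
Proof.
move=> e0 t; apply: (@lipschitz_continuous_at _ _ _ 1 setT); first exact: filterT.
by move=> s _; rewrite mul1r; exact: clamp_lipschitz.
Qed.

(* Picard iteration; after clamping time to [-e, e] the iterates are continuous on the
   whole line and converge uniformly. *)
Lemma picard q (f : 'rV[R]_q -> 'rV[R]_q) (L e : R) (z : 'rV[R]_q) :
  0 < L -> 0 < e -> L * e <= 2^-1 ->
  (forall x y, `|f x - f y| <= L * `|x - y|) ->
  exists2 u : R -> 'rV[R]_q, u 0 = z &
    forall t : R, `|t| < e -> is_derive t (1 : R) u (f (u t)).
Proof.
move=> L0 e0 Le fL.
have cf : continuous f.
  move=> x; apply: (@lipschitz_continuous_at _ _ _ L setT); first exact: filterT.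
  by move=> y _; exact: fL.
have e20 : 0 < 2 * e by rewrite mulr_gt0.
(* Antiderivatives are taken on twice the interval, because clamped time reaches the ends of
   [[-e, e]], where continuity from both sides is still wanted. For a discontinuous [w] the witness
   is a filler. *)
have AD (w : R -> 'rV[R]_q) : exists G : R -> 'rV[R]_q, continuous w -> G 0 = 0 /\
    forall t : R, `|t| < 2 * e -> is_derive t (1 : R) G (f (w t)).
  have [cw|ncw] := pselect (continuous w); last by exists w => /ncw.
  have cfw : continuous (f \o w) by move=> t; apply: continuous_comp; [exact: cw|exact: cf].
  by have [G G0 GD] := antiderivative_rV e20 cfw; exists G.
pose G w := projT1 (cid (AD w)).
have GP w : continuous w -> G w 0 = 0 /\
    forall t : R, `|t| < 2 * e -> is_derive t (1 : R) (G w) (f (w t)) := projT2 (cid (AD w)).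
pose P (w : R -> 'rV[R]_q) (t : R) : 'rV[R]_q := z + G w (clamp e t).
have cP w : continuous w -> continuous (P w).
  move=> cw t.
  have c2 : {for t, continuous (fun t => G w (clamp e t))}.
    apply: (@continuous_comp _ _ _ (clamp e) (G w)); first exact: clamp_continuous (ltW e0) _.
    have [_ GD] := GP w cw; apply: is_derive_continuous (GD _ _).
    by apply: le_lt_trans (clamp_bound _ (ltW e0)) _; rewrite mulr_natl mulr2n ltrDl.
  exact: (cvgD (cvg_cst z) c2).
have le2 t : `|t| <= e -> `|t| < 2 * e.
  by move=> /le_lt_trans; apply; rewrite mulr_natl mulr2n ltrDl.
(* The contraction factor 1/2 is the bound on [L * e]: the fields differ by at most [L * c],
   integrated over a time of at most [e]. *)
have contr (w w' : R -> 'rV[R]_q) (c : R) : continuous w -> continuous w' -> 0 <= c ->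
    (forall t, `|w t - w' t| <= c) -> forall t, `|P w t - P w' t| <= c / 2.
  move=> cw cw' c0 ww t.
  have [G0 GD] := GP w cw; have [G0' GD'] := GP w' cw'.
  rewrite /P opprD addrACA subrr add0r.
  have dd s : `|s| <= e -> is_derive s (1 : R) (fun s => G w s - G w' s) (f (w s) - f (w' s)).
    by move=> /le2 se; apply: is_deriveB; [exact: GD|exact: GD'].
  have bd s : `|f (w s) - f (w' s)| <= L * c.
    by apply: le_trans (fL _ _) _; rewrite ler_pM2l.
  have z0 : G w 0 - G w' 0 = 0 by rewrite G0 G0' subrr.
  have := clamp_bound t (ltW e0); set s := clamp e t => se.
  apply: (@le_trans _ _ (L * c * `|s|)).
    have [s0|s0] := leP 0 s.
      have := @mean_value_cst q (fun s => G w s - G w' s) (fun s => f (w s) - f (w' s)) (L * c) 0 s s0.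
      rewrite z0 !subr0 (ger0_norm s0) => H; apply: H => r /andP[r0 rs].
        by apply: dd; rewrite ger0_norm// (le_trans rs)// -(ger0_norm s0).
      exact: bd.
    have := @mean_value_cst q (fun s => G w s - G w' s) (fun s => f (w s) - f (w' s)) (L * c) s 0 (ltW s0).
    rewrite z0 !sub0r normrN (ltr0_norm s0) => H; apply: H => r /andP[rs r0].
      by apply: dd; rewrite ler0_norm// (le_trans _ se)// (ltr0_norm s0) lerN2.
    exact: bd.
  rewrite mulrAC mulrC; apply: (@le_trans _ _ (c * (L * e))).
    by rewrite ler_wpM2l// ler_wpM2l// ltW.
  by rewrite ler_wpM2l.
pose w (n : nat) := iter n P (fun _ => z).
have cw n : continuous (w n) by elim: n => [|n ih]; [exact: cst_continuous|exact: cP].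
pose K := `|f z| * e.
have K0 : 0 <= K by rewrite mulr_ge0// ltW.
have wK n t : `|w n.+1 t - w n t| <= K / 2 ^+ n.
  elim: n t => [t|n ih t].
    have [G0 GD] := GP _ (cw 0%N).
    rewrite expr0 divr1 /= /P addrAC subrr add0r -[G _ _]subr0 -[X in _ - X]G0.
    have := clamp_bound t (ltW e0); set s := clamp e t => se.
    apply: (@le_trans _ _ (`|f z| * `|s|)); last by rewrite ler_wpM2l.
    have [s0|s0] := leP 0 s.
      have := @mean_value_cst q (G (w 0%N)) (fun s => f (w 0%N s)) `|f z| 0 s s0.
      rewrite subr0 (ger0_norm s0) => H; apply: H => r /andP[r0 rs] //.
      by apply: GD; apply: le2; rewrite ger0_norm// (le_trans rs)// -(ger0_norm s0).
    have := @mean_value_cst q (G (w 0%N)) (fun s => f (w 0%N s)) `|f z| s 0 (ltW s0).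
    rewrite sub0r distrC (ltr0_norm s0) => H; apply: H => r /andP[rs r0] //.
    by apply: GD; apply: le2; rewrite ler0_norm// (le_trans _ se)// (ltr0_norm s0) lerN2.
  have := contr (w n.+1) (w n) (K / 2 ^+ n) (cw _) (cw _) _ ih t.
  rewrite exprS invfM [2^-1 * _]mulrC mulrA; apply.
  by rewrite mulr_ge0// invr_ge0 exprn_ge0.
have lim_ex t : exists l, forall n, `|l - w n t| <= 2 * K / 2 ^+ n.
  exact: (geometric_cvg_rV K0 (fun n => wK n t)).
pose v t := projT1 (cid (lim_ex t)).
have vw t n : `|v t - w n t| <= 2 * K / 2 ^+ n := projT2 (cid (lim_ex t)) n.
have cv : continuous v.
  move=> t; apply/cvgrPdist_le => d d0.
  have d3 : 0 < d / 3 by rewrite divr_gt0.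
  have [n nd] := half_pow_small (2 * K) d3.
  have := near_close (cw n t) d3; apply: filterS => s ws.
  have -> : v t - v s = (v t - w n t) + ((w n t - w n s) + (w n s - v s)).
    by rewrite addrA subrKA addrA subrK.
  have a1 := le_trans (vw t n) nd; have a2 := le_trans (vw s n) nd.
  rewrite (le_trans (ler_normD _ _))//.
  rewrite distrC in ws; rewrite distrC in a2.
  have a3 := le_trans (ler_normD (w n t - w n s) (w n s - v s)) (lerD ws a2).
  have := lerD a1 a3; move/le_trans; apply; lra.
have Pv t : P v t = v t.
  apply/eqP; rewrite -subr_eq0 -normr_le0; apply/ler_addgt0Pr => d d0; rewrite add0r.
  have d2 : 0 < d / 2 by rewrite divr_gt0.
  have [n nd] := half_pow_small (2 * K) d2.
  have Kn : 0 <= 2 * K / 2 ^+ n := le_trans (normr_ge0 _) (vw t n).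
  have := contr v (w n) _ cv (cw n) Kn (vw^~ n) t => H1.
  have H2 := vw t n.+1; rewrite distrC in H2.
  rewrite -(subrKA (w n.+1 t)) (le_trans (ler_normD _ _))//.
  apply: (le_trans (lerD H1 H2)).
  have -> : 2 * K / 2 ^+ n.+1 = 2 * K / 2 ^+ n / 2 by rewrite exprS invfM [2^-1 * _]mulrC mulrA.
  by move: nd; set k := 2 * K / _ => nd; lra.
exists v.
  rewrite -Pv /P; have [G0 _] := GP v cv.
  by rewrite clamp_id ?normr0 ?ltW// G0 addr0.
move=> t te; have [_ GD] := GP v cv.
have H : is_derive t (1 : R) (fun t => z + G v t) (f (v t)).
  apply: is_derive_eq (is_deriveD (is_derive_cst z t (1 : R)) (GD t _)) _; last by rewrite add0r.
  by apply: le2; exact: ltW.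
apply: near_eq_is_derive H; near=> s.
rewrite -[v s]Pv /P clamp_id//; apply: ltW; near: s.
by apply: (@cvgr_lt _ _ _ _ (fun s : R => `|s|) `|t|) => //; exact: norm_continuous.
Unshelve. all: by end_near. Qed.

End ODETools.

Section Flow.
Variable R : realType.

Definition boxed q (O : set 'rV[R]_q) :=
  forall x y z : 'rV[R]_q, O x -> O y ->
  (forall i, (x 0 i <= z 0 i <= y 0 i) || (y 0 i <= z 0 i <= x 0 i)) -> O z.

Lemma subr_split (W : zmodType) (a b x y : W) : a - b = (x - y) + ((a - x) - (b - y)).
Proof.
have -> : (a - x) - (b - y) = (a - b) - (x - y).
  by rewrite !opprB addrACA [- x + _]addrC -addrACA.
by rewrite addrCA subrr addr0.
Qed.

Lemma uniform_bound (I : finType) (T : Type) (U : set T) (F : I -> T -> R) :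
  (forall i, exists C : R, forall x, U x -> F i x <= C) ->
  exists2 C : R, 0 <= C & forall i x, U x -> F i x <= C.
Proof.
move=> H; pose C i := projT1 (cid (H i)).
exists (\sum_i `|C i|); first exact: sumr_ge0.
move=> i x Ux; apply: le_trans (projT2 (cid (H i)) x Ux) _; rewrite -/(C i).
by rewrite (bigD1 i)//= (le_trans (ler_norm _))// lerDl sumr_ge0.
Qed.

(** The differential of [F] at [x] applied to [v], built from partial derivatives so that it is
    linear in [v] by construction; [C1_diff_rV] identifies it with ['d F x v]. *)
Definition jacmul p q (F : 'rV[R]_p -> 'rV[R]_q) (x v : 'rV[R]_p) : 'rV[R]_q :=
  \row_j lincomb (fun i => 'D_(delta_mx 0 i) (fun y => F y 0 j) x) v.

Lemma jacmulB p q (F : 'rV[R]_p -> 'rV[R]_q) x v w :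
  jacmul F x (v - w) = jacmul F x v - jacmul F x w.
Proof.
apply/rowP => j; rewrite !mxE /lincomb -sumrB; apply: eq_bigr => i _.
by rewrite !mxE mulrBl.
Qed.

Lemma jacmulZ p q (F : 'rV[R]_p -> 'rV[R]_q) x k v :
  jacmul F x (k *: v) = k *: jacmul F x v.
Proof.
apply/rowP => j; rewrite !mxE /lincomb mulr_sumr; apply: eq_bigr => i _.
by rewrite !mxE mulrA.
Qed.

Lemma lincomb_le p (a : 'I_p -> R) (h : 'rV[R]_p) (c : R) :
  (forall i, `|a i| <= c) -> `|lincomb a h| <= p%:R * c * `|h|.
Proof.
move=> ac; apply: (le_trans (ler_norm_sum _ _ _)).
apply: (@le_trans _ _ (\sum_(i < p) c * `|h|)).
  by apply: ler_sum => i _; rewrite normrM mulrC ler_pM// coord_le_norm.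
by rewrite [leLHS]sumr_const card_ord -[leLHS]mulr_natl mulrA.
Qed.

Lemma Ck_bound_D p q (O : set 'rV[R]_p) (F : 'rV[R]_p -> 'rV[R]_q) :
  (forall j, Ck true 1 O (fun x => F x 0 j)) ->
  exists2 C : R, 0 <= C & forall i j x, O x -> `|'D_(delta_mx 0 i) (fun y => F y 0 j) x| <= C.
Proof.
move=> cF.
have [|C C0 H] := @uniform_bound ('I_p * 'I_q)%type _ O (fun ij x => `|'D_(delta_mx 0 ij.1) (fun y => F y 0 ij.2) x|).
  by move=> [i j] /=; have [_ /(_ isT)] := Ck_Ck0 (CkS_derive (delta_mx 0 i) (cF j)).
by exists C => // i j x Ox; exact: (H (i, j) x Ox).
Qed.

(** [C1_increment] with the zero linear form; the box condition keeps its coordinatewise path inside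
    [O]. *)
Lemma C1_lipschitz p q (O : set 'rV[R]_p) (F : 'rV[R]_p -> 'rV[R]_q) : boxed O ->
  (forall j, Ck true 1 O (fun x => F x 0 j)) ->
  exists2 L : R, 0 <= L & (forall x y, O x -> O y -> `|F y - F x| <= L * `|y - x|) /\
    (forall x v, O x -> `|jacmul F x v| <= L * `|v|).
Proof.
move=> bO cF; have [C C0 CH] := Ck_bound_D cF.
exists (p%:R * C); first by rewrite mulr_ge0.
split=> [x y Ox Oy|x v Ox].
  apply/norm_rV_le => [|j]; first by rewrite !mulr_ge0.
  have := @C1_increment R p (fun x => F x 0 j) x y O (fun _ => 0) C.
  have -> : lincomb (fun _ : 'I_p => 0) (y - x) = 0 :> R.
    by rewrite /lincomb big1// => i _; rewrite mulr0.
  rewrite subr0 !mxE; apply.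
  - by move=> z zi; exact: bO Ox Oy zi.
  - by move=> z i Oz; exact: CkS_derivable (cF j) Oz.
  - by move=> z i Oz; rewrite subr0; exact: CH.
apply/norm_rV_le => [|j]; first by rewrite !mulr_ge0.
by rewrite mxE; apply: lincomb_le => i; exact: CH.
Qed.

(** The partial derivatives are Lipschitz by [C1_lipschitz], so [C1_increment] with the linear form
    at [x] has an error of second order. *)
Lemma C2_taylor p q (O : set 'rV[R]_p) (F : 'rV[R]_p -> 'rV[R]_q) : boxed O ->
  (forall j, Ck true 2 O (fun x => F x 0 j)) ->
  exists2 C : R, 0 <= C &
    (forall x y, O x -> O y -> `|F y - F x - jacmul F x (y - x)| <= C * `|y - x| ^+ 2) /\
    (forall x y v, O x -> O y -> `|jacmul F y v - jacmul F x v| <= C * `|y - x| * `|v|).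
Proof.
move=> bO cF.
(* All partial derivatives are packed into one row vector, so that a single Lipschitz constant
   serves them all. *)
pose DF x : 'rV[R]_(p * q) := mxvec (\matrix_(i, j) 'D_(delta_mx 0 i) (fun y => F y 0 j) x).
have [|L L0 [LH _]] := @C1_lipschitz p (p * q) O DF bO.
  move=> k; have [i j] := mxvec_indexP k.
  have -> : (fun x => DF x 0 (mxvec_index i j)) = 'D_(delta_mx 0 i) (fun y => F y 0 j).
    by apply/funext => x; rewrite mxvecE mxE.
  exact: CkS_derive (cF j).
have LD x y i j : O x -> O y -> `|'D_(delta_mx 0 i) (fun y => F y 0 j) y -
    'D_(delta_mx 0 i) (fun y => F y 0 j) x| <= L * `|y - x|.
  move=> Ox Oy; have := coord_le_norm (DF y - DF x) (mxvec_index i j).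
  by rewrite mxE [in X in _ + X]mxE !mxvecE ![in X in X <= _]mxE => /le_trans; apply; exact: LH.
have bd (x y z : 'rV[R]_p) : (forall i, (x 0 i <= z 0 i <= y 0 i) || (y 0 i <= z 0 i <= x 0 i)) ->
    `|z - x| <= `|y - x|.
  move=> zi; apply/norm_rV_le => // i; apply: le_trans (coord_le_norm (y - x) i).
  rewrite !mxE ler_norml; have := zi i.
  have := ler_norm (y 0 i - x 0 i); have := ler_norm (x 0 i - y 0 i); rewrite distrC.
  by move: `|_| => d a b /orP[] /andP[h1 h2]; apply/andP; split; lra.
exists (p%:R * L); first by rewrite mulr_ge0.
split=> [x y Ox Oy|x y v Ox Oy].
  apply/norm_rV_le => [|j]; first by rewrite !mulr_ge0// exprn_ge0.
  have := @C1_increment R p (fun x => F x 0 j) x y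
    [set z | forall i, (x 0 i <= z 0 i <= y 0 i) || (y 0 i <= z 0 i <= x 0 i)]
    (fun i => 'D_(delta_mx 0 i) (fun y => F y 0 j) x) (L * `|y - x|).
  rewrite !mxE expr2 !mulrA; apply => //.
  - by move=> z i zi; apply: CkS_derivable (cF j) _; exact: bO Ox Oy zi.
  - move=> z i zi; have Oz := bO _ _ _ Ox Oy zi.
    by apply: (le_trans (LD x z i j Ox Oz)); rewrite ler_wpM2l// bd.
apply/norm_rV_le => [|j]; first by rewrite !mulr_ge0.
rewrite !mxE /lincomb -sumrB.
have -> : \sum_i (v 0 i * 'D_(delta_mx 0 i) (fun y => F y 0 j) y -
    v 0 i * 'D_(delta_mx 0 i) (fun y => F y 0 j) x) =
  lincomb (fun i => 'D_(delta_mx 0 i) (fun y => F y 0 j) y -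
    'D_(delta_mx 0 i) (fun y => F y 0 j) x) v.
  by apply: eq_bigr => i _; rewrite mulrBr.
apply: le_trans (lincomb_le v (c := L * `|y - x|) _) _; last by rewrite !mulrA.
by move=> i; exact: LD.
Qed.

Lemma mean_value_seg q (u du : R -> 'rV[R]_q) (c s t : R) :
  (forall r, Num.min s t <= r <= Num.max s t -> is_derive r (1 : R) u (du r)) ->
  (forall r, Num.min s t <= r <= Num.max s t -> `|du r| <= c) ->
  `|u s - u t| <= c * `|s - t|.
Proof.
case: (leP s t) => st uD le.
  by rewrite distrC (distrC s) (ger0_norm (_ : 0 <= t - s)) ?subr_ge0//; exact: mean_value_cst.
by rewrite (gtr0_norm (_ : 0 < s - t)) ?subr_gt0//; apply: mean_value_cst => //; exact: ltW.
Qed.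

Lemma between_lt (e s t r : R) : `|s| < e -> `|t| < e ->
  Num.min s t <= r <= Num.max s t -> `|r| < e.
Proof.
rewrite !ltr_norml => /andP[a b] /andP[c d].
by case: (leP s t) => st /andP[h1 h2]; apply/andP; split; lra.
Qed.

Lemma between_dist (s t r : R) :
  Num.min s t <= r <= Num.max s t -> `|r - t| <= `|s - t|.
Proof.
case: (leP s t) => st /andP[h1 h2].
  by rewrite distrC (distrC s) !ger0_norm ?subr_ge0//; lra.
by rewrite !ger0_norm ?subr_ge0//; lra.
Qed.

(** Divided by [s - t], the remainder is of first order. The criterion suits functions that are
    themselves limits, since a quadratic bound passes to the limit. *)
Lemma is_derive_quadratic (W : normedModType R) (u : R -> W) (t d0 C : R) (d : W) :
  0 < d0 -> (forall s, `|s - t| < d0 -> `|u s - u t - (s - t) *: d| <= C * `|s - t| ^+ 2) ->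
  is_derive t (1 : R) u d.
Proof.
move=> d00 H.
have E : (fun h : R => h^-1 *: ((u \o shift t) (h *: (1 : R)) - u t)) @ 0^' --> d.
  apply/cvgrPdist_le => e e0.
  have C1 : 0 < `|C| + 1 by rewrite ltr_wpDl.
  near=> h.
  have h0 : h != 0 by near: h; exact: nbhs_dnbhs_neq.
  have hd : `|h| < d0 by near: h; exact: dnbhs0_lt.
  have hC : `|h| < e / (`|C| + 1) by near: h; apply: dnbhs0_lt; rewrite divr_gt0.
  have := H (h + t); rewrite addrK => /(_ hd).
  rewrite /= scaler1 => Hh.
  have -> : d - h^-1 *: (u (h + t) - u t) = - (h^-1 *: (u (h + t) - u t - h *: d)).
    by rewrite [in RHS]scalerBr scalerA mulVf// scale1r opprB.
  rewrite normrN normrZ normfV ler_pdivrMl ?normr_gt0//; apply: (le_trans Hh).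
  rewrite expr2 mulrCA ler_wpM2l//.
  apply: (@le_trans _ _ ((`|C| + 1) * `|h|)).
    by rewrite ler_wpM2r//; apply: (le_trans (ler_norm _)); rewrite lerDl.
  by rewrite mulrC -ler_pdivlMr// ltW.
split; first by apply/cvg_ex; exists d.
exact: cvg_lim.
Unshelve. all: by end_near. Qed.

Lemma is_derive_scalel (W : normedModType R) (v : W) (t : R) :
  is_derive t (1 : R) (fun s => s *: v) v.
Proof.
apply: (@is_derive_quadratic _ _ t 1 0) => // s _.
by rewrite scalerBl subrr normr0 mul0r.
Qed.

(** The initial value is affine in the parameter: its derivative in a direction [w] is then the
    constant [w *m P], and the flow paired with its derivative has affine initial values again, as
    the induction in [flow_smooth] requires. Boxedness of [O] serves the mean value estimates. *)
Definition smooth_flow p q (F : 'rV[R]_q -> 'rV[R]_q) (O : set 'rV[R]_q)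
    (Lam : set 'rV[R]_p) (phi : R -> 'rV[R]_p -> 'rV[R]_q) (e : R)
    (P : 'M[R]_(p, q)) (c : 'rV[R]_q) :=
  [/\ open O, boxed O, (exists M : R, forall x, O x -> `|x| <= M) &
      forall k i, Ck true k O (fun x => F x 0 i)] /\
  [/\ open Lam, 0 < e,
      forall l (t : R), Lam l -> `|t| < e ->
        O (phi t l) /\ is_derive t (1 : R) (phi ^~ l) (F (phi t l)) &
      forall l, Lam l -> phi 0 l = l *m P + c].

Lemma mulmx_norm_le p q (P : 'M[R]_(p, q)) :
  exists2 C : R, 0 <= C & forall v : 'rV[R]_p, `|v *m P| <= C * `|v|.
Proof.
have cP : continuous (mulmxr P : 'rV[R]_p -> 'rV[R]_q).
  move=> v; apply: continuous_mx => i j.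
  have -> : (fun y : 'rV[R]_p => mulmxr P y i j) = lincomb (fun k => P k j).
    by apply/funext => y; rewrite /= mxE ord1.
  exact: continuous_lincomb.
have [C C0 CH] := linear_lipschitz cP.
by exists C; [exact: ltW|exact: CH].
Qed.

Lemma flow_lipschitz p q F O (Lam : set 'rV[R]_p) (phi : R -> 'rV[R]_p -> 'rV[R]_q) e P c :
  smooth_flow F O Lam phi e P c ->
  exists2 C : R, 0 <= C & forall (t : R) l l', `|t| < e -> Lam l -> Lam l' ->
    `|phi t l' - phi t l| <= C * `|l' - l|.
Proof.
move=> [[oO bO _ cF] [oL e0 ode ini]].
have [L L0 [LH _]] := C1_lipschitz bO (cF 1%N).
have [A A0 AH] := mulmx_norm_le P.
have L1 : 0 < L + 1 by rewrite ltr_wpDl.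
exists (2 * A * expR (2 * (L + 1) * e)); first by rewrite !mulr_ge0// expR_ge0.
move=> t l l' te Ll Ll'.
have := @gronwall R q (fun t => phi t l' - phi t l) (fun t => F (phi t l') - F (phi t l)) (L + 1) 0 e L1 (lexx 0).
move=> /(_ _ _ t te) H; apply: (le_trans (H _ _)).
- move=> s se; apply: is_deriveB; [exact: (ode l' s Ll' se).2|exact: (ode l s Ll se).2].
- move=> s se; rewrite addr0.
  apply: (le_trans (LH _ _ (ode l s Ll se).1 (ode l' s Ll' se).1)).
  by rewrite ler_wpM2r// lerDl.
- rewrite !ini// mul0r addr0 opprD addrACA subrr addr0 -mulmxBl.
  rewrite [leRHS]mulrAC; apply: ler_wpM2r; first exact: expR_ge0.
  by rewrite -mulrA ler_wpM2l.
Qed.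

(** By [C2_taylor] the difference quotients [q_ h] solve the variational equation up to an error of
    order [h], so Gronwall's inequality makes them Cauchy as [h] tends to 0. The bound on [psi] is
    uniform in [l]; this keeps the phase space of the extended system in [flow_smooth] bounded. *)
Lemma flow_derive p q F O (Lam : set 'rV[R]_p) (phi : R -> 'rV[R]_p -> 'rV[R]_q) e P c w :
  smooth_flow F O Lam phi e P c ->
  exists2 C : R, 0 <= C & forall l, Lam l -> exists psi : R -> 'rV[R]_q,
    [/\ psi 0 = w *m P,
      forall t : R, `|t| < e -> is_derive l w (phi t) (psi t),
      forall t : R, `|t| < e -> is_derive t (1 : R) psi (jacmul F (phi t l) (psi t)) &
      forall t : R, `|t| < e -> `|psi t| <= C].
Proof.
move=> sf; have [C1 C10 C1H] := flow_lipschitz sf.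
have [[oO bO [MO MOH] cF] [oL e0 ode ini]] := sf.
have [L L0 [LH JH]] := C1_lipschitz bO (cF 1%N).
have [C2 C20 [TH J2H]] := C2_taylor bO (cF 2%N).
have [MF MF0 MFH] : exists2 M : R, 0 <= M & forall x, O x -> `|F x| <= M.
  have [|C C0 H] := @uniform_bound 'I_q _ O (fun i x => `|F x 0 i|).
    by move=> i; have [_ /(_ isT)] := Ck_Ck0 (cF 0%N i).
  by exists C => // x Ox; apply/norm_rV_le => // i; exact: H.
have L1 : 0 < L + 1 by rewrite ltr_wpDl.
exists (C1 * `|w|) => [|l Ll]; first by rewrite mulr_ge0.
have [d d0 dH] : exists2 d : R, 0 < d & forall h : R, `|h| < d -> Lam (l + h *: w).
  have : nbhs l Lam by exact: open_nbhs_nbhs.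
  move=> /nbhs_ballP[r /= r0 rH]; have w1 : 0 < `|w| + 1 by rewrite ltr_wpDl.
  exists (r / (`|w| + 1)); first by rewrite divr_gt0.
  move=> h; rewrite ltr_pdivlMr// => hr; apply: rH.
  rewrite -ball_normE /= opprD addNKr normrN normrZ; apply: le_lt_trans hr.
  by rewrite ler_wpM2l// lerDl.
pose q_ (h t : R) := h^-1 *: (phi t (l + h *: w) - phi t l).
pose dq (h t : R) := h^-1 *: (F (phi t (l + h *: w)) - F (phi t l)).
have qD (h t : R) : `|h| < d -> `|t| < e -> is_derive t (1 : R) (q_ h) (dq h t).
  move=> hd te; have D1 := (ode _ t (dH h hd) te).2; have D2 := (ode _ t Ll te).2.
  exact: is_deriveZ (is_deriveB D1 D2).
have phiw (h t : R) : `|h| < d -> `|t| < e -> `|phi t (l + h *: w) - phi t l| <= C1 * (`|h| * `|w|).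
  by move=> hd te; apply: (le_trans (C1H t _ _ te Ll (dH h hd))); rewrite addrC addKr normrZ.
have qbd (h t : R) : h != 0 -> `|h| < d -> `|t| < e -> `|q_ h t| <= C1 * `|w|.
  move=> h0 hd te; rewrite normrZ normfV ler_pdivrMl ?normr_gt0//.
  by rewrite mulrCA; exact: phiw.
pose C4 := C2 * (C1 * `|w|) ^+ 2.
have C40 : 0 <= C4 by rewrite mulr_ge0// exprn_ge0// mulr_ge0.
have dqJ (h t : R) : h != 0 -> `|h| < d -> `|t| < e -> `|dq h t - jacmul F (phi t l) (q_ h t)| <= C4 * `|h|.
  move=> h0 hd te; rewrite jacmulZ -scalerBr normrZ normfV ler_pdivrMl ?normr_gt0//.
  have O1 := (ode _ t Ll te).1; have O2 := (ode _ t (dH h hd) te).1.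
  apply: (le_trans (TH _ _ O1 O2)); have B := phiw h t hd te.
  have -> : `|h| * (C4 * `|h|) = C2 * (C1 * (`|h| * `|w|)) ^+ 2 by rewrite /C4; ring.
  by rewrite ler_wpM2l// lerXn2r// ?nnegrE// !mulr_ge0.
pose C3 := 2 * (C4 * e) * expR (2 * (L + 1) * e).
have C30 : 0 <= C3 by rewrite !mulr_ge0 ?expR_ge0// ltW.
have q0 (h : R) : h != 0 -> `|h| < d -> q_ h 0 = w *m P.
  move=> h0 hd; rewrite /q_ !ini//; last exact: dH.
  by rewrite opprD addrACA subrr addr0 -mulmxBl addrC addKr -scalemxAl scalerA mulVf// scale1r.
have qq (h h' t : R) : h != 0 -> h' != 0 -> `|h| < d -> `|h'| < d -> `|t| < e ->
    `|q_ h t - q_ h' t| <= C3 * (`|h| + `|h'|).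
  move=> h0 h'0 hd h'd te.
  have hh : 0 <= C4 * (`|h| + `|h'|) by rewrite mulr_ge0// addr_ge0.
  have := @gronwall R q (fun t => q_ h t - q_ h' t) (fun t => dq h t - dq h' t) (L + 1)
    (C4 * (`|h| + `|h'|)) e L1 hh.
  move=> /(_ _ _ t te) H; apply: (le_trans (H _ _)).
  - by move=> s se; apply: is_deriveB; exact: qD.
  - move=> s se.
    have -> : dq h s - dq h' s = jacmul F (phi s l) (q_ h s - q_ h' s) +
       ((dq h s - jacmul F (phi s l) (q_ h s)) - (dq h' s - jacmul F (phi s l) (q_ h' s))).
      by rewrite jacmulB; exact: subr_split.
    rewrite (le_trans (ler_normD _ _))// lerD//.
      apply: (le_trans (JH _ _ (ode _ s Ll se).1)).
      by rewrite ler_wpM2r// lerDl.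
    by rewrite (le_trans (ler_normB _ _))// mulrDr lerD// dqJ.
  - rewrite !q0// subrr normr0 add0r /C3 le_eqVlt; apply/orP; left; apply/eqP; ring.
(* The limit is taken along a geometric sequence of steps, and [qq] extends the estimate to all
   small [h]. For [t] outside the time interval 0 is a default value. *)
have lim_ex t : exists z, `|t| < e -> forall h : R, h != 0 -> `|h| < d -> `|q_ h t - z| <= C3 * `|h|.
  have [te|] := ltP `|t| e; last by exists 0.
  pose hn (n : nat) := d / 2 / 2 ^+ n.
  have hn0 n : 0 < hn n by rewrite !divr_gt0// exprn_gt0.
  have hnd n : `|hn n| < d.
    rewrite gtr0_norm//; apply: (@le_lt_trans _ _ (d / 2)).
      have d2 : 0 <= d / 2 by rewrite divr_ge0// ltW.
      by rewrite ler_pdivrMr ?exprn_gt0// ler_peMr// exprn_ege1// ler1n.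
    by rewrite ltr_pdivrMr// ltr_pMr// ltr1n.
  have hnS n : hn n.+1 <= hn n.
    by rewrite /hn ler_pM2l ?divr_gt0// lef_pV2 ?posrE ?exprn_gt0// exprS ler_peMl ?exprn_ge0// ler1n.
  have step n : `|q_ (hn n.+1) t - q_ (hn n) t| <= (C3 * d) / 2 ^+ n.
    apply: (le_trans (qq _ _ t (lt0r_neq0 (hn0 _)) (lt0r_neq0 (hn0 _)) (hnd _) (hnd _) te)).
    rewrite -mulrA ler_wpM2l// !gtr0_norm//.
    apply: (@le_trans _ _ (hn n + hn n)); first by rewrite lerD2r.
    by rewrite /hn -mulrDl -splitr.
  have K0 : 0 <= C3 * d by rewrite mulr_ge0// ltW.
  have [z zH] := geometric_cvg_rV K0 step.
  exists z => _ h h0 hd; apply/ler_addgt0Pr => eps eps0.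
  have [n nH] := half_pow_small (3 * (C3 * d)) eps0.
  rewrite -(subrKA (q_ (hn n) t)) (le_trans (ler_normD _ _))//.
  have A1 := qq _ _ t h0 (lt0r_neq0 (hn0 n)) hd (hnd n) te.
  have A2 := zH n; rewrite distrC in A2.
  apply: (le_trans (lerD A1 A2)); rewrite mulrDr -addrA lerD2l.
  apply: le_trans nH; rewrite gtr0_norm// /hn.
  have -> : 3 * (C3 * d) / 2 ^+ n = C3 * d / 2 ^+ n + 2 * (C3 * d) / 2 ^+ n by rewrite -mulrDl; congr (_ / _); ring.
  rewrite lerD2r mulrA ler_wpM2r ?invr_ge0 ?exprn_ge0//.
  by rewrite ler_wpM2l// ler_pdivrMr// ler_pMr// ler1n.
pose psi t := projT1 (cid (lim_ex t)).
have psiH (t : R) : `|t| < e -> forall h : R, h != 0 -> `|h| < d -> `|q_ h t - psi t| <= C3 * `|h| :=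
  projT2 (cid (lim_ex t)).
have small (X Y K : R) : 0 <= K -> (forall h : R, h != 0 -> `|h| < d -> X <= Y + K * `|h|) -> X <= Y.
  move=> K0 H; apply/ler_addgt0Pr => eps eps0.
  have K1 : 0 < K + 1 by rewrite ltr_wpDl.
  pose h := Num.min (d / 2) (eps / (K + 1)).
  have h0 : 0 < h by rewrite lt_min !divr_gt0.
  have hd : `|h| < d.
    rewrite gtr0_norm// gt_min; apply/orP; left.
    by rewrite ltr_pdivrMr// ltr_pMr// ltr1n.
  apply: (le_trans (H h (lt0r_neq0 h0) hd)); rewrite lerD2l gtr0_norm//.
  apply: (@le_trans _ _ ((K + 1) * h)); first by rewrite ler_pM2r// lerDl.
  by rewrite mulrC -ler_pdivlMr// ge_min lexx orbT.
exists psi.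
have e00 : `|0 : R| < e by rewrite normr0.
have psibd (t : R) : `|t| < e -> `|psi t| <= C1 * `|w|.
  move=> te; apply: (small _ _ C3) => // h h0 hd.
  rewrite -[psi t](subKr (q_ h t)) (le_trans (ler_normB _ _))// lerD//; first exact: qbd.
  exact: psiH.
split=> //.
- apply/eqP; rewrite -subr_eq0 -normr_le0; apply: (small _ _ C3) => // h h0 hd.
  by rewrite add0r -(q0 h h0 hd) distrC; exact: psiH.
- move=> t te.
  have E : (fun h : R => h^-1 *: ((phi t \o shift l) (h *: w) - phi t l)) @ 0^' --> psi t.
    apply/cvgrPdist_le => eps eps0.
    have K1 : 0 < C3 + 1 by rewrite ltr_wpDl.
    near=> h.
    have h0 : h != 0 by near: h; exact: nbhs_dnbhs_neq.
    have hd : `|h| < d by near: h; exact: dnbhs0_lt.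
    have hC : `|h| < eps / (C3 + 1) by near: h; apply: dnbhs0_lt; rewrite divr_gt0.
    rewrite distrC /= [h *: w + l]addrC; apply: (le_trans (psiH t te h h0 hd)).
    apply: (@le_trans _ _ ((C3 + 1) * `|h|)); first by rewrite ler_wpM2r// lerDl.
    by rewrite mulrC -ler_pdivlMr// ltW.
  split; first by apply/cvg_ex; exists (psi t).
  exact: cvg_lim.
- move=> t te.
  pose B0 := jacmul F (phi t l) (psi t).
  pose C6 := C4 * d + L * (C1 * `|w|).
  have C60 : 0 <= C6 by rewrite addr_ge0// !mulr_ge0// ltW.
  have dqbd (h s : R) : h != 0 -> `|h| < d -> `|s| < e -> `|dq h s| <= C6.
    move=> h0 hd se; rewrite -[dq h s](subrK (jacmul F (phi s l) (q_ h s))).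
    rewrite (le_trans (ler_normD _ _))// lerD//.
      by apply: (le_trans (dqJ h s h0 hd se)); rewrite ler_wpM2l// ltW.
    apply: (le_trans (JH _ _ (ode _ s Ll se).1)); rewrite ler_wpM2l//.
    exact: qbd.
  pose C5 := L * C6 + C2 * MF * (C1 * `|w|).
  have C50 : 0 <= C5 by rewrite addr_ge0// !mulr_ge0.
  pose C7 := C4 + L * C3.
  have C70 : 0 <= C7 by rewrite addr_ge0// mulr_ge0.
  (* The constants do not depend on [h]. Integrating from [t] to [s] and then letting [h] tend to 0
     gives [psi] a quadratic remainder at [t], as [is_derive_quadratic] asks. *)
  have main (h s : R) : h != 0 -> `|h| < d -> `|s| < e -> `|dq h s - B0| <= C5 * `|s - t| + C7 * `|h|.
    move=> h0 hd se.
    have -> : dq h s - B0 = (dq h s - jacmul F (phi s l) (q_ h s)) +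
        (jacmul F (phi s l) (q_ h s - psi t) + (jacmul F (phi s l) (psi t) - B0)).
      by rewrite jacmulB addrA subrKA addrA subrK.
    have b1 := dqJ h s h0 hd se.
    have b2 := JH (phi s l) (q_ h s - psi t) (ode _ s Ll se).1.
    have b3 := J2H (phi t l) (phi s l) (psi t) (ode _ t Ll te).1 (ode _ s Ll se).1.
    have c1 : `|q_ h s - q_ h t| <= C6 * `|s - t|.
      apply: (mean_value_seg (du := dq h)) => r rI; have re := between_lt se te rI.
        exact: qD.
      exact: dqbd.
    have c2 : `|phi s l - phi t l| <= MF * `|s - t|.
      apply: (mean_value_seg (u := fun r => phi r l) (du := fun r => F (phi r l))) => r rI;
        have re := between_lt se te rI; have [Or Dr] := ode _ r Ll re; [exact: Dr|exact: MFH].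
    have c3 := psiH t te h h0 hd; have c4 := psibd t te.
    have c5 : `|q_ h s - psi t| <= C6 * `|s - t| + C3 * `|h|.
      rewrite -(subrKA (q_ h t)) (le_trans (ler_normD _ _))// lerD//.
    rewrite (le_trans (ler_normD _ _))// (le_trans (lerD b1 (ler_normD _ _)))//.
    have b2' : L * `|q_ h s - psi t| <= L * (C6 * `|s - t| + C3 * `|h|) by rewrite ler_wpM2l.
    have b3' : C2 * `|phi s l - phi t l| * `|psi t| <= C2 * (MF * `|s - t|) * (C1 * `|w|).
      by apply: ler_pM => //; rewrite ?mulr_ge0// ler_wpM2l.
    apply: (le_trans (lerD (lexx _) (lerD (le_trans b2 b2') (le_trans b3 b3')))).
    rewrite /C5 /C7 le_eqVlt; apply/orP; left; apply/eqP; ring.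
  apply: (@is_derive_quadratic _ _ t (e - `|t|) C5); first by rewrite subr_gt0.
  move=> s st.
  have se : `|s| < e.
    rewrite -[s](subrK t) (le_lt_trans (ler_normD _ _))//.
    by move: st; rewrite ltrBrDr.
  apply: (small _ _ (C7 * `|s - t| + 2 * C3)) => [|h h0 hd].
    by rewrite addr_ge0// mulr_ge0.
  have b1 : `|q_ h s - s *: B0 - (q_ h t - t *: B0)| <= (C5 * `|s - t| + C7 * `|h|) * `|s - t|.
    apply: (mean_value_seg (u := fun r => q_ h r - r *: B0) (du := fun r => dq h r - B0)) => r rI;
      have re := between_lt se te rI.
      apply: is_deriveB; first exact: qD.
      exact: is_derive_scalel.
    apply: (le_trans (main h r h0 hd re)); rewrite lerD2r ler_wpM2l//.
    exact: between_dist.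
  have b2 := psiH s se h h0 hd; have b3 := psiH t te h h0 hd.
  have -> : psi s - psi t - (s - t) *: B0 = (q_ h s - s *: B0 - (q_ h t - t *: B0)) +
     ((q_ h t - psi t) - (q_ h s - psi s)).
    rewrite scalerBl; apply/rowP => j; rewrite !mxE; ring.
  rewrite (le_trans (ler_normD _ _))// (le_trans (lerD b1 (le_trans (ler_normB _ _) (lerD b3 b2))))//.
  rewrite le_eqVlt; apply/orP; left; apply/eqP; ring.
Unshelve. all: by end_near. Qed.

Lemma Ck_coord p (bd : bool) k (U : set 'rV[R]_p) i : open U ->
  (bd -> exists M : R, forall x, U x -> `|x| <= M) -> Ck bd k U (fun x => x 0 i).
Proof.
move=> oU bU.
have E : (fun x : 'rV[R]_p => x 0 i) = lincomb (fun j => (j == i)%:R).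
  apply/funext => x; rewrite /lincomb (bigD1 i)//= eqxx mulr1 big1 ?addr0// => j ji.
  by rewrite (negbTE ji) mulr0.
rewrite E; pose Lm := GRing.isLinear.Build _ _ _ _ _ (lincomb_linear (fun j : 'I_p => (j == i)%:R : R)).
pose L : {linear 'rV[R]_p -> R} := HB.pack (lincomb (fun j => (j == i)%:R)) Lm.
apply: (@Ck_linear R _ bd U oU k L); first exact: continuous_lincomb.
move=> /bU[M MH]; exists M => x Ux; rewrite -[L x]/(lincomb (fun j => (j == i)%:R) x) -E.
by apply: le_trans (coord_le_norm _ _) _; exact: MH.
Qed.

Lemma norm_lsubmx_le p1 p2 (x : 'rV[R]_(p1 + p2)) : `|lsubmx x| <= `|x|.
Proof. by apply/norm_rV_le => // i; rewrite mxE coord_le_norm. Qed.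

Lemma norm_rsubmx_le p1 p2 (x : 'rV[R]_(p1 + p2)) : `|rsubmx x| <= `|x|.
Proof. by apply/norm_rV_le => // i; rewrite mxE coord_le_norm. Qed.

Lemma norm_row_mx_le p1 p2 (x : 'rV[R]_p1) (y : 'rV[R]_p2) c :
  `|x| <= c -> `|y| <= c -> `|row_mx x y| <= c.
Proof.
move=> xc yc; apply/norm_rV_le => [|i]; first exact: le_trans xc.
by rewrite mxE; case: splitP => j _; [apply: le_trans xc|apply: le_trans yc]; exact: coord_le_norm.
Qed.

Lemma is_derive_row_mx p1 p2 (u : R -> 'rV[R]_p1) (v : R -> 'rV[R]_p2) (t : R) du dv :
  is_derive t (1 : R) u du -> is_derive t (1 : R) v dv ->
  is_derive t (1 : R) (fun s => row_mx (u s) (v s)) (row_mx du dv).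
Proof.
move=> /is_derive_mxP uD /is_derive_mxP vD; apply/is_derive_mxP => i j; rewrite mxE.
case: splitP => k jk.
  have -> : (fun y => row_mx (u y) (v y) i j) = (fun y => u y i k).
    by apply/funext => y; rewrite mxE; case: splitP => k' jk'; [congr (u y i _); apply: val_inj; rewrite /= -jk jk'|
      move: jk; rewrite jk' => H; have := ltn_ord k; rewrite -H ltnNge leq_addr].
  exact: uD.
have -> : (fun y => row_mx (u y) (v y) i j) = (fun y => v y i k).
  apply/funext => y; rewrite mxE; case: splitP => k' jk'.
    by have := ltn_ord k'; rewrite -jk' jk ltnNge leq_addr.
  by congr (v y i _); apply: val_inj; apply: (@addnI p1); rewrite -jk jk'.
exact: vD.
Qed.

(* The derivative of the flow solves the variational equation, so that the pair (flow,
   derivative) is again a flow: regularity improves by induction. *)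
Lemma flow_smooth k p : forall q F O (Lam : set 'rV[R]_p) (phi : R -> 'rV[R]_p -> 'rV[R]_q) e P c,
  smooth_flow F O Lam phi e P c ->
  forall (t : R) i, `|t| < e -> Ck false k Lam (fun l => phi t l 0 i).
Proof.
have base q F O Lam (phi : R -> 'rV[R]_p -> 'rV[R]_q) e P c : smooth_flow F O Lam phi e P c ->
    forall (t : R) i, `|t| < e -> Ck0 false Lam (fun l => phi t l 0 i).
  move=> sf t i te; have [C C0 CH] := flow_lipschitz sf; have [_ [oL e0 _ _]] := sf.
  split=> // l Ll; apply: (@continuous_comp _ _ _ (phi t) (fun x : 'rV[R]_q => x 0 i)).
    apply: (@lipschitz_continuous_at _ _ _ _ C Lam); first exact: open_nbhs_nbhs.
    by move=> l' Ll'; apply: CH.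
  exact: coord_continuous.
elim: k => [|k ih] q F O Lam phi e P c sf t i te; (split; first exact: (base _ _ _ _ _ _ _ _ sf)) => // w.
have [[oO bO [M MH] cF] [oL e0 ode ini]] := sf.
have [C C0 CH] := flow_derive w sf.
pose psi t l := if pselect (Lam l) is left Ll then projT1 (cid (CH l Ll)) t else 0.
have psiH l : Lam l -> [/\ psi 0 l = w *m P,
      forall t : R, `|t| < e -> is_derive l w (phi t) (psi t l),
      forall t : R, `|t| < e -> is_derive t (1 : R) (psi ^~ l) (jacmul F (phi t l) (psi t l)) &
      forall t : R, `|t| < e -> `|psi t l| <= C].
  move=> Ll; rewrite /psi; case: pselect => // Ll'; exact: (projT2 (cid (CH l Ll'))).
have dphi t' l : `|t'| < e -> Lam l -> is_derive l w (fun l => phi t' l 0 i) (psi t' l 0 i).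
  by move=> t'e Ll; have [_ /(_ t' t'e) /is_derive_mxP /(_ 0 i)] := psiH l Ll.
split=> [l Ll|]; first exact: (@ex_derive _ _ _ _ _ _ _ (dphi t l te Ll)).
apply: (Ck_ext oL (f := fun l => psi t l 0 i)).
  by move=> l Ll; rewrite (@derive_val _ _ _ _ _ _ _ (dphi t l te Ll)).
(* The derivative along every trajectory is at most [C]; the slack 1 puts it inside an open set that
   is still bounded. *)
pose O' := [set x : 'rV[R]_(q + q) | O (lsubmx x) /\ `|rsubmx x| < C + 1].
pose F' (x : 'rV[R]_(q + q)) := row_mx (F (lsubmx x)) (jacmul F (lsubmx x) (rsubmx x)).
have oO' : open O'.
  have o1 : open [set x : 'rV[R]_(q + q) | O (lsubmx x)].
    by apply: open_comp => // x _; exact: continuous_lsubmx.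
  have o2 : open [set x : 'rV[R]_(q + q) | `|rsubmx x| < C + 1].
    apply: (@open_comp _ _ (fun x : 'rV[R]_(q + q) => `|rsubmx x|) [set y | y < C + 1]); last exact: open_lt.
    by move=> x _; apply: continuous_comp; [exact: continuous_rsubmx|exact: norm_continuous].
  exact: openI o1 o2.
have bdO' : exists M : R, forall x, O' x -> `|x| <= M.
  exists (Num.max M (C + 1)) => x [Ox xC]; rewrite -[x]hsubmxK.
  by apply: norm_row_mx_le; rewrite le_max; [rewrite MH|rewrite (ltW xC) orbT].
have cl j : Ck true k.+1 O' (fun x : 'rV[R]_(q + q) => lsubmx x 0 j).
  have -> : (fun x : 'rV[R]_(q + q) => lsubmx x 0 j) = (fun x => x 0 (lshift q j)).
    by apply/funext => x; rewrite mxE.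
  exact: Ck_coord.
have sf' : smooth_flow F' O' Lam (fun t l => row_mx (phi t l) (psi t l)) e (row_mx P 0) (row_mx c (w *m P)).
  split; split=> //.
  - move=> x y z [Ox xC] [Oy yC] zi; split.
      by apply: bO Ox Oy _ => j; rewrite !mxE; exact: zi.
    apply: (@le_lt_trans _ _ (Num.max `|rsubmx x| `|rsubmx y|)); last by rewrite gt_max xC yC.
    apply/norm_rV_le => [|j]; first by rewrite le_max normr_ge0.
    rewrite le_max; have := zi (rshift q j).
    have := coord_le_norm (rsubmx x) j; have := coord_le_norm (rsubmx y) j; rewrite !mxE.
    by move=> h1 h2; exact: norm_between h2 h1.
  - move=> k' i'; rewrite /F'.
    have oOl : forall x, O' x -> O (lsubmx x) by move=> x [].
    have cl' j : Ck true k' O' (fun x : 'rV[R]_(q + q) => lsubmx x 0 j).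
      have -> : (fun x : 'rV[R]_(q + q) => lsubmx x 0 j) = (fun x => x 0 (lshift q j)).
        by apply/funext => x; rewrite mxE.
      exact: Ck_coord.
    case: (split_ordP i') => j ->.
      have -> : (fun x => row_mx (F (lsubmx x)) (jacmul F (lsubmx x) (rsubmx x)) 0 (lshift q j)) =
         (fun x => F (lsubmx x) 0 j) by apply/funext => x; rewrite row_mxEl.
      exact: (Ck_comp (g := fun x => lsubmx x) oO' oO oOl cl' (cF k' j)).
    have -> : (fun x => row_mx (F (lsubmx x)) (jacmul F (lsubmx x) (rsubmx x)) 0 (rshift q j)) =
         (fun x => \sum_i x 0 (rshift q i) * 'D_(delta_mx 0 i) (fun y => F y 0 j) (lsubmx x)).
      by apply/funext => x; rewrite row_mxEr mxE /lincomb; apply: eq_bigr => i0 _; rewrite mxE.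
    apply: Ck_sum => // i0; apply: Ck_mul => //; first exact: Ck_coord.
    have cD := CkS_derive (delta_mx 0 i0) (cF k'.+1 j).
    exact: (Ck_comp (g := fun x => lsubmx x) oO' oO oOl cl' cD).
  - move=> l s Ll se; have [Os Ds] := ode l s Ll se; have [_ _ psiD psiC] := psiH l Ll.
    split.
      rewrite /O' /= row_mxKl row_mxKr; split=> //; apply: le_lt_trans (psiC s se) _.
      by rewrite ltrDl.
    by rewrite /F' row_mxKl row_mxKr; apply: is_derive_row_mx => //; exact: psiD.
  - move=> l Ll; have [p0 _ _ _] := psiH l Ll.
    by rewrite ini// p0 mul_mx_row mulmx0 add_row_mx add0r.
have := ih _ _ _ _ _ _ _ _ sf' t (rshift q i) te.
have -> // : (fun l => row_mx (phi t l) (psi t l) 0 (rshift q i)) = (fun l => psi t l 0 i).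
by apply/funext => l; rewrite row_mxEr.
Qed.

Lemma ode_unique q (F : 'rV[R]_q -> 'rV[R]_q) (B : set 'rV[R]_q) (L e : R) (u v : R -> 'rV[R]_q) :
  (forall x y, B x -> B y -> `|F y - F x| <= L * `|y - x|) ->
  (forall t : R, `|t| < e -> B (u t) /\ is_derive t (1 : R) u (F (u t))) ->
  (forall t : R, `|t| < e -> B (v t) /\ is_derive t (1 : R) v (F (v t))) ->
  u 0 = v 0 -> forall t : R, `|t| < e -> u t = v t.
Proof.
move=> FL uD vD uv t te.
have L1 : 0 < `|L| + 1 by rewrite ltr_wpDl.
have := @gronwall R q (fun t => u t - v t) (fun t => F (u t) - F (v t)) (`|L| + 1) 0 e L1 (lexx 0).
move=> /(_ _ _ t te) H.
apply/eqP; rewrite -subr_eq0 -normr_le0; apply: (le_trans (H _ _)).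
- by move=> s se; apply: is_deriveB; [exact: (uD s se).2|exact: (vD s se).2].
- move=> s se; rewrite addr0; apply: (le_trans (FL _ _ (vD s se).1 (uD s se).1)).
  by rewrite ler_wpM2r//; apply: (le_trans (ler_norm _)); rewrite lerDl.
- by rewrite uv subrr normr0 mul0r addr0 mulr0 mul0r.
Qed.

Lemma ball_boxed q (z0 : 'rV[R]_q) (r : R) : boxed (ball z0 r).
Proof.
move=> x y z; rewrite -ball_normE /= => xr yr zi.
apply: (@le_lt_trans _ _ (Num.max `|z0 - x| `|z0 - y|)); last by rewrite gt_max xr yr.
apply/norm_rV_le => [|j]; first by rewrite le_max normr_ge0.
rewrite le_max; have := zi j.
have := coord_le_norm (z0 - x) j; have := coord_le_norm (z0 - y) j; rewrite !mxE.
move=> h1 h2 h3; apply: (norm_between h2 h1); rewrite !lerD2l !lerN2.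
by case/orP: h3 => /andP[-> ->]; rewrite ?orbT.
Qed.

(** The closed ball is compact and lies in [O], so every derivative attains a maximal absolute value
    on it. *)
Lemma Ck_ball_bounded q (z0 : 'rV[R]_q) (rho : R) O k f :
  (forall z, `|z0 - z| <= rho -> O z) -> Ck false k O f -> Ck true k (ball z0 rho) f.
Proof.
move=> bO.
have bd g : Ck0 false O g -> Ck0 true (ball z0 rho) g.
  move=> [cg _]; split=> [x|_].
    by rewrite -ball_normE /= => /ltW /bO; exact: cg.
  pose A := [set z : 'rV[R]_q | `|z0 - z| <= rho].
  have [r0|r0] := leP 0 rho; last first.
    by exists 0 => x; rewrite -ball_normE /= => /(le_lt_trans (normr_ge0 _)) /(lt_trans r0); rewrite ltxx.
  have cA : compact A.
    apply: bounded_closed_compact.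
      exists (`|z0| + rho); split; first exact: num_real.
      move=> M HM z zA; apply: le_trans (ltW HM); rewrite -[z](subKr z0).
      by rewrite (le_trans (ler_normB _ _))// lerD2l.
    apply: (@preimage_closed _ _ (fun z : 'rV[R]_q => `|z0 - z|) [set y | y <= rho]); last exact: closed_le.
    move=> z _; apply: (@lipschitz_continuous_at _ _ _ _ 1 setT); first exact: filterT.
    move=> y _; rewrite mul1r; apply: le_trans (ler_dist_dist _ _) _.
    by rewrite opprB addrC subrKA distrC.
  have [||c cI cM] := @EVT_max_rV R q (fun z => `|g z|) A _ cA.
  - by exists z0; rewrite /A /= subrr normr0.
  - apply: continuous_in_subspaceT => z; rewrite inE => zA.
    by apply: (@continuous_comp _ _ _ g (fun y => `|y|)); [apply: cg; exact: bO|exact: norm_continuous].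
  exists `|g c| => x; rewrite -ball_normE /= => /ltW xr; apply: cM; rewrite inE.
  exact: xr.
elim: k f => [|k ih] f [f0 fS]; (split; first exact: bd) => // v.
have [d1 d2] := fS v; split; last exact: ih.
by move=> x; rewrite -ball_normE /= => /ltW /bO; exact: d1.
Qed.

(** The field is made globally Lipschitz by clamping its argument, solved by [picard], and the
    solutions that start near [z0] are shown never to notice the clamping. Smoothness is
    [flow_smooth] with the identity as initial map. *)
Theorem local_flow q (F : 'rV[R]_q -> 'rV[R]_q) O z0 : open O -> O z0 ->
  (forall k i, Ck false k O (fun x => F x 0 i)) ->
  exists rho r e L : R, exists Phi : R -> 'rV[R]_q -> 'rV[R]_q,
  [/\ 0 < rho, 0 < r <= rho, 0 < e, 0 < L & L * e <= 16^-1] /\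
  [/\ ball z0 rho `<=` O,
      (forall x y, ball z0 rho x -> ball z0 rho y -> `|F y - F x| <= L * `|y - x|),
      (forall z (t : R), ball z0 r z -> `|t| < e ->
         ball z0 rho (Phi t z) /\ is_derive t (1 : R) (Phi ^~ z) (F (Phi t z))),
      (forall z, ball z0 r z -> Phi 0 z = z) &
      forall k (t : R) i, `|t| < e -> Ck false k (ball z0 r) (fun z => Phi t z 0 i)].
Proof.
move=> oO Oz0 cF.
have : nbhs z0 O by exact: open_nbhs_nbhs.
move=> /nbhs_ballP[rho' /= rho'0 rhoO'].
pose rho := rho' / 2; have rho0 : 0 < rho by rewrite divr_gt0.
have rhoO z : `|z0 - z| <= rho -> O z.
  move=> zr; apply: rhoO'; rewrite -ball_normE /=; apply: le_lt_trans zr _.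
  by rewrite ltr_pdivrMr// ltr_pMr// ltr1n.
have cFb k i : Ck true k (ball z0 rho) (fun x => F x 0 i) by exact: Ck_ball_bounded rhoO (cF k i).
have [L' L'0 [LH _]] := C1_lipschitz (@ball_boxed q z0 rho) (cFb 1%N).
pose L := L' + 1; have L0 : 0 < L by rewrite ltr_wpDl.
have LH' x y : ball z0 rho x -> ball z0 rho y -> `|F y - F x| <= L * `|y - x|.
  by move=> bx by_; apply: (le_trans (LH x y bx by_)); rewrite ler_wpM2r// lerDl.
have [MF MF0 MFH] : exists2 M : R, 0 <= M & forall x, ball z0 rho x -> `|F x| <= M.
  have [|C C0 H] := @uniform_bound 'I_q _ (ball z0 rho) (fun i x => `|F x 0 i|).
    by move=> i; have [_ /(_ isT)] := Ck_Ck0 (cFb 0%N i).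
  by exists C => // x Ox; apply/norm_rV_le => // i; exact: H.
(* The first entry gives the smallness of [L * e] on which the constants of [exp_ball_exists] rest.
   The second lets a trajectory move by at most [rho / 8], so that one starting within [rho / 4]
   stays within [rho / 2]. *)
pose e := Num.min (16 * L)^-1 (rho / (8 * (MF + 1))).
have MF1 : 0 < MF + 1 by rewrite ltr_wpDl.
have e0 : 0 < e by rewrite lt_min invr_gt0 !divr_gt0// mulr_gt0.
have Le : L * e <= 16^-1.
  rewrite mulrC -ler_pdivlMr// -invfM ge_min; apply/orP; left.
  by rewrite lexx.
have Me : MF * e <= rho / 8.
  apply: (@le_trans _ _ ((MF + 1) * e)); first by rewrite ler_pM2r// lerDl.
  rewrite mulrC -ler_pdivlMr// -mulrA -invfM ge_min; apply/orP; right.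
  by rewrite lexx.
(* Coordinatewise clamping is Lipschitz with constant 1 and is the identity within [rho / 2] of
   [z0], since balls of the maximum norm are boxes. *)
pose cl (x : 'rV[R]_q) : 'rV[R]_q := \row_i (z0 0 i + clamp (rho / 2) (x 0 i - z0 0 i)).
have rho2 : 0 < rho / 2 by rewrite divr_gt0.
have clb x : ball z0 rho (cl x).
  rewrite -ball_normE /=; apply: (@le_lt_trans _ _ (rho / 2)); last first.
    by rewrite ltr_pdivrMr// ltr_pMr// ltr1n.
  apply/norm_rV_le => [|i]; first exact: ltW.
  by rewrite !mxE opprD addNKr normrN; apply: clamp_bound; exact: ltW.
have clid x : `|z0 - x| <= rho / 2 -> cl x = x.
  move=> xr; apply/rowP => i; rewrite mxE clamp_id; first by rewrite addrC subrK.
  rewrite distrC; apply: le_trans xr; have := coord_le_norm (z0 - x) i.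
  by rewrite !mxE.
have clL x y : `|cl x - cl y| <= `|x - y|.
  apply/norm_rV_le => // i; rewrite !mxE opprD addrACA subrr add0r.
  apply: le_trans (clamp_lipschitz _ _ (ltW rho2)) _.
  rewrite opprB addrA subrK; have := coord_le_norm (x - y) i.
  by rewrite !mxE.
have FL x y : `|F (cl x) - F (cl y)| <= L * `|x - y|.
  by apply: (le_trans (LH' _ _ (clb y) (clb x))); rewrite ler_pM2l.
have Le2 : L * e <= 2^-1.
  by apply: (le_trans Le); rewrite lef_pV2 ?posrE// ler_nat.
have pic z : exists u : R -> 'rV[R]_q, u 0 = z /\
    forall t : R, `|t| < e -> is_derive t (1 : R) u (F (cl (u t))).
  by have [u u0 uD] := picard z L0 e0 Le2 FL; exists u.
pose Phi t z := projT1 (cid (pic z)) t.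
have PhiH z : Phi 0 z = z /\ forall t : R, `|t| < e -> is_derive t (1 : R) (Phi ^~ z) (F (cl (Phi t z))).
  exact: projT2 (cid (pic z)).
have stay z (t : R) : ball z0 (rho / 4) z -> `|t| < e -> `|z0 - Phi t z| <= rho / 2.
  move=> zb te; have [P0 PD] := PhiH z.
  have H : `|Phi t z - Phi 0 z| <= MF * `|t - 0|.
    apply: (mean_value_seg (u := Phi ^~ z) (du := fun s => F (cl (Phi s z)))) => s sI.
      by apply: PD; apply: between_lt te _ sI; rewrite normr0.
    by apply: MFH; exact: clb.
  move: zb; rewrite -ball_normE /= => zb.
  rewrite P0 subr0 in H.
  have -> : z0 - Phi t z = (z0 - z) - (Phi t z - z) by rewrite opprB addrA subrK.
  rewrite (le_trans (ler_normB _ _))//.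
  have H2 : MF * `|t| <= MF * e by rewrite ler_wpM2l// ltW.
  by move: (le_trans H H2) zb; move: (`|z0 - z|) (`|Phi t z - z|) => X Y; lra.
have Phi1 z (t : R) : ball z0 (rho / 4) z -> `|t| < e ->
    ball z0 rho (Phi t z) /\ is_derive t (1 : R) (Phi ^~ z) (F (Phi t z)).
  move=> zb te; have st := stay z t zb te; split.
    rewrite -ball_normE /=; apply: le_lt_trans st _.
    by rewrite ltr_pdivrMr// ltr_pMr// ltr1n.
  by have [_ /(_ t te)] := PhiH z; rewrite clid.
exists rho, (rho / 4), e, L, Phi; split; split=> //.
- apply/andP; split; first by rewrite divr_gt0.
  by rewrite ler_pdivrMr// ler_peMr ?ltW// ltr1n.
- by move=> z; rewrite -ball_normE /= => /ltW; exact: rhoO.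
- by move=> z _; have [] := PhiH z.
- move=> k t i te.
  apply: (@flow_smooth k q q F (ball z0 rho) (ball z0 (rho / 4)) Phi e 1%:M 0) => //.
  split; split=> //.
  + exact: ball_open.
  + exact: ball_boxed.
  + exists (`|z0| + rho) => x; rewrite -ball_normE /= => xr; rewrite -[x](subKr z0).
    by rewrite (le_trans (ler_normB _ _))// lerD2l ltW.
  + exact: ball_open.
  + by move=> l lb; rewrite mulmx1 addr0; have [] := PhiH l.
Qed.

End Flow.

(** * Smooth inverse functions *)

Section Inverse.
Variable R : realType.

Lemma Ck_det (V : normedModType R) bd k (U : set V) n (A : V -> 'M[R]_n) : open U ->
  (forall i j, Ck bd k U (fun x => A x i j)) -> Ck bd k U (fun x => \det (A x)).
Proof.
move=> oU cA; rewrite /determinant; apply: Ck_sum => // s.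
by apply: Ck_mul => //; [exact: Ck_cst|apply: Ck_prod => // i; exact: cA].
Qed.

Lemma Ck_invmx (V : normedModType R) k (U : set V) n (A : V -> 'M[R]_n) : open U ->
  (forall i j, Ck false k U (fun x => A x i j)) -> (forall x, U x -> A x \in unitmx) ->
  forall i j, Ck false k U (fun x => invmx (A x) i j).
Proof.
move=> oU cA uA i j.
apply: (Ck_ext oU (f := fun x => (\det (A x))^-1 * ((-1) ^+ (j + i) * \det (row' j (col' i (A x)))))).
  by move=> x Ux; rewrite /invmx (uA x Ux) !mxE.
apply: Ck_mul => //.
  apply: Ck_inv => // [x Ux|]; last exact: Ck_det.
  by rewrite -unitfE -unitmxE uA.
apply: Ck_mul => //; first exact: Ck_cst.
apply: Ck_det => // i' j'.
have -> : (fun x => row' j (col' i (A x)) i' j') = (fun x => A x (lift j i') (lift i j')).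
  by apply/funext => x; rewrite !mxE.
exact: cA.
Qed.

Definition jacmx p (e : 'rV[R]_p -> 'rV[R]_p) (v : 'rV[R]_p) : 'M[R]_p :=
  \matrix_(i, j) 'D_(delta_mx 0 i) (fun y => e y 0 j) v.

Lemma C1_diff_rV p q (U : set 'rV[R]_p) (e : 'rV[R]_p -> 'rV[R]_q) v : open U -> U v ->
  (forall i, Ck false 1 U (fun x => e x 0 i)) ->
  differentiable e v /\ forall w, 'd e v w = jacmul e v w.
Proof.
move=> oU Uv ce.
have de : differentiable e v.
  by apply: differentiable_mx => i j; rewrite ord1; have [] := C1_differentiable oU (ce j) Uv.
split=> // w; rewrite -deriveE// derive_mx; last exact: diff_derivable.
apply/rowP => j; rewrite !mxE; have [dj dE] := C1_differentiable oU (ce j) Uv.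
by rewrite deriveE// dE.
Qed.

Lemma jacmul_jacmx p (e : 'rV[R]_p -> 'rV[R]_p) v w : jacmul e v w = w *m jacmx e v.
Proof. by apply/rowP => j; rewrite !mxE; apply: eq_bigr => i _; rewrite mxE. Qed.

(** The Lipschitz bound for the difference between [e] and the identity passes to difference
    quotients, hence to the derivative. *)
Lemma is_derive_linear_approx p (e : 'rV[R]_p -> 'rV[R]_p) N v w (c : R) :
  open N -> N v -> (forall i, Ck false 1 N (fun x => e x 0 i)) ->
  (forall v1 v2, N v1 -> N v2 -> `|e v1 - e v2 - (v1 - v2)| <= c * `|v1 - v2|) ->
  `|jacmul e v w - w| <= c * `|w|.
Proof.
move=> oN Nv ce eN.
have [de dE] := C1_diff_rV oN Nv ce.
have dw : derivable e v w by exact: diff_derivable.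
have E : (fun h : R => h^-1 *: ((e \o shift v) (h *: w) - e v)) @ 0^' --> jacmul e v w.
  have := dw; rewrite /derivable => /cvgP; rewrite -dE -deriveE//.
apply/ler_addgt0Pr => eps eps0.
have /cvgrPdist_le /(_ eps eps0) H := E.
have nN : \forall h \near (0 : R), N (v + h *: w).
  have : {for (0 : R), continuous (fun h : R => v + h *: w)}.
    apply: (is_derive_continuous (d := w)).
    by apply: is_derive_eq (is_deriveD (is_derive_cst v (0 : R) (1 : R)) (is_derive_scalel w (0 : R))) _; rewrite add0r.
  move=> /(_ N); apply; rewrite scale0r addr0; exact: open_nbhs_nbhs.
have : \forall h \near (0 : R)^', `|jacmul e v w - w| <= c * `|w| + eps.
  near=> h.
  have h0 : h != 0 by near: h; exact: nbhs_dnbhs_neq.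
  have Nh : N (v + h *: w) by near: h; apply: nbhs_dnbhs; exact: nN.
  have Hh : `|jacmul e v w - h^-1 *: ((e \o shift v) (h *: w) - e v)| <= eps by near: h; exact: H.
  move: Hh; set q := h^-1 *: _ => Hh.
  rewrite -(subrKA q) addrC (le_trans (ler_normD _ _))// lerD//.
  have -> : q - w = h^-1 *: (e (v + h *: w) - e v - (v + h *: w - v)).
    by rewrite (addrC v) addrK [in RHS]scalerBr scalerA mulVf// scale1r.
  rewrite normrZ normfV ler_pdivrMl ?normr_gt0//; apply: (le_trans (eN _ _ Nh Nv)).
  by rewrite addrC addKr normrZ mulrCA.
by move=> /filter_ex[].
Unshelve. all: by end_near. Qed.

(** A row in the kernel would have norm at most half its norm. *)
Lemma near_id_unitmx p (A : 'M[R]_p) :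
  (forall w : 'rV[R]_p, `|w *m A - w| <= 2^-1 * `|w|) -> A \in unitmx.
Proof.
move=> H; rewrite -row_free_unit -kermx_eq0; apply/eqP/row_matrixP => i.
have := H (row i (kermx A)); rewrite -row_mul mulmx_ker row0 sub0r normrN => Hi.
apply/eqP; rewrite -normr_le0; move: Hi; set n := `|_|.
have : 0 <= n by exact: normr_ge0.
lra.
Qed.

(** Since [e] differs from the identity by a map with Lipschitz constant 1/2, [l] has Lipschitz
    constant 2 and the Jacobians of [e] are invertible. The derivative of [l] at [x] is the inverse
    Jacobian of [e] at [l x]; hence regularity of order [k] for [l] yields order [k.+1]. *)
Lemma inverse_smooth p (e l : 'rV[R]_p -> 'rV[R]_p) (N U : set 'rV[R]_p) :
  open N -> open U -> (forall x, U x -> N (l x) /\ e (l x) = x) ->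
  (forall k i, Ck false k N (fun x => e x 0 i)) ->
  (forall v1 v2, N v1 -> N v2 -> `|e v1 - e v2 - (v1 - v2)| <= 2^-1 * `|v1 - v2|) ->
  forall k i, Ck false k U (fun x => l x 0 i).
Proof.
move=> oN oU el ce eN.
have lL x y : U x -> U y -> `|l x - l y| <= 2 * `|x - y|.
  move=> /el[Nx ex] /el[Ny ey]; have := eN _ _ Nx Ny; rewrite ex ey.
  have := ler_normB (x - y) (x - y - (l x - l y)); rewrite subKr.
  by move: `|l x - l y| `|x - y| `|x - y - _| => a b c; lra.
have lc x : U x -> {for x, continuous l}.
  move=> Ux; apply: (@lipschitz_continuous_at _ _ _ _ 2 U); first exact: open_nbhs_nbhs.
  by move=> y Uy; exact: lL.
have uJ v : N v -> jacmx e v \in unitmx.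
  move=> Nv; apply: near_id_unitmx => w; rewrite -jacmul_jacmx.
  exact: is_derive_linear_approx oN Nv (ce 1%N) eN.
have dl x w : U x -> is_derive x w l (w *m invmx (jacmx e (l x))).
  move=> Ux; have [Nx ex] := el x Ux.
  have [de dE] := C1_diff_rV oN Nx (ce 1%N).
  have [C C0 CH] := mulmx_norm_le (invmx (jacmx e (l x))).
  have /diff_locallyP[_] := de; move=> /eqaddoP H.
  have E : (fun h : R => h^-1 *: ((l \o shift x) (h *: w) - l x)) @ 0^' --> w *m invmx (jacmx e (l x)).
    apply/cvgrPdist_le => eps eps0.
    (* The linearisation error gets multiplied by the bound [C] for the inverse Jacobian, by the
       Lipschitz constant 2 of [l] and by the norm of [w]; the summands 1 keep the denominator
       positive. *)
    pose eta := eps / (2 * (C + 1) * (`|w| + 1)).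
    have C1 : 0 < C + 1 by rewrite ltr_wpDl.
    have w1 : 0 < `|w| + 1 by rewrite ltr_wpDl.
    have eta0 : 0 < eta by rewrite divr_gt0// !mulr_gt0.
    have clin : {for (0 : R), continuous (fun h : R => x + h *: w)}.
      apply: (is_derive_continuous (d := w)).
      by apply: is_derive_eq (is_deriveD (is_derive_cst x (0 : R) (1 : R)) (is_derive_scalel w (0 : R))) _; rewrite add0r.
    have nU : \forall h \near (0 : R), U (x + h *: w).
      move: clin => /(_ U); apply; rewrite scale0r addr0; exact: open_nbhs_nbhs.
    have nk : \forall h \near (0 : R), `|e (l (x + h *: w) - l x + l x) - (e (l x) + 'd e (l x) (l (x + h *: w) - l x))| <= eta * `|l (x + h *: w) - l x|.
      have c0 : {for (0 : R), continuous (fun h : R => l (x + h *: w) - l x)}.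
        have c1 : {for (0 : R), continuous (fun h : R => l (x + h *: w))}.
          apply: continuous_comp; first exact: clin.
          by rewrite scale0r addr0; exact: lc.
        exact: (cvgB c1 (cvg_cst (l x))).
      have := c0 _; rewrite /continuous_at /= scale0r addr0 subrr => c0'.
      exact: (c0' _ (H _ eta0)).
    near=> h.
    have h0 : h != 0 by near: h; exact: nbhs_dnbhs_neq.
    have Uh : U (x + h *: w) by near: h; apply: nbhs_dnbhs; exact: nU.
    have nh : `|e (l (x + h *: w) - l x + l x) - (e (l x) + 'd e (l x) (l (x + h *: w) - l x))| <= eta * `|l (x + h *: w) - l x|.
      by near: h; apply: nbhs_dnbhs; exact: nk.
    move: nh; rewrite subrK (el _ Uh).2 ex dE jacmul_jacmx.
    rewrite opprD addrA [x + _]addrC addrK; set k := l _ - l x => nh.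
    rewrite /= -/k.
    have kb : `|k| <= 2 * (`|h| * `|w|).
      rewrite -normrZ -[X in _ * `|X|](addrK x); apply: lL => //.
      by rewrite addrC.
    have -> : w *m invmx (jacmx e (l x)) - h^-1 *: k =
       h^-1 *: ((h *: w - k *m jacmx e (l x)) *m invmx (jacmx e (l x))).
      rewrite mulmxBl mulmxK ?uJ// [in RHS]scalerBr; congr (_ - _).
      by rewrite -scalemxAl scalerA mulVf// scale1r.
    rewrite normrZ normfV ler_pdivrMl ?normr_gt0//.
    apply: (le_trans (CH _)).
    apply: (@le_trans _ _ (C * (eta * (2 * (`|h| * `|w|))))).
      by rewrite ler_wpM2l// (le_trans nh)// ler_wpM2l// ltW.
    apply: (@le_trans _ _ ((C + 1) * (eta * (2 * (`|h| * (`|w| + 1)))))).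
      apply: ler_pM => //; first by apply: mulr_ge0; [exact: ltW|rewrite !mulr_ge0].
        by rewrite lerDl.
      by rewrite ler_pM2l// ler_pM2l// ler_wpM2l// lerDl.
    rewrite /eta le_eqVlt; apply/orP; left; apply/eqP.
    by field; rewrite !gt_eqF.
  split; first by apply/cvg_ex; exists (w *m invmx (jacmx e (l x))).
  exact: cvg_lim.
have dli x w i : U x -> is_derive x w (fun x => l x 0 i) (\sum_j w 0 j * invmx (jacmx e (l x)) j i).
  by move=> Ux; have /is_derive_mxP /(_ 0 i) := dl x w Ux; rewrite mxE.
elim=> [|k ih] i.
  split=> //; split=> // x Ux.
  by apply: (@continuous_comp _ _ _ l (fun v : 'rV[R]_p => v 0 i)); [exact: lc|exact: coord_continuous].
split; first by have [] := Ck_Ck0 (ih i).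
move=> w; split=> [x Ux|]; first exact: (@ex_derive _ _ _ _ _ _ _ (dli x w i Ux)).
apply: (Ck_ext oU (f := fun x => \sum_j w 0 j * invmx (jacmx e (l x)) j i)).
  by move=> x Ux; rewrite (@derive_val _ _ _ _ _ _ _ (dli x w i Ux)).
apply: Ck_sum => // j; apply: Ck_mul => //; first exact: Ck_cst.
have cJ i' j' : Ck false k N (fun v => jacmx e v i' j').
  have -> : (fun v => jacmx e v i' j') = 'D_(delta_mx 0 i') (fun y => e y 0 j').
    by apply/funext => v; rewrite mxE.
  exact: CkS_derive (ce k.+1 j').
exact: (Ck_comp (g := l) oU oN (fun x Ux => (el x Ux).1) ih (Ck_invmx oN cJ uJ j i)).
Unshelve. all: by end_near. Qed.

End Inverse.

(** * Lorentzian forms and the geodesic spray *)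

Section BilinearForms.
Variables (R : realType) (m : nat).
Implicit Types (A : 'M[R]_m) (v w : 'rV[R]_m).

Definition bf A v w : R := (v *m A *m w^T) 0 0.

Lemma bfE A v w : bf A v w = \sum_i \sum_j v 0 i * A i j * w 0 j.
Proof.
rewrite /bf mxE exchange_big /=; apply: eq_bigr => j _.
by rewrite !mxE mulr_suml.
Qed.

Lemma bfDl A v v' w : bf A (v + v') w = bf A v w + bf A v' w.
Proof. by rewrite /bf !mulmxDl mxE. Qed.
Lemma bfDr A v w w' : bf A v (w + w') = bf A v w + bf A v w'.
Proof. by rewrite /bf linearD /= mulmxDr mxE. Qed.
Lemma bfZl A k v w : bf A (k *: v) w = k * bf A v w.
Proof. by rewrite /bf -!scalemxAl mxE. Qed.
Lemma bfZr A k v w : bf A v (k *: w) = k * bf A v w.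
Proof. by rewrite /bf linearZ /= -scalemxAr mxE. Qed.
Lemma bfNl A v w : bf A (- v) w = - bf A v w.
Proof. by rewrite -scaleN1r bfZl mulN1r. Qed.
Lemma bfNr A v w : bf A v (- w) = - bf A v w.
Proof. by rewrite -scaleN1r bfZr mulN1r. Qed.
Lemma bf0l A w : bf A 0 w = 0.
Proof. by rewrite /bf !mul0mx mxE. Qed.
Lemma bf0r A v : bf A v 0 = 0.
Proof. by rewrite /bf trmx0 mulmx0 mxE. Qed.

Lemma bfC A v w : A^T = A -> bf A v w = bf A w v.
Proof.
move=> sA; rewrite /bf.
have <- : (v *m A *m w^T)^T = w *m A *m v^T by rewrite !trmx_mul trmxK sA mulmxA.
by rewrite [RHS]mxE.
Qed.

Lemma bf_delta A v j : bf A v (delta_mx 0 j) = (v *m A) 0 j.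
Proof. by rewrite /bf trmx_delta -colE mxE. Qed.

Lemma bf_inj A v w : A \in unitmx -> (forall u, bf A v u = bf A w u) -> v = w.
Proof.
move=> uA H; rewrite -[v](mulmxK uA) -[w](mulmxK uA); congr (_ *m _).
by apply/rowP => j; rewrite -!bf_delta.
Qed.

Lemma is_derive_sumf (V : normedModType R) (I : Type) (r : seq I) (F : I -> V -> R) (dF : I -> R) x u :
  (forall i, is_derive x u (F i) (dF i)) ->
  is_derive x u (fun y => \sum_(i <- r) F i y) (\sum_(i <- r) dF i).
Proof.
move=> H; elim: r => [|i r ih].
  rewrite big_nil; have -> : (fun y => \sum_(i <- [::]) F i y) = (fun _ => 0).
    by apply/funext => y; rewrite big_nil.
  exact: is_derive_cst.
rewrite big_cons; have -> : (fun y => \sum_(i <- i :: r) F i y) = (fun y => F i y + \sum_(i <- r) F i y).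
  by apply/funext => y; rewrite big_cons.
exact: is_deriveD (H i) ih.
Qed.

Lemma is_deriveMf (V : normedModType R) (f g : V -> R) x u df dg :
  is_derive x u f df -> is_derive x u g dg ->
  is_derive x u (fun y => f y * g y) (df * g x + f x * dg).
Proof.
move=> hf hg; apply: is_derive_eq (is_deriveM hf hg) _.
by rewrite addrC /GRing.scale /= [g x * _]mulrC.
Qed.

Lemma is_derive_bf (V : normedModType R) (A : V -> 'M[R]_m) (v w : V -> 'rV[R]_m) x u dA dv dw :
  is_derive x u A dA -> is_derive x u v dv -> is_derive x u w dw ->
  is_derive x u (fun y => bf (A y) (v y) (w y))
    (bf dA (v x) (w x) + bf (A x) dv (w x) + bf (A x) (v x) dw).
Proof.
move=> /is_derive_mxP hA /is_derive_mxP hv /is_derive_mxP hw.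
have -> : (fun y => bf (A y) (v y) (w y)) =
   (fun y => \sum_i \sum_j v y 0 i * A y i j * w y 0 j) by apply/funext => y; rewrite bfE.
have H : is_derive x u (fun y => \sum_i \sum_j v y 0 i * A y i j * w y 0 j)
    (\sum_i \sum_j ((dv 0 i * A x i j + v x 0 i * dA i j) * w x 0 j + v x 0 i * A x i j * dw 0 j)).
  apply: is_derive_sumf => i; apply: is_derive_sumf => j.
  exact: is_deriveMf (is_deriveMf (hv 0 i) (hA i j)) (hw 0 j).
apply: is_derive_eq H _.
rewrite !bfE -!big_split /=; apply: eq_bigr => i _; rewrite -!big_split /=.
by apply: eq_bigr => j _; ring.
Qed.

End BilinearForms.

Section Lorentz.
Variables (R : realType) (n : nat).
Implicit Types (A : 'M[R]_n.+2) (v w : 'rV[R]_n.+2).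

Definition lorentzian A := A^T = A /\
  exists2 P : 'M[R]_n.+2, P \in unitmx &
    P *m A *m P^T = diag_mx (\row_k (if k == ord0 then -1 else 1)).

Lemma cauchy_schwarz_sum (I : finType) (Q : pred I) (a b : I -> R) :
  (\sum_(i | Q i) a i * b i) ^+ 2 <= (\sum_(i | Q i) a i ^+ 2) * (\sum_(i | Q i) b i ^+ 2).
Proof.
set Sab := \sum_(i | Q i) a i * b i; set Saa := \sum_(i | Q i) a i ^+ 2.
set Sbb := \sum_(i | Q i) b i ^+ 2.
have Sbb0 : 0 <= Sbb by apply: sumr_ge0 => i _; exact: sqr_ge0.
have H : 0 <= Sbb * (Saa * Sbb - Sab ^+ 2).
  have -> : Sbb * (Saa * Sbb - Sab ^+ 2) = \sum_(i | Q i) (Sbb * a i - Sab * b i) ^+ 2.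
    have -> : Sbb * (Saa * Sbb - Sab ^+ 2) = Sbb ^+ 2 * Saa - 2 * Sbb * Sab * Sab + Sab ^+ 2 * Sbb by ring.
    rewrite (eq_bigr (fun i => Sbb ^+ 2 * a i ^+ 2 - 2 * Sbb * Sab * (a i * b i) + Sab ^+ 2 * b i ^+ 2)).
      by rewrite big_split sumrB /= -!mulr_sumr.
    by move=> i _; ring.
  by apply: sumr_ge0 => i _; exact: sqr_ge0.
have [S0|S0] := eqVneq Sbb 0; last first.
  have : 0 < Sbb by rewrite lt0r S0.
  by move=> Sp; rewrite -subr_ge0 -(pmulr_rge0 _ Sp).
have bz i : Q i -> b i = 0.
  move=> Qi; apply/eqP; rewrite -sqrf_eq0; apply/eqP; move: i Qi.
  by apply/psumr_eq0P => // i _; exact: sqr_ge0.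
have -> : Sab = 0 by apply: big1 => i /bz ->; rewrite mulr0.
by rewrite expr0n S0 mulr0.
Qed.

(** The rows of [P] form a Sylvester basis, and [f v] lists the coordinates of [v] in it. *)
Lemma lorentzian_coords A : lorentzian A -> exists2 f : 'rV[R]_n.+2 -> 'rV[R]_n.+2,
  (forall v, f v = 0 -> v = 0) &
  forall v w, bf A v w = - f v 0 0 * f w 0 0 + \sum_(k | k != ord0) f v 0 k * f w 0 k.
Proof.
move=> [_ [P uP PA]]; exists (fun v => v *m invmx P).
  by move=> v v0; rewrite -[v](mulmxKV uP) v0 mul0mx.
move=> v w; rewrite /bf -[v in LHS](mulmxKV uP) -[w in LHS](mulmxKV uP).
set a := v *m _; set b := w *m _; rewrite trmx_mul.
have -> : a *m P *m A *m (P^T *m b^T) = a *m (P *m A *m P^T) *m b^T by rewrite !mulmxA.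
rewrite PA mxE (bigD1 ord0)//=; congr (_ + _).
  rewrite !mxE (bigD1 ord0)//= big1 => [|k k0].
    by rewrite !mxE eqxx /= mulr1n addr0 mulrN1.
  by rewrite !mxE (negbTE k0) mulr0n mulr0.
apply: eq_bigr => k k0; rewrite !mxE (bigD1 k)//= big1 => [|l lk].
  by rewrite !mxE eqxx (negbTE k0) mulr1n addr0 mulr1.
by rewrite !mxE (negbTE lk) mulr0n mulr0.
Qed.

(** Reverse Cauchy-Schwarz in Sylvester coordinates: orthogonality equates the product of the time
    components with the spatial inner product, whose square is strictly smaller because [v] is
    timelike. A vanishing time component of [w] would force [w = 0]. *)
Lemma timelike_not_orthogonal A v w : lorentzian A -> bf A v v < 0 -> bf A w w <= 0 -> w != 0 ->
  bf A v w != 0.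
Proof.
move=> /lorentzian_coords[f f0 fE]; rewrite !fE => hv hw w0; apply/eqP => hvw.
move: hv hw hvw; set a0 := f v 0 0; set b0 := f w 0 0.
set Sab := \sum_(k | _) f v 0 k * f w 0 k.
set Saa := \sum_(k | _) f v 0 k * f v 0 k; set Sbb := \sum_(k | _) f w 0 k * f w 0 k => hv hw hvw.
have CS : Sab ^+ 2 <= Saa * Sbb := cauchy_schwarz_sum _ (f v 0) (f w 0).
have Saa0 : 0 <= Saa by apply: sumr_ge0 => i _; rewrite -expr2; exact: sqr_ge0.
have Sbb0 : 0 <= Sbb by apply: sumr_ge0 => i _; rewrite -expr2; exact: sqr_ge0.
have [b00|b00] := eqVneq b0 0.
  have S0 : Sbb = 0 by apply/eqP; rewrite eq_le Sbb0 andbT; move: hw; rewrite b00; lra.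
  move: w0; rewrite (f0 w) ?eqxx//; apply/rowP => k; rewrite mxE.
  have [->//|k0] := eqVneq k ord0.
  apply/eqP; rewrite -sqrf_eq0 expr2; apply/eqP; move: k k0.
  by apply/psumr_eq0P => // i _; rewrite -expr2; exact: sqr_ge0.
have b2 : 0 < b0 ^+ 2 by rewrite lt0r sqrf_eq0 b00 sqr_ge0.
have E : Sab = a0 * b0 by lra.
have h1 : Saa * Sbb <= Saa * b0 ^+ 2 by rewrite ler_wpM2l// expr2; lra.
have h2 : Saa * b0 ^+ 2 < a0 ^+ 2 * b0 ^+ 2 by rewrite ltr_pM2r// expr2; lra.
have := le_lt_trans (le_trans CS h1) h2.
by rewrite E exprMn ltxx.
Qed.

Lemma unit_lorentzian A : lorentzian A -> A \in unitmx.
Proof.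
move=> [_ [P uP PA]].
have : diag_mx (\row_k (if k == ord0 then -1 else 1)) \in @unitmx R n.+2.
  rewrite unitmxE det_diag unitfE prodf_seq_neq0; apply/allP => k _ /=.
  by rewrite mxE; case: (k == ord0); rewrite ?oppr_eq0 oner_eq0.
rewrite -PA !unitmx_mul => /andP[/andP[]//].
Qed.

(** All vectors on the segment from [v] to [X] are timelike, so their product with [w] never
    vanishes. This product is affine in the parameter and negative at [X]; were it nonnegative at
    [v], it would have the zero [s0]. *)
Lemma same_cone A v w X : lorentzian A -> bf A X X < 0 -> bf A v v < 0 -> bf A X v < 0 ->
  bf A w w <= 0 -> bf A X w < 0 -> bf A v w < 0.
Proof.
move=> lA hX hv hXv hw hXw.
have w0 : w != 0 by apply/eqP => w0; move: hXw; rewrite w0 bf0r ltxx.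
pose z (s : R) := (1 - s) *: v + s *: X.
have zt s : 0 <= s <= 1 -> bf A (z s) (z s) < 0.
  move=> /andP[s0 s1]; rewrite /z !bfDl !bfDr !bfZl !bfZr (bfC v X lA.1).
  move: (bf A v v) (bf A X v) (bf A X X) hv hXv hX => a b c a0 b0 c0.
  have [->|sn] := eqVneq s 0; first by lra.
  have sp : 0 < s by rewrite lt0r sn.
  have p1 : (1 - s) * ((1 - s) * a) <= 0 by rewrite mulr_ge0_le0 ?subr_ge0// mulr_ge0_le0 ?subr_ge0// ltW.
  have p2 : (1 - s) * (s * b) <= 0 by rewrite mulr_ge0_le0 ?subr_ge0// mulr_ge0_le0// ltW.
  have p3 : s * (s * c) < 0 by rewrite pmulr_rlt0// pmulr_rlt0.
  have p4 : s * ((1 - s) * b) <= 0 by rewrite mulr_ge0_le0// mulr_ge0_le0 ?subr_ge0// ltW.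
  lra.
have zn s : 0 <= s <= 1 -> bf A (z s) w != 0 by move=> /zt h; exact: timelike_not_orthogonal.
rewrite ltNge; apply/negP => vw0.
pose s0 := bf A v w / (bf A v w - bf A X w).
have d0 : 0 < bf A v w - bf A X w by lra.
have : bf A (z s0) w = 0.
  by rewrite /z bfDl !bfZl /s0; field; rewrite gt_eqF.
move/eqP; apply/negP/zn; apply/andP; split; first by rewrite divr_ge0// ltW.
by rewrite ler_pdivrMr// mul1r; lra.
Qed.

End Lorentz.

Section Spray.
Variables (R : realType) (m : nat).
Variable G : 'rV[R]_m -> 'M[R]_m.
Implicit Types (y u v w : 'rV[R]_m).

Definition dG y (a b c : 'I_m) : R := 'D_(delta_mx 0 a) (fun y => G y b c) y.

Definition Gam y (k a b : 'I_m) : R :=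
  2^-1 * \sum_l invmx (G y) k l * (dG y a b l + dG y b a l - dG y l a b).

(** The right-hand side of the geodesic equation solved for the second derivative; [spray] is the
    corresponding first-order system for position and velocity. *)
Definition acc y v : 'rV[R]_m := \row_k - (\sum_a \sum_b Gam y k a b * v 0 a * v 0 b).

Definition DG y u : 'M[R]_m := \matrix_(b, c) \sum_a u 0 a * dG y a b c.

Definition spray (z : 'rV[R]_(m + m)) : 'rV[R]_(m + m) :=
  row_mx (rsubmx z) (acc (lsubmx z) (rsubmx z)).

Lemma accZ y k v : acc y (k *: v) = k ^+ 2 *: acc y v.
Proof.
apply/rowP => i; rewrite !mxE mulrN mulr_sumr; congr (- _); apply: eq_bigr => a _.
by rewrite mulr_sumr; apply: eq_bigr => b _; rewrite !mxE; ring.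
Qed.

Lemma bf_DG y u v w : bf (DG y u) v w = \sum_a \sum_b \sum_c u 0 a * v 0 b * w 0 c * dG y a b c.
Proof.
rewrite bfE exchange_big /= [RHS](eq_bigr (fun a => \sum_c \sum_b u 0 a * v 0 b * w 0 c * dG y a b c)); last first.
  by move=> a _; rewrite exchange_big.
rewrite [RHS]exchange_big /=; apply: eq_bigr => c _.
rewrite [RHS]exchange_big /=; apply: eq_bigr => b _.
rewrite mxE mulr_sumr mulr_suml; apply: eq_bigr => a _; ring.
Qed.

(** Pairing with [G y] cancels the inverse matrix in [Gam] and leaves the Euler-Lagrange equation of
    the energy. Energy conservation, Gauss' lemma and the change of charts all use this form. *)
Lemma acc_EL y v w : (G y)^T = G y -> G y \in unitmx ->
  bf (G y) (acc y v) w = - bf (DG y v) v w + 2^-1 * bf (DG y w) v v.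
Proof.
move=> Gsym uG.
pose C : 'rV[R]_m := \row_l \sum_a \sum_b (dG y a b l + dG y b a l - dG y l a b) * v 0 a * v 0 b.
have -> : acc y v = (- 2^-1) *: (C *m invmx (G y)).
  apply/rowP => k; rewrite !mxE mulNr; congr (- _); rewrite mulr_sumr.
  rewrite (eq_bigr (fun a => \sum_b \sum_l 2^-1 * (invmx (G y) k l * (dG y a b l + dG y b a l - dG y l a b) * v 0 a * v 0 b))); last first.
    move=> a _; apply: eq_bigr => b _; rewrite /Gam mulr_sumr !mulr_suml.
    by apply: eq_bigr => l _; ring.
  rewrite (eq_bigr (fun a => \sum_l \sum_b 2^-1 * (invmx (G y) k l * (dG y a b l + dG y b a l - dG y l a b) * v 0 a * v 0 b))); last first.
    by move=> a _; rewrite exchange_big.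
  rewrite exchange_big /=; apply: eq_bigr => l _.
  rewrite mxE (_ : invmx (G y) l k = invmx (G y) k l); last by rewrite -[in LHS]Gsym -trmx_inv mxE.
  rewrite mulr_suml mulr_sumr; apply: eq_bigr => a _.
  by rewrite mulr_suml mulr_sumr; apply: eq_bigr => b _; ring.
rewrite bfZl; have -> : bf (G y) (C *m invmx (G y)) w = \sum_l C 0 l * w 0 l.
  by rewrite /bf (mulmxKV uG) mxE; apply: eq_bigr => l _; congr (_ * _); rewrite mxE.
rewrite !bf_DG.
have -> : \sum_l C 0 l * w 0 l = 2 * (\sum_a \sum_b \sum_c v 0 a * v 0 b * w 0 c * dG y a b c) -
   \sum_a \sum_b \sum_c w 0 a * v 0 b * v 0 c * dG y a b c.
  have -> : \sum_a \sum_b \sum_c v 0 a * v 0 b * w 0 c * dG y a b c =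
      \sum_c \sum_a \sum_b v 0 a * v 0 b * w 0 c * dG y a b c.
    rewrite exchange_big /= [RHS](eq_bigr (fun c => \sum_b \sum_a v 0 a * v 0 b * w 0 c * dG y a b c)); last first.
      by move=> c _; rewrite exchange_big.
    rewrite [RHS]exchange_big /=; apply: eq_bigr => b _; rewrite exchange_big /=.
    by [].
  have -> : 2 * (\sum_c \sum_a \sum_b v 0 a * v 0 b * w 0 c * dG y a b c) =
      \sum_c \sum_a \sum_b v 0 a * v 0 b * w 0 c * dG y a b c +
      \sum_c \sum_a \sum_b v 0 a * v 0 b * w 0 c * dG y b a c.
    rewrite mulr_natl mulr2n; congr (_ + _); apply: eq_bigr => c _.
    rewrite exchange_big /=; apply: eq_bigr => a _; apply: eq_bigr => b _; ring.
  rewrite -big_split -sumrB /=; apply: eq_bigr => l _; rewrite mxE mulr_suml -big_split -sumrB /=.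
  apply: eq_bigr => a _; rewrite mulr_suml -big_split -sumrB /=; apply: eq_bigr => b _; ring.
by field.
Qed.

Section OnOpen.
Variable Om : set 'rV[R]_m.
Hypothesis oOm : open Om.
Hypothesis Gsm : forall k i j, Ck false k Om (fun y => G y i j).

Lemma is_derive_G y u : Om y -> is_derive y u G (DG y u).
Proof.
move=> Oy; apply/is_derive_mxP => i j.
have [dg dE] := C1_differentiable oOm (Gsm 1%N i j) Oy.
apply: DeriveDef; first exact: diff_derivable.
by rewrite deriveE// dE mxE.
Qed.

Lemma differentiable_G y : Om y -> differentiable G y.
Proof.
move=> Oy; apply: differentiable_mx => i j.
by have [] := C1_differentiable oOm (Gsm 1%N i j) Oy.
Qed.

Lemma is_derive_G_curve (c : R -> 'rV[R]_m) (t : R) dc : Om (c t) -> is_derive t (1 : R) c dc ->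
  is_derive t (1 : R) (fun s => G (c s)) (DG (c t) dc).
Proof.
move=> Oc hc; have dg := differentiable_G Oc.
apply: is_derive_eq (@is_derive_comp _ _ _ _ c G t 1 (@ex_derive _ _ _ _ _ _ _ hc) dg) _.
rewrite (@derive_val _ _ _ _ _ _ _ hc) -deriveE//.
exact: (@derive_val _ _ _ _ _ _ _ (is_derive_G dc Oc)).
Qed.

Hypothesis Gunit : forall y, Om y -> G y \in unitmx.
Hypothesis Gsym : forall y, Om y -> (G y)^T = G y.

(** In [acc_EL] with [w] equal to the velocity, the two acceleration terms cancel the derivative of
    the metric along the curve. *)
Lemma geodesic_energy (c cd : R -> 'rV[R]_m) (t : R) : Om (c t) ->
  is_derive t (1 : R) c (cd t) -> is_derive t (1 : R) cd (acc (c t) (cd t)) ->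
  is_derive t (1 : R) (fun s => bf (G (c s)) (cd s) (cd s)) 0.
Proof.
move=> Oc hc hcd.
apply: is_derive_eq (is_derive_bf (is_derive_G_curve Oc hc) hcd hcd) _.
rewrite [bf _ (cd t) (acc _ _)]bfC ?Gsym// !acc_EL ?Gunit ?Gsym//; by field.
Qed.

Lemma Gam_smooth k i a b : Ck false k Om (fun y => Gam y i a b).
Proof.
apply: Ck_mul => //; first exact: Ck_cst.
apply: Ck_sum => // l; apply: Ck_mul => //; first exact: Ck_invmx.
by apply: Ck_sub => //; [apply: Ck_add => //|]; exact: CkS_derive (Gsm k.+1 _ _).
Qed.

Lemma spray_open : open [set z : 'rV[R]_(m + m) | Om (lsubmx z)].
Proof. by apply: open_comp => // x _; exact: continuous_lsubmx. Qed.

Lemma spray_smooth k i : Ck false k [set z : 'rV[R]_(m + m) | Om (lsubmx z)] (fun z => spray z 0 i).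
Proof.
have oO := spray_open.
have cc j : Ck false k [set z : 'rV[R]_(m + m) | Om (lsubmx z)] (fun z => z 0 j) by exact: Ck_coord.
case: (split_ordP i) => j ->.
  apply: (Ck_ext oO (f := fun z => z 0 (rshift m j))) => // z _.
  by rewrite /spray row_mxEl mxE.
apply: (Ck_ext oO (f := fun z => - (\sum_a \sum_b Gam (lsubmx z) j a b * z 0 (rshift m a) * z 0 (rshift m b)))).
  move=> z _; rewrite /spray row_mxEr mxE; congr (- _); apply: eq_bigr => a _.
  by apply: eq_bigr => b _; rewrite !mxE.
apply: Ck_opp => //; apply: Ck_sum => // a; apply: Ck_sum => // b.
apply: Ck_mul => //; apply: Ck_mul => //.
apply: (Ck_comp (g := fun z : 'rV[R]_(m + m) => lsubmx z) oO oOm _ _ (Gam_smooth k j a b)) => // l.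
by apply: (Ck_ext oO (f := fun z => z 0 (lshift m l))) => // z _; rewrite mxE.
Qed.

End OnOpen.

End Spray.

(** * The exponential map on convex balls *)

Section ConvexAux.
Variable R : realType.

Lemma is_derive_scale_arg (W : normedModType R) (f : R -> W) (k s : R) d :
  is_derive (k * s) (1 : R) f d -> is_derive s (1 : R) (fun t => f (k * t)) (k *: d).
Proof.
move=> H; have df : differentiable f (k * s).
  by apply/derivable1_diffP; exact: (@ex_derive _ _ _ _ _ _ _ H).
have dk := is_derive_mulc k s.
apply: is_derive_eq (@is_derive_comp _ _ _ _ (fun t => k * t) f s 1 (@ex_derive _ _ _ _ _ _ _ dk) df) _.
rewrite (@derive_val _ _ _ _ _ _ _ dk) -(@derive_val _ _ _ _ _ _ _ H) deriveE//.
by rewrite -linearZ /= /GRing.scale /= mulr1.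
Qed.

Lemma is_derive_sub_arg (W : normedModType R) (f : R -> W) (a s : R) d :
  is_derive (a - s) (1 : R) f d -> is_derive s (1 : R) (fun t => f (a - t)) (- d).
Proof.
move=> H; have df : differentiable f (a - s).
  by apply/derivable1_diffP; exact: (@ex_derive _ _ _ _ _ _ _ H).
have dk : is_derive s (1 : R) (fun t : R => a - t) (- 1).
  by apply: is_derive_eq (is_deriveB (is_derive_cst a s (1 : R)) (is_derive_id s (1 : R))) _; rewrite sub0r.
apply: is_derive_eq (@is_derive_comp _ _ _ _ (fun t => a - t) f s 1 (@ex_derive _ _ _ _ _ _ _ dk) df) _.
rewrite (@derive_val _ _ _ _ _ _ _ dk) linearN -deriveE//.
by rewrite (@derive_val _ _ _ _ _ _ _ H).
Qed.

Lemma near_norm_lt (V : normedModType R) (v : V) (k : R) :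
  `|v| < k -> \forall w \near v, `|w| < k.
Proof.
move=> vk; exact: (@cvgr_lt _ _ _ (nbhs_filter v) (fun s : V => `|s|) `|v| (@norm_continuous _ V v) _ vk).
Qed.

(** Meant for the squared distance from a centre along a geodesic: if it is convex, a geodesic with
    both ends in the ball stays in the ball. *)
Lemma convex_le_ends (f df ddf : R -> R) :
  (forall s : R, 0 <= s <= 1 -> is_derive s (1 : R) f (df s)) ->
  (forall s : R, 0 <= s <= 1 -> is_derive s (1 : R) df (ddf s)) ->
  (forall s : R, 0 <= s <= 1 -> 0 <= ddf s) ->
  forall s : R, 0 <= s <= 1 -> f s <= Num.max (f 0) (f 1).
Proof.
move=> fD dfD dd0 s /andP[s0 s1].
have mono (g dg : R -> R) (a b : R) : a <= b -> (forall t, a <= t <= b -> is_derive t (1 : R) g (dg t)) ->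
    (forall t, a <= t <= b -> 0 <= dg t) -> g a <= g b.
  move=> ab gD g0.
  have [||c] := @MVT_segment R g dg a b ab.
  - by move=> t; rewrite in_itv /= => /andP[t0 t1]; apply: gD; rewrite !ltW.
  - exact: is_derive_within_continuous gD.
  rewrite in_itv /= => cI E; rewrite -subr_ge0 E mulr_ge0 ?g0//.
  by rewrite subr_ge0.
have dmono a b : 0 <= a -> a <= b -> b <= 1 -> df a <= df b.
  move=> a0 ab b1; apply: (mono df ddf) => // t /andP[ta tb].
    by apply: dfD; rewrite (le_trans a0 ta) (le_trans tb b1).
  by apply: dd0; rewrite (le_trans a0 ta) (le_trans tb b1).
rewrite le_max; have [d0|d0] := leP 0 (df s).
  apply/orP; right; apply: (mono f df) => // t /andP[ta tb].
    by apply: fD; rewrite (le_trans s0 ta) tb.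
  by apply: (le_trans d0); exact: dmono.
apply/orP; left; rewrite -lerN2.
apply: (mono (fun t => - f t) (fun t => - df t)) => // t /andP[ta tb].
  by apply: is_deriveN; apply: fD; rewrite ta (le_trans tb s1).
rewrite oppr_ge0; apply: le_trans (ltW d0); exact: dmono.
Qed.

(** The Euclidean square is used beside the maximum norm because it can be differentiated twice
    along geodesics. *)
Definition sqn m (v : 'rV[R]_m) : R := \sum_i v 0 i ^+ 2.

Lemma sqn_norm m (v : 'rV[R]_m) : `|v| ^+ 2 <= sqn v.
Proof.
have [->|v0] := eqVneq v 0.
  by rewrite normr0 expr0n; apply: sumr_ge0 => i _; exact: sqr_ge0.
have [|[i j] E] := @mx_norm_neq0 R 1 m v.
  by apply: contra_neq v0 => /mx_norm_eq0.
have -> : `|v| = `|v 0 j| by rewrite -(ord1 i); exact: E.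
rewrite /sqn (bigD1 j)//= real_normK ?num_real//.
by rewrite lerDl; apply: sumr_ge0 => k _; exact: sqr_ge0.
Qed.

Lemma sqn_lt m (v : 'rV[R]_m) (k : R) : 0 < k -> sqn v < k ^+ 2 -> `|v| < k.
Proof.
move=> k0 /(le_lt_trans (sqn_norm v)) H; rewrite ltNge; apply/negP => kv.
have := lerXn2r 2 (ltW k0 : k \in Num.nneg) (normr_ge0 v : `|v| \in Num.nneg) kv.
by rewrite leNgt H.
Qed.

Lemma row_mx_norm_lt p1 p2 (x : 'rV[R]_p1) (y : 'rV[R]_p2) c :
  0 < c -> `|x| < c -> `|y| < c -> `|row_mx x y| < c.
Proof.
move=> c0 xc yc; apply: (@le_lt_trans _ _ (Num.max `|x| `|y|)); last by rewrite gt_max xc yc.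
by apply: norm_row_mx_le; rewrite le_max lexx ?orbT.
Qed.

End ConvexAux.

Section Exponential.
Variables (R : realType) (m : nat) (G : 'rV[R]_m -> 'M[R]_m) (Om : set 'rV[R]_m).
Local Notation E := 'rV[R]_m.

(* A convex ball: [ex y] is the exponential map at [y], [lg y] its inverse. *)
Record exp_ball (U : set E) (N : E -> set E) (ex lg : E -> E -> E) : Prop := ExpBall {
  eb_open : open U;
  eb_sub : U `<=` Om;
  eb_Nopen : forall y, U y -> open (N y);
  eb_N0 : forall y, U y -> N y 0;
  eb_star : forall y v (t : R), U y -> N y v -> 0 <= t <= 1 -> N y (t *: v);
  eb_ex0 : forall y, U y -> ex y 0 = y;
  eb_exU : forall y v, U y -> N y v -> U (ex y v);
  eb_lgK : forall y v, U y -> N y v -> lg y (ex y v) = v;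
  eb_lgN : forall y q, U y -> U q -> N y (lg y q);
  eb_exK : forall y q, U y -> U q -> ex y (lg y q) = q;
  eb_exsm : forall y, U y -> forall k i, Ck false k (N y) (fun v => ex y v 0 i);
  eb_lgsm : forall y, U y -> forall k i, Ck false k U (fun q => lg y q 0 i);
  eb_near : forall y v1 v2, U y -> N y v1 -> N y v2 ->
    `|ex y v1 - ex y v2 - (v1 - v2)| <= 2^-1 * `|v1 - v2|;
  eb_geo : forall y v (t0 : R), U y -> N y (t0 *: v) ->
    is_derive t0 (1 : R) (fun t => ex y (t *: v)) ('D_1 (fun t : R => ex y (t *: v)) t0) /\
    is_derive t0 (1 : R) ('D_1 (fun t : R => ex y (t *: v)))
      (acc G (ex y (t0 *: v)) ('D_1 (fun t : R => ex y (t *: v)) t0));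
  eb_vel0 : forall y v, U y -> 'D_1 (fun t : R => ex y (t *: v)) 0 = v;
  eb_rev : forall y q, U y -> U q ->
    lg q y = - 'D_1 (fun t : R => ex y (t *: lg y q)) 1
}.

Hypothesis oOm : open Om.
Hypothesis Gsm : forall k i j, Ck false k Om (fun y => G y i j).
Hypothesis Gunit : forall y, Om y -> G y \in unitmx.

(* The many inequalities in context would slow [lra] down. *)
Local Ltac goal_lra := clear -oOm Gsm Gunit; lra.

Lemma acc0 y : acc G y 0 = 0.
Proof. by have := accZ G y 0 0; rewrite scaler0 expr0n /= scale0r. Qed.

Lemma acc_bound y0 : Om y0 -> exists2 r : R, 0 < r & exists2 C : R, 0 <= C &
  forall y v, `|y - y0| <= r -> `|acc G y v| <= C * `|v| ^+ 2.
Proof.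
move=> Oy0.
have nb : \forall y \near y0, forall k a b : 'I_m,
    `|Gam G y k a b - Gam G y0 k a b| <= 1.
  have nf := nbhs_filter (y0 : E).
  apply: (@filter_forall _ _ _ _ nf) => k; apply: (@filter_forall _ _ _ _ nf) => a; apply: (@filter_forall _ _ _ _ nf) => b.
  apply: (@near_close _ _ _ (fun x : E => Gam G x k a b)) => //; exact: Ck_cont (Gam_smooth oOm Gsm Gunit 0 k a b) Oy0.
move: nb => /nbhs_ballP[r /= r0 rH].
pose C := \sum_(kab : 'I_m * 'I_m * 'I_m) (`|Gam G y0 kab.1.1 kab.1.2 kab.2| + 1).
have C0 : 0 <= C by apply: sumr_ge0 => kab _; rewrite addr_ge0.
exists (r / 2); first by rewrite divr_gt0.
exists (m%:R * (m%:R * C)); first by rewrite !mulr_ge0.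
move=> y v yr.
have yb : ball y0 r y.
  rewrite -ball_normE /= distrC; apply: (le_lt_trans yr).
  by rewrite ltr_pdivrMr// ltr_pMr// ltr1n.
have GC k a b : `|Gam G y k a b| <= C.
  rewrite -[Gam G y k a b](subrK (Gam G y0 k a b)) (le_trans (ler_normD _ _))//.
  rewrite /C (bigD1 (k, a, b))//= addrC.
  have H := rH _ yb k a b.
  move: H; set S1 := (X in _ -> _ <= X + _).
  have S0 : 0 <= S1 by apply: sumr_ge0 => kab _; rewrite addr_ge0.
  by move: S0; move: S1 (`|_ - _|) (`|Gam G y0 k a b|) => c1 c2 c3; lra.
apply/norm_rV_le => [|k]; first by rewrite !mulr_ge0// exprn_ge0.
rewrite mxE normrN; apply: (le_trans (ler_norm_sum _ _ _)).
apply: (@le_trans _ _ (\sum_(a < m) \sum_(b < m) C * `|v| ^+ 2)).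
  apply: ler_sum => a _; apply: (le_trans (ler_norm_sum _ _ _)); apply: ler_sum => b _.
  move: (Gam G y k a b) (GC k a b) => g gC.
  rewrite !normrM -mulrA expr2; apply: ler_pM => //.
  by apply: ler_pM; rewrite ?normr_ge0 ?coord_le_norm.
clearbody C; rewrite !sumr_const !card_ord -[C * _ *+ m]mulr_natl -[_ * _ *+ m]mulr_natl.
by rewrite !mulrA.
Qed.

(** For small velocities the rescaled geodesic flow at time 1 is so close to the map [y + v] that it
    is inverted by iteration, uniformly in [y]. A Euclidean ball is geodesically convex once its
    radius is small against the Christoffel symbols near [y0]. Homogeneity and time reversal follow
    from uniqueness of solutions. *)
Theorem exp_ball_exists y0 : Om y0 -> exists U N ex lg, U y0 /\ exp_ball U N ex lg.
Proof.
move=> Oy0.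

(* Geodesic flow on phase space and its Lipschitz dependence *)
have Oz : [set z : 'rV[R]_(m + m) | Om (lsubmx z)] (row_mx y0 0) by rewrite /= row_mxKl.
have [rho [r [e [L [Phi [[rho0 /andP[r0 rrho] e0 L0 Le] [bO FL PhiD Phi0 Phism]]]]]]] :=
  @local_flow R (m + m) (spray G) _ (row_mx y0 0) (spray_open oOm) Oz
  (spray_smooth oOm Gsm Gunit).
have ballE c (x p : E) : 0 < c -> ball (row_mx y0 0) c (row_mx x p) <-> (`|y0 - x| < c /\ `|p| < c).
  move=> c0; rewrite -ball_normE /=; split=> [H|[h1 h2]].
    split; [rewrite -(row_mxKl (y0 - x) (0 - p))|rewrite -normrN -[- p]sub0r -(row_mxKr (y0 - x) (0 - p))].
      by apply: le_lt_trans (norm_lsubmx_le _) _; rewrite -add_row_mx -opp_row_mx in H *.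
    by apply: le_lt_trans (norm_rsubmx_le _) _; rewrite -add_row_mx -opp_row_mx in H *.
  by rewrite opp_row_mx add_row_mx sub0r; apply: row_mx_norm_lt => //; rewrite normrN.
pose x_ t z := lsubmx (Phi t z); pose p_ t z := rsubmx (Phi t z).
have PhiE t z : Phi t z = row_mx (x_ t z) (p_ t z) by rewrite hsubmxK.
have init (z0 p : E) : `|y0 - z0| < r -> `|p| < r -> ball (row_mx y0 0) r (row_mx z0 p).
  by move=> h1 h2; apply/(ballE _ _ _ r0).
have inB z (t : R) : ball (row_mx y0 0) r z -> `|t| < e -> `|y0 - x_ t z| < rho /\ `|p_ t z| < rho.
  by move=> bz te; have [+ _] := PhiD z t bz te; rewrite PhiE; move/(ballE _ _ _ rho0).
have xD z (t : R) : ball (row_mx y0 0) r z -> `|t| < e -> is_derive t (1 : R) (x_ ^~ z) (p_ t z).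
  move=> bz te; have [_ /is_derive_mxP H] := PhiD z t bz te; apply/is_derive_mxP => i j.
  have -> : (fun y => x_ y z i j) = (fun y => Phi y z i (lshift m j)) by apply/funext => y; rewrite mxE.
  apply: is_derive_eq (H i (lshift m j)) _.
  by rewrite /spray row_mxEl.
have pD z (t : R) : ball (row_mx y0 0) r z -> `|t| < e -> is_derive t (1 : R) (p_ ^~ z) (acc G (x_ t z) (p_ t z)).
  move=> bz te; have [_ /is_derive_mxP H] := PhiD z t bz te; apply/is_derive_mxP => i j.
  have -> : (fun y => p_ y z i j) = (fun y => Phi y z i (rshift m j)) by apply/funext => y; rewrite mxE.
  apply: is_derive_eq (H i (rshift m j)) _.
  by rewrite /spray row_mxEr.
have lip z z' (t : R) : ball (row_mx y0 0) r z -> ball (row_mx y0 0) r z' -> `|t| < e ->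
    `|Phi t z - Phi t z'| <= 4 * `|z - z'|.
  move=> bz bz' te.
  have := @gronwall R (m + m) (fun t => Phi t z - Phi t z') (fun t => spray G (Phi t z) - spray G (Phi t z')) L 0 e L0 (lexx 0).
  move=> /(_ _ _ t te) H; apply: (le_trans (H _ _)).
  - by move=> s se; apply: is_deriveB; [exact: (PhiD z s bz se).2|exact: (PhiD z' s bz' se).2].
  - move=> s se; rewrite addr0; apply: FL; [exact: (PhiD z' s bz' se).1|exact: (PhiD z s bz se).1].
  - rewrite !Phi0// mul0r addr0.
    (* The bound 1/16 for [L * e] gives exp(-2Le) >= 1/2; with the factor 2 of [gronwall] this makes
       the constant 4. *)
    have E2 : expR (2 * L * e) <= 2.
      have h : expR (- (2 * L * e)) >= 1 - 2 * L * e by exact: expR_ge1Dx.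
      have h2 : 2^-1 <= expR (- (2 * L * e)).
        by apply: le_trans h; move: Le; rewrite -mulrA; move: (L * e) => q; goal_lra.
      by rewrite expRN in h2; move: h2; rewrite lef_pV2 ?posrE ?expR_gt0.
    have n0 := normr_ge0 (z - z'); move: E2 n0; move: (expR _) (`|_|) => a b; nra.

(* Rescaled time and comparison with straight lines *)
pose h := e / 4; have h0 : 0 < h by rewrite divr_gt0.
(* The margin 4 is for reversal: [rever] compares two solutions on a symmetric time interval that
   contains 1, which uses the original geodesic on a longer interval. *)
have hs (s : R) : `|s| < 4 -> `|h * s| < e.
  by move=> s4; rewrite normrM (gtr0_norm h0) /h mulrAC ltr_pdivrMr// ltr_pM2l.
pose ini (y v : E) := row_mx y (h^-1 *: v).
pose D (y v : E) := `|y0 - y| < r /\ `|v| < r * h.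
have Dini y v : D y v -> ball (row_mx y0 0) r (ini y v).
  move=> [yr vr]; apply: init => //; rewrite normrZ normfV (gtr0_norm h0).
  by rewrite ltr_pdivrMl// mulrC.
pose u (s : R) y v := x_ (h * s) (ini y v).
pose ud (s : R) y v := h *: p_ (h * s) (ini y v).
have uD y v (s : R) : D y v -> `|s| < 4 -> is_derive s (1 : R) (fun s => u s y v) (ud s y v).
  by move=> /Dini bz /hs se; exact: (is_derive_scale_arg (xD _ _ bz se)).
have udD y v (s : R) : D y v -> `|s| < 4 -> is_derive s (1 : R) (fun s => ud s y v) (acc G (u s y v) (ud s y v)).
  move=> /Dini bz /hs se; rewrite /ud accZ expr2 -scalerA.
  exact: is_deriveZ (is_derive_scale_arg (pD _ _ bz se)).
have u0 y v : D y v -> u 0 y v = y.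
  by move=> /Dini bz; rewrite /u /x_ mulr0 Phi0// row_mxKl.
have ud0 y v : D y v -> ud 0 y v = v.
  by move=> /Dini bz; rewrite /ud /p_ mulr0 Phi0// row_mxKr scalerA mulfV ?gt_eqF// scale1r.
(* Comparison with the constant solution through [row_mx y 0]. *)
have pbd y v (s : R) : D y v -> `|s| < 4 -> `|ud s y v| <= 4 * `|v|.
  move=> Dv s4; have [yr vr] := Dv.
  have eqm : forall t : R, `|t| < e -> Phi t (row_mx y 0) = row_mx y 0.
    have b0 : ball (row_mx y0 (0 : E)) r (row_mx y (0 : E)) by apply: (init _ 0 yr); rewrite normr0.
    move=> t te; apply: (@ode_unique R (m + m) (spray G) (ball (row_mx y0 0) rho) L e (Phi ^~ (row_mx y 0)) (fun _ => row_mx y 0) FL) => //.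
    - by move=> s' s'e; exact: PhiD.
    - move=> s' s'e; split.
        by apply/(ballE _ _ _ rho0); rewrite normr0; split=> //; exact: lt_le_trans yr rrho.
      by rewrite /spray row_mxKl row_mxKr acc0 row_mx0; exact: is_derive_cst.
    - exact: Phi0.
  have b0 : ball (row_mx y0 (0 : E)) r (row_mx y (0 : E)) by apply: (init _ 0 yr); rewrite normr0.
  have := lip _ _ (h * s) (Dini _ _ Dv) b0 (hs _ s4).
  have Ei : ini y v - row_mx y 0 = row_mx 0 (h^-1 *: v) by rewrite /ini opp_row_mx add_row_mx subrr subr0.
  rewrite eqm ?hs// Ei => H.
  rewrite /ud normrZ (gtr0_norm h0).
  have -> : p_ (h * s) (ini y v) = rsubmx (Phi (h * s) (row_mx y (h^-1 *: v)) - row_mx y 0).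
    by rewrite PhiE opp_row_mx add_row_mx row_mxKr subr0.
  apply: (@le_trans _ _ (h * (4 * `|h^-1 *: v|))).
    rewrite ler_pM2l//; apply: le_trans (norm_rsubmx_le _) _; apply: (le_trans H).
    by rewrite ler_pM2l//; apply: norm_row_mx_le; rewrite ?normr0.
  by rewrite normrZ normfV (gtr0_norm h0) mulrCA mulVKf// gt_eqF.
(* Two integrations of the difference of the accelerations give the error [4 * L * e] times the
   linear term, and this factor is at most 1/4. *)
have near_lin y v1 v2 (s : R) : D y v1 -> D y v2 -> `|s| < 4 ->
    `|u s y v1 - u s y v2 - s *: (v1 - v2)| <= 4^-1 * (`|s| * `|v1 - v2|).
  move=> D1 D2 s4.
  set P1 := ini y v1; set P2 := ini y v2.
  pose dp := h^-1 *: v1 - h^-1 *: v2.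
  have dini : `|P1 - P2| <= `|dp|.
    by rewrite /P1 /P2 /ini opp_row_mx add_row_mx subrr; apply: norm_row_mx_le; rewrite ?normr0.
  have b1 := Dini _ _ D1; have b2 := Dini _ _ D2.
  have pp (t : R) : `|t| < e -> `|p_ t P1 - p_ t P2 - dp| <= L * (4 * `|dp|) * `|t|.
    move=> te.
    have p0 : p_ 0 P1 - p_ 0 P2 = dp by rewrite /p_ !Phi0// !row_mxKr.
    have := @mean_value_seg _ _ (fun t => p_ t P1 - p_ t P2)
       (fun t => acc G (x_ t P1) (p_ t P1) - acc G (x_ t P2) (p_ t P2)) (L * (4 * `|dp|)) t 0.
    rewrite p0 subr0; apply => w wI;
      have we : `|w| < e by apply: between_lt te _ wI; rewrite normr0.
      by apply: is_deriveB; exact: pD.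
    have -> : acc G (x_ w P1) (p_ w P1) - acc G (x_ w P2) (p_ w P2) =
        rsubmx (spray G (Phi w P1) - spray G (Phi w P2)).
      by rewrite /spray opp_row_mx add_row_mx row_mxKr.
    apply: le_trans (norm_rsubmx_le _) _.
    apply: (le_trans (FL _ _ (PhiD _ _ b2 we).1 (PhiD _ _ b1 we).1)).
    rewrite ler_pM2l//; apply: (le_trans (lip _ _ _ b1 b2 we)).
    by rewrite ler_pM2l.
  have se := hs _ s4.
  have xx : `|x_ (h * s) P1 - x_ (h * s) P2 - (h * s) *: dp| <= (4 * L * `|dp| * `|h * s|) * `|h * s|.
    have x0 : x_ 0 P1 - x_ 0 P2 - 0 *: dp = 0 by rewrite /x_ !Phi0// !row_mxKl subrr scale0r subr0.
    have := @mean_value_seg _ _ (fun t => x_ t P1 - x_ t P2 - t *: dp)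
       (fun t => p_ t P1 - p_ t P2 - dp) (4 * L * `|dp| * `|h * s|) (h * s) 0.
    rewrite x0 !subr0; apply => w wI;
      have we : `|w| < e by apply: between_lt se _ wI; rewrite normr0.
      apply: is_deriveB; last exact: is_derive_scalel.
      by apply: is_deriveB; exact: xD.
    apply: (le_trans (pp w we)).
    have -> : L * (4 * `|dp|) * `|w| = 4 * L * `|dp| * `|w| by ring.
    rewrite ler_wpM2l//; first by rewrite !mulr_ge0// ltW.
    by have := between_dist wI; rewrite !subr0.
  have dpE : h *: dp = v1 - v2 by rewrite /dp -scalerBr scalerA mulfV ?gt_eqF// scale1r.
  have : (h * s) *: dp = s *: (v1 - v2) by rewrite -dpE scalerA mulrC.
  rewrite /u => <-; apply: (le_trans xx).
  have -> : `|s| * `|v1 - v2| = `|h * s| * `|dp|.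
    have E1 : `|v1 - v2| = `|h| * `|dp| by rewrite -dpE normrZ.
  by rewrite E1 (normrM h s) mulrCA mulrA.
  have -> : 4 * L * `|dp| * `|h * s| * `|h * s| = (4 * (L * `|h * s|)) * (`|h * s| * `|dp|) by ring.
  rewrite ler_wpM2r// ?mulr_ge0//.
  have : L * `|h * s| <= L * e by rewrite ler_pM2l// ltW.
  by move: Le; move: (L * e) (L * `|h * s|) => a b; goal_lra.

(* Homogeneity and time reversal by uniqueness *)
have homog y v (k s : R) : D y v -> `|k| <= 1 -> `|s| < 4 ->
    u s y (k *: v) = u (k * s) y v /\ ud s y (k *: v) = k *: ud (k * s) y v.
  move=> Dv k1 s4.
  have Dk : D y (k *: v).
    split; first exact: Dv.1.
    rewrite normrZ; apply: le_lt_trans Dv.2.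
    by rewrite ler_piMl.
  have b1 := Dini _ _ Dk; have b2 := Dini _ _ Dv.
  have kt (t : R) : `|t| < e -> `|k * t| < e.
    by move=> te; rewrite normrM; apply: le_lt_trans te; rewrite ler_piMl.
  have U : forall t : R, `|t| < e -> Phi t (ini y (k *: v)) = row_mx (x_ (k * t) (ini y v)) (k *: p_ (k * t) (ini y v)).
    move=> t te; apply: (@ode_unique R (m + m) (spray G) (ball (row_mx y0 0) rho) L e (Phi ^~ (ini y (k *: v)))
       (fun t => row_mx (x_ (k * t) (ini y v)) (k *: p_ (k * t) (ini y v))) FL) => //.
    - by move=> s' s'e; exact: PhiD.
    - move=> s' s'e; have [i1 i2] := inB _ _ b2 (kt _ s'e); split.
        apply/(ballE _ _ _ rho0); split=> //; rewrite normrZ; apply: le_lt_trans i2.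
        by rewrite ler_piMl.
      rewrite /spray row_mxKl row_mxKr accZ; apply: is_derive_row_mx.
        exact: (is_derive_scale_arg (xD _ _ b2 (kt _ s'e))).
      rewrite expr2 -scalerA; apply: is_deriveZ.
      exact: (is_derive_scale_arg (pD _ _ b2 (kt _ s'e))).
    - rewrite mulr0 /x_ /p_ !Phi0// row_mxKl row_mxKr /ini.
      by rewrite !scalerA [k * _]mulrC.
  rewrite /u /ud /x_ /p_ U ?hs// row_mxKl row_mxKr.
  by rewrite !(mulrCA h) scalerA [h * k]mulrC -scalerA.
(* The end velocity is at most four times the initial one by [pbd]; the bound on [v] thus makes the
   reversed velocity admissible initial data. *)
have rever y v : D y v -> `|v| < r * h / 4 -> `|y0 - u 1 y v| < r ->
    u 1 (u 1 y v) (- ud 1 y v) = y.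
  move=> Dv v4 qr.
  have i14 : `|1 : R| < 4 by rewrite normr1 ltr1n.
  have DV : D (u 1 y v) (- ud 1 y v).
    split=> //; rewrite normrN; apply: (le_lt_trans (pbd _ _ _ Dv i14)).
    by move: v4; rewrite ltr_pdivlMr// mulrC.
  have b1 := Dini _ _ DV; have b2 := Dini _ _ Dv.
  have kt (t : R) : `|t| < 3 * h -> `|h - t| < e.
    move=> te; rewrite (le_lt_trans (ler_normB _ _))// (gtr0_norm h0).
    have : 4 * h = e by rewrite /h mulrCA mulfV ?mulr1.
    by move: te; move: (`|t|) => q; goal_lra.
  have h3 : 3 * h <= e by rewrite /h mulrA ler_pdivrMr// mulrC ler_pM2l// ler_nat.
  have U : forall t : R, `|t| < 3 * h -> Phi t (ini (u 1 y v) (- ud 1 y v)) =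
      row_mx (x_ (h - t) (ini y v)) (- p_ (h - t) (ini y v)).
    move=> t te; apply: (@ode_unique R (m + m) (spray G) (ball (row_mx y0 0) rho) L (3 * h) (Phi ^~ (ini (u 1 y v) (- ud 1 y v)))
       (fun t => row_mx (x_ (h - t) (ini y v)) (- p_ (h - t) (ini y v))) FL) => //.
    - by move=> s' s'e; apply: PhiD => //; exact: lt_le_trans s'e h3.
    - move=> s' s'e; have [i1 i2] := inB _ _ b2 (kt _ s'e); split.
        by apply/(ballE _ _ _ rho0); split=> //; rewrite normrN.
      rewrite /spray row_mxKl row_mxKr -[- p_ _ _ in X in acc G _ X]scaleN1r accZ sqrrN expr1n scale1r.
      apply: is_derive_row_mx.
        exact: (is_derive_sub_arg (xD _ _ b2 (kt _ s'e))).
      rewrite -[acc G _ _]opprK; apply: is_deriveN.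
      exact: (is_derive_sub_arg (pD _ _ b2 (kt _ s'e))).
    - rewrite subr0 Phi0// /ini /u /ud mulr1 scalerN scalerA mulVf ?gt_eqF// scale1r.
      by [].
  have h3' : `|h * 1| < 3 * h by rewrite mulr1 (gtr0_norm h0) ltr_pMl// ltr1n.
  have -> : u 1 (u 1 y v) (- ud 1 y v) = lsubmx (Phi (h * 1) (ini (u 1 y v) (- ud 1 y v))) by [].
  by rewrite U// row_mxKl mulr1 subrr /x_ Phi0// row_mxKl.

(* Geodesic convexity of a small Euclidean ball *)
have [r2 r20 [Ca Ca0 accb]] := acc_bound Oy0.
(* With [m%:R * Ca * R2] at most 1, the acceleration term in the second derivative of the squared
   distance is dominated by the squared speed. *)
pose R2 := Num.min r2 (m%:R * Ca + 1)^-1.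
have mC : 0 < m%:R * Ca + 1 by rewrite ltr_wpDl// mulr_ge0.
have R20 : 0 < R2 by rewrite lt_min r20 invr_gt0.
(* The factor 6 adds up the distance [kap] of the start, the straight displacement [4 * kap] and its
   error [kap] from [near_lin]. The other entries make [4 * kap] at most [r * h / 4], as [rever]
   requires, and keep base points within [r]. *)
pose kap := Num.min (R2 / 6) (Num.min (r * h / 16) r).
have kap0 : 0 < kap by rewrite !lt_min !divr_gt0//= mulr_gt0.
have kap1 : kap <= R2 / 6 by rewrite ge_min lexx.
have kap2 : kap <= r * h / 16 by rewrite !ge_min lexx orbT.
have kap3 : kap <= r by rewrite !ge_min lexx !orbT.
pose U : set E := [set y | sqn (y - y0) < kap ^+ 2].
have Uk y : U y -> `|y - y0| < kap by exact: sqn_lt.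
have UD y v : U y -> `|v| < 4 * kap -> D y v.
  move=> /Uk yk vk; split; first by rewrite distrC; exact: lt_le_trans yk kap3.
  apply: (lt_trans vk); apply: (@le_lt_trans _ _ (4 * (r * h / 16))); first by rewrite ler_pM2l.
  by rewrite mulrCA gtr_pMr ?mulr_gt0//; lra.
have i14 : `|1 : R| < 4 by rewrite normr1 ltr1n.
have lt4 (s : R) : 0 <= s <= 1 -> `|s| < 4.
  by move=> /andP[s0 s1]; rewrite ger0_norm// (le_lt_trans s1)// ltr1n.
have u_y y v (s : R) : U y -> `|v| < 4 * kap -> 0 <= s <= 1 -> `|u s y v - y0| <= R2.
  move=> Uy vk sI; have Dv := UD _ _ Uy vk.
  have D0 : D y 0 by apply: UD => //; rewrite normr0 mulr_gt0.
  have uy0 : u s y 0 = y.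
    have := homog y 0 0 s D0; rewrite normr0 scale0r mul0r => /(_ ler01 (lt4 _ sI)) [-> _].
    exact: u0.
  have := near_lin y v 0 s Dv D0 (lt4 _ sI); rewrite uy0 !subr0 => H.
  have sv : `|s| * `|v| <= 4 * kap.
    move: sI => /andP[s0 s1]; rewrite ger0_norm//; apply: le_trans (ltW vk).
    by rewrite ler_piMl.
  have -> : u s y v - y0 = (u s y v - y - s *: v) + (s *: v + (y - y0)) by rewrite !addrA subrK subrK.
  rewrite (le_trans (ler_normD _ _))// (le_trans (lerD H (ler_normD _ _)))// normrZ.
  have := ltW (Uk _ Uy); move: sv kap1; move: (`|s| * `|v|) (`|y - y0|) => a b; goal_lra.
have conv y v : U y -> `|v| < 4 * kap -> U (u 1 y v) -> forall s : R, 0 <= s <= 1 -> U (u s y v).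
  move=> Uy vk U1 s sI; have Dv := UD _ _ Uy vk.
  pose f s := sqn (u s y v - y0).
  pose df s := \sum_i 2 * ((u s y v 0 i - y0 0 i) * ud s y v 0 i).
  pose ddf s := \sum_i 2 * (ud s y v 0 i * ud s y v 0 i + (u s y v 0 i - y0 0 i) * acc G (u s y v) (ud s y v) 0 i).
  have ui (w : R) i : 0 <= w <= 1 -> is_derive w (1 : R) (fun s => u s y v 0 i - y0 0 i) (ud w y v 0 i).
    move=> wI; have /is_derive_mxP /(_ 0 i) H := uD y v w Dv (lt4 _ wI).
    by apply: is_derive_eq (is_deriveB H (is_derive_cst _ _ _)) _; rewrite subr0.
  have udi (w : R) i : 0 <= w <= 1 -> is_derive w (1 : R) (fun s => ud s y v 0 i) (acc G (u w y v) (ud w y v) 0 i).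
    by move=> wI; have /is_derive_mxP /(_ 0 i) H := udD y v w Dv (lt4 _ wI).
  have := @convex_le_ends R f df ddf _ _ _ s sI => H.
  rewrite /U /= -/(f s); apply: le_lt_trans (H _ _ _) _; last first.
  - by rewrite gt_max /f u0// Uy U1.
  - move=> w wI; rewrite /ddf -mulr_sumr mulr_ge0// big_split /=.
    set p := ud w y v; set a := acc G _ _; set q := u w y v.
    have q0 : `|q - y0| <= R2 by exact: u_y.
    have ab : `|a| <= Ca * `|p| ^+ 2.
      by apply: accb; apply: (le_trans q0); rewrite ge_min lexx.
    have B : `|\sum_i (q 0 i - y0 0 i) * a 0 i| <= `|p| ^+ 2.
      apply: (le_trans (ler_norm_sum _ _ _)).
      apply: (@le_trans _ _ (\sum_(i < m) R2 * (Ca * `|p| ^+ 2))).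
        apply: ler_sum => i _; rewrite normrM; apply: ler_pM => //.
          by have := coord_le_norm (q - y0) i; rewrite !mxE => /le_trans; apply.
        by apply: le_trans ab; exact: coord_le_norm.
      rewrite sumr_const card_ord -mulr_natl.
      have -> : m%:R * (R2 * (Ca * `|p| ^+ 2)) = (m%:R * Ca * R2) * `|p| ^+ 2 by ring.
      rewrite ler_piMl ?exprn_ge0//.
      apply: (@le_trans _ _ ((m%:R * Ca + 1) * R2)); first by rewrite ler_pM2r// lerDl.
      by rewrite -ler_pdivlMl// mulr1 ge_min lexx orbT.
    have Q : `|p| ^+ 2 <= \sum_i p 0 i * p 0 i.
      by apply: le_trans (sqn_norm p) _; rewrite /sqn; apply: ler_sum => i _; rewrite expr2.
    by move: B; rewrite ler_norml => /andP[B _]; move: B Q; move: (\sum_i _) (\sum_i _) => X Y; goal_lra.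
  - move=> w wI; apply: is_derive_sumf => i.
    apply: is_derive_eq (is_deriveZ 2 (is_deriveMf (ui w i wI) (udi w i wI))) _.
    by [].
  - move=> w wI; rewrite /f /sqn /df.
    have -> : (fun s0 : R => \sum_i (u s0 y v - y0) 0 i ^+ 2) =
       (fun s0 : R => \sum_i (u s0 y v 0 i - y0 0 i) * (u s0 y v 0 i - y0 0 i)).
      by apply/funext => s0; apply: eq_bigr => i _; rewrite !mxE expr2.
    apply: is_derive_sumf => i.
    apply: is_derive_eq (is_deriveMf (ui w i wI) (ui w i wI)) _.
    by ring.

(* The exponential map and its inverse *)
pose ex y v := u 1 y v.
have exl y v1 v2 : U y -> `|v1| < 4 * kap -> `|v2| < 4 * kap ->
    `|ex y v1 - ex y v2 - (v1 - v2)| <= 4^-1 * `|v1 - v2|.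
  move=> Uy k1 k2; have := near_lin y v1 v2 1 (UD _ _ Uy k1) (UD _ _ Uy k2) i14.
  by rewrite normr1 mul1r scale1r.
pose N (y : E) : set E := [set v | `|v| < 4 * kap /\ U (ex y v)].
have oU : open U.
  apply: (@open_comp _ _ (fun y : E => sqn (y - y0)) [set a | a < kap ^+ 2]); last exact: open_lt.
  move=> y _; have cs : Ck false 0 setT (fun y : E => sqn (y - y0)).
    apply: (Ck_ext openT (f := fun y : E => \sum_i (y 0 i - y0 0 i) * (y 0 i - y0 0 i))).
      by move=> z _; apply: eq_bigr => i _; rewrite !mxE expr2.
    have c1 i : Ck false 0 setT (fun y : E => y 0 i - y0 0 i).
      by apply: Ck_sub => //; [exact: openT|apply: Ck_coord => //; exact: openT|exact: Ck_cst].
    by apply: Ck_sum => [|i]; [exact: openT|apply: Ck_mul => //; exact: openT].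
  exact: (Ck_cont cs).
have sol y q : U y -> U q -> exists v, `|v| < 4 * kap /\ ex y v = q.
  move=> Uy Uq; pose K := `|q - y|.
  have K2 : K < 2 * kap.
    rewrite /K -(subrKA y0) (le_lt_trans (ler_normD _ _))// [`|y0 - y|]distrC.
    by rewrite mulr_natl mulr2n ltrD// Uk.
  have K0 : 0 <= K by exact: normr_ge0.
  (* A fixed point of [T] solves [ex y v = q], and by [exl] the map contracts by 1/4. Started at 0,
     the iterates stay below [2 * K], hence below [4 * kap], where [exl] is available. *)
  pose T (v : E) := v + (q - ex y v).
  pose v_ n := iter n T (0 : E).
  have k0 : `|0 : E| < 4 * kap by rewrite normr0 mulr_gt0.
  have ey0 : ex y 0 = y.
    have D0 := UD _ _ Uy k0.
    have := homog y 0 0 1 D0; rewrite normr0 scale0r mul0r => /(_ ler01 i14) [+ _].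
    by rewrite /ex => ->; exact: u0.
  have st n : `|v_ n| <= 2 * K - 2 * K / 2 ^+ n /\ `|v_ n.+1 - v_ n| <= K / 2 ^+ n.
    elim: n => [|n [ih1 ih2]].
      rewrite /v_ /= normr0 expr0 divr1 subrr; split=> //.
      by rewrite /T ey0 add0r subr0 divr1.
    have e2 : 2 * K / 2 ^+ n.+1 = K / 2 ^+ n by rewrite exprS -mulf_div divff ?mul1r.
    have e3 : 2 * K / 2 ^+ n = K / 2 ^+ n + K / 2 ^+ n by rewrite -mulrA mulr_natl mulr2n.
    have b1 : `|v_ n.+1| <= 2 * K - 2 * K / 2 ^+ n.+1.
      rewrite -[v_ n.+1](subrK (v_ n)) (le_trans (ler_normD _ _))// e2.
      by move: ih1 ih2; rewrite e3; move: (K / 2 ^+ n) (`|v_ n|) (`|v_ n.+1 - v_ n|) => a b c; goal_lra.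
    split=> //.
    have Kp : 0 <= K / 2 ^+ n by rewrite divr_ge0// exprn_ge0.
    have Kp' : 0 <= 2 * K / 2 ^+ n.+1 by rewrite e2.
    have l1 : `|v_ n.+1| < 4 * kap by move: b1 K2 Kp'; move: (2 * K / _) => a; goal_lra.
    have l2 : `|v_ n| < 4 * kap by move: ih1 K2 Kp; rewrite e3; move: (K / _) => a; goal_lra.
    have -> : v_ n.+2 - v_ n.+1 = - (ex y (v_ n.+1) - ex y (v_ n) - (v_ n.+1 - v_ n)).
      rewrite [v_ n.+2]/(T (v_ n.+1)) [X in _ = - (_ - (X - _))]/(T (v_ n)) /T -/(v_ n.+1).
      by apply/rowP => i; rewrite !mxE; ring.
    rewrite normrN; apply: (le_trans (exl _ _ _ Uy l1 l2)).
    rewrite exprS invfM mulrCA; apply: (@le_trans _ _ (4^-1 * (K / 2 ^+ n))); first by rewrite ler_pM2l.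
    by move: Kp; move: (K / _) => a; goal_lra.
  have [v vH] := geometric_cvg_rV K0 (fun n => (st n).2).
  have vb : `|v| < 4 * kap.
    by have := vH 0%N; rewrite /v_ /= subr0 expr0 divr1; move: K2; move: (`|v|) => a; goal_lra.
  exists v; split=> //; apply/eqP; rewrite -subr_eq0 -normr_le0; apply/ler_addgt0Pr => eps eps0.
  have [n nH] := half_pow_small (4 * (2 * K)) eps0.
  have vn : `|v_ n| < 4 * kap.
    have Kp : 0 <= 2 * K / 2 ^+ n by rewrite !mulr_ge0// invr_ge0 exprn_ge0.
    by move: (st n).1 Kp K2; move: (2 * K / _) => a; goal_lra.
  have a1 := exl _ _ _ Uy vb vn.
  have a2 := vH n; have a3 := (st n).2.
  have -> : ex y v - q = (ex y v - ex y (v_ n) - (v - v_ n)) + ((v - v_ n) - (v_ n.+1 - v_ n)).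
    by rewrite [v_ n.+1]/(T (v_ n)) /T; apply/rowP => i; rewrite !mxE; ring.
  rewrite add0r (le_trans (ler_normD _ _))// (le_trans (lerD a1 (ler_normB _ _)))//.
  have e3 : 4 * (2 * K) / 2 ^+ n = 4 * (2 * K / 2 ^+ n) by rewrite !mulrA.
  have e4 : 2 * K / 2 ^+ n = K / 2 ^+ n + K / 2 ^+ n by rewrite -mulrA mulr_natl mulr2n.
  have Kp : 0 <= K / 2 ^+ n by rewrite divr_ge0// exprn_ge0.
  by move: nH a2 a3 Kp; rewrite e3 e4; move: (K / _) (`|v - v_ n|) (`|v_ n.+1 - v_ n|) => a b c; goal_lra.
have solP y q : exists v, U y -> U q -> `|v| < 4 * kap /\ ex y v = q.
  have [[Uy Uq]|nU] := pselect (U y /\ U q); last by exists 0 => a b; case: nU.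
  by have [v vH] := sol y q Uy Uq; exists v.
pose lg y q := projT1 (cid (solP y q)).
have lgP y q : U y -> U q -> `|lg y q| < 4 * kap /\ ex y (lg y q) = q.
  by move=> Uy Uq; exact: (projT2 (cid (solP y q))).
have inj y v1 v2 : D y v1 -> D y v2 -> ex y v1 = ex y v2 -> v1 = v2.
  move=> D1 D2 E12; have := near_lin y v1 v2 1 D1 D2 i14.
  rewrite -/(ex y v1) -/(ex y v2) E12 subrr sub0r normrN scale1r normr1 mul1r => H.
  apply/eqP; rewrite -subr_eq0 -normr_le0; move: H; have := normr_ge0 (v1 - v2).
  by move: (`|_|) => a; goal_lra.
(* The time [t0] may be negative or exceed 1. For [t1] slightly above its absolute value, with
   [t1 *: v] still admissible, homogeneity writes [ex y (t *: v)] as the geodesic of [t1 *: v] at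
   time [t / t1], whose derivatives are known. *)
have rescale y v (t0 : R) : U y -> N y (t0 *: v) -> exists2 t1 : R, `|t0| < t1 &
   forall t : R, `|t| < t1 -> [/\ is_derive t (1 : R) (fun t => ex y (t *: v)) (t1^-1 *: ud (t / t1) y (t1 *: v)),
     is_derive t (1 : R) (fun t => t1^-1 *: ud (t / t1) y (t1 *: v)) (acc G (ex y (t *: v)) (t1^-1 *: ud (t / t1) y (t1 *: v))) &
     D y (t1 *: v)].
  move=> Uy [tv _].
  have [t1 t01 t1v] : exists2 t1 : R, `|t0| < t1 & t1 * `|v| < 4 * kap.
    have [->|v0] := eqVneq v 0.
      by exists (`|t0| + 1); [rewrite ltrDl|rewrite normr0 mulr0 mulr_gt0].
    have vp : 0 < `|v| by rewrite normr_gt0.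
    have tk : `|t0| < 4 * kap / `|v| by rewrite ltr_pdivlMr// -normrZ.
    exists ((`|t0| + 4 * kap / `|v|) / 2); first by move: tk; move: (`|t0|) (_ / _) => a b; goal_lra.
    rewrite -ltr_pdivlMr//; move: tk; move: (`|t0|) (_ / _) => a b; goal_lra.
  have t10 : 0 < t1 by exact: le_lt_trans t01.
  have DV : D y (t1 *: v) by apply: UD => //; rewrite normrZ (gtr0_norm t10).
  exists t1 => // t tt1.
  have le1 (s : R) : `|s| < t1 -> `|s / t1| <= 1.
    by move=> st; rewrite normrM normfV (gtr0_norm t10) ler_pdivrMr// mul1r ltW.
  have eqn (s : R) : `|s| < t1 -> ex y (s *: v) = u (s / t1) y (t1 *: v).
    move=> st; have [H _] := homog y (t1 *: v) (s / t1) 1 DV (le1 _ st) i14.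
    by move: H; rewrite mulr1 scalerA divfK ?gt_eqF// => <-.
  have nt : \forall s \near t, `|s| < t1.
    exact: near_norm_lt tt1.
  have l4 : `|t / t1| < 4 by apply: le_lt_trans (le1 _ tt1) _; rewrite ltr1n.
  have uDt : is_derive t (1 : R) (fun s => u (s / t1) y (t1 *: v)) (t1^-1 *: ud (t / t1) y (t1 *: v)).
    have := @is_derive_scale_arg R _ (fun s => u s y (t1 *: v)) t1^-1 t (ud (t / t1) y (t1 *: v)).
    rewrite [t1^-1 * t]mulrC => /(_ (uD _ _ _ DV l4)).
    by under [X in is_derive _ _ X _]eq_fun do rewrite [t1^-1 * _]mulrC.
  split=> //.
    by apply: near_eq_is_derive uDt; near=> s; rewrite eqn//; near: s.
  rewrite eqn// accZ expr2 -scalerA; apply: is_deriveZ.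
  have := @is_derive_scale_arg R _ (fun s => ud s y (t1 *: v)) t1^-1 t (acc G (u (t / t1) y (t1 *: v)) (ud (t / t1) y (t1 *: v))).
  rewrite [t1^-1 * t]mulrC => /(_ (udD _ _ _ DV l4)).
  by under [X in is_derive _ _ X _]eq_fun do rewrite [t1^-1 * _]mulrC.

(* Verification of the fields of [exp_ball] *)
have N0 y : U y -> N y 0.
  move=> Uy; have k0 : `|0 : E| < 4 * kap by rewrite normr0 mulr_gt0.
  split=> //; have D0 := UD _ _ Uy k0.
  have := homog y 0 0 1 D0; rewrite normr0 scale0r mul0r => /(_ ler01 i14) [+ _].
  by rewrite /ex => ->; rewrite u0.
have ex0 y : U y -> ex y 0 = y.
  move=> Uy; have k0 : `|0 : E| < 4 * kap by rewrite normr0 mulr_gt0.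
  have D0 := UD _ _ Uy k0.
  have := homog y 0 0 1 D0; rewrite normr0 scale0r mul0r => /(_ ler01 i14) [+ _].
  by rewrite /ex => ->; rewrite u0.
have Nop y : U y -> open (N y).
  move=> Uy; rewrite openE => v [vk Uv].
  have n1 : nbhs v [set w : E | `|w| < 4 * kap].
    exact: near_norm_lt vk.
  have ce : {for v, continuous (ex y)}.
    apply: (@lipschitz_continuous_at _ _ _ _ 2 _ _ n1) => w wk.
    have := exl _ _ _ Uy vk wk => H.
    rewrite -[ex y v - ex y w](subrK (v - w)) (le_trans (ler_normD _ _))//.
    by move: H; have := normr_ge0 (v - w); move: (`|v - w|) (`|_ - (v - w)|) => a b; goal_lra.
  have n2 : nbhs v (ex y @^-1` U) by apply: ce; exact: open_nbhs_nbhs.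
  exact: (@filterI _ _ (nbhs_filter v) _ _ n1 n2).
have exU1 y v1 v2 : U y -> N y v1 -> N y v2 -> `|ex y v1 - ex y v2 - (v1 - v2)| <= 2^-1 * `|v1 - v2|.
  move=> Uy [k1 _] [k2 _]; apply: (le_trans (exl _ _ _ Uy k1 k2)).
  by rewrite ler_wpM2r// lef_pV2 ?posrE// ler_nat.
have exsm y : U y -> forall k i, Ck false k (N y) (fun v => ex y v 0 i).
  move=> Uy k i; rewrite /ex /u /x_.
  have -> : (fun v => lsubmx (Phi (h * 1) (ini y v)) 0 i) = (fun v => Phi (h * 1) (ini y v) 0 (lshift m i)).
    by apply/funext => v; rewrite mxE.
  apply: (Ck_comp (g := ini y) (Nop _ Uy) (@ball_open _ _ _ _) _ _ (Phism k (h * 1) (lshift m i) (hs _ i14))).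
    by move=> v [vk _]; apply: Dini; exact: UD.
  move=> j; rewrite /ini; case: (split_ordP j) => l ->.
    apply: (Ck_ext (Nop _ Uy) (f := fun _ => y 0 l)); last exact: Ck_cst.
    by move=> v _; rewrite row_mxEl.
  apply: (Ck_ext (Nop _ Uy) (f := fun v : E => h^-1 * v 0 l)).
    by move=> v _; rewrite row_mxEr mxE.
  by apply: Ck_scale; [exact: Nop|apply: Ck_coord => //; exact: Nop].
exists U, N, ex, lg; split.
  by rewrite /U /= subrr /sqn big1 ?exprn_gt0// => i _; rewrite mxE expr0n.
split=> //.
- move=> y Uy; have D0 : D y 0 by apply: UD => //; rewrite normr0 mulr_gt0.
  have b0 : ball (row_mx y0 (0 : E)) rho (row_mx y (0 : E)).
    by apply/(ballE _ _ _ rho0); rewrite normr0; split=> //; exact: lt_le_trans D0.1 rrho.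
  by have := bO _ b0; rewrite /= row_mxKl.
- move=> y v t Uy [vk Uv] tI; have Dv := UD _ _ Uy vk.
  have t1 : `|t| <= 1 by move: tI => /andP[t0 t1]; rewrite ger0_norm.
  split.
    by rewrite normrZ; apply: le_lt_trans vk; rewrite ler_piMl.
  have [H _] := homog y v t 1 Dv t1 i14; rewrite mulr1 in H.
  by rewrite /ex H; exact: conv.
- by move=> y v Uy [].
- move=> y v Uy [vk Uv]; have [lk lE] := lgP y _ Uy Uv.
  by apply: inj lE; exact: UD.
- by move=> y q Uy Uq; have [lk lE] := lgP y _ Uy Uq; split; rewrite ?lE.
- by move=> y q Uy Uq; have [_ lE] := lgP y _ Uy Uq.
- move=> y Uy; apply: (@inverse_smooth R m (ex y) (lg y) (N y) U) => //; first exact: Nop.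
    by move=> q Uq; have [lk lE] := lgP y _ Uy Uq; split=> //; split; rewrite ?lE.
  + exact: exsm.
  + by move=> v1 v2; exact: exU1.
- move=> y v t0 Uy Nv; have [t1 t01 H] := rescale y v t0 Uy Nv.
  have [d1 d2 DV] := H _ t01.
  have E1 (t : R) : `|t| < t1 -> 'D_1 (fun t : R => ex y (t *: v)) t = t1^-1 *: ud (t / t1) y (t1 *: v).
    by move=> /H[d _ _]; exact: (@derive_val _ _ _ _ _ _ _ d).
  rewrite E1//; split=> //; apply: near_eq_is_derive d2; near=> t.
  rewrite E1//; near: t.
  exact: near_norm_lt t01.
- move=> y v Uy; have Nv : N y (0 *: v) by rewrite scale0r; exact: N0.
  have [t1 t01 H] := rescale y v 0 Uy Nv; have [d1 _ DV] := H _ t01.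
  have t10 : t1 != 0 by rewrite gt_eqF// (le_lt_trans _ t01).
  by rewrite (@derive_val _ _ _ _ _ _ _ d1) mul0r ud0// scalerA mulVf// scale1r.
(* [rever] leads from [q] back to [y]. The reversed velocity is only known to lie in the larger set
   [D], where [inj] still identifies it with [lg q y]. *)
- move=> y q Uy Uq; have [lk lE] := lgP y _ Uy Uq.
  have Nv : N y (1 *: lg y q) by rewrite scale1r; split; rewrite ?lE.
  have [t1 t01 H] := rescale y _ 1 Uy Nv; have [d1 _ DV] := H _ t01.
  have t10 : 0 < t1 by exact: le_lt_trans t01.
  have t11 : `|t1^-1| <= 1.
    by rewrite normfV (gtr0_norm t10) invf_le1// ltW//; move: t01; rewrite normr1.
  rewrite (@derive_val _ _ _ _ _ _ _ d1).
  have Dl := UD _ _ Uy lk.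
  have [_ E1] := homog y (t1 *: lg y q) t1^-1 1 DV t11 i14.
  move: E1; rewrite scalerA mulVf ?gt_eqF// scale1r mulr1 => E1.
  rewrite mul1r -E1.
  have [lk' lE'] := lgP q y Uq Uy.
  have qr : `|y0 - ex y (lg y q)| < r by rewrite lE distrC; apply: lt_le_trans kap3; exact: Uk.
  have lk4 : `|lg y q| < r * h / 4.
    apply: (lt_le_trans lk); apply: (@le_trans _ _ (4 * (r * h / 16))); first by rewrite ler_pM2l.
    by move: (r * h) => a; goal_lra.
  have rv := rever y (lg y q) Dl lk4 qr; rewrite -/(ex y (lg y q)) lE -/(ex q _) in rv.
  apply: (inj q); [exact: UD| |by rewrite lE' rv].
  split; first by rewrite distrC; apply: lt_le_trans kap3; exact: Uk.
  rewrite normrN; apply: (le_lt_trans (pbd _ _ _ Dl i14)).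
  by move: lk4; rewrite ltr_pdivlMr// mulrC.
Unshelve. all: by end_near. Qed.

End Exponential.

(** * Gauss' lemma and causal cones *)

Section CurveTools.
Variable R : realType.

Lemma is_derive_ext (V W : normedModType R) (f g : V -> W) x v d :
  f =1 g -> is_derive x v f d -> is_derive x v g d.
Proof. by move=> /funext ->. Qed.

Lemma is_derive_line0 (V W : normedModType R) (f : V -> W) v (t : R) d :
  is_derive (t *: v) v f d -> is_derive t (1 : R) (fun s => f (s *: v)) d.
Proof.
move=> H; have := @is_derive_line R V W f 0 v t.
rewrite add0r (@derive_val _ _ _ _ _ _ _ H) => /(_ (@ex_derive _ _ _ _ _ _ _ H)).
by apply: is_derive_ext => s; rewrite add0r.
Qed.

Lemma is_derive_line_at (V W : normedModType R) (f : V -> W) x v d :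
  is_derive x v f d -> is_derive (0 : R) (1 : R) (fun s => f (x + s *: v)) d.
Proof.
move=> H; have := @is_derive_line R V W f x v 0.
by rewrite scale0r addr0 (@derive_val _ _ _ _ _ _ _ H) => /(_ (@ex_derive _ _ _ _ _ _ _ H)).
Qed.

Lemma derive0_constant (f : R -> R) (a b : R) : a <= b ->
  (forall t : R, a <= t <= b -> is_derive t (1 : R) f 0) -> f b = f a.
Proof.
move=> ab fD; have [||c] := @MVT_segment R f (fun _ => 0) a b ab.
- by move=> t; rewrite in_itv /= => /andP[t0 t1]; apply: fD; rewrite !ltW.
- exact: is_derive_within_continuous fD.
by move=> _ /eqP; rewrite mul0r subr_eq0 => /eqP.
Qed.

Lemma derive_neg_lt (f df : R -> R) (a b : R) : a < b ->
  (forall t : R, a <= t <= b -> is_derive t (1 : R) f (df t)) ->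
  (forall t : R, a <= t < b -> df t < 0) -> f b < f a.
Proof.
move=> ab fD fN; have [||c] := @MVT R f df a b ab.
- by move=> t; rewrite in_itv /= => /andP[t0 t1]; apply: fD; rewrite !ltW.
- exact: is_derive_within_continuous fD.
rewrite in_itv /= => /andP[ac cb] E; rewrite -subr_lt0 E.
by rewrite nmulr_rlt0 ?subr_gt0// fN// ltW.
Qed.

Lemma continuous_neg (o : R -> R) (a b : R) : a <= b ->
  {within `[a, b], continuous o} -> (forall t : R, a <= t <= b -> o t != 0) ->
  o a < 0 -> o b < 0.
Proof.
move=> ab co on oa; rewrite ltNge; apply/negP => ob.
have [|c] := @IVT R o a b 0 ab co.
  by rewrite ge_min (ltW oa)/= le_max ob orbT.
by rewrite in_itv /= => /on /negP nz /eqP.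
Qed.

Lemma real_induction (P : R -> Prop) (a b : R) :
  (forall t : R, a <= t < b -> (forall s : R, a <= s <= t -> P s) ->
    exists2 d : R, 0 < d & forall s : R, t <= s < t + d -> P s) ->
  (forall t : R, a < t <= b -> (forall s : R, a <= s < t -> P s) -> P t) ->
  P a -> forall t : R, a <= t <= b -> P t.
Proof.
move=> step lim Pa t tI; apply: contrapT => nPt.
pose B : set R := [set s | a <= s <= b /\ ~ P s].
have Bt : B t by [].
have hB : has_inf B by split; [exists t|exists a => s [/andP[]]].
set m := inf B.
have am : a <= m by apply: lb_le_inf; [exists t|move=> s [/andP[]]].
have mt : m <= t by apply: ge_inf => //; exists a => s [/andP[]].
have mb : m <= b by case/andP: tI => _; exact: le_trans.
have below s : a <= s < m -> P s.
  move=> /andP[sa sm]; apply: contrapT => nPs.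
  have : m <= s by apply: ge_inf; [exists a => z [/andP[]]|split=> //; rewrite sa (le_trans (ltW sm))].
  by rewrite leNgt sm.
have Pm : P m.
  have [->//|am'] := eqVneq m a.
  by apply: lim => //; rewrite mb andbT lt_neqAle eq_sym am' am.
have mlt : m < b.
  rewrite lt_neqAle mb andbT; apply/eqP => mb'.
  have : t = m by apply: le_anti; rewrite mt andbT mb'; case/andP: tI.
  by move=> tm; apply: nPt; rewrite tm.
have [||d d0 dP] := step m.
- by rewrite am.
- move=> s /andP[sa]; rewrite le_eqVlt => /orP[/eqP->//|sm].
  by apply: below; rewrite sa.
have [s [sI nPs] sm] := inf_adherent d0 hB.
apply: (nPs); apply: dP; rewrite sm andbT; apply: ge_inf; last by split.
by exists a => z [/andP[]].
Qed.

Lemma continuous_bf (T : topologicalType) m (A : T -> 'M[R]_m) (v w : T -> 'rV[R]_m) x :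
  {for x, continuous A} -> {for x, continuous v} -> {for x, continuous w} ->
  {for x, continuous (fun y => bf (A y) (v y) (w y))}.
Proof.
move=> cA cv cw.
have -> : (fun y => bf (A y) (v y) (w y)) =
   (fun y => \sum_i \sum_j v y 0 i * A y i j * w y 0 j) by apply/funext => y; exact: bfE.
have cc p q (B : T -> 'M[R]_(p, q)) i j : {for x, continuous B} -> {for x, continuous (fun y => B y i j)}.
  by move=> cB; apply: (@continuous_comp _ _ _ B (fun M : 'M[R]_(p, q) => M i j)) => //; exact: coord_continuous.
apply: cvg_big => [|i _]; first by apply: add_continuous.
apply: cvg_big => [|j _]; first by apply: add_continuous.
by apply: cvgM; [apply: cvgM|]; exact: cc.
Qed.

End CurveTools.

Section SecondDerivative.
Variables (R : realType) (V : normedModType R) (p : nat).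
Implicit Types (f : V -> 'rV[R]_p) (v a b : V).

Lemma diff_is_derive (W W' : normedModType R) (f : W -> W') x (v : W) :
  differentiable f x -> is_derive x v f ('d f x v).
Proof. by move=> df; apply: DeriveDef; [exact: diff_derivable|rewrite deriveE]. Qed.

Lemma diff_curve (W W' : normedModType R) (f : W -> W') (c : R -> W) (t : R) d :
  is_derive t (1 : R) c d -> differentiable f (c t) ->
  is_derive t (1 : R) (fun s => f (c s)) ('d f (c t) d).
Proof.
move=> cD df; apply: is_derive_eq (is_derive_comp (@ex_derive _ _ _ _ _ _ _ cD) df) _.
by rewrite (@derive_val _ _ _ _ _ _ _ cD).
Qed.

Definition d2 f v a b : 'rV[R]_p := \row_i 'D_a ('D_b (fun z => f z 0 i)) v.

Lemma d2E f v a b i : d2 f v a b 0 i = 'D_a ('D_b (fun z => f z 0 i)) v.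
Proof. by rewrite mxE. Qed.

Variables (f : V -> 'rV[R]_p) (N : set V).
Hypotheses (oN : open N) (fsm : forall k i, Ck false k N (fun v => f v 0 i)).
Hypothesis C1 : C1_criterion V.

Lemma smooth_diff v : N v -> differentiable f v.
Proof.
by move=> Nv; apply: differentiable_mx => i j; rewrite (ord1 i); exact: C1 oN (fsm 1 j) Nv.
Qed.

Lemma d_derive v a b : N v -> is_derive v a (fun z => 'd f z b) (d2 f v a b).
Proof.
move=> Nv; apply/is_derive_mxP => i j; rewrite (ord1 i) d2E.
have c2 := fsm 2 j.
have cE z : N z -> 'd f z b 0 j = 'D_b (fun z => f z 0 j) z.
  move=> Nz; have /is_derive_mxP /(_ 0 j) H := diff_is_derive b (smooth_diff Nz).
  by rewrite (@derive_val _ _ _ _ _ _ _ H).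
have d1 : derivable ('D_b (fun z => f z 0 j)) v a by exact: CkS_derivable (CkS_derive b c2) Nv.
apply: (near_eq_is_derive (f := 'D_b (fun z => f z 0 j))).
  by apply: filterS (open_nbhs_nbhs (conj oN Nv)) => z /cE ->.
by apply: DeriveDef.
Qed.

Lemma d2_sym v a b : N v -> d2 f v a b = d2 f v b a.
Proof.
move=> Nv; apply/rowP => i; have c2 := fsm 2 i.
exact: etrans (d2E f v a b i) (etrans (Ck_schwarz a b oN c2 Nv) (esym (d2E f v b a i))).
Qed.

Lemma d2Zl v a b (k : R) : N v -> d2 f v (k *: a) b = k *: d2 f v a b.
Proof.
move=> Nv; apply/rowP => i; rewrite !mxE derive_scale_dir//.
exact: CkS_derivable (CkS_derive b (fsm 2 i)) Nv.
Qed.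

End SecondDerivative.

Section Gauss.
Variables (R : realType) (m : nat) (G : 'rV[R]_m -> 'M[R]_m) (Om : set 'rV[R]_m).
Local Notation E := 'rV[R]_m.
Variables (U : set E) (N : E -> set E) (ex lg : E -> E -> E).
Hypothesis oOm : open Om.
Hypothesis Gsm : forall k i j, Ck false k Om (fun y => G y i j).
Hypothesis Gunit : forall y, Om y -> G y \in unitmx.
Hypothesis Gsym : forall y, Om y -> (G y)^T = G y.
Hypothesis eb : exp_ball G Om U N ex lg.

Lemma ex_diff y w : U y -> N y w -> differentiable (ex y) w.
Proof.
by move=> Uy; exact: (smooth_diff (eb_Nopen eb Uy) (eb_exsm eb Uy) (@C1_criterion_rV _ _)).
Qed.

Lemma lg_diff y q : U y -> U q -> differentiable (lg y) q.
Proof.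
by move=> Uy; exact: (smooth_diff (eb_open eb) (eb_lgsm eb Uy) (@C1_criterion_rV _ _)).
Qed.

Lemma ex_line y v (t : R) : U y -> N y (t *: v) ->
  is_derive t (1 : R) (fun s => ex y (s *: v)) ('d (ex y) (t *: v) v).
Proof.
by move=> Uy Nv; apply: (diff_curve (f := ex y) (c := fun s => s *: v)); [exact: is_derive_scalel|exact: ex_diff].
Qed.

Lemma star_seg y v (t0 : R) : U y -> N y (t0 *: v) -> forall t : R, 0 <= t <= t0 -> N y (t *: v).
Proof.
move=> Uy Nv t /andP[t1 t2]; have [t00|t00] := eqVneq t0 0.
  have -> : t = t0 by apply: le_anti; rewrite t2 t00 t1.
  by [].
have t0p : 0 < t0 by rewrite lt_neqAle eq_sym t00 (le_trans t1).
have -> : t *: v = (t / t0) *: (t0 *: v) by rewrite scalerA divfK.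
have le1 : t / t0 <= 1 by rewrite ler_pdivrMr// mul1r.
have ge0 : 0 <= t / t0 by apply: divr_ge0 => //; exact: ltW.
by apply: (eb_star eb) => //; rewrite le1 ge0.
Qed.

Lemma near_star y v (t0 : R) : U y -> N y (t0 *: v) -> \forall t \near t0, N y (t *: v).
Proof.
move=> Uy Nv; have cs : {for t0, continuous (fun t : R => t *: v)}.
  exact: is_derive_continuous (is_derive_scalel v t0).
by apply: cs; apply: open_nbhs_nbhs; split=> //; exact: (eb_Nopen eb).
Qed.

Lemma ex_geo y v (t : R) : U y -> N y (t *: v) ->
  is_derive t (1 : R) (fun s => 'd (ex y) (s *: v) v) (acc G (ex y (t *: v)) ('d (ex y) (t *: v) v)).
Proof.
move=> Uy Nv; have [d1 d2] := eb_geo eb Uy Nv.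
have E1 (s : R) : N y (s *: v) -> 'D_1 (fun t : R => ex y (t *: v)) s = 'd (ex y) (s *: v) v.
  by move=> Ns; exact: (@derive_val _ _ _ _ _ _ _ (ex_line Uy Ns)).
pose cd (s : R) := 'D_1 (fun t : R => ex y (t *: v)) s.
have d2' : is_derive t (1 : R) cd (acc G (ex y (t *: v)) (cd t)) := d2.
have E1' : forall s, N y (s *: v) -> cd s = 'd (ex y) (s *: v) v := E1.
clear d1 d2 E1; clearbody cd; rewrite (E1' _ Nv) in d2'.
have nS : \forall s \near t, cd s = 'd (ex y) (s *: v) v.
  by apply: filterS (near_star Uy Nv) => s /E1' ->.
exact: near_eq_is_derive d2'.
Qed.

Lemma d_ex0 y v : U y -> 'd (ex y) 0 v = v.
Proof.
move=> Uy; have N0 : N y (0 *: v) by rewrite scale0r; exact: (eb_N0 eb).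
have e1 := @derive_val _ _ _ _ _ _ _ (ex_line Uy N0).
have e2 := eb_vel0 eb v Uy.
have -> : (0 : E) = 0 *: v by rewrite scale0r.
exact: etrans (esym e1) e2.
Qed.

Lemma ex_energy y v (t0 : R) : U y -> 0 <= t0 -> N y (t0 *: v) ->
  bf (G (ex y (t0 *: v))) ('d (ex y) (t0 *: v) v) ('d (ex y) (t0 *: v) v) = bf (G y) v v.
Proof.
move=> Uy t00 Nv; have Ns := star_seg Uy Nv.
have H : forall t : R, 0 <= t <= t0 -> is_derive t (1 : R)
   (fun s => bf (G (ex y (s *: v))) ('d (ex y) (s *: v) v) ('d (ex y) (s *: v) v)) 0.
  move=> t /Ns Nt; apply: (geodesic_energy oOm Gsm Gunit Gsym (c := fun s => ex y (s *: v)) (cd := fun s => 'd (ex y) (s *: v) v)).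
  - exact: (eb_sub eb) (eb_exU eb Uy Nt).
  - exact: ex_line.
  - exact: ex_geo.
rewrite (derive0_constant t00 H) scale0r d_ex0//.
by rewrite (eb_ex0 eb).
Qed.

Lemma d_ex_derive y v a b : U y -> N y v -> is_derive v a (fun z => 'd (ex y) z b) (d2 (ex y) v a b).
Proof.
by move=> Uy; exact: (d_derive (eb_Nopen eb Uy) (eb_exsm eb Uy) (@C1_criterion_rV _ _)).
Qed.

Lemma d_ex_sym y v a b : U y -> N y v -> d2 (ex y) v a b = d2 (ex y) v b a.
Proof. by move=> Uy; exact: (d2_sym (eb_Nopen eb Uy) (eb_exsm eb Uy)). Qed.

Lemma d_ex_line y w b (t : R) : U y -> N y (t *: w) ->
  is_derive t (1 : R) (fun s => 'd (ex y) (s *: w) b) (d2 (ex y) (t *: w) w b).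
Proof.
move=> Uy Nv; have H := d_ex_derive w b Uy Nv.
exact: (is_derive_line0 (f := fun z => 'd (ex y) z b) H).
Qed.

(** Pair the radial velocity with the variation field of the geodesics whose initial velocity moves
    in direction [eta]. The pairing [phi] vanishes at 0 and has the constant derivative [K]: the
    Euler-Lagrange form of the geodesic equation reduces this to the derivative of the energy with
    respect to the variation. *)
Theorem gauss_lemma y w eta : U y -> N y w ->
  bf (G (ex y w)) ('d (ex y) w w) ('d (ex y) w eta) = bf (G y) w eta.
Proof.
move=> Uy Nw; set K := bf (G y) w eta.
have Nt (t : R) : 0 <= t <= 1 -> N y (t *: w).
  by move=> tI; apply: (@star_seg y w 1) => //; rewrite scale1r.
pose P (t : R) := 'd (ex y) (t *: w) w; pose Q (t : R) := 'd (ex y) (t *: w) eta.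
pose phi (t : R) := bf (G (ex y (t *: w))) (P t) (t *: Q t).
have phiD (t : R) : 0 <= t <= 1 -> is_derive t (1 : R) phi K.
  move=> tI; have Nv := Nt t tI; have tI0 : 0 <= t by case/andP: tI.
  have Oc : Om (ex y (t *: w)) by exact: (eb_sub eb) (eb_exU eb Uy Nv).
  have JD : is_derive t (1 : R) (fun s => s *: Q s) (Q t + t *: d2 (ex y) (t *: w) w eta).
    have QD := d_ex_line eta Uy Nv.
    apply/is_derive_mxP => i j.
    have /is_derive_mxP /(_ i j) QDij := QD.
    have -> : (fun s => (s *: Q s) i j) = (fun s => s * Q s i j) by apply/funext => s; rewrite mxE.
    apply: is_derive_eq (is_deriveMf (is_derive_id t (1 : R)) QDij) _.
    by rewrite !mxE mul1r.
  (* the energy of the geodesic with initial velocity w + s eta, differentiated at s = 0 *)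
  have EN : bf (DG G (ex y (t *: w)) (t *: Q t)) (P t) (P t) +
     2 * bf (G (ex y (t *: w))) (P t) (Q t + t *: d2 (ex y) (t *: w) w eta) = 2 * K.
    pose p (s : R) := t *: (w + s *: eta).
    have p0 : p 0 = t *: w by rewrite /p scale0r addr0.
    have pD : is_derive (0 : R) (1 : R) p (t *: eta).
      rewrite /p; apply: is_deriveZ.
      apply: is_derive_eq (is_deriveD (is_derive_cst w (0 : R) (1 : R)) (is_derive_scalel eta 0)) _.
      by rewrite add0r.
    have Np0 : N y (p 0) by rewrite p0.
    have pcD : is_derive (0 : R) (1 : R) (fun s => ex y (p s)) (t *: Q t).
      apply: is_derive_eq (diff_curve pD (ex_diff Uy Np0)) _.
      by rewrite p0 linearZ.
    have sD b : is_derive (0 : R) (1 : R) (fun s => 'd (ex y) (p s) b) (t *: d2 (ex y) (t *: w) eta b).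
      have Hd := d_ex_derive (t *: eta) b Uy Nv.
      have cp : forall s : R, p s = t *: w + s *: (t *: eta).
        by move=> s; rewrite /p scalerDr !scalerA mulrC.
      have := is_derive_line_at (f := fun z => 'd (ex y) z b) Hd.
      move=> /(is_derive_ext (fun s => congr1 (fun z => 'd (ex y) z b) (esym (cp s)))) h.
      apply: is_derive_eq h _.
      exact: (d2Zl (eb_exsm eb Uy) _ _ _ Nv).
    pose V (s : R) := 'd (ex y) (p s) w + s *: 'd (ex y) (p s) eta.
    have VE (s : R) : V s = 'd (ex y) (p s) (w + s *: eta) by rewrite /V linearD linearZ.
    have VD : is_derive (0 : R) (1 : R) V (t *: d2 (ex y) (t *: w) eta w + Q t).
      apply: (is_deriveD (sD w) _).
      apply/is_derive_mxP => i j; have /is_derive_mxP /(_ i j) sDij := sD eta.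
      apply: (@is_derive_ext _ _ _ (fun s : R => s * 'd (ex y) (p s) eta i j)) => [s|]; first by rewrite mxE.
      apply: is_derive_eq (is_deriveMf (is_derive_id (0 : R) (1 : R)) sDij) _.
      by rewrite mul1r mul0r addr0 p0.
    have V0 : V 0 = P t by rewrite /V scale0r addr0 p0.
    have Op : Om (ex y (p 0)) by rewrite p0.
    have L1 := is_derive_bf (is_derive_G_curve oOm Gsm Op pcD) VD VD.
    have L2 : is_derive (0 : R) (1 : R) (fun s : R => bf (G y) (w + s *: eta) (w + s *: eta)) (2 * K).
      have wD : is_derive (0 : R) (1 : R) (fun s : R => w + s *: eta) eta.
        apply: is_derive_eq (is_deriveD (is_derive_cst w (0 : R) (1 : R)) (is_derive_scalel eta 0)) _.
        by rewrite add0r.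
      apply: is_derive_eq (is_derive_bf (is_derive_cst (G y) (0 : R) (1 : R)) wD wD) _.
      have -> : bf (0 : 'M[R]_m) (w + 0 *: eta) (w + 0 *: eta) = 0 by rewrite /bf mulmx0 mul0mx mxE.
      rewrite scale0r addr0 add0r (bfC eta w (Gsym _)); last exact: (eb_sub eb).
      by rewrite mulr_natl mulr2n.
    have L3 : is_derive (0 : R) (1 : R) (fun s : R => bf (G (ex y (p s))) (V s) (V s)) (2 * K).
      apply: near_eq_is_derive L2.
      have cp : {for (0 : R), continuous p} by exact: is_derive_continuous pD.
      have nN : nbhs (p 0) (N y) by apply: open_nbhs_nbhs; split=> //; exact: (eb_Nopen eb).
      have cpN : \forall s \near (0 : R), N y (p s) := cp _ nN.
      apply: filterS cpN => s /= Ns.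
      by rewrite VE /p ex_energy.
    have := @derive_val _ _ _ _ _ _ _ L1; rewrite (@derive_val _ _ _ _ _ _ _ L3) V0 p0 => ->.
    rewrite (bfC _ (P t) (Gsym Oc)) (d_ex_sym eta w Uy Nv) [_ + Q t]addrC.
    by rewrite -addrA; congr (_ + _); rewrite mulr_natl mulr2n.
  apply: is_derive_eq (is_derive_bf (is_derive_G_curve oOm Gsm Oc (ex_line Uy Nv)) (ex_geo Uy Nv) JD) _.
  rewrite acc_EL//; [|exact: Gsym|exact: Gunit].
  move: EN; rewrite -/(P t).
  move: (bf (DG G _ (t *: Q t)) _ _) (bf (G _) _ (Q t + _)) (bf (DG G _ _) _ (t *: Q t)) => x1 x2 x3; lra.
have H0 : phi 0 = 0 by rewrite /phi [0 *: Q 0]scale0r bf0r.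
have : forall t : R, 0 <= t <= 1 -> is_derive t (1 : R) (fun s => phi s - K * s) 0.
  by move=> t tI; apply: is_derive_eq (is_deriveB (phiD t tI) (is_derive_mulc K t)) _; rewrite subrr.
move=> /(derive0_constant ler01); rewrite H0 mulr0 mulr1 subrr => /eqP; rewrite subr_eq0 => /eqP <-.
by rewrite /phi /P /Q !scale1r.
Qed.

Lemma d_ex_near y w a : U y -> N y w -> `|'d (ex y) w a - a| <= 2^-1 * `|a|.
Proof.
move=> Uy Nw; have [_ ->] := C1_diff_rV (eb_Nopen eb Uy) Nw (eb_exsm eb Uy 1).
apply: (is_derive_linear_approx a (eb_Nopen eb Uy) Nw (eb_exsm eb Uy 1)).
by move=> v1 v2 n1 n2; exact: (eb_near eb Uy n1 n2).
Qed.

Lemma d_ex_neq0 y w a : U y -> N y w -> a != 0 -> 'd (ex y) w a != 0.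
Proof.
move=> Uy Nw a0; apply/eqP => E0; have := d_ex_near a Uy Nw.
rewrite E0 sub0r normrN => H.
have a1 : 0 < `|a| by rewrite normr_gt0.
by move: H a1; move: (`|a|) => x; lra.
Qed.

(** Differentiate [ex y (lg y (c s)) = c s]. This presents the velocity of [c] as an image under the
    differential of [ex y], the shape to which [gauss_lemma] applies. *)
Lemma ex_lg_derive y (c : R -> E) (t : R) d : U y -> U (c t) -> is_derive t (1 : R) c d ->
  exists2 dw, is_derive t (1 : R) (fun s => lg y (c s)) dw & 'd (ex y) (lg y (c t)) dw = d.
Proof.
move=> Uy Uc cD; have wD := diff_curve cD (lg_diff Uy Uc).
exists ('d (lg y) (c t) d) => //.
have eD := diff_curve wD (ex_diff Uy (eb_lgN eb Uy Uc)).
have cD' : is_derive t (1 : R) (fun s => ex y (lg y (c s))) d.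
  have nU : nbhs (c t) U by apply: open_nbhs_nbhs; split=> //; exact: (eb_open eb).
  have nE : \forall s \near t, U (c s) := is_derive_continuous cD nU.
  apply: near_eq_is_derive cD.
  by apply: filterS nE => s /= Us; rewrite (eb_exK eb).
by rewrite -(@derive_val _ _ _ _ _ _ _ eD) (@derive_val _ _ _ _ _ _ _ cD').
Qed.

End Gauss.

Section Cones.
Variables (R : realType) (n : nat).
Local Notation E := 'rV[R]_n.+2.

(* [X] is the timelike vector that orients the cone of the form [A]. *)
Definition timelike_vec (A : 'M[R]_n.+2) (X v : E) := bf A v v < 0 /\ bf A X v < 0.
Definition causal_vec (A : 'M[R]_n.+2) (X v : E) := [/\ v != 0, bf A v v <= 0 & bf A X v < 0].

Lemma timelike_causal_vec A X v : timelike_vec A X v -> causal_vec A X v.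
Proof.
move=> [h1 h2]; split=> //; last exact: ltW.
by apply: contraTneq h2 => ->; rewrite bf0r ltxx.
Qed.

Lemma causal_timelike_vec A X v : causal_vec A X v -> bf A v v < 0 -> timelike_vec A X v.
Proof. by case. Qed.

Lemma timelike_vec_opp A X v : timelike_vec A (- X) (- v) <-> timelike_vec A X v.
Proof. by rewrite /timelike_vec !bfNl !bfNr !opprK. Qed.

Lemma causal_vec_opp A X v : causal_vec A (- X) (- v) <-> causal_vec A X v.
Proof. by rewrite /causal_vec !bfNl !bfNr !opprK oppr_eq0. Qed.

Lemma timelike_vecZ A X v (k : R) : 0 < k -> timelike_vec A X v -> timelike_vec A X (k *: v).
Proof.
move=> k0 [h1 h2]; split; rewrite ?bfZl !bfZr; last by rewrite pmulr_rlt0.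
by rewrite !pmulr_rlt0.
Qed.

Variables (G : E -> 'M[R]_n.+2) (Om : set E).
Variables (U : set E) (N : E -> set E) (ex lg : E -> E -> E).
Hypothesis oOm : open Om.
Hypothesis Gsm : forall k i j, Ck false k Om (fun y => G y i j).
Hypothesis Glor : forall y, Om y -> lorentzian (G y).
Hypothesis eb : exp_ball G Om U N ex lg.

Let Gsym y : Om y -> (G y)^T = G y. Proof. by move=> /Glor[]. Qed.
Let Gunit y : Om y -> G y \in unitmx. Proof. by move=> /Glor/unit_lorentzian. Qed.
Let UO y : U y -> Om y. Proof. exact: (eb_sub eb). Qed.

Section Orientation.
Variable X : E -> E.
Hypothesis Xt : forall y, Om y -> bf (G y) (X y) (X y) < 0.
Hypothesis Xc : forall y, Om y -> {for y, continuous X}.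

Lemma Gcont y : Om y -> {for y, continuous G}.
Proof. by move=> Oy; apply: differentiable_continuous; exact: (differentiable_G oOm Gsm Oy). Qed.

(** Conservation of energy keeps the velocity causal, and invertibility of the differential keeps it
    nonzero. Its product with the timelike [X] therefore never vanishes along the ray and cannot
    change sign. *)
Lemma ray_causal y w (t : R) : U y -> causal_vec (G y) (X y) w -> N y (t *: w) -> 0 <= t ->
  causal_vec (G (ex y (t *: w))) (X (ex y (t *: w))) ('d (ex y) (t *: w) w).
Proof.
move=> Uy [w0 ww Xw] Nw t0.
have Ns := star_seg eb Uy Nw.
have OU (s : R) : 0 <= s <= t -> Om (ex y (s *: w)).
  by move=> sI; apply: UO; apply: (eb_exU eb) => //; exact: Ns.
have en (s : R) : 0 <= s <= t -> bf (G (ex y (s *: w))) ('d (ex y) (s *: w) w) ('d (ex y) (s *: w) w) <= 0.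
  by move=> sI; rewrite (ex_energy oOm Gsm Gunit Gsym eb)//; [case/andP: sI|exact: Ns].
have nz (s : R) : 0 <= s <= t -> 'd (ex y) (s *: w) w != 0.
  by move=> sI; apply: (d_ex_neq0 eb) => //; exact: Ns.
have tI : 0 <= t <= t by rewrite t0 lexx.
split; [exact: nz|exact: en|].
pose o (s : R) := bf (G (ex y (s *: w))) (X (ex y (s *: w))) ('d (ex y) (s *: w) w).
rewrite -/(o t); apply: (continuous_neg t0).
- apply: continuous_in_subspaceT => s; rewrite inE /= in_itv /= => sI.
  have cc : {for s, continuous (fun s : R => ex y (s *: w))}.
    exact: is_derive_continuous (ex_line eb Uy (Ns s sI)).
  apply: (@continuous_bf R _ _ (fun s : R => G (ex y (s *: w))) (fun s : R => X (ex y (s *: w))) (fun s : R => 'd (ex y) (s *: w) w) s).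
  + exact: (@continuous_comp _ _ _ (fun s : R => ex y (s *: w)) G s cc (Gcont (OU s sI))).
  + exact: (@continuous_comp _ _ _ (fun s : R => ex y (s *: w)) X s cc (Xc (OU s sI))).
  + exact: is_derive_continuous (ex_geo eb Uy (Ns s sI)).
- move=> s sI; apply: timelike_not_orthogonal; [exact: Glor (OU s sI)|exact: Xt (OU s sI)|exact: en|exact: nz].
- by rewrite /o scale0r (d_ex0 eb)// (eb_ex0 eb).
Qed.

Lemma ray_timelike y w (t : R) : U y -> timelike_vec (G y) (X y) w -> N y (t *: w) -> 0 <= t ->
  timelike_vec (G (ex y (t *: w))) (X (ex y (t *: w))) ('d (ex y) (t *: w) w).
Proof.
move=> Uy wt Nw t0; apply: causal_timelike_vec; first exact: ray_causal (timelike_causal_vec wt) Nw t0.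
by rewrite (ex_energy oOm Gsm Gunit Gsym eb)//; case: wt.
Qed.

(** By [eb_rev] the vector [lg q p] is minus the end velocity of the ray from [p] to [q]. With [- X]
    in the conclusion, the lemma applies again to the reversed orientation and gives the converse in
    [local_chron_past]. *)
Lemma timelike_vec_rev p q : U p -> U q -> timelike_vec (G p) (X p) (lg p q) -> timelike_vec (G q) (- X q) (lg q p).
Proof.
move=> Up Uq h.
have Nl : N p (1 *: lg p q) by rewrite scale1r; exact: (eb_lgN eb).
have := ray_timelike Up h Nl ler01.
have e1 := @derive_val _ _ _ _ _ _ _ (ex_line eb Up Nl).
have e2 := eb_rev eb Up Uq.
have e3 : lg q p = - 'd (ex p) (1 *: lg p q) (lg p q) := etrans e2 (congr1 -%R e1).
by rewrite e3 timelike_vec_opp scale1r (eb_exK eb).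
Qed.

(* Since [c] is causal and the radial vector at [c t] is timelike, Gauss'
   lemma makes the square of [lg r (c t)] decrease. *)
Lemma cone_stay r (c cd : R -> E) (a b : R) : U r ->
  (forall t : R, a <= t <= b -> [/\ U (c t), is_derive t (1 : R) c (cd t) &
     causal_vec (G (c t)) (X (c t)) (cd t)]) ->
  timelike_vec (G r) (X r) (lg r (c a)) -> forall t : R, a <= t <= b ->
  timelike_vec (G r) (X r) (lg r (c t)) /\
  (a < t -> bf (G r) (lg r (c t)) (lg r (c t)) < bf (G r) (lg r (c a)) (lg r (c a))).
Proof.
move=> Ur cH start.
pose h (t : R) := bf (G r) (lg r (c t)) (lg r (c t)).
have wD (t : R) : a <= t <= b -> exists2 dw, is_derive t (1 : R) (fun s => lg r (c s)) dw &
    'd (ex r) (lg r (c t)) dw = cd t.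
  by move=> /cH[Uc cD _]; exact: (ex_lg_derive eb Ur Uc cD).
have hD (t : R) : a <= t <= b -> exists2 dh, is_derive t (1 : R) h dh &
    (timelike_vec (G r) (X r) (lg r (c t)) -> dh < 0).
  move=> tI; have [dw dwD dwE] := wD t tI; have [Uc cD cC] := cH t tI.
  exists (2 * bf (G r) (lg r (c t)) dw).
    apply: is_derive_eq (is_derive_bf (is_derive_cst (G r) t (1 : R)) dwD dwD) _.
    have -> : bf (0 : 'M[R]_n.+2) (lg r (c t)) (lg r (c t)) = 0 by rewrite /bf mulmx0 mul0mx mxE.
    by rewrite add0r (bfC dw _ (Gsym (UO Ur))) mulr_natl mulr2n.
  move=> wt; rewrite pmulr_rlt0//.
  have Nl : N r (lg r (c t)) by exact: (eb_lgN eb).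
  rewrite -(gauss_lemma oOm Gsm Gunit Gsym eb dw Ur Nl) dwE (eb_exK eb)//.
  have Nl1 : N r (1 *: lg r (c t)) by rewrite scale1r.
  have := ray_timelike Ur wt Nl1 ler01; rewrite scale1r (eb_exK eb)// => -[P1 P2].
  have [_ c1 c2] := cC; have Oc := UO Uc.
  exact: (same_cone (Glor Oc) (Xt Oc) P1 P2 c1 c2).
have wc (t : R) : a <= t <= b -> {for t, continuous (fun s => lg r (c s))}.
  by move=> /wD[dw dwD _]; exact: is_derive_continuous dwD.
have hc (t : R) : a <= t <= b -> {for t, continuous h}.
  by move=> /hD[dw dwD _]; exact: is_derive_continuous dwD.
have oc (t : R) : a <= t <= b -> {for t, continuous (fun s => bf (G r) (X r) (lg r (c s)))}.
  by move=> tI; apply: (@continuous_bf R _ _ (fun=> G r) (fun=> X r) _ t _ _ (wc t tI)); exact: cst_continuous.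
pose dh (t : R) := 'D_1 h t.
have hD' (t : R) : a <= t <= b -> is_derive t (1 : R) h (dh t).
  by move=> /hD[d dD _]; apply: (is_derive_eq dD); rewrite /dh (@derive_val _ _ _ _ _ _ _ dD).
have dhN (t : R) : a <= t <= b -> timelike_vec (G r) (X r) (lg r (c t)) -> dh t < 0.
  by move=> tI wt; have [d dD /(_ wt)] := hD t tI; rewrite /dh (@derive_val _ _ _ _ _ _ _ dD).
have dec (t : R) : a < t <= b -> (forall s : R, a <= s < t -> timelike_vec (G r) (X r) (lg r (c s))) -> h t < h a.
  move=> /andP[ta tb] Hs; apply: (derive_neg_lt ta (df := dh)) => s /andP[sa st].
    by apply: hD'; rewrite sa (le_trans st tb).
  by apply: dhN; [rewrite sa (le_trans (ltW st) tb)|apply: Hs; rewrite sa st].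
have cone : forall t : R, a <= t <= b -> timelike_vec (G r) (X r) (lg r (c t)).
  apply: real_induction => //.
  - move=> t /andP[ta tb] /(_ t); rewrite ta lexx => /(_ isT) wt.
    have tI : a <= t <= b by rewrite ta ltW.
    have n1 : \forall s \near t, h s < 0 := @cvgr_lt _ _ _ (nbhs_filter t) h (h t) (hc t tI) 0 wt.1.
    have n2 : \forall s \near t, bf (G r) (X r) (lg r (c s)) < 0 :=
      @cvgr_lt _ _ _ (nbhs_filter t) _ _ (oc t tI) 0 wt.2.
    have n12 : \forall s \near t, h s < 0 /\ bf (G r) (X r) (lg r (c s)) < 0 := @filterI _ _ (nbhs_filter t) _ _ n1 n2.
    have /nbhs_ballP[d /= d0 dH] := n12.
    exists d => // s /andP[s1 s2]; have [|g1 g2] := dH s; last by split.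
    by rewrite -ball_normE /= distrC ger0_norm ?subr_ge0// ltrBlDl.
  (* Strict decrease keeps the square of the limit vector below its negative initial value, away
     from the null cone; a flip of orientation is then excluded by continuity. *)
  - move=> t tI Hs; have ht := dec t tI Hs.
    have ht0 : h t < 0 by apply: lt_trans ht start.1.
    split=> //; move: tI => /andP[ta tb]; have tI : a <= t <= b by rewrite (ltW ta).
    apply: (continuous_neg (ltW ta) (o := fun s => bf (G r) (X r) (lg r (c s)))) => //.
    + apply: continuous_in_subspaceT => s; rewrite inE /= in_itv /= => /andP[sa st].
      by apply: oc; rewrite sa (le_trans st tb).
    + move=> s /andP[sa]; rewrite le_eqVlt => /orP[/eqP->|st].
        apply: timelike_not_orthogonal; [exact: Glor (UO Ur)|exact: Xt (UO Ur)|exact: ltW|].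
        by apply: contraTneq ht0 => E0; rewrite /h E0 bf0r ltxx.
      by rewrite lt_eqF// (Hs s _).2// sa st.
    + exact: start.2.
move=> t tI; split; first exact: cone.
move=> ta; apply: dec; first by rewrite ta; case/andP: tI.
by move=> s /andP[sa st]; apply: cone; rewrite sa (le_trans (ltW st))//; case/andP: tI.
Qed.

End Orientation.

Variable X : E -> E.
Hypothesis Xt : forall y, Om y -> bf (G y) (X y) (X y) < 0.
Hypothesis Xc : forall y, Om y -> {for y, continuous X}.

Let XtN y : Om y -> bf (G y) (- X y) (- X y) < 0.
Proof. by rewrite bfNl bfNr opprK; exact: Xt. Qed.
Let XcN y : Om y -> {for y, continuous (fun z => - X z)}.
Proof. by move=> Oy; exact: (@cvgN _ _ _ _ (nbhs_filter y) X (X y) (Xc Oy)). Qed.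

(* [local_cau p q] says that p precedes the chronological future of q and that the Lorentzian
   distance to later points decreases strictly: it is transitive by construction and, by
   [cone_stay], holds along causal curves. *)
Definition local_chron p q := timelike_vec (G p) (X p) (lg p q).
Definition local_cau p q := forall r, U r -> local_chron q r ->
  local_chron p r /\ bf (G r) (lg r p) (lg r p) < bf (G r) (lg r q) (lg r q).

Lemma local_chron_past p q : U p -> U q -> local_chron p q <-> timelike_vec (G q) (- X q) (lg q p).
Proof.
move=> Up Uq; split; first exact: timelike_vec_rev.
by move=> /(timelike_vec_rev XtN XcN Uq Up); rewrite opprK.
Qed.

Lemma local_chron_ray p q (t : R) : U p -> U q -> local_chron p q -> 0 <= t <= 1 ->
  U (ex p (t *: lg p q)) /\
  timelike_vec (G (ex p (t *: lg p q))) (X (ex p (t *: lg p q))) ('d (ex p) (t *: lg p q) (lg p q)).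
Proof.
move=> Up Uq I /andP[t0 t1].
have N1 : N p (1 *: lg p q) by rewrite scale1r; exact: (eb_lgN eb).
have Nt : N p (t *: lg p q) by apply: (star_seg eb Up N1); rewrite t0.
by split; [exact: (eb_exU eb)|exact: ray_timelike].
Qed.

(** Short rays from [q] in the directions [X q] and [- X q]. *)
Lemma near_local_chron q W : U q -> nbhs q W ->
  (exists r, [/\ W r, U r & local_chron q r]) /\ (exists r, [/\ W r, U r & local_chron r q]).
Proof.
move=> Uq nW.
have toq (v : E) : exists2 r, W r /\ U r & exists2 k : R, 0 < k & lg q r = k *: v.
  have Nv : N q (0 *: v) by rewrite scale0r; exact: (eb_N0 eb).
  have c0 : {for (0 : R), continuous (fun t : R => ex q (t *: v))}.
    exact: is_derive_continuous (ex_line eb Uq Nv).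
  have nq : nbhs (ex q (0 *: v)) W by rewrite scale0r (eb_ex0 eb).
  have n1 : \forall t \near (0 : R), W (ex q (t *: v)) := c0 _ nq.
  have n2 : \forall t \near (0 : R), W (ex q (t *: v)) /\ N q (t *: v) := @filterI _ _ (nbhs_filter (0 : R)) _ _ n1 (near_star eb Uq Nv).
  have /nbhs_ballP[d /= d0 dH] := n2.
  have [|h1 h2] := dH (d / 2).
    by rewrite -ball_normE /= sub0r normrN gtr0_norm ?divr_gt0// ltr_pdivrMr// ltr_pMr// ltr1n.
  exists (ex q (d / 2 *: v)); first by split=> //; exact: (eb_exU eb).
  by exists (d / 2); [rewrite divr_gt0|rewrite (eb_lgK eb)].
have Xq := Xt (UO Uq).
split.
  have [r [Wr Ur] [k k0 kE]] := toq (X q); exists r; split=> //.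
  by rewrite /local_chron kE; exact: timelike_vecZ.
have [r [Wr Ur] [k k0 kE]] := toq (- X q); exists r; split=> //.
apply/local_chron_past => //; rewrite kE; apply: timelike_vecZ => //.
by apply/timelike_vec_opp; split.
Qed.

(** Points [r] slightly later than [q] are chronologically after [p]; as [r] tends to [q], the
    vector [lg p q] becomes causal in the limit. The strict inequality in [local_cau] excludes
    [p = q]. *)
Lemma local_cau_causal p q : U p -> U q -> local_cau p q -> p != q /\ causal_vec (G p) (X p) (lg p q).
Proof.
move=> Up Uq pq.
have lc : {for q, continuous (lg p)} by apply: differentiable_continuous; exact: (lg_diff eb Up Uq).
have c1 : {for q, continuous (fun z => bf (G p) (lg p z) (lg p z))}.
  by apply: (@continuous_bf R _ _ (fun=> G p) _ _ q _ lc lc); exact: cst_continuous.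
have c2 : {for q, continuous (fun z => bf (G p) (X p) (lg p z))}.
  by apply: (@continuous_bf R _ _ (fun=> G p) (fun=> X p) _ q _ _ lc); exact: cst_continuous.
have lim (f : E -> R) : {for q, continuous f} -> (forall r, U r -> local_chron p r -> f r <= 0) -> f q <= 0.
  move=> cf fH; rewrite leNgt; apply/negP => fq.
  have n1 : \forall z \near q, 0 < f z := @cvgr_gt _ _ _ (nbhs_filter q) f (f q) cf 0 fq.
  have [[r [fr Ur Ir]] _] := near_local_chron Uq n1.
  by have := fH r Ur (pq r Ur Ir).1; rewrite leNgt fr.
have pq0 : p != q.
  apply/eqP => E0; have [[r [_ Ur Ir]] _] := near_local_chron Uq (filterT : nbhs q setT).
  by have [_] := pq r Ur Ir; rewrite E0 ltxx.
have l0 : lg p q != 0.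
  apply: contra_neq pq0 => l0; have := eb_exK eb Up Uq.
  by rewrite l0 (eb_ex0 eb).
have l1 : bf (G p) (lg p q) (lg p q) <= 0 by apply: (lim _ c1) => r _ [/ltW].
have l2 : bf (G p) (X p) (lg p q) <= 0 by apply: (lim _ c2) => r _ [_ /ltW].
split=> //; split=> //; rewrite lt_neqAle l2 andbT.
by apply: timelike_not_orthogonal => //; [exact: Glor (UO Up)|exact: Xt (UO Up)].
Qed.

Lemma local_cau_ray p q (t : R) : U p -> U q -> local_cau p q -> 0 <= t <= 1 ->
  U (ex p (t *: lg p q)) /\
  causal_vec (G (ex p (t *: lg p q))) (X (ex p (t *: lg p q))) ('d (ex p) (t *: lg p q) (lg p q)).
Proof.
move=> Up Uq /(local_cau_causal Up Uq)[_ I] /andP[t0 t1].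
have N1 : N p (1 *: lg p q) by rewrite scale1r; exact: (eb_lgN eb).
have Nt : N p (t *: lg p q) by apply: (star_seg eb Up N1); rewrite t0.
by split; [exact: (eb_exU eb)|exact: ray_causal].
Qed.

(** [cone_stay] seen from the later point [r], with parameter and orientation reversed: going back
    from [c b], the curve stays in the past cone of [r]. *)
Lemma causal_curve_local_cau (c cd : R -> E) (a b : R) : a < b ->
  (forall t : R, a <= t <= b -> [/\ U (c t), is_derive t (1 : R) c (cd t) &
     causal_vec (G (c t)) (X (c t)) (cd t)]) -> local_cau (c a) (c b).
Proof.
move=> ab cH r Ur.
have aI : a <= a <= b by rewrite lexx ltW.
have bI : a <= b <= b by rewrite lexx ltW.
have [Ua _ _] := cH a aI; have [Ub _ _] := cH b bI.
move=> /(local_chron_past Ub Ur) start.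
have nI (t : R) : - b <= t <= - a -> a <= - t <= b by rewrite lerNl lerNr andbC.
have := @cone_stay (fun y => - X y) XtN XcN r (fun t => c (- t)) (fun t => - cd (- t)) (- b) (- a) Ur.
have H : forall t : R, - b <= t <= - a -> [/\ U (c (- t)), is_derive t (1 : R) (fun t => c (- t)) (- cd (- t)) &
     causal_vec (G (c (- t))) (- X (c (- t))) (- cd (- t))].
  move=> t /nI /cH[h1 h2 h3]; split=> //; first exact: is_derive_reflect.
  by apply/causal_vec_opp.
move=> /(_ H); rewrite opprK => /(_ start (- a)).
rewrite opprK lexx andbT lerN2 (ltW ab) ltrN2 ab => /(_ isT)[h1 h2].
by split; [apply/local_chron_past|exact: h2].
Qed.

Lemma ray_ends p q : U p -> U q -> ex p (0 *: lg p q) = p /\ ex p (1 *: lg p q) = q.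
Proof. by move=> Up Uq; rewrite scale0r scale1r (eb_ex0 eb)// (eb_exK eb). Qed.

Lemma local_chron_open_past q : U q -> open [set p | U p /\ local_chron p q].
Proof.
move=> Uq; rewrite openE => p [Up /(local_chron_past Up Uq) [h1 h2]].
have nU : nbhs p U by apply: open_nbhs_nbhs; split=> //; exact: (eb_open eb).
have lc : {for p, continuous (lg q)} by apply: differentiable_continuous; exact: (lg_diff eb Uq Up).
have c1 : {for p, continuous (fun z => bf (G q) (lg q z) (lg q z))}.
  by apply: (@continuous_bf R _ _ (fun=> G q) _ _ p _ lc lc); exact: cst_continuous.
have c2 : {for p, continuous (fun z => bf (G q) (- X q) (lg q z))}.
  by apply: (@continuous_bf R _ _ (fun=> G q) (fun=> - X q) _ p _ _ lc); exact: cst_continuous.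
have n1 : \forall z \near p, bf (G q) (lg q z) (lg q z) < 0 := @cvgr_lt _ _ _ (nbhs_filter p) _ _ c1 0 h1.
have n2 : \forall z \near p, bf (G q) (- X q) (lg q z) < 0 := @cvgr_lt _ _ _ (nbhs_filter p) _ _ c2 0 h2.
by apply: filterS (filterI nU (filterI n1 n2)) => z [Uz [? ?]]; split=> //; apply/local_chron_past.
Qed.

Lemma local_chron_open p : U p -> open [set q | U q /\ local_chron p q].
Proof.
move=> Up; rewrite openE => q [Uq [h1 h2]].
have nU : nbhs q U by apply: open_nbhs_nbhs; split=> //; exact: (eb_open eb).
have lc : {for q, continuous (lg p)} by apply: differentiable_continuous; exact: (lg_diff eb Up Uq).
have c1 : {for q, continuous (fun z => bf (G p) (lg p z) (lg p z))}.
  by apply: (@continuous_bf R _ _ (fun=> G p) _ _ q _ lc lc); exact: cst_continuous.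
have c2 : {for q, continuous (fun z => bf (G p) (X p) (lg p z))}.
  by apply: (@continuous_bf R _ _ (fun=> G p) (fun=> X p) _ q _ _ lc); exact: cst_continuous.
have n1 : \forall z \near q, bf (G p) (lg p z) (lg p z) < 0 := @cvgr_lt _ _ _ (nbhs_filter q) _ _ c1 0 h1.
have n2 : \forall z \near q, bf (G p) (X p) (lg p z) < 0 := @cvgr_lt _ _ _ (nbhs_filter q) _ _ c2 0 h2.
by apply: filterS (filterI nU (filterI n1 n2)) => z [? [? ?]].
Qed.

End Cones.

(** * Passage to the manifold *)

Section ChartChange.
Variables (R : realType) (m : nat).
Local Notation E := 'rV[R]_m.

Lemma d_coord p (f : E -> 'rV[R]_p) (N : set E) v a j : open N -> N v ->
  (forall k i, Ck false k N (fun v => f v 0 i)) ->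
  'd f v a 0 j = \sum_i a 0 i * 'D_(delta_mx 0 i) (fun z => f z 0 j) v.
Proof.
move=> oN Nv fsm.
have /is_derive_mxP /(_ 0 j) H := diff_is_derive a (smooth_diff oN fsm (@C1_criterion_rV _ _) Nv).
rewrite -(@derive_val _ _ _ _ _ _ _ H).
have [df dE] := C1_differentiable oN (fsm 1%N j) Nv.
by rewrite deriveE// dE.
Qed.

(** Expanding the moving vector over the standard basis avoids differentiating a map with values in
    linear maps. *)
Lemma d_curve2 p (f : E -> 'rV[R]_p) (N : set E) (u v : R -> E) (t : R) du dv :
  open N -> N (u t) -> (forall k i, Ck false k N (fun v => f v 0 i)) ->
  is_derive t (1 : R) u du -> is_derive t (1 : R) v dv ->
  is_derive t (1 : R) (fun s => 'd f (u s) (v s)) ('d f (u t) dv + d2 f (u t) du (v t)).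
Proof.
move=> oN Nu fsm uD vD; apply/is_derive_mxP => i j; rewrite (ord1 i).
have nN : \forall s \near t, N (u s) := is_derive_continuous uD (open_nbhs_nbhs (conj oN Nu)).
pose g (s : R) := \sum_i v s 0 i * 'D_(delta_mx 0 i) (fun z => f z 0 j) (u s).
apply: (near_eq_is_derive (f := g)).
  by apply: filterS nN => s Ns; rewrite /g (d_coord _ j oN Ns fsm).
have pD k : is_derive t (1 : R) (fun s => 'D_(delta_mx 0 k) (fun z => f z 0 j) (u s))
    ('D_du ('D_(delta_mx 0 k) (fun z => f z 0 j)) (u t)).
  have dk := (C1_differentiable oN (CkS_derive (delta_mx 0 k) (fsm 2%N j)) Nu).1.
  by apply: is_derive_eq (diff_curve uD dk) _; rewrite deriveE.
have kD k : is_derive t (1 : R) (fun s => v s 0 k * 'D_(delta_mx 0 k) (fun z => f z 0 j) (u s))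
    (dv 0 k * 'D_(delta_mx 0 k) (fun z => f z 0 j) (u t) +
     v t 0 k * 'D_du ('D_(delta_mx 0 k) (fun z => f z 0 j)) (u t)).
  by have /is_derive_mxP /(_ 0 k) vk := vD; exact: (is_deriveMf vk (pD k)).
apply: is_derive_eq (is_derive_sumf _ kD) _.
rewrite big_split mxE (d_coord dv j oN Nu fsm) d2E; congr (_ + _).
pose h z := \sum_k v t 0 k * 'D_(delta_mx 0 k) (fun z => f z 0 j) z.
have hD : is_derive (u t) du h (\sum_k v t 0 k * 'D_du ('D_(delta_mx 0 k) (fun z => f z 0 j)) (u t)).
  apply: is_derive_sumf => k.
  have dk := (C1_differentiable oN (CkS_derive (delta_mx 0 k) (fsm 2%N j)) Nu).1.
  have dk' : is_derive (u t) du ('D_(delta_mx 0 k) (fun z => f z 0 j)) ('D_du ('D_(delta_mx 0 k) (fun z => f z 0 j)) (u t)).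
    by apply: DeriveDef => //; exact: diff_derivable.
  apply: is_derive_eq (is_deriveMf (is_derive_cst (v t 0 k) (u t) du) dk') _.
  by rewrite mul0r add0r.
have hD' : is_derive (u t) du ('D_(v t) (fun z => f z 0 j))
    (\sum_k v t 0 k * 'D_du ('D_(delta_mx 0 k) (fun z => f z 0 j)) (u t)).
  apply: near_eq_is_derive hD; apply: filterS (open_nbhs_nbhs (conj oN Nu)) => z Nz.
  have [df dE] := C1_differentiable oN (fsm 1%N j) Nz.
  by rewrite deriveE// dE.
by rewrite (@derive_val _ _ _ _ _ _ _ hD').
Qed.

Variables (G1 G2 : E -> 'M[R]_m) (O1 O2 D : set E) (psi : E -> E).
Hypotheses (oO1 : open O1) (oO2 : open O2) (oD : open D).
Hypothesis G1sm : forall k i j, Ck false k O1 (fun y => G1 y i j).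
Hypothesis G2sm : forall k i j, Ck false k O2 (fun y => G2 y i j).
Hypothesis G1unit : forall y, O1 y -> G1 y \in unitmx.
Hypothesis G2unit : forall y, O2 y -> G2 y \in unitmx.
Hypothesis G1sym : forall y, O1 y -> (G1 y)^T = G1 y.
Hypothesis G2sym : forall y, O2 y -> (G2 y)^T = G2 y.
Hypotheses (DO1 : D `<=` O1) (DO2 : forall y, D y -> O2 (psi y)).
Hypothesis psism : forall k i, Ck false k D (fun y => psi y 0 i).
Hypothesis iso : forall y, D y -> forall a b,
  bf (G1 y) a b = bf (G2 (psi y)) ('d psi y a) ('d psi y b).

Lemma d_psi_inj y a : D y -> 'd psi y a = 0 -> a = 0.
Proof.
move=> Dy a0; apply: (bf_inj (G1unit (DO1 Dy))) => b.
by rewrite iso// a0 !bf0l.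
Qed.

Lemma d_psi_surj y b : D y -> exists a, 'd psi y a = b.
Proof.
move=> Dy; have [dp dE] := C1_diff_rV oD Dy (psism 1%N).
have JE a : 'd psi y a = a *m jacmx psi y by rewrite dE jacmul_jacmx.
have Ju : jacmx psi y \in unitmx.
  rewrite -row_free_unit -kermx_eq0; apply/eqP/row_matrixP => i; rewrite row0.
  apply: (d_psi_inj Dy); rewrite JE; apply: sub_kermxP.
  exact: row_sub.
by exists (b *m invmx (jacmx psi y)); rewrite JE -mulmxA mulVmx// mulmx1.
Qed.

(** Obtained by differentiating [iso] with [a] and [b] fixed: on the right the metric and both
    differentials depend on the base point, whence the two terms with [d2]. *)
Lemma iso_derive y d a b : D y ->
  bf (DG G1 y d) a b = bf (DG G2 (psi y) ('d psi y d)) ('d psi y a) ('d psi y b) +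
    bf (G2 (psi y)) (d2 psi y d a) ('d psi y b) + bf (G2 (psi y)) ('d psi y a) (d2 psi y d b).
Proof.
move=> Dy.
have C1 := @C1_criterion_rV R m.
have cst (w : E) : is_derive y d (fun=> w) (0 : E) by exact: is_derive_cst.
have L := is_derive_bf (is_derive_G oO1 G1sm d (DO1 Dy)) (cst a) (cst b).
have pd := smooth_diff oD psism C1 Dy.
have GD : is_derive y d (fun z => G2 (psi z)) (DG G2 (psi y) ('d psi y d)).
  have dG2 := differentiable_G oO2 G2sm (DO2 Dy).
  have c1 := @is_derive_comp R E E _ psi G2 y d (diff_derivable pd) dG2.
  apply: (is_derive_eq c1).
  have h := @derive_val _ _ _ _ _ _ _ (is_derive_G oO2 G2sm ('d psi y d) (DO2 Dy)).
  by rewrite deriveE// in h; rewrite deriveE.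
have RD := is_derive_bf GD (d_derive oD psism C1 d a Dy) (d_derive oD psism C1 d b Dy).
have L' : is_derive y d (fun z => bf (G2 (psi z)) ('d psi z a) ('d psi z b)) (bf (DG G1 y d) a b).
  have L2 : is_derive y d (fun z => bf (G1 z) a b) (bf (DG G1 y d) a b).
    by apply: is_derive_eq L _; rewrite bf0l bf0r !addr0.
  apply: near_eq_is_derive L2.
  by apply: filterS (open_nbhs_nbhs (conj oD Dy)) => z Dz; rewrite iso.
by rewrite -(@derive_val _ _ _ _ _ _ _ RD) (@derive_val _ _ _ _ _ _ _ L').
Qed.

(* The Euler-Lagrange form of the geodesic equation is coordinate free; the
   second derivatives of psi cancel because they are symmetric. *)
Lemma geodesic_change (u v : R -> E) (t : R) : D (u t) ->
  is_derive t (1 : R) u (v t) -> is_derive t (1 : R) v (acc G1 (u t) (v t)) ->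
  is_derive t (1 : R) (fun s => 'd psi (u s) (v s)) (acc G2 (psi (u t)) ('d psi (u t) (v t))).
Proof.
move=> Du uD vD; have H := d_curve2 oD Du psism uD vD.
apply: is_derive_eq H _.
have O1u := DO1 Du; have O2u := DO2 Du.
apply: (bf_inj (G2unit O2u)) => b; have [a <-] := d_psi_surj b Du.
set y := u t; set w := v t; rewrite -/y -/w in Du O1u O2u *.
rewrite bfDl -iso// !acc_EL//; [|exact: G2sym|exact: G2unit|exact: G1sym|exact: G1unit].
rewrite (iso_derive w w a Du) (iso_derive a w w Du).
have e2 : d2 psi y w a = d2 psi y a w := d2_sym oD psism w a Du.
rewrite e2; clear e2; move: (d2 psi y a w) (d2 psi y w w) ('d psi y w) ('d psi y a) => q1 q2 Tw Ta.
rewrite (bfC q1 Tw (G2sym O2u)).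
lra.
Qed.

End ChartChange.

Section Charts.
Variables (R : realType) (n : nat) (M : topologicalType) (S : spacetime R n M).
Local Notation E := 'rV[R]_n.+2.
Implicit Types (i j : chart S) (p q : M) (y v w : E).

Definition chart_range i : set E := coord i @` dom i.
Definition metric_at i y := metric i (param i y).
Definition torient_at i y := torient i (param i y).
Definition overlap i j : set E := coord i @` (dom i `&` dom j).

Lemma chart_range_open i : open (chart_range i).
Proof. exact: coord_open. Qed.

Lemma range_coord i p : dom i p -> chart_range i (coord i p).
Proof. by move=> ip; exists p. Qed.

Lemma paramK i y : chart_range i y -> coord i (param i y) = y.
Proof. by move=> [p ip <-]; rewrite coordK. Qed.

Lemma param_dom i y : chart_range i y -> dom i (param i y).
Proof. by move=> [p ip <-]; rewrite coordK. Qed.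

Lemma metric_at_lorentzian i y : chart_range i y -> lorentzian (metric_at i y).
Proof.
by move=> /param_dom ip; split; [exact: metric_sym|exact: metric_signature].
Qed.

Lemma metric_at_smooth i k a b : Ck false k (chart_range i) (fun y => metric_at i y a b).
Proof. by apply: (smooth_on_Ck (@chart_range_open i) (f := metric i \o param i)); exact: metric_smooth. Qed.

Lemma torient_at_timelike i y : chart_range i y -> bf (metric_at i y) (torient_at i y) (torient_at i y) < 0.
Proof. by move=> /param_dom ip; exact: torient_timelike. Qed.

Lemma torient_at_cont i y : chart_range i y -> {for y, continuous (torient_at i)}.
Proof.
move=> iy; apply: (@continuous_comp _ _ _ (param i) (torient i)); first exact: param_cont.
by apply: torient_cont; exact: param_dom.
Qed.

Lemma open_preimage (T T' : topologicalType) (O : set T) (A : set T') (c : T -> T') :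
  open O -> open A -> (forall t, O t -> {for t, continuous c}) -> open (O `&` c @^-1` A).
Proof.
move=> oO oA cc; rewrite openE => t [Ot At].
have n1 : nbhs t O by apply: open_nbhs_nbhs.
have n2 : nbhs t (c @^-1` A) by apply: cc => //; apply: open_nbhs_nbhs.
exact: (@filterI _ _ (nbhs_filter t) _ _ n1 n2).
Qed.

Lemma overlapE i j : overlap i j = chart_range i `&` param i @^-1` dom j.
Proof.
apply/seteqP; split=> [y [p [ip jp] <-]|y [[p ip <-]]]; rewrite /= coordK//.
  by split=> //; exact: range_coord.
by move=> jp; exists p.
Qed.

Lemma overlap_open i j : open (overlap i j).
Proof.
rewrite overlapE; apply: open_preimage; [exact: coord_open|exact: dom_open|exact: param_cont].
Qed.

Lemma transition_Ck i j k l : Ck false k (overlap i j) (fun y => (coord j \o param i) y 0 l).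
Proof. by apply: (smooth_on_Ck (@overlap_open i j) (f := coord j \o param i)); exact: transition_smooth. Qed.

Lemma transition_range i j y : overlap i j y -> chart_range j (coord j (param i y)).
Proof. by rewrite overlapE => -[_ jy]; exact: range_coord. Qed.

Lemma transition_iso i j y : overlap i j y -> forall a b,
  bf (metric_at i y) a b = bf (metric_at j ((coord j \o param i) y))
    ('d (coord j \o param i) y a) ('d (coord j \o param i) y b).
Proof.
move=> [p [ip jp] <-] a b; rewrite /metric_at /= !coordK//.
by rewrite /bf (metric_change ip jp).
Qed.

(** [smooth_map] refers to all charts; smooth transition maps carry regularity from the single chart
    [i] to the others. *)
Lemma smooth_map_chart (W : normedModType R) (O : set W) (c : W -> M) i :
  C1_criterion W -> open O -> (forall t, O t -> dom i (c t)) ->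
  (forall k l, Ck false k O (fun t => coord i (c t) 0 l)) -> smooth_map S O c.
Proof.
move=> C1 oO ic csm.
have cc t : O t -> {for t, continuous c}.
  move=> Ot A nA.
  have cu : {for t, continuous (coord i \o c)}.
    by apply: continuous_mx => a l; rewrite (ord1 a); exact: Ck_cont (csm 0%N l) Ot.
  have cp : {for t, continuous (param i \o (coord i \o c))}.
    by apply: continuous_comp => //; apply: param_cont; apply: range_coord; exact: ic.
  have nA' : nbhs ((param i \o (coord i \o c)) t) A by rewrite /= coordK//; exact: ic.
  have n1 : \forall s \near t, A (param i (coord i (c s))) := cp _ nA'.
  have n2 : \forall s \near t, O s := open_nbhs_nbhs (conj oO Ot).
  have n3 : \forall s \near t, A (c s).
    apply: (@filterS2 _ _ (nbhs_filter t) _ _ _ _ n1 n2) => s As Os.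
    by rewrite -(coordK (ic _ Os)).
  exact: n3.
split=> // j; set O' := O `&` _.
have oO' : open O' by apply: open_preimage => //; exact: dom_open.
apply: Ck_smooth_on => // k a l; rewrite (ord1 a).
apply: (Ck_ext oO' (f := fun t => (coord j \o param i) (coord i (c t)) 0 l)).
  by move=> t [Ot _]; rewrite /= coordK//; exact: ic.
apply: (Ck_comp (g := coord i \o c) oO' (@overlap_open i j) _ _ (@transition_Ck i j k l)).
- by move=> t [Ot jt]; exists (c t) => //; split=> //; exact: ic.
- by move=> l'; apply: (Ck_subset _ (csm k l')) => t [].
Qed.

Lemma velocity_derive (O : set R) (c : R -> M) i (t : R) : open O -> smooth_map S O c -> O t ->
  dom i (c t) -> is_derive t (1 : R) (coord i \o c) (velocity i c t).
Proof.
move=> oO [cc csm] Ot it.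
have df := smooth_on_differentiable (csm i) (conj Ot it : (O `&` c @^-1` dom i) t).
rewrite /velocity derive1E; apply: DeriveDef => //; exact: diff_derivable.
Qed.

Lemma overlap_coord i j p : dom i p -> dom j p -> overlap i j (coord i p).
Proof. by move=> ip jp; exists p. Qed.

Lemma transition_diff i j y : overlap i j y -> differentiable (coord j \o param i) y.
Proof. exact: (smooth_diff (@overlap_open i j) (@transition_Ck i j) (@C1_criterion_rV _ _)). Qed.

Lemma velocity_change (c : R -> M) i j (t : R) d : {for t, continuous c} ->
  is_derive t (1 : R) (coord i \o c) d -> dom i (c t) -> dom j (c t) ->
  velocity j c t = 'd (coord j \o param i) (coord i (c t)) d.
Proof.
move=> cc vD it jt.
have df := transition_diff (overlap_coord it jt).
have H := diff_curve vD df.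
have nd : \forall s \near t, dom i (c s).
  by apply: cc; apply: open_nbhs_nbhs; split=> //; exact: dom_open.
have H' : is_derive t (1 : R) (coord j \o c) ('d (coord j \o param i) (coord i (c t)) d).
  by apply: near_eq_is_derive H; apply: filterS nd => s ds; rewrite /= coordK.
by rewrite /velocity derive1E (@derive_val _ _ _ _ _ _ _ H').
Qed.

Lemma gform_change i j p v w : dom i p -> dom j p ->
  gform j p ('d (coord j \o param i) (coord i p) v) ('d (coord j \o param i) (coord i p) w) = gform i p v w.
Proof. by move=> ip jp; rewrite /gform (metric_change ip jp). Qed.

Lemma future_causal_change i j p v : dom i p -> dom j p -> future_causal i p v ->
  future_causal j p ('d (coord j \o param i) (coord i p) v).
Proof.
move=> ip jp [v0 vv vt]; split; rewrite ?(torient_change ip jp) ?gform_change//.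
apply: contra_neq v0; apply: (d_psi_inj (G1 := metric_at i) (G2 := metric_at j) (O1 := chart_range i) (D := overlap i j)).
- by move=> y /metric_at_lorentzian/unit_lorentzian.
- by move=> y [q [iq _] <-]; exact: range_coord.
- exact: transition_iso.
- exact: overlap_coord.
Qed.

Lemma future_timelike_change i j p v : dom i p -> dom j p -> future_timelike i p v ->
  future_timelike j p ('d (coord j \o param i) (coord i p) v).
Proof.
by move=> ip jp [vv vt]; split; rewrite ?(torient_change ip jp) ?gform_change.
Qed.

Lemma christoffelE i p k a b : dom i p -> christoffel i p k a b = Gam (metric_at i) (coord i p) k a b.
Proof. by move=> ip; rewrite /christoffel /Gam /metric_at coordK. Qed.

(** [geodesic] asks for the equation in every chart; [geodesic_change] transports it from the chart
    in which it was solved. *)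
Lemma geodesic_chart i (O : set R) (u v : R -> E) : open O ->
  (forall k l, Ck false k O (fun t => u t 0 l)) ->
  (forall t : R, O t -> [/\ chart_range i (u t), is_derive t (1 : R) u (v t) &
     is_derive t (1 : R) v (acc (metric_at i) (u t) (v t))]) ->
  geodesic S O (param i \o u) /\ forall t : R, O t -> velocity i (param i \o u) t = v t.
Proof.
move=> oO usm uH.
have cu t : O t -> coord i ((param i \o u) t) = u t by move=> /uH[h _ _]; exact: paramK.
have di t : O t -> dom i ((param i \o u) t) by move=> /uH[h _ _]; exact: param_dom.
have sm : smooth_map S O (param i \o u).
  apply: (@smooth_map_chart _ _ _ i) => //; first exact: C1_criterion_R.
  by move=> k l; apply: (Ck_ext oO _ (usm k l)) => t Ot; rewrite cu.
have vel t : O t -> is_derive t (1 : R) (coord i \o (param i \o u)) (v t).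
  move=> Ot; have [_ uD _] := uH t Ot.
  apply: near_eq_is_derive uD; apply: filterS (open_nbhs_nbhs (conj oO Ot)) => s Os.
  by rewrite /= -[LHS](cu _ Os).
split; last first.
  by move=> t Ot; rewrite /velocity derive1E (@derive_val _ _ _ _ _ _ _ (vel t Ot)).
split=> // j t Ot jt k; set c := param i \o u.
have [ru uD vD] := uH t Ot; have it := di t Ot.
have Du : overlap i j (u t) by rewrite -(cu _ Ot); exact: overlap_coord.
have H := @geodesic_change R n.+2 (metric_at i) (metric_at j) (chart_range i) (chart_range j) (overlap i j)
  (coord j \o param i) (@chart_range_open i) (@chart_range_open j) (@overlap_open i j)
  (@metric_at_smooth i) (@metric_at_smooth j)
  (fun y h => unit_lorentzian (metric_at_lorentzian h)) (fun y h => unit_lorentzian (metric_at_lorentzian h))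
  (fun y h => (metric_at_lorentzian h).1) (fun y h => (metric_at_lorentzian h).1)
  _ (@transition_range i j) (@transition_Ck i j) (@transition_iso i j) u v t Du uD vD.
have {}H : is_derive t (1 : R) (fun s => 'd (coord j \o param i) (u s) (v s))
    (acc (metric_at j) (coord j (c t)) ('d (coord j \o param i) (u t) (v t))).
  by apply: H => y [q [iq _] <-]; exact: range_coord.
have nO : \forall s \near t, O s := open_nbhs_nbhs (conj oO Ot).
have nj : \forall s \near t, dom j (c s).
  by apply: sm.1 => //; apply: open_nbhs_nbhs; split=> //; exact: dom_open.
have velj s : O s -> dom j (c s) -> velocity j c s = 'd (coord j \o param i) (u s) (v s).
  move=> Os js; rewrite (velocity_change (sm.1 s Os) (vel s Os) (di s Os) js).
  by rewrite cu.
have H2 : is_derive t (1 : R) (velocity j c) (acc (metric_at j) (coord j (c t)) (velocity j c t)).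
  rewrite (velj t)//; apply: near_eq_is_derive H.
  by apply: (@filterS2 _ _ (nbhs_filter t) _ _ _ _ nO nj) => s Os js; rewrite velj.
rewrite derive1E (@derive_val _ _ _ _ _ _ _ H2) mxE.
under [X in _ + X]eq_bigr => a _ do under eq_bigr => b _ do rewrite christoffelE//.
by rewrite addNr.
Qed.

End Charts.

Section GoodNeighbourhoods.
Variables (R : realType) (n : nat) (M : topologicalType) (S : spacetime R n M).
Local Notation E := 'rV[R]_n.+2.

(* [I] and [K] are the chronological and the causal relation of [V], regarded
   as a spacetime of its own. *)
Record good_nbhd (V : set M) (I K : M -> M -> Prop) : Prop := GoodNbhd {
  gn_open : open V;
  gn_convex : convex_normal S V;
  gn_I_geodesic : forall p q, V p -> V q -> I p q ->
    geodesic_in (@future_timelike R n M S) V p q;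
  gn_K_geodesic : forall p q, V p -> V q -> K p q ->
    p <> q /\ geodesic_in (@future_causal R n M S) V p q;
  gn_segment : forall (u v : R) beta, u < v ->
    smooth_segment (@future_causal R n M S) u v beta ->
    (forall t : R, u <= t <= v -> V (beta t)) -> K (beta u) (beta v);
  gn_K_trans : forall p q r, V p -> V q -> V r -> K p q -> K q r -> K p r;
  gn_KI : forall p q r, V p -> V q -> V r -> K p q -> I q r -> I p r;
  gn_I_openr : forall p, V p -> open [set q | V q /\ I p q];
  gn_I_openl : forall q, V q -> open [set p | V p /\ I p q];
  gn_near : forall q W, V q -> nbhs q W ->
    (exists r, [/\ W r, V r & I q r]) /\ (exists r, [/\ W r, V r & I r q])
}.

Section FromExponential.
Variables (i : chart S) (U : set E) (N : E -> set E) (ex lg : E -> E -> E).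
Hypothesis eb : exp_ball (metric_at i) (chart_range i) U N ex lg.

Let oOm := @chart_range_open R n M S i.
Let Gsm := @metric_at_smooth R n M S i.
Let Glor := @metric_at_lorentzian R n M S i.
Let Xt := @torient_at_timelike R n M S i.
Let Xc := @torient_at_cont R n M S i.

Definition chart_nbhd : set M := dom i `&` coord i @^-1` U.

Lemma chart_nbhd_preimage (W : set E) : open W -> open (dom i `&` coord i @^-1` W).
Proof. by move=> oW; apply: (open_preimage _ oW); [exact: dom_open|exact: coord_cont]. Qed.

Lemma chart_nbhd_open : open chart_nbhd.
Proof. exact: chart_nbhd_preimage (eb_open eb). Qed.

Lemma param_nbhd y : U y -> chart_nbhd (param i y) /\ coord i (param i y) = y.
Proof.
move=> Uy; have ry := eb_sub eb Uy.
by rewrite /chart_nbhd /= paramK//; split=> //; split=> //; exact: param_dom.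
Qed.

Lemma ray_open y v : U y -> open [set t : R | N y (t *: v)].
Proof.
by move=> Uy; rewrite openE => t Nt; exact: (near_star eb Uy Nt).
Qed.

Lemma Ck_id k (O : set R) : Ck false k O (fun t : R => t).
Proof.
have c0 : Ck0 false O (fun t : R => t) by split=> // t _; exact: cvg_id.
case: k => [|k]; split=> // v; split=> [t _|]; first exact: derivable_id.
have -> : 'D_v (fun t : R => t) = fun=> v by apply/funext => t; exact: derive_id.
exact: Ck_cst.
Qed.

Lemma ray_Ck y v k l : U y -> Ck false k [set t : R | N y (t *: v)] (fun t => ex y (t *: v) 0 l).
Proof.
move=> Uy; have oO := @ray_open y v Uy.
apply: (Ck_comp (g := fun t : R => t *: v) oO (eb_Nopen eb Uy) _ _ (eb_exsm eb Uy k l)) => // j.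
have -> : (fun t : R => (t *: v) 0 j) = (fun t : R => t * v 0 j) by apply/funext => t; rewrite mxE.
apply: Ck_mul => //; last exact: Ck_cst.
exact: Ck_id.
Qed.

Lemma ray_geodesic y v : U y ->
  geodesic S [set t : R | N y (t *: v)] (fun t => param i (ex y (t *: v))) /\
  forall t : R, N y (t *: v) -> velocity i (fun t => param i (ex y (t *: v))) t = 'd (ex y) (t *: v) v.
Proof.
move=> Uy; apply: (@geodesic_chart R n M S i _ (fun t => ex y (t *: v)) (fun t => 'd (ex y) (t *: v) v)).
- exact: ray_open.
- by move=> k l; exact: ray_Ck.
- move=> t Nt; split; [|exact: (ex_line eb)|exact: (ex_geo eb)].
  by apply: (eb_sub eb); exact: (eb_exU eb).
Qed.

(** In an [exp_ball] every [lg y] is defined on the whole of [U], so one open set is a normal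
    neighbourhood of each of its points. *)
Lemma chart_nbhd_convex : convex_normal S chart_nbhd.
Proof.
split; first exact: chart_nbhd_open.
move=> p [ip Up]; set y := coord i p.
exists i, (N y), (fun v => param i (ex y v)), (fun q => lg y (coord i q)).
have pK v : N y v -> chart_nbhd (param i (ex y v)) /\ coord i (param i (ex y v)) = ex y v.
  by move=> Nv; apply: param_nbhd; exact: (eb_exU eb).
split; first split=> //.
- exact: (eb_Nopen eb).
- exact: (eb_N0 eb).
- by move=> v t Nv; exact: (eb_star eb).
split.
  move=> v Nv; have [g1 g2] := ray_geodesic v Up.
  split=> //; first by rewrite (eb_ex0 eb)// coordK.
  have N0 : N y (0 *: v) by rewrite scale0r; exact: (eb_N0 eb).
  by rewrite g2// scale0r (d_ex0 eb).
split.
- split=> [v /pK[]//| |q [iq Uq]].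
  + move=> v1 v2; rewrite !inE => N1 N2 /(congr1 (coord i)); rewrite (pK _ N1).2 (pK _ N2).2.
    by move=> /(congr1 (lg y)); rewrite !(eb_lgK eb).
  + exists (lg y (coord i q)); first exact: (eb_lgN eb).
    by rewrite (eb_exK eb)// coordK.
- by move=> v Nv; rewrite (pK _ Nv).2 (eb_lgK eb).
- apply: (@smooth_map_chart _ _ _ _ _ _ _ i); first exact: C1_criterion_rV.
  + exact: (eb_Nopen eb).
  + by move=> v /pK[[]].
  + move=> k l; apply: (Ck_ext (eb_Nopen eb Up) _ (eb_exsm eb Up k l)).
    by move=> v Nv; rewrite (pK _ Nv).2.
- move=> j; set D := coord j @` _.
  have DE : D = overlap j i `&` (coord i \o param j) @^-1` U.
    apply/seteqP; split=> [z [q [jq [iq Uq]] <-]|z [[q [jq iq] <-] /= Uq]].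
      by split; [exists q|rewrite /= coordK].
    by exists q => //; rewrite coordK// in Uq.
  have oD : open D.
    rewrite DE; apply: open_preimage; [exact: overlap_open|exact: (eb_open eb)|].
    by move=> z Dz; apply: differentiable_continuous; exact: transition_diff.
  apply: Ck_smooth_on => //; first exact: C1_criterion_rV.
  move=> k a l; rewrite (ord1 a).
  apply: (Ck_comp (g := coord i \o param j) oD (eb_open eb) _ _ (eb_lgsm eb Up k l)).
    by rewrite DE => z [].
  by move=> l'; apply: (Ck_subset _ (@transition_Ck R n M S j i k l')); rewrite DE => z [].
Qed.

Let chron' p q := local_chron (metric_at i) lg (torient_at i) (coord i p) (coord i q).
Let cau' p q := local_cau (metric_at i) U lg (torient_at i) (coord i p) (coord i q).

(** The ray is controlled in the chart [i] only, while [geodesic_in] constrains the velocity in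
    every chart; hence the invariance assumed of [Q]. *)
Lemma ray_geodesic_in (Q : forall j, M -> E -> Prop) p q :
  (forall j r v, dom i r -> dom j r -> Q i r v -> Q j r ('d (coord j \o param i) (coord i r) v)) ->
  chart_nbhd p -> chart_nbhd q ->
  (forall t : R, 0 <= t <= 1 ->
    Q i (param i (ex (coord i p) (t *: lg (coord i p) (coord i q))))
      ('d (ex (coord i p)) (t *: lg (coord i p) (coord i q)) (lg (coord i p) (coord i q)))) ->
  geodesic_in Q chart_nbhd p q.
Proof.
move=> Qch [ip Up] [iq Uq]; set y := coord i p; set w := lg y (coord i q) => QH.
have [g1 g2] := ray_geodesic w Up.
have N1 : N y (1 *: w) by rewrite scale1r; exact: (eb_lgN eb).
have Nt (t : R) : t \in `[0, 1] -> N y (t *: w).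
  by rewrite in_itv /=; exact: (star_seg eb Up N1).
have [e0 e1] := ray_ends eb Up Uq.
exists [set t : R | N y (t *: w)], (fun t => param i (ex y (t *: w))); split.
  split=> //; first exact: ray_open.
  by move: e0 e1; rewrite -/y -/w => -> ->; rewrite !coordK.
move=> t tI; have Ntt := Nt t tI.
have Uc : U (ex y (t *: w)) by exact: (eb_exU eb).
have [Vc cE] := param_nbhd Uc.
split=> // j jc.
have vD : is_derive t (1 : R) (coord i \o (fun t => param i (ex y (t *: w)))) ('d (ex y) (t *: w) w).
  rewrite -(g2 t Ntt); apply: (@velocity_derive R n M S [set t : R | N y (t *: w)]).
  - exact: ray_open.
  - by case: g1.
  - exact: Ntt.
  - exact: Vc.1.
have cc : {for t, continuous (fun t : R => param i (ex y (t *: w)))} by case: g1 => -[cc _] _; exact: cc.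
rewrite (velocity_change cc vD _ jc); last by case: Vc.
by apply: Qch => //; [case: Vc|exact: QH].
Qed.

Lemma good_chart_nbhd : good_nbhd chart_nbhd chron' cau'.
Proof.
split.
- exact: chart_nbhd_open.
- exact: chart_nbhd_convex.
- move=> p q Vp Vq I; apply: ray_geodesic_in => //; first exact: future_timelike_change.
  by move=> t tI; exact: (local_chron_ray oOm Gsm Glor eb Xt Xc Vp.2 Vq.2 I tI).2.
- move=> p q Vp Vq K; split.
    by move=> pq; have [] := local_cau_causal oOm Gsm Glor eb Xt Xc Vp.2 Vq.2 K; rewrite pq eqxx.
  apply: ray_geodesic_in => //; first exact: future_causal_change.
  by move=> t tI; exact: (local_cau_ray oOm Gsm Glor eb Xt Xc Vp.2 Vq.2 K tI).2.
- move=> u v b uv; case=> O; case=> c; case=> oO OI sm cE cQ bV.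
  have cb (t : R) : u <= t <= v -> c t = b t by move=> tI; apply: cE; rewrite in_itv.
  rewrite /cau' -!cb ?lexx ?ltW//.
  apply: (causal_curve_local_cau oOm Gsm Glor eb Xt Xc (c := coord i \o c) (cd := velocity i c) uv).
  move=> t tI; have [ib Ub] := bV t tI; rewrite -(cb t tI) in ib Ub.
  have Ot : O t by apply: OI; rewrite /= in_itv.
  split; [exact: Ub|exact: (velocity_derive oO sm Ot ib)|].
  have := cQ t i; rewrite in_itv /= => /(_ tI ib).
  by rewrite /future_causal /causal_vec /metric_at /torient_at /= coordK.
- by move=> p q r _ _ _ K1 K2 z Uz Iz; have [I1 l1] := K2 z Uz Iz; have [I2 l2] := K1 z Uz I1; split=> //; exact: lt_trans l1.
- by move=> p q r _ _ [ir Ur] K I; have [] := K _ Ur I.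
- move=> p Vp.
  have -> : [set q | chart_nbhd q /\ chron' p q] = dom i `&` coord i @^-1`
      [set q | U q /\ local_chron (metric_at i) lg (torient_at i) (coord i p) q].
    by apply/seteqP; split=> q; [case=> -[? ?] ?|case=> ? [? ?]].
  by apply: chart_nbhd_preimage; exact: (local_chron_open eb Vp.2).
- move=> q Vq.
  have -> : [set p | chart_nbhd p /\ chron' p q] = dom i `&` coord i @^-1`
      [set p | U p /\ local_chron (metric_at i) lg (torient_at i) p (coord i q)].
    by apply/seteqP; split=> p; [case=> -[? ?] ?|case=> ? [? ?]].
  by apply: chart_nbhd_preimage; exact: (local_chron_open_past oOm Gsm Glor eb Xt Xc Vq.2).
- move=> q W [iq Uq] nW.
  have nW' : nbhs (coord i q) (param i @^-1` W).
    by apply: param_cont; [exact: range_coord|rewrite coordK].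
  have [[r [Wr Ur Ir]] [r' [Wr' Ur' Ir']]] := near_local_chron oOm Gsm Glor eb Xt Xc Uq nW'.
  have [V1 E1] := param_nbhd Ur; have [V2 E2] := param_nbhd Ur'.
  by split; [exists (param i r)|exists (param i r')]; split=> //; rewrite /chron' ?E1 ?E2.
Qed.

End FromExponential.

Theorem good_nbhd_exists p : exists V I K, good_nbhd V I K /\ V p.
Proof.
have [i ip] := dom_cover S p.
have rp := range_coord ip.
have [U [N [ex [lg [Up eb]]]]] := exp_ball_exists (@chart_range_open R n M S i)
  (@metric_at_smooth R n M S i) (fun y h => unit_lorentzian (metric_at_lorentzian h)) rp.
by do 3 eexists; split; [exact: good_chart_nbhd eb|split].
Qed.

End GoodNeighbourhoods.

(** * Causal curves *)

Section AffineChange.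
Variables (R : realType) (k m : R).
Let aff (t : R) : R := k * t + m.

(** Treating the inner derivative as a change of direction from [v] to [k * v] gives an identity of
    difference quotients for every [k], zero and negative included. Iterated derivatives then
    transform without regularity assumptions. *)
Lemma affine_quotient (W : normedModType R) (f : R -> W) (t v : R) :
  (fun h : R => h^-1 *: (((f \o aff) \o shift t) (h *: v) - (f \o aff) t)) =
  (fun h : R => h^-1 *: ((f \o shift (aff t)) (h *: (k * v)) - f (aff t))).
Proof.
apply/funext => h; congr (_ *: (f _ - _)); rewrite /aff /shift /= /GRing.scale /=.
by ring.
Qed.

Lemma derive_affine (W : normedModType R) (f : R -> W) (v : R) :
  'D_v (f \o aff) = ('D_(k * v) f) \o aff.
Proof. by apply/funext => t; rewrite /= /derive affine_quotient. Qed.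

Lemma derive_affineE (W : normedModType R) (f : R -> W) (t v : R) :
  'D_v (f \o aff) t = 'D_(k * v) f (aff t).
Proof. by rewrite /derive affine_quotient. Qed.

Lemma derivable_affine (W : normedModType R) (f : R -> W) (t v : R) :
  derivable f (aff t) (k * v) -> derivable (f \o aff) t v.
Proof. by rewrite /derivable affine_quotient. Qed.

Lemma smooth_on_affine (W : normedModType R) (O : set R) (f : R -> W) :
  smooth_on O f -> smooth_on (aff @^-1` O) (f \o aff).
Proof.
move=> fsm vs t Ot.
have -> : foldr (fun v (h : R -> W) => 'D_v h) (f \o aff) vs =
    foldr (fun v (h : R -> W) => 'D_v h) f (map ( *%R k) vs) \o aff.
  by elim: vs {Ot} => // v vs /= ->; exact: derive_affine.
apply/derivable1_diffP; apply: derivable_affine; apply: diff_derivable.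
exact: fsm.
Qed.

Lemma affine_continuous : continuous aff.
Proof.
move=> t; apply: (@continuousD _ _ _ (fun t => k * t) (fun=> m)); last exact: cst_continuous.
exact: mulrl_continuous.
Qed.

Variables (n : nat) (M : topologicalType) (S : spacetime R n M).

Lemma smooth_map_affine (O : set R) (c : R -> M) :
  smooth_map S O c -> smooth_map S (aff @^-1` O) (c \o aff).
Proof.
move=> [cc csm]; split.
  by move=> t Ot; apply: continuous_comp; [exact: affine_continuous|exact: cc].
by move=> i; exact: (smooth_on_affine (csm i)).
Qed.

Lemma velocity_affine (O : set R) (c : R -> M) (i : chart S) (t : R) :
  open O -> smooth_map S O c -> O (aff t) -> dom i (c (aff t)) ->
  velocity i (c \o aff) t = k *: velocity i c (aff t).
Proof.
move=> oO sm Ot it; rewrite /velocity !derive1E.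
have -> : coord i \o (c \o aff) = (coord i \o c) \o aff by [].
rewrite derive_affineE mulr1.
have H := velocity_derive oO sm Ot it.
have := @derive_val _ _ _ _ _ _ _ (is_derive_scale_dir k H).
rewrite /GRing.scale /= mulr1 => ->.
by rewrite /velocity derive1E.
Qed.

Lemma geodesic_affine (O : set R) (c : R -> M) : open O ->
  geodesic S O c -> geodesic S (aff @^-1` O) (c \o aff).
Proof.
move=> oO [sm geo]; have sma := smooth_map_affine sm; split=> // i t Ot it l.
have oO' : open (O `&` c @^-1` dom i).
  by apply: open_preimage => //; [exact: dom_open|case: sm].
have nO : \forall s \near t, O (aff s) /\ dom i (c (aff s)).
  have nb : nbhs (aff t) (O `&` c @^-1` dom i) by apply: open_nbhs_nbhs.
  exact: (affine_continuous nb).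
have df : differentiable (velocity i c) (aff t).
  have := smooth_on_differentiable (smooth_on_derive (1 : R) (sm.2 i)) (conj Ot it : (O `&` c @^-1` dom i) (aff t)).
  have -> // : velocity i c = 'D_1 (coord i \o c).
  by apply/funext => s; rewrite /velocity derive1E.
have vD : is_derive (aff t) (1 : R) (velocity i c) (derive1 (velocity i c) (aff t)).
  by rewrite derive1E; apply: DeriveDef => //; exact: diff_derivable.
have kD : is_derive t (1 : R) (velocity i c \o aff) (k *: derive1 (velocity i c) (aff t)).
  have kv := is_derive_scale_dir k vD; rewrite /GRing.scale /= in kv.
  apply: DeriveDef.
    by apply: derivable_affine; exact: (@ex_derive _ _ _ _ _ _ _ kv).
  by rewrite derive_affineE (@derive_val _ _ _ _ _ _ _ kv).
have aD : is_derive t (1 : R) (velocity i (c \o aff)) (k *: (k *: derive1 (velocity i c) (aff t))).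
  apply: near_eq_is_derive (is_deriveZ k kD).
  by apply: filterS nO => s [Os ds]; rewrite (velocity_affine oO sm Os ds).
rewrite derive1E (@derive_val _ _ _ _ _ _ _ aD) (velocity_affine oO sm Ot it) !mxE /=.
have := geo i (aff t) Ot it l.
set A := (X in X + _ = 0 -> _); set B := (X in _ + X = 0 -> _) => AB.
have -> : \sum_a \sum_b christoffel i (c (aff t)) l a b * (k *: velocity i c (aff t)) 0 a *
    (k *: velocity i c (aff t)) 0 b = k * (k * B).
  rewrite /B !mulr_sumr; apply: eq_bigr => a _; rewrite !mulr_sumr; apply: eq_bigr => b _.
  by rewrite !mxE; ring.
by rewrite -!mulrDr AB !mulr0.
Qed.

Lemma smooth_segment_affine (Q : forall i : chart S, M -> 'rV[R]_n.+2 -> Prop) (u v : R) beta :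
  0 < k -> (forall i p w, Q i p w -> Q i p (k *: w)) ->
  smooth_segment Q (aff u) (aff v) beta -> smooth_segment Q u v (beta \o aff).
Proof.
move=> k0 Qk; case=> O; case=> c; case=> oO OI sm cE cQ.
have inI (t : R) : t \in `[u, v] -> aff t \in `[aff u, aff v].
  by rewrite !in_itv /= /aff !lerD2r !ler_pM2l.
exists (aff @^-1` O), (c \o aff); split.
- by apply: open_comp => // t _; exact: affine_continuous.
- by move=> t tI; apply: OI; exact: inI.
- exact: smooth_map_affine.
- by move=> t tI; rewrite /= cE//; exact: inI.
- move=> t i tI it; have Ot : O (aff t) by apply: OI; exact: inI.
  by rewrite (velocity_affine oO sm Ot it); apply: Qk; apply: cQ => //; exact: inI.
Qed.

End AffineChange.

Section Reversal.
Variables (R : realType) (n : nat) (M : topologicalType) (S : spacetime R n M).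

Lemma geodesic_in_reverse (Q Q' : forall i : chart S, M -> 'rV[R]_n.+2 -> Prop) V p q :
  (forall i r w, Q i r w -> Q' i r (- w)) -> geodesic_in Q V p q -> geodesic_in Q' V q p.
Proof.
move=> QQ' [D [c [[oO OI geo [c0 c1]] cQ]]].
have inI (t : R) : t \in `[0, 1] -> -1 * t + 1 \in `[(0 : R), 1].
  by rewrite !in_itv /= mulN1r => /andP[t0 t1]; apply/andP; split; lra.
exists ((fun t : R => -1 * t + 1) @^-1` D), (c \o (fun t : R => -1 * t + 1)); split.
  split.
  - by apply: open_comp => // t _; exact: affine_continuous.
  - by move=> t tI; apply: OI; exact: inI.
  - exact: geodesic_affine.
  - by rewrite /= mulr0 add0r mulN1r addNr.
move=> t tI; have [Vt Qt] := cQ _ (inI _ tI); split=> // i it.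
have Ot : D (-1 * t + 1) by apply: OI; exact: inI.
by rewrite (velocity_affine oO geo.1 Ot it) scaleN1r; apply: QQ'; exact: Qt.
Qed.

Lemma directed_curve_opp (Q Q' : forall i : chart S, M -> 'rV[R]_n.+2 -> Prop) (I : set R) gamma :
  (forall i r w, Q i r w -> Q' i r (- w)) -> directed_curve Q I gamma ->
  directed_curve Q' ((fun t => - t) @^-1` I) (gamma \o (fun t => - t)).
Proof.
move=> QQ' [gc gd].
have nN (t : R) (A : set R) : nbhs (- t) A -> nbhs t ((fun t => - t) @^-1` A).
  move=> nA; have cN : {for t, continuous (fun t : R => - t)}.
    exact: is_derive_continuous (is_deriveN (is_derive_id t (1 : R))).
  exact: cN.
split.
  apply/subspace_continuousP => t It A nA.
  move/subspace_continuousP: gc => /(_ _ It A nA) H.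
  exact: (nN _ _ H).
move=> t It; have [J [U [[JI nJ cU Ut JU] H]]] := gd _ It.
exists ((fun t => - t) @^-1` J), U; split.
  split=> //; first by move=> s; exact: JI.
    exact: (nN _ _ nJ).
  by move=> _ [s Js <-]; apply: JU; exists (- s).
move=> t1 t2 J1 J2 t12; have [|ne ge] := H (- t2) (- t1) J2 J1; first by rewrite ltrN2.
split; first by move=> E; apply: ne; exact: esym E.
exact: geodesic_in_reverse ge.
Qed.

Lemma past_causal_curve_opp (I : set R) gamma : past_causal_curve S I gamma ->
  future_causal_curve S ((fun t => - t) @^-1` I) (gamma \o (fun t => - t)).
Proof. exact: directed_curve_opp. Qed.

Lemma future_causal_curve_opp (I : set R) gamma : future_causal_curve S I gamma ->
  past_causal_curve S ((fun t => - t) @^-1` I) (gamma \o (fun t => - t)).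
Proof. by apply: directed_curve_opp => i r w; rewrite /past_causal opprK. Qed.

End Reversal.

Section CausalCurves.
Variables (R : realType) (n : nat) (M : topologicalType) (S : spacetime R n M).

Lemma within_contP (T : topologicalType) (I : set T) (alpha : T -> M) :
  {within I, continuous alpha} <->
  (forall t, I t -> forall A, nbhs (alpha t) A -> \forall s \near t, I s -> A (alpha s)).
Proof.
split=> [/subspace_continuousP H t It A nA|H].
  have nA' := H t It A nA; exact: nA'.
apply/subspace_continuousP => t It A nA; exact: H.
Qed.

(* Unlike [directed_curve], this form passes to subcurves, reparametrisations and
   concatenations; see [locally_causal_curve] and [future_causal_locally]. *)
Definition locally_causal (I : set R) (alpha : R -> M) :=
  {within I, continuous alpha} /\
  forall t V C K, I t -> good_nbhd S V C K -> V (alpha t) ->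
  exists J : set R, [/\ nbhs t J, forall s, I s -> J s -> V (alpha s) &
    forall t1 t2, I t1 -> I t2 -> J t1 -> J t2 -> t1 < t2 -> K (alpha t1) (alpha t2)].

Lemma locally_causal_curve I alpha :
  locally_causal I alpha -> future_causal_curve S I alpha.
Proof.
move=> [ac aK]; split=> // t It.
have [V [C [K [gn Vt]]]] := good_nbhd_exists S (alpha t).
have [J [nJ JV JK]] := aK t V C K It gn Vt.
exists (I `&` J), V; split.
  have IJ : I `&` J `<=` I by move=> s [].
  have nIJ : \forall s \near t, I s -> (I `&` J) s by apply: filterS nJ => s Js Is.
  split=> //; first exact: gn_convex gn.
  by move=> _ [s [Is Js] <-]; exact: JV.
move=> t1 t2 [I1 J1] [I2 J2] t12.
by apply: (gn_K_geodesic gn); [exact: JV|exact: JV|exact: JK].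
Qed.

Lemma locally_causal_sub (I I' : set R) alpha : I' `<=` I ->
  locally_causal I alpha -> locally_causal I' alpha.
Proof.
move=> II' [ac aK]; split; first exact: continuous_subspaceW II' ac.
move=> t V C K It gn Vt; have [J [nJ JV JK]] := aK t V C K (II' _ It) gn Vt.
by exists J; split=> // [s /II'|t1 t2 /II' ? /II' ?]; [exact: JV|exact: JK].
Qed.

Lemma locally_causal_ext (I : set R) alpha beta : (forall t, I t -> alpha t = beta t) ->
  locally_causal I alpha -> locally_causal I beta.
Proof.
move=> ab [ac aK]; split.
  apply/within_contP => t It A; rewrite -ab// => nA.
  move/within_contP: ac => /(_ t It A nA) H.
  by apply: filterS H => s As Is; rewrite -ab//; exact: As.
move=> t V C K It gn; rewrite -ab// => Vt; have [J [nJ JV JK]] := aK t V C K It gn Vt.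
exists J; split=> // [s Is Js|t1 t2 I1 I2 J1 J2 t12]; rewrite -!ab//; first exact: JV.
exact: JK.
Qed.

Lemma locally_causal_affine (k m : R) (I : set R) alpha : 0 < k ->
  locally_causal I alpha ->
  locally_causal [set t | I (k * t + m)] (alpha \o (fun t => k * t + m)).
Proof.
move=> k0 [ac aK].
have nA (t : R) (A : set R) : nbhs (k * t + m) A -> nbhs t [set s | A (k * s + m)].
  by move=> nA; exact: (@affine_continuous R k m t _ nA).
split.
  apply/subspace_continuousP => t It A nbA.
  move/subspace_continuousP: ac => /(_ _ It A nbA) H.
  exact: (nA _ _ H).
move=> t V C K It gn Vt; have [J [nJ JV JK]] := aK _ V C K It gn Vt.
exists [set s | J (k * s + m)]; split; first exact: nA.
  by move=> s; exact: JV.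
by move=> t1 t2 I1 I2 J1 J2 t12; apply: JK => //; rewrite ltrD2r ltr_pM2l.
Qed.

Lemma within_continuous_concat (I : set R) (b : R) (alpha : R -> M) :
  {within I `&` [set t | t <= b], continuous alpha} ->
  {within I `&` [set t | b <= t], continuous alpha} -> {within I, continuous alpha}.
Proof.
move=> lc rc; apply/within_contP => t It A nA.
have nl : t <= b -> \forall s \near t, I s -> s <= b -> A (alpha s).
  move=> tb; move/within_contP: lc => /(_ t (conj It tb) A nA) H.
  by apply: filterS H => s As Is sb; exact: As.
have nr : b <= t -> \forall s \near t, I s -> b <= s -> A (alpha s).
  move=> tb; move/within_contP: rc => /(_ t (conj It tb) A nA) H.
  by apply: filterS H => s As Is sb; exact: As.
have [tb|tb|tb] := ltgtP t b.
- have nb : \forall s \near t, s < b by exact: lt_nbhsl.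
  by apply: (@filterS2 _ _ (nbhs_filter t) _ _ _ _ (nl (ltW tb)) nb) => s h sb Is; apply: h => //; exact: ltW.
- have nb : \forall s \near t, b < s by exact: lt_nbhsr.
  by apply: (@filterS2 _ _ (nbhs_filter t) _ _ _ _ (nr (ltW tb)) nb) => s h sb Is; apply: h => //; exact: ltW.
- have nl' : \forall s \near t, I s -> s <= b -> A (alpha s) by apply: nl; rewrite tb.
  have nr' : \forall s \near t, I s -> b <= s -> A (alpha s) by apply: nr; rewrite tb.
  apply: (@filterS2 _ _ (nbhs_filter t) _ _ _ _ nl' nr') => s h1 h2 Is.
  by case: (leP s b) => sb; [exact: h1|apply: h2 => //; exact: ltW].
Qed.

(** Away from [b] the neighbourhood is shrunk to one side. Around [b], points on opposite sides are
    related through [alpha b] by transitivity of [K]; this is the step for which the geodesic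
    condition was replaced. *)
Lemma locally_causal_concat (I : set R) (b : R) alpha : I b ->
  locally_causal (I `&` [set t | t <= b]) alpha ->
  locally_causal (I `&` [set t | b <= t]) alpha -> locally_causal I alpha.
Proof.
move=> Ib [lc lK] [rc rK]; split; first exact: within_continuous_concat lc rc.
move=> t V C K It gn Vt; have [tb|tb|tb] := ltgtP t b.
- have [J [nJ JV JK]] := lK t V C K (conj It (ltW tb)) gn Vt.
  have nb : \forall s \near t, s < b by exact: lt_nbhsl.
  exists (J `&` [set s | s < b]); split; first exact: (@filterI _ _ (nbhs_filter t) _ _ nJ nb).
    by move=> s Is [Js sb]; apply: JV => //; split=> //; exact: ltW.
  by move=> t1 t2 I1 I2 [J1 b1] [J2 b2]; apply: JK => //; split=> //; exact: ltW.
- have [J [nJ JV JK]] := rK t V C K (conj It (ltW tb)) gn Vt.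
  have nb : \forall s \near t, b < s by exact: lt_nbhsr.
  exists (J `&` [set s | b < s]); split; first exact: (@filterI _ _ (nbhs_filter t) _ _ nJ nb).
    by move=> s Is [Js sb]; apply: JV => //; split=> //; exact: ltW.
  by move=> t1 t2 I1 I2 [J1 b1] [J2 b2]; apply: JK => //; split=> //; exact: ltW.
- rewrite tb in It Vt *.
  have [J [nJ JV JK]] := lK b V C K (conj It (lexx b)) gn Vt.
  have [J' [nJ' JV' JK']] := rK b V C K (conj It (lexx b)) gn Vt.
  have bJ : J b := nbhs_singleton nJ.
  have bJ' : J' b := nbhs_singleton nJ'.
  have JVV s : I s -> (J `&` J') s -> V (alpha s).
    by move=> Is [Js Js']; case: (leP s b) => sb; [apply: JV|apply: JV' => //; split=> //; exact: ltW].
  exists (J `&` J'); split=> //; first exact: (@filterI _ _ (nbhs_filter b) _ _ nJ nJ').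
  move=> t1 t2 I1 I2 [J1 J1'] [J2 J2'] t12.
  have [b2|b2] := leP t2 b.
    by apply: JK => //; split=> //; exact: (le_trans (ltW t12)).
  have [b1|b1] := leP b t1.
    by apply: JK' => //; split=> //; exact: ltW.
  apply: (gn_K_trans gn (q := alpha b)); [exact: JVV|exact: Vt|exact: JVV|apply: JK|apply: JK'] => //;
    by split=> //=; exact: ltW.
Qed.

Lemma sub_smooth_segment (Q : forall i : chart S, M -> 'rV[R]_n.+2 -> Prop) (u v u' v' : R) beta :
  u <= u' -> v' <= v -> smooth_segment Q u v beta -> smooth_segment Q u' v' beta.
Proof.
move=> uu vv; case=> D; case=> c; case=> oD DI sm cE cQ.
have sub (t : R) : t \in `[u', v'] -> t \in `[u, v].
  by rewrite !in_itv /= => /andP[h1 h2]; rewrite (le_trans uu) ?(le_trans _ vv).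
exists D, c; split=> //.
- by move=> t tI; apply: DI; exact: sub.
- by move=> t /sub; exact: cE.
- by move=> t i /sub; exact: cQ.
Qed.

Lemma smooth_segment_continuous (Q : forall i : chart S, M -> 'rV[R]_n.+2 -> Prop) (u v : R) beta :
  smooth_segment Q u v beta -> {within `[u, v], continuous beta}.
Proof.
case=> D; case=> c; case=> oD DI sm cE _.
apply/within_contP => t tI A; rewrite -cE// => nA.
have H : \forall s \near t, A (c s) := sm.1 t (DI _ tI) _ nA.
by apply: filterS H => s As sI; rewrite -cE.
Qed.

Lemma smooth_segment_ext (Q : forall i : chart S, M -> 'rV[R]_n.+2 -> Prop) (u v : R) beta beta' :
  (forall t : R, u <= t <= v -> beta t = beta' t) ->
  smooth_segment Q u v beta -> smooth_segment Q u v beta'.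
Proof.
move=> bb; case=> D; case=> c; case=> oD DI sm cE cQ.
exists D, c; split=> // t tI; rewrite cE//; apply: bb.
by move: tI; rewrite in_itv.
Qed.

(** On a ball of parameters mapped into [V], every subsegment is a smooth causal segment inside [V],
    to which [gn_segment] applies. *)
Lemma smooth_segment_causal (u v : R) beta : smooth_segment (@future_causal R n M S) u v beta ->
  locally_causal `[u, v] beta.
Proof.
move=> sg; have [D [c [oD DI sm cE _]]] := sg.
have cb (t : R) : u <= t <= v -> c t = beta t by move=> tI; apply: cE; rewrite in_itv.
have cc (t : R) : u <= t <= v -> {for t, continuous c}.
  by move=> tI; apply: sm.1; apply: DI; rewrite /= in_itv.
split; first exact: smooth_segment_continuous sg.
move=> t V C K; rewrite /= in_itv /= => tI gn Vt; rewrite -cb// in Vt.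
have nV : nbhs (c t) V by apply: open_nbhs_nbhs; split=> //; exact: (gn_open gn).
have H : nbhs t (c @^-1` V) := cc t tI _ nV.
have /nbhs_ballP[e /= e0 eV] := H.
have bV (s : R) : u <= s <= v -> ball t e s -> V (beta s) by move=> sI /eV; rewrite /= cb.
exists (ball t e); split=> //; first exact: nbhsx_ballx.
move=> t1 t2; rewrite /= !in_itv /= => /andP[u1 v1] /andP[u2 v2] b1 b2 t12.
apply: (gn_segment gn t12); first exact: (sub_smooth_segment u1 v2 sg).
move=> s /andP[s1 s2]; apply: bV; first by rewrite (le_trans u1 s1) (le_trans s2 v2).
move: b1 b2; rewrite -!ball_normE /= !ltr_distlC => /andP[x1 x2] /andP[x3 x4].
by apply/andP; split; [exact: lt_le_trans s1|exact: le_lt_trans x4].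
Qed.

Lemma geodesic_in_segment (Q : forall i : chart S, M -> 'rV[R]_n.+2 -> Prop) V p q :
  geodesic_in Q V p q -> exists c, [/\ smooth_segment Q 0 1 c, c 0 = p, c 1 = q &
    forall t : R, 0 <= t <= 1 -> V (c t)].
Proof.
move=> [D [c [[oD DI geo [c0 c1]] cQ]]]; exists c; split=> //.
  exists D, c; split=> //; first by case: geo.
  by move=> t i /cQ[_]; apply.
by move=> t tI; have [] := cQ t; rewrite ?in_itv.
Qed.

Hypothesis Hsc : strongly_causal S.

(* By strong causality the geodesics between nearby points of the curve, which
   lie in some convex neighbourhood, also lie in V. *)
Lemma future_causal_locally (I : set R) alpha :
  future_causal_curve S I alpha -> locally_causal I alpha.
Proof.
move=> [ac ad]; split=> // t V C K It gn Vt.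
have nV : nbhs (alpha t) V by apply: open_nbhs_nbhs; split=> //; exact: (gn_open gn).
have [W [nW WV HW]] := Hsc nV.
have [J [U [[JI nJ cU Ut JU] H]]] := ad t It.
move/within_contP: ac => /(_ t It W nW) nW'.
have nJ' : \forall s \near t, I s -> J s := nJ.
exists ([set s | I s -> J s] `&` [set s | I s -> W (alpha s)]); split.
- exact: (@filterI _ _ (nbhs_filter t) _ _ nJ' nW').
- by move=> s Is [_ Ws]; apply: WV; exact: Ws.
move=> t1 t2 I1 I2 [J1 W1] [J2 W2] t12.
have [_ /geodesic_in_segment[c [sg c0 c1 _]]] := H t1 t2 (J1 I1) (J2 I2) t12.
rewrite -c0 -c1; apply: (gn_segment gn ltr01 sg) => s sI.
have := HW 0 1 c ltr01 (locally_causal_curve (smooth_segment_causal sg)).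
rewrite c0 c1 => /(_ (W1 I1) (W2 I2)); apply.
by exists s => //=; rewrite in_itv.
Qed.

End CausalCurves.

(** * Chronological and causal relations *)

Section Chronology.
Variables (R : realType) (n : nat) (M : topologicalType) (S : spacetime R n M).

(** Chains of local relations, so that openness and push-up propagate by induction. [chr_curve] and
    [chr_chron_past] pass from [chr] to curves, [locally_causal_cau] from curves to [cau]. *)
Inductive chr : M -> M -> Prop :=
| chr_step V C K p q : good_nbhd S V C K -> V p -> V q -> C p q -> chr p q
| chr_trans p q r : chr p q -> chr q r -> chr p r.

Inductive cau : M -> M -> Prop :=
| cau_refl p : cau p p
| cau_step V C K p q r : good_nbhd S V C K -> V p -> V q -> K p q -> cau q r -> cau p r.

Lemma cau_trans p q r : cau p q -> cau q r -> cau p r.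
Proof. by move=> pq; elim: pq r => // V C K p1 q1 r1 gn Vp Vq Kpq _ IH r qr; exact: cau_step gn Vp Vq Kpq (IH _ qr). Qed.

Lemma cau_good V C K p q : good_nbhd S V C K -> V p -> V q -> K p q -> cau p q.
Proof. by move=> gn Vp Vq Kpq; exact: cau_step gn Vp Vq Kpq (cau_refl q). Qed.

(** Real induction on the parameter: a good neighbourhood of the current point adds one link to the
    chain, rightwards in the successor case and from the left in the limit case. *)
Lemma locally_causal_cau (u v : R) alpha : locally_causal S `[u, v] alpha ->
  forall t : R, u <= t <= v -> cau (alpha u) (alpha t).
Proof.
move=> [ac aK]; apply: real_induction => [t tI H|t tI H|]; last exact: cau_refl.
- have [tu tv] := andP tI; have ut : cau (alpha u) (alpha t) by apply: H; rewrite tu lexx.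
  have It : `[u, v]%classic t by rewrite /= in_itv /= tu ltW.
  have [V [C [K [gn Vt]]]] := good_nbhd_exists S (alpha t).
  have [J [nJ JV JK]] := aK t V C K It gn Vt.
  have tJ : J t := nbhs_singleton nJ.
  have /nbhs_ballP[e /= e0 eJ] := nJ.
  exists (Num.min e (v - t)); first by rewrite lt_min e0 subr_gt0.
  move=> s /andP[ts]; rewrite -ltrBlDl lt_min => /andP[se sv].
  have Is : `[u, v]%classic s by rewrite /= in_itv /= (le_trans tu ts)/=; lra.
  have Js : J s by apply: eJ; rewrite -ball_normE /= distrC ger0_norm ?subr_ge0.
  have [<-//|ts'] := eqVneq t s.
  apply: (cau_trans ut); apply: (cau_good gn); [exact: Vt|exact: JV|].
  by apply: JK => //; rewrite lt_neqAle ts' ts.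
- have [tu tv] := andP tI.
  have It : `[u, v]%classic t by rewrite /= in_itv /= tv ltW.
  have [V [C [K [gn Vt]]]] := good_nbhd_exists S (alpha t).
  have [J [nJ JV JK]] := aK t V C K It gn Vt.
  have tJ : J t := nbhs_singleton nJ.
  have /nbhs_ballP[e /= e0 eJ] := nJ.
  pose s := Num.max u (t - e / 2).
  have st : s < t by rewrite gt_max tu ltrBlDr ltrDl divr_gt0.
  have us : u <= s by rewrite le_max lexx.
  have Is : `[u, v]%classic s by rewrite /= in_itv /= us (le_trans (ltW st)).
  have Js : J s.
    apply: eJ; rewrite -ball_normE /= gtr0_norm ?subr_gt0// ltrBlDr -ltrBlDl lt_max.
    by apply/orP; right; lra.
  apply: (@cau_trans _ (alpha s)); first by apply: H; rewrite us.
  by apply: (cau_good gn); [exact: JV|exact: Vt|exact: JK].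
Qed.

Lemma chr_near q W : nbhs q W -> (exists2 r, W r & chr q r) /\ (exists2 r, W r & chr r q).
Proof.
move=> nW; have [V [C [K [gn Vq]]]] := good_nbhd_exists S q.
have [[r [Wr Vr Ir]] [r' [Wr' Vr' Ir']]] := gn_near gn Vq nW.
by split; [exists r => //; exact: chr_step gn Vq Vr Ir|exists r' => //; exact: chr_step gn Vr' Vq Ir'].
Qed.

Lemma chr_openr p q : chr p q -> \forall r \near q, chr p r.
Proof.
move=> pq; elim: pq => [V C K p1 q1 gn Vp Vq Cpq|p1 q1 r1 pq _ _ IH]; last first.
  by apply: filterS IH => r; exact: chr_trans.
have oV := gn_I_openr gn Vp.
have nV : nbhs q1 [set q | V q /\ C p1 q] by apply: open_nbhs_nbhs.
by apply: filterS nV => r [Vr Cr]; exact: chr_step gn Vp Vr Cr.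
Qed.

Lemma chr_openl p q : chr p q -> \forall r \near p, chr r q.
Proof.
move=> pq; elim: pq => [V C K p1 q1 gn Vp Vq Cpq|p1 q1 r1 _ IH qr _]; last first.
  by apply: filterS IH => r rq; exact: chr_trans rq qr.
have oV := gn_I_openl gn Vq.
have nV : nbhs p1 [set p | V p /\ C p q1] by apply: open_nbhs_nbhs.
by apply: filterS nV => r [Vr Cr]; exact: chr_step gn Vr Vq Cr.
Qed.

(* Push-up: at the junction point replace q by a slightly later point r'. *)
Lemma cau_chr p q r : cau p q -> chr q r -> chr p r.
Proof.
move=> pq; elim: pq r => // V C K p1 q1 r1 gn Vp Vq Kpq _ IH r /IH {IH}.
clear p q; move=> qr; elim: qr gn Vp Vq Kpq => [V' C' K' q r2 gn' Vq' Vr' Cqr|q q2 r2 _ IH q2r _] gn Vp Vq Kpq; last first.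
  exact: chr_trans (IH gn Vp Vq Kpq) q2r.
have nW : nbhs q [set s | V' s /\ C' s r2].
  by apply: open_nbhs_nbhs; split=> //; exact: (gn_I_openl gn' Vr').
have [[s [[V's C's] Vs Cs]] _] := gn_near gn Vq nW.
apply: (@chr_trans _ s); last exact: chr_step gn' V's Vr' C's.
apply: (chr_step gn Vp Vs); exact: (gn_KI gn Vp Vq Vs Kpq Cs).
Qed.

Lemma future_timelike_causal (i : chart S) p v : future_timelike i p v -> future_causal i p v.
Proof. exact: (@timelike_causal_vec R n (metric i p)). Qed.

Lemma smooth_segment_imp (Q Q' : forall i : chart S, M -> 'rV[R]_n.+2 -> Prop) (u v : R) beta :
  (forall i p w, Q i p w -> Q' i p w) -> smooth_segment Q u v beta -> smooth_segment Q' u v beta.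
Proof.
move=> QQ'; case=> D; case=> c; case=> oD DI sm cE cQ; exists D, c; split=> // t i tI it.
by apply: QQ'; exact: cQ.
Qed.

(** The factor [1 *] gives the shift the shape expected by the affine substitution lemmas. *)
Definition join_curve (alpha : R -> M) (b : R) (beta : R -> M) (c : R) (t : R) :=
  if t <= b then alpha t else beta (1 * t + (c - b)).

Lemma join_curvel alpha b beta c t : t <= b -> join_curve alpha b beta c t = alpha t.
Proof. by rewrite /join_curve => ->. Qed.

Lemma join_curver alpha b beta c t : alpha b = beta c -> b <= t ->
  join_curve alpha b beta c t = beta (1 * t + (c - b)).
Proof.
move=> E; rewrite /join_curve; case: ltgtP => // <- _.
by rewrite mul1r addrC subrK.
Qed.

Lemma itv_le (a b e : R) : b <= e -> `[a, e]%classic `&` [set t | t <= b] `<=` `[a, b]%classic.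
Proof. by move=> be t []; rewrite /= !in_itv /= => /andP[-> _] ->. Qed.

Lemma itv_ge (a b c d : R) : `[a, b + (d - c)]%classic `&` [set t | b <= t] `<=`
  [set t | `[c, d]%classic (1 * t + (c - b))].
Proof.
move=> t []; rewrite /= !in_itv /= mul1r => /andP[_ h1] h2; apply/andP; split; lra.
Qed.

Lemma locally_causal_join (a b c d : R) alpha beta : a <= b -> c <= d -> alpha b = beta c ->
  locally_causal S `[a, b] alpha -> locally_causal S `[c, d] beta ->
  locally_causal S `[a, b + (d - c)] (join_curve alpha b beta c).
Proof.
move=> ab cd E la lb; have be : b <= b + (d - c) by rewrite lerDl subr_ge0.
apply: (locally_causal_concat (b := b)); first by rewrite /= in_itv /= ab.
  apply: (locally_causal_sub (itv_le be)); apply: locally_causal_ext la => t.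
  by rewrite /= in_itv /= => /andP[_ tb]; rewrite join_curvel.
apply: (@locally_causal_ext _ _ _ _ _ (beta \o (fun t => 1 * t + (c - b)))).
  by move=> t [_ bt]; rewrite join_curver.
apply: (locally_causal_sub (@itv_ge a b c d)).
exact: (locally_causal_affine (c - b) ltr01 lb).
Qed.

Lemma join_curve_end (b c d : R) alpha beta : c <= d -> alpha b = beta c ->
  join_curve alpha b beta c (b + (d - c)) = beta d.
Proof.
move=> cd E; rewrite join_curver//; last by rewrite lerDl subr_ge0.
by congr beta; ring.
Qed.

Lemma chr_curve p q : chr p q -> exists (u v : R) beta,
  [/\ u < v, locally_causal S `[u, v] beta, beta u = p & beta v = q].
Proof.
elim=> [V C K p1 q1 gn Vp Vq Cpq|p1 q1 r1 _ [u [v [al [uv la au av]]]] _ [u' [v' [be [uv' lb bu bv]]]]].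
  have [c [sg c0 c1 _]] := geodesic_in_segment (gn_I_geodesic gn Vp Vq Cpq).
  exists 0, 1, c; split=> //; apply: smooth_segment_causal.
  exact: smooth_segment_imp future_timelike_causal sg.
have E : al v = be u' by rewrite av bu.
exists u, (v + (v' - u')), (join_curve al v be u'); split.
- by rewrite ltr_wpDr// subr_ge0 ltW.
- by apply: locally_causal_join => //; exact: ltW.
- by rewrite join_curvel// ltW.
- by rewrite join_curve_end// ltW.
Qed.

Lemma future_timelikeZ (i : chart S) p v (k : R) : 0 < k -> future_timelike i p v ->
  future_timelike i p (k *: v).
Proof. exact: (@timelike_vecZ R n (metric i p)). Qed.

Lemma chron_past_trans p q r : chron_past S q p -> chron_past S r q -> chron_past S r p.
Proof.
move=> [u [v [al [k [t [uv [ca [t0 tk tS] sa] au av]]]]]].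
move=> [u' [v' [be [k' [t' [uv' [cb [t0' tk' tS'] sb] bu bv]]]]]].
have E : al v = be u' by rewrite av bu.
(* At [i = k] both branches give [v], so that [T2] holds from [k] on and no step of the partition
   straddles the two cases. *)
pose T i := if (i <= k)%N then t i else t' (i - k)%N + (v - u').
have T2 i : (k <= i)%N -> T i = t' (i - k)%N + (v - u').
  rewrite /T leq_eqVlt => /orP[/eqP <-|ki]; last by rewrite leqNgt ki.
  by rewrite leqnn subnn t0' tk addrC subrK.
exists u, (v + (v' - u')), (join_curve al v be u'), (k + k')%N, T; split.
- by rewrite ltr_wpDr// subr_ge0 ltW.
- have ve : v <= v + (v' - u') by rewrite lerDl subr_ge0 ltW.
  have mono j : (j <= k)%N -> t j <= v.
    move=> jk; rewrite -tk; elim: k jk tS {ca sa T T2 tk} => [|k IH] jk tS.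
      by move: jk; rewrite leqn0 => /eqP ->.
    move: jk; rewrite leq_eqVlt => /orP[/eqP -> //|jk].
    apply: le_trans (ltW (tS k (ltnSn k))); apply: IH => // m mk; apply: tS.
    exact: ltn_trans mk (ltnSn k).
  have mono' j : (j <= k')%N -> u' <= t' j.
    rewrite -t0'; elim: j => // j IH jk; apply: le_trans (IH (ltnW jk)) (ltW (tS' j jk)).
  split.
  + apply: (within_continuous_concat (b := v)).
      apply: (continuous_subspaceW (itv_le ve)).
      apply/within_contP => s sI A; have sv : s <= v by move: sI; rewrite /= in_itv => /andP[].
      rewrite join_curvel// => nA; move/within_contP: ca => /(_ s sI A nA).
      apply: filterS => z Az zI; rewrite join_curvel; first exact: Az.
      by move: zI; rewrite /= in_itv => /andP[].
    apply: (continuous_subspaceW (B := `[v, v + (v' - u')]%classic)).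
      by move=> z []; rewrite /= !in_itv /= => /andP[_ ->] ->.
    apply/within_contP => s sI A.
    have sv : v <= s by move: sI; rewrite /= in_itv => /andP[].
    rewrite join_curver// => nA; move/within_contP: cb => /(_ (1 * s + (u' - v)) _ A nA).
    have inI z : `[v, v + (v' - u')]%classic z -> `[u', v']%classic (1 * z + (u' - v)).
      by rewrite /= !in_itv /= mul1r => /andP[h1 h2]; apply/andP; split; lra.
    move=> /(_ (inI _ sI)) H.
    have H2 : \forall z \near s, `[u', v']%classic (1 * z + (u' - v)) -> A (be (1 * z + (u' - v))).
      exact: (@affine_continuous R 1 (u' - v) s _ H).
    apply: filterS H2 => z Az zI; rewrite join_curver//; first by apply: Az; exact: inI.
    by move: zI; rewrite /= in_itv => /andP[].
  + split; first by rewrite /T leq0n.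
      by rewrite T2 ?leq_addr// addKn tk'; ring.
    move=> m mk; have [km|km] := ltnP m k.
      by rewrite /T km (ltnW km); exact: tS.
    rewrite !T2 ?(leq_trans km)// subSn// ltrD2r; apply: tS'.
    by rewrite ltn_subLR.
  + move=> m mk; have [km|km] := ltnP m k.
      rewrite /T km (ltnW km).
      apply: smooth_segment_ext (sa m km) => s /andP[_ s2]; rewrite join_curvel//.
      exact: le_trans s2 (mono _ km).
    have mk' : (m - k < k')%N by rewrite ltn_subLR.
    rewrite !T2 ?(leq_trans km)// subSn//.
    have := @smooth_segment_affine R 1 (u' - v) n M S (@future_timelike R n M S)
      (t' (m - k)%N + (v - u')) (t' (m - k).+1 + (v - u')) be ltr01.
    have -> x : 1 * (x + (v - u')) + (u' - v) = x by ring.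
    have -> x : 1 * (x + (v - u')) + (u' - v) = x by ring.
    move=> /(_ _ (sb _ mk')) sg.
    apply: smooth_segment_ext (sg _); last by move=> i p' w; exact: future_timelikeZ.
    move=> s /andP[s1 _]; rewrite join_curver//.
    by have := mono' (m - k)%N (ltnW mk'); lra.
- by rewrite join_curvel// ltW.
- by rewrite join_curve_end// ltW.
Qed.

Lemma chr_chron_past p q : chr p q -> chron_past S q p.
Proof.
elim=> [V C K p1 q1 gn Vp Vq Cpq|p1 q1 r1 _ h1 _ h2]; last exact: chron_past_trans h1 h2.
have [c [sg c0 c1 _]] := geodesic_in_segment (gn_I_geodesic gn Vp Vq Cpq).
exists 0, 1, c, 1%N, (fun i => i%:R); split=> //; split.
- exact: smooth_segment_continuous sg.
- by split=> // -[|].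
- by case.
Qed.

End Chronology.

(** * Lengths *)

Section IntegralComparison.
Variable R : realType.
Local Notation mu := (@lebesgue_measure R).
Import HBNNSimple.

(* The speed of a curve is not known to be measurable, so that the integrals are compared
   through simple functions. *)
Lemma ge0_le_integral_transport (phi : R -> R) (f g : R -> R) (D D' N : set R) :
  measurable_fun setT (phi : measurableTypeR R -> measurableTypeR R) ->
  (forall A : set (measurableTypeR R), measurable A -> mu (phi @^-1` A) = mu A) ->
  measurable (D : set (measurableTypeR R)) -> measurable (N : set (measurableTypeR R)) -> mu N = 0%E ->
  (forall x, 0 <= f x) -> (forall x, 0 <= g x) ->
  (forall y, D (phi y) -> ~ N (phi y) -> D' y /\ f (phi y) <= g y) ->
  (\int[mu]_(x in D) (f x)%:E <= \int[mu]_(x in D') (g x)%:E)%E.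
Proof.
move=> mphi muphi mD mN N0 f0 g0 fg.
rewrite ge0_integralE; last by move=> x _; rewrite lee_fin.
rewrite [leRHS]ge0_integralE; last by move=> x _; rewrite lee_fin.
apply: ge_ereal_sup => _ [h /= hf <-].
(* The simple function is cut off outside [D] and on the null set [N]. Its integral does not change,
   and [fg] now applies wherever it can be nonzero. *)
pose F (x : measurableTypeR R) : \bar R := (h x * \1_(D `\` N) x)%:E.
have mA : measurable (D `\` N : set (measurableTypeR R)) by exact: measurableD.
have F0 x : (0 <= F x)%E by rewrite lee_fin mulr_ge0.
pose H (x : measurableTypeR R) : \bar R := (h x)%:E.
have mh : measurable_fun setT H.
  by apply/measurable_EFinP; exact: measurable_funPT.
have mF : measurable_fun setT F.
  apply/measurable_EFinP; apply: measurable_funM; first exact: measurable_funPT.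
  exact: measurable_indic.
have -> : sintegral mu h = (\int[mu]_x F (phi x))%E.
  rewrite -integralT_nnsfun.
  have -> : (\int[mu]_x H x = \int[mu]_x F x)%E.
    apply: ge0_ae_eq_integral => //; first by move=> x _; rewrite lee_fin.
    exists N; split=> // x /= nh; apply: contrapT => nN; apply: nh => _.
    rewrite /H /F indicE; have [/set_mem xD|xD] := boolP (x \in D).
      by rewrite mem_set ?mulr1//; split.
    have -> : x \in (D `\` N) = false by apply/negP => /set_mem[/mem_set]; rewrite (negbTE xD).
    rewrite mulr0; have := hf x; rewrite patchE (negbTE xD) lee_fin => hx.
    by congr EFin; apply: le_anti; rewrite hx fun_ge0.
  have -> : (\int[mu]_x F x = \int[pushforward mu (phi : measurableTypeR R -> measurableTypeR R)]_x F x)%E.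
    by apply: eq_measure_integral => A mA' _; exact: esym (muphi A mA').
  by rewrite ge0_integral_pushforward//= preimage_setT.
rewrite ge0_integralTE//; apply: le_ereal_sup => _ [k /= kF <-].
exists k => //= x; apply: (le_trans (kF x)); rewrite patchE /F indicE.
have [/set_mem[Dx Nx]|_] := boolP (phi x \in D `\` N).
  have [D'x fgx] := fg x Dx Nx; rewrite mem_set// lee_fin mulr1.
  apply: le_trans fgx; have := hf (phi x); rewrite patchE mem_set//.
by rewrite mulr0; case: ifP => _; rewrite ?lee_fin.
Qed.

Lemma endpoints_null (a b : R) : measurable ([set a; b] : set (measurableTypeR R)) /\ mu [set a; b] = 0%E.
Proof.
have m (c : R) : measurable ([set c] : set (measurableTypeR R)) by exact: measurable_set1.
split; first exact: measurableU.
have e (c : R) : mu [set c] = 0%E by exact: lebesgue_measure_set1.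
exact: etrans (measureU0 (m a) (m b) (e b)) (e a).
Qed.

End IntegralComparison.

Section Lengths.
Variables (R : realType) (n : nat) (M : topologicalType) (S : spacetime R n M).

Lemma speed_ge0 (c : R -> M) t : 0 <= speed S c t.
Proof. exact: sqrtr_ge0. Qed.

(** [speed] picks a value by [get] from a set indexed by charts; equality of speeds is therefore
    proved through equality of these sets. *)
Lemma speed_eq (c c' : R -> M) (t t' : R) :
  (forall i : chart S, forall r, [/\ dom i (c t), derivable (coord i \o c) t 1 &
        r = gform i (c t) (velocity i c t) (velocity i c t)] <->
     [/\ dom i (c' t'), derivable (coord i \o c') t' 1 &
        r = gform i (c' t') (velocity i c' t') (velocity i c' t')]) ->
  speed S c t = speed S c' t'.
Proof.
move=> H; apply: (f_equal (fun A : set R => Num.sqrt (- get A))).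
by apply/seteqP; split=> r [i /H ir]; exists i.
Qed.

Lemma speed_near (c c' : R -> M) (t : R) : (\forall s \near t, c s = c' s) ->
  speed S c t = speed S c' t.
Proof.
move=> nc; have ct : c t = c' t := nbhs_singleton nc.
have ni (i : chart S) : \forall s \near t, (coord i \o c) s = (coord i \o c') s.
  by apply: filterS nc => s /= ->.
have ni' (i : chart S) : \forall s \near t, (coord i \o c') s = (coord i \o c) s.
  by apply: filterS nc => s /= ->.
have vE (i : chart S) : velocity i c t = velocity i c' t.
  by rewrite /velocity !derive1E; exact: near_eq_derive.
apply: speed_eq => i r; rewrite ct vE.
split=> -[h1 h2 h3].
  by split; [exact: h1|exact: near_eq_derivable (ni i) h2|exact: h3].
by split; [exact: h1|exact: near_eq_derivable (ni' i) h2|exact: h3].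
Qed.

Lemma speed_opp (c : R -> M) (t : R) : speed S (c \o (fun s => - s)) t = speed S c (- t).
Proof.
have cE (i : chart S) : coord i \o (c \o (fun s => - s)) = (coord i \o c) \o (fun s => -1 * s + 0).
  by apply/funext => s; rewrite /= mulN1r addr0.
have tE : - t = -1 * t + 0 :> R by rewrite mulN1r addr0.
have dE (i : chart S) : derivable (coord i \o (c \o (fun s => - s))) t 1 <-> derivable (coord i \o c) (- t) 1.
  rewrite cE tE; split=> h.
    have := @derivable_affine R (-1) 0 _ ((coord i \o c) \o (fun s => -1 * s + 0)) (-1 * t + 0) 1.
    have -> : ((coord i \o c) \o (fun s => -1 * s + 0)) \o (fun s => -1 * s + 0) = coord i \o c.
      by apply/funext => s; rewrite /= !addr0 !mulN1r opprK.
    have -> : -1 * (-1 * t + 0) + 0 = t by rewrite !addr0 !mulN1r opprK.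
    apply; rewrite mulr1; have := is_derive_scale_dir (-1) (derivableP h).
    by rewrite /GRing.scale /= mulr1 => h'; exact: (@ex_derive _ _ _ _ _ _ _ h').
  apply: derivable_affine; rewrite mulr1; have := is_derive_scale_dir (-1) (derivableP h).
  by rewrite /GRing.scale /= mulr1 => h'; exact: (@ex_derive _ _ _ _ _ _ _ h').
have vE (i : chart S) : derivable (coord i \o c) (- t) 1 ->
    velocity i (c \o (fun s => - s)) t = - velocity i c (- t).
  move=> h; rewrite /velocity !derive1E cE derive_affineE -tE mulr1.
  have := is_derive_scale_dir (-1) (derivableP h); rewrite /GRing.scale /= mulr1 => h'.
  by rewrite (@derive_val _ _ _ _ _ _ _ h'); exact: scaleN1r.
have gE (i : chart S) p v : gform i p (- v) (- v) = gform i p v v :> R.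
  by apply: (etrans (bfNl (metric i p) v (- v))); rewrite bfNr opprK.
apply: speed_eq => i r; split=> -[h1 h2 h3].
  have h2' := (dE i).1 h2.
  by split; [exact: h1|exact: h2'|move: h3; rewrite (vE _ h2') => h3; exact: etrans h3 (gE _ _ _)].
by split; [exact: h1|exact: (dE i).2 h2|rewrite h3 (vE _ h2) gE].
Qed.

(** At the ends of the interval the derivative also sees values outside it, so the speeds are
    compared only in the interior, the two endpoints being a null set. An inequality is what the
    length bounds need. *)
Lemma is_length_eq_on (c c' : R -> M) (u v : R) l : (forall t : R, u <= t <= v -> c t = c' t) ->
  is_length S c u v l -> exists2 l', is_length S c' u v l' & (l <= l')%E.
Proof.
move=> cc [u' [v' [r [uv rP lip ->]]]].
have rI (t : R) : `[u', v']%classic t -> u <= r t <= v.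
  by case: rP => -[rf _ _] _ tI; have := rf _ tI; rewrite /= in_itv.
have crE (t : R) : `[u', v']%classic t -> (c \o r) t = (c' \o r) t by move=> /rI; exact: cc.
eexists.
  exists u', v', r; split=> //.
  move=> t i tI it; rewrite -crE// in it; have [J nJ [Ji Jl]] := lip t i tI it.
  exists J => //; split=> [s [sI Js]|]; first by rewrite -crE//; exact: Ji.
  case: Jl => C0 [C0r HC]; exists C0; split=> // C C0C [s1 s2] [h1 h2] /=.
  rewrite -[c' (r s1)](crE s1 h1.1) -[c' (r s2)](crE s2 h2.1).
  exact: (HC C C0C (s1, s2)).
have [mN N0] := endpoints_null u' v'.
apply: (@ge0_le_integral_transport R id _ _ _ _ [set u'; v']).
- exact: measurable_id.
- by [].
- exact: measurable_itv.
- exact: mN.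
- exact: N0.
- by move=> x; exact: speed_ge0.
- by move=> x; exact: speed_ge0.
- move=> t tI nt; split; first exact: tI.
  suff E : \forall s \near t, (c \o r) s = (c' \o r) s by rewrite (speed_near E); exact: lexx.
  move: (tI); rewrite /= in_itv /= => /andP[t1 t2].
  have ut : u' < t by rewrite lt_neqAle t1 andbT; apply/eqP => e; apply: nt; left.
  have tv : t < v' by rewrite lt_neqAle t2 andbT; apply/eqP => e; apply: nt; right.
  have n1 : \forall s \near t, u' < s by exact: lt_nbhsr.
  have n2 : \forall s \near t, s < v' by exact: lt_nbhsl.
  apply: (@filterS2 _ _ (nbhs_filter t) _ _ _ _ n1 n2) => s s1 s2; apply: crE.
  by rewrite /= in_itv /= !ltW.
Qed.

Lemma change_of_parameter_opp (A B : set R) r : change_of_parameter A B r ->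
  change_of_parameter ((fun t => - t) @^-1` A) ((fun t => - t) @^-1` B) (fun t => - r (- t)).
Proof.
move=> [[rf ri rs] rm]; split.
  split.
  - by move=> t At; rewrite /= opprK; exact: rf.
  - move=> s t; rewrite !inE => As At /oppr_inj E; apply: oppr_inj; apply: ri => //; exact/mem_set.
  - move=> y /rs[x Ax xE]; exists (- x); first by rewrite /= opprK.
    by rewrite opprK xE opprK.
move=> t1 t2; rewrite !inE => A1 A2 t12; rewrite ltrN2; apply: rm; rewrite ?ltrN2//; exact/mem_set.
Qed.

Lemma opp_itv (a b : R) : (fun t : R => - t) @^-1` `[a, b] = `[- b, - a]%classic.
Proof. by apply/seteqP; split=> t; rewrite /= !in_itv /= lerNr lerNl andbC. Qed.

Lemma is_length_opp (c : R -> M) (u v : R) l : is_length S c u v l ->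
  exists2 l', is_length S (c \o (fun t => - t)) (- v) (- u) l' & (l <= l')%E.
Proof.
move=> [u' [v' [r [uv rP lip ->]]]].
have crE : (c \o (fun t => - t)) \o (fun t => - r (- t)) = (c \o r) \o (fun t => - t).
  by apply/funext => t; rewrite /= opprK.
eexists.
  exists (- v'), (- u'), (fun t => - r (- t)); rewrite crE; split=> //; first by rewrite ltrN2.
    by have := change_of_parameter_opp rP; rewrite !opp_itv.
  move=> t i tI it; have tI' : `[u', v']%classic (- t) by move: tI; rewrite -opp_itv.
  have [J nJ [Ji Jl]] := lip _ i tI' it.
  have nJ' : \forall s \near - t, `[u', v']%classic s -> J s := nJ.
  exists ((fun t => - t) @^-1` J).
    have cN : {for t, continuous (fun t : R => - t)}.
      exact: is_derive_continuous (is_deriveN (is_derive_id t (1 : R))).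
    have H : \forall s \near t, `[u', v']%classic (- s) -> J (- s) := cN _ nJ'.
    have H' : \forall s \near t, `[- v', - u']%classic s -> J (- s).
      by apply: filterS H => s Hs sI; apply: Hs; move: sI; rewrite -opp_itv.
    exact: H'.
  split=> [s [sI Js]|]; first by apply: Ji; split=> //; move: sI; rewrite -opp_itv.
  case: Jl => C0 [C0r HC]; exists C0; split=> // C C0C [s1 s2] [[I1 J1] [I2 J2]] /=.
  have -> : `|s1 - s2| = `|- s1 - - s2| by rewrite -opprD normrN.
  apply: (HC C C0C (- s1, - s2)).
  by split; split=> //; [move: I1|move: I2]; rewrite -opp_itv.
apply: (@ge0_le_integral_transport R (fun t => - t) _ _ _ _ set0).
- exact: measurable_realfun.oppr_measurable.
- by move=> A mA; exact: lebesgue_measureN.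
- exact: measurable_itv.
- exact: measurable0.
- exact: measure0.
- by move=> x; exact: speed_ge0.
- by move=> x; exact: speed_ge0.
- move=> t tI _; split; first by rewrite -opp_itv.
  by rewrite speed_opp; exact: lexx.
Qed.

Lemma change_of_parameter_itv (A B : set R) s (u v : R) : change_of_parameter A B s ->
  `[u, v]%classic `<=` A -> u <= v -> (forall x y z : R, B x -> B y -> x <= z <= y -> B z) ->
  change_of_parameter `[u, v] `[s u, s v] s.
Proof.
move=> [[sf si ss] sm] uvA uv Bc.
have mono (x y : R) : `[u, v]%classic x -> `[u, v]%classic y -> x <= y -> s x <= s y.
  move=> xI yI; rewrite le_eqVlt => /orP[/eqP ->//|xy]; apply: ltW; apply: sm => //; exact/mem_set/uvA.
have uI : `[u, v]%classic u by rewrite /= in_itv /= lexx.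
have vI : `[u, v]%classic v by rewrite /= in_itv /= uv lexx.
split; last by move=> x y /set_mem xI /set_mem yI; apply: sm; exact/mem_set/uvA.
split.
- move=> t tI; have := tI; rewrite /= !in_itv /= => /andP[t1 t2].
  by rewrite !mono.
- by move=> x y /set_mem xI /set_mem yI; apply: si; exact/mem_set/uvA.
- move=> y; rewrite /= in_itv /= => /andP[y1 y2].
  have [x Ax xE] := ss y (Bc _ _ _ (sf _ (uvA _ uI)) (sf _ (uvA _ vI)) (introT andP (conj y1 y2))).
  exists x => //; rewrite /= in_itv /=; apply/andP; split; rewrite leNgt; apply/negP => lt.
    by have := sm x u (mem_set Ax) (mem_set (uvA _ uI)) lt; rewrite xE ltNge y1.
  by have := sm v x (mem_set (uvA _ vI)) (mem_set Ax) lt; rewrite xE ltNge y2.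
Qed.

Lemma is_length_comp (c : R -> M) s (u v : R) l : change_of_parameter `[u, v] `[s u, s v] s ->
  is_length S (c \o s) u v l -> is_length S c (s u) (s v) l.
Proof.
move=> [sb sm] [u' [v' [r [uv [rb rm] lip lE]]]].
exists u', v', (s \o r); split=> //; split; first exact: set_bij_comp rb sb.
move=> x y xI yI xy; apply: sm; last exact: rm.
  by case: rb => rf _ _; apply: mem_set; apply: rf; exact: set_mem.
by case: rb => rf _ _; apply: mem_set; apply: rf; exact: set_mem.
Qed.

Hypothesis Hsc : strongly_causal S.

Lemma lorentz_dist_ge (u v : R) beta l (u' v' : R) : u < v -> locally_causal S `[u, v] beta ->
  u <= u' -> u' < v' -> v' <= v -> is_length S beta u' v' l ->
  (l <= lorentz_dist S (beta u) (beta v))%E.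
Proof.
move=> uv bc uu uv' vv bl; apply: (@le_trans _ _ (lorentz_length S `[u, v] beta)).
  apply: ereal_sup_ubound; exists u', v'; split=> //; rewrite /= in_itv /=.
    by rewrite uu (le_trans (ltW uv')).
  by rewrite vv (le_trans uu (ltW uv')).
apply: ereal_sup_ubound; right; exists u, v, beta; split=> //.
exact: locally_causal_curve.
Qed.

(** Prolong [alpha] by [beta]: the piece of [alpha] is one of the subcurves whose lengths enter the
    length of the joined curve, and that is at most the distance of its ends. *)
Lemma is_length_join (u v u' v' w1 w2 : R) alpha beta l :
  u < v -> w1 < w2 -> alpha v = beta w1 -> locally_causal S `[u, v] alpha ->
  locally_causal S `[w1, w2] beta -> u <= u' -> u' < v' -> v' <= v ->
  is_length S alpha u' v' l -> (l <= lorentz_dist S (alpha u) (beta w2))%E.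
Proof.
move=> uv w12 E ac bc uu uv' vv al.
have jc := locally_causal_join (ltW uv) (ltW w12) E ac bc.
have [|l' jl ll] := is_length_eq_on _ al (c' := join_curve alpha v beta w1).
  by move=> t /andP[_ tv]; rewrite join_curvel// (le_trans tv).
apply: (le_trans ll).
have e1 : join_curve alpha v beta w1 u = alpha u by rewrite join_curvel// ltW.
have e2 := join_curve_end (ltW w12) E : join_curve alpha v beta w1 (v + (w2 - w1)) = beta w2.
have := lorentz_dist_ge _ jc uu uv' _ jl; rewrite e1 e2; apply.
- by rewrite ltr_wpDr// subr_ge0 ltW.
- by rewrite (le_trans vv)// lerDl subr_ge0 ltW.
Qed.

(** Any causal curve ending at [y] is prolonged to [z] without loss of length, and its starting
    point then lies in the chronological past of [z]. *)
Lemma cosmological_time_mono y z : chr S y z ->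
  (cosmological_time S y <= cosmological_time S z)%E.
Proof.
move=> yz; apply: ge_ereal_sup => _ [x xy <-].
apply: (@le_trans _ _ (lorentz_dist S x z)); last first.
  apply: ereal_sup_ubound; exists x => //; exact: chron_past_trans xy (chr_chron_past yz).
apply: ge_ereal_sup => l [->|[u [v [beta [uv /(future_causal_locally Hsc) bc bu bv ->]]]]].
  by apply: ereal_sup_ubound; left.
apply: ge_ereal_sup => l' [u' [v' []]]; rewrite /= !in_itv /= => /andP[u1 _] /andP[_ v2] uv' bl.
have [w1 [w2 [al [w12 ac a1 a2]]]] := chr_curve yz.
by have := is_length_join uv w12 _ bc ac u1 uv' v2 bl; rewrite bu a2; apply; rewrite a1.
Qed.

(** Push-up puts every point of [gam] in the chronological past of [z]. The reversed piece of [gam]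
    is therefore continued from [gam u] to [z], and the distance from [gam v] to [z] enters the
    supremum that defines the cosmological time of [z]. *)
Lemma past_length_bound (b : \bar R) gam z (u v : R) l : past_causal_curve S (ico0 b) gam ->
  chr S (gam 0) z -> ico0 b u -> ico0 b v -> u < v -> is_length S gam u v l ->
  (l <= cosmological_time S z)%E.
Proof.
move=> gp gz [u0 ub] [v0 vb] uv gl.
have ac := future_causal_locally Hsc (past_causal_curve_opp gp).
set al := gam \o _ in ac.
have sub (w : R) : (w%:E < b)%E -> `[- w, 0]%classic `<=` (fun t : R => - t) @^-1` ico0 b.
  move=> wb t; rewrite /= in_itv /= => /andP[t1 t2]; split; first by rewrite oppr_ge0.
  by apply: le_lt_trans wb; rewrite lee_fin lerNl.
have chrz (w : R) : 0 <= w -> (w%:E < b)%E -> chr S (gam w) z.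
  move=> w0 wb; apply: cau_chr gz.
  have := locally_causal_cau (locally_causal_sub (sub w wb) ac) (t := 0).
  by rewrite /al /= opprK oppr0; apply; rewrite lexx oppr_le0 w0.
have [w1 [w2 [be [w12 bc b1 b2]]]] := chr_curve (chrz u u0 ub).
have avu : locally_causal S `[- v, - u] al.
  apply: locally_causal_sub ac; apply: subset_trans (sub v vb) => t.
  by rewrite /= !in_itv /= => /andP[-> t2]; apply: (le_trans t2); rewrite oppr_le0.
have [l' al' ll] := is_length_opp gl.
apply: (le_trans ll); apply: (@le_trans _ _ (lorentz_dist S (gam v) z)).
  have := is_length_join _ w12 _ avu bc (lexx _) _ (lexx _) al'.
  by rewrite b2 /al /= !opprK b1; apply; rewrite ?ltrN2.
by apply: ereal_sup_ubound; exists (gam v) => //; exact: chr_chron_past (chrz v v0 vb).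
Qed.

End Lengths.

(** * Escaping sequences of causal curves *)

Lemma compact_exhaustion_mono (M : topologicalType) (K : nat -> set M) : compact_exhaustion K ->
  forall i j, (i <= j)%N -> K i `<=` K j.
Proof.
move=> [_ KS _] i; elim=> [|j ih]; first by rewrite leqn0 => /eqP ->.
rewrite leq_eqVlt => /orP[/eqP ->//|/ih h]; apply: subset_trans h _.
by apply: subset_trans (@interior_subset _ _); exact: KS.
Qed.

Section EscapingCurves.
Variables (R : realType) (n : nat) (M : topologicalType) (S : spacetime R n M).

Lemma chr_causal_le p q : chr S p q -> causal_le S p q.
Proof.
move=> /chr_curve[u [v [c [uv lc cu cv]]]]; right; exists u, v, c; split=> //.
exact: locally_causal_curve.
Qed.

(** The connecting curves are future directed, so the [m]-th one is placed on the interval from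
    [- m.+1] to [- m]; the whole is reversed at the end. *)
Lemma chr_chain_curve (z : nat -> M) : (forall m, chr S (z m.+1) (z m)) ->
  exists gamma, past_causal_curve S (ico0 +oo) gamma /\ forall m, gamma (m%:R : R) = z m.
Proof.
move=> zc.
have /choice[c cP] (m : nat) : exists c, [/\ locally_causal S `[- m.+1%:R, - m%:R] c,
    c (- m.+1%:R) = z m.+1 & c (- m%:R) = z m].
  have [u [v [c [uv lc cu cv]]]] := chr_curve (zc m).
  have k0 : 0 < v - u by rewrite subr_gt0.
  have m1 : (m.+1%:R : R) = m%:R + 1 by rewrite -natr1.
  exists (c \o (fun t => (v - u) * t + (v + (v - u) * m%:R))); split.
  - apply: locally_causal_sub (locally_causal_affine (v + (v - u) * m%:R) k0 lc) => t.
    by rewrite /= !in_itv /= m1 => /andP[t1 t2]; apply/andP; split; nra.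
  - by rewrite -cu /=; congr c; rewrite m1; ring.
  - by rewrite -cv /=; congr c; ring.
(* The truncation selects the piece. At the left end of the [m]-th interval it selects the next
   piece, and both pieces take the value [z m.+1] there. *)
pose al (t : R) := c (Num.truncn (- t)) t.
have alz (m : nat) : al (- m%:R) = z m.
  by rewrite /al opprK natrK; case: (cP m).
have alI (m : nat) : locally_causal S `[- m.+1%:R, - m%:R] al.
  have [lc cu _] := cP m; apply: locally_causal_ext lc => t; rewrite /= in_itv /= => /andP[t1 t2].
  have [e|ne] := eqVneq (- t) m.+1%:R; first by rewrite -(opprK t) e cu alz.
  rewrite /al; congr c; symmetry; apply/eqP; rewrite truncn_eq; last first.
    by rewrite (le_trans _ (_ : m%:R <= _))// lerNr.
  by rewrite lerNr t2 lt_neqAle ne lerNl.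
have al0 (m : nat) : locally_causal S `[- m.+1%:R, 0] al.
  elim: m => [|m ih]; first by have := alI 0%N; rewrite oppr0.
  apply: (@locally_causal_concat _ _ _ S _ (- m.+1%:R)).
  - by rewrite /= in_itv /= lerN2 ler_nat leqnSn oppr_le0 ler0n.
  - apply: locally_causal_sub (alI m.+1) => t [] /=; rewrite !in_itv /= => /andP[-> _] -> //.
  - by apply: locally_causal_sub ih => t [] /=; rewrite !in_itv /= => /andP[_ ->] ->.
(* Causality is established on the intervals from [- m.+1] to 0; every [t] has a neighbourhood to
   the right of such a left end, which suffices for a local property. *)
have nm (t : R) : \forall s \near t, - (Num.truncn (- t)).+1%:R < s.
  apply: lt_nbhsr; rewrite ltrNl.
  exact: truncnS_gt.
have sI (t s : R) : - (Num.truncn (- t)).+1%:R < s -> s <= 0 -> `[- (Num.truncn (- t)).+1%:R, 0]%classic s.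
  by move=> h1 h2; rewrite /= in_itv /= h2 ltW.
have lc : locally_causal S ((fun t : R => - t) @^-1` ico0 +oo) al.
  split.
    apply/within_contP => t [t0 _] A nA.
    have [/within_contP cc _] := al0 (Num.truncn (- t)).
    have H : \forall s \near t, `[- (Num.truncn (- t)).+1%:R, 0]%classic s -> A (al s).
      by apply: cc nA; apply: sI (nbhs_singleton (nm t)) _; rewrite -oppr_ge0.
    apply: (@filterS2 _ _ (nbhs_filter t) _ _ _ _ H (nm t)) => s h1 h2 [s0 _].
    by apply: h1; apply: sI h2 _; rewrite -oppr_ge0.
  move=> t V C K [t0 _] gV Vt.
  have [|J [nJ JV JK]] := (al0 (Num.truncn (- t))).2 t V C K _ gV Vt.
    by apply: sI (nbhs_singleton (nm t)) _; rewrite -oppr_ge0.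
  exists (J `&` [set s | - (Num.truncn (- t)).+1%:R < s]); split.
  - exact: (@filterI _ _ (nbhs_filter t) _ _ nJ (nm t)).
  - by move=> s [s0 _] [Js h]; apply: JV => //; apply: sI h _; rewrite -oppr_ge0.
  - move=> t1 t2 [I1 _] [I2 _] [J1 h1] [J2 h2].
    by apply: JK => //; [apply: sI h1 _|apply: sI h2 _]; rewrite -oppr_ge0.
exists (al \o (fun t => - t)); split; last by move=> m; exact: alz.
have := future_causal_curve_opp (locally_causal_curve lc).
have -> // : (fun t : R => - t) @^-1` ((fun t : R => - t) @^-1` ico0 +oo) = ico0 +oo.
by apply/funext => t; rewrite /preimage /= opprK.
Qed.

Hypothesis Hsc : strongly_causal S.
Hypothesis diamond_compact : forall p q, compact [set z | causal_le S p z /\ causal_le S z q].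

Lemma causal_le_cau p q : causal_le S p q -> cau S p q.
Proof.
case=> [->|[u [v [c [uv /(future_causal_locally Hsc) lc <- <-]]]]]; first exact: cau_refl.
by apply: (locally_causal_cau lc); rewrite ltW ?lexx.
Qed.

(** Choose [y] with p << y << z and [m] with m << p'. Eventually [q' k] lies in the compact, hence
    closed, diamond between [m] and [y], so the limit [p'] does too. Thus p' <= y << z, and push-up
    leaves room for [z'] just after [p']. *)
Lemma limit_below_intermediate (G : set_system nat) (FG : ProperFilter G)
    (q q' : nat -> M) p p' W z : q @ G --> p -> q' @ G --> p' ->
  (\forall k \near G, cau S (q' k) (q k)) -> nbhs p' W -> chr S p z ->
  exists z', [/\ W z', chr S p' z' & chr S z' z].
Proof.
move=> qp qp' qq nW pz.
have [[y yz py] _] := chr_near S (chr_openl pz).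
have [_ [m _ mp']] := chr_near S (filterT : nbhs p' setT).
have n1 : \forall k \near G, chr S m (q' k) := qp' _ (chr_openr mp').
have n2 : \forall k \near G, chr S (q k) y := qp _ (chr_openl py).
have cl := compact_closed (space_hausdorff S) (diamond_compact (p := m) (q := y)).
have Jp' : causal_le S m p' /\ causal_le S p' y.
  apply: (@closed_cvg _ _ G FG q' _ cl _ p' qp').
  have n3 : \forall k \near G, cau S (q' k) (q k) /\ chr S (q k) y.
    exact: (@filterI _ _ _ _ _ qq n2).
  apply: (@filterS2 _ _ _ _ _ _ _ n1 n3) => k k1 [k3 k2]; split; apply: chr_causal_le => //.
  exact: cau_chr k3 k2.
have p'z : chr S p' z := cau_chr (causal_le_cau Jp'.2) yz.
have nW' : nbhs p' (W `&` [set r | chr S r z]) := @filterI _ _ (nbhs_filter p') _ _ nW (chr_openl p'z).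
have [[z' [Wz' z'z] p'z'] _] := chr_near S nW'.
by exists z'; split.
Qed.

Lemma compact_ultra_cvg (T : Type) (G : set_system T) (K : set M) (f : T -> M) :
  UltraFilter G -> compact K -> (\forall k \near G, K (f k)) -> exists2 p, K p & f @ G --> p.
Proof.
move=> UG cK GK; have [p [Kp cp]] := cK (f @ G) _ GK.
exists p => // A nA; have [//|nGA] := in_ultra_setVsetC (f @^-1` A) UG.
by have [r [/= nAr Ar]] := cp (~` A) A nGA nA.
Qed.

Hypothesis finite_time : forall p, (cosmological_time S p < +oo)%E.

Lemma cosmological_time_ge0 p : (0 <= cosmological_time S p)%E.
Proof.
have [_ [r _ rp]] := chr_near S (filterT : nbhs p setT).
apply: (@le_trans _ _ (lorentz_dist S r p)); first by apply: ereal_sup_ubound; left.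
by apply: ereal_sup_ubound; exists r => //; exact: chr_chron_past rp.
Qed.

Lemma cosmological_time_fin_num p : cosmological_time S p \is a fin_num.
Proof. by rewrite ge0_fin_numE// cosmological_time_ge0. Qed.

Hypothesis time_vanishes : forall (b : \bar R) gamma, (0 < b)%E -> past_inextendible S b gamma ->
  cosmological_time S (gamma t) @[t --> at_end b] --> 0%E.

(** One ultrafilter on the indices [k] makes all sequences [q j] converge simultaneously, so that
    the relation between [q j.+1 k] and [q j k] survives in the limits. Outside its hypothesis the
    choice function [F] has the default value [z0]. *)
Lemma escaping_sequence_time (K : nat -> set M) (q : nat -> nat -> M) (eps : R) :
  compact_exhaustion K -> 0 < eps ->
  (forall j, \forall k \near \oo, K j (q j k)) ->
  (forall j, \forall k \near \oo, ~ (K j)^° (q j k)) ->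
  (forall j, \forall k \near \oo, cau S (q j.+1 k) (q j k)) ->
  (forall j, \forall k \near \oo, (eps%:E <= cosmological_time S (q j k))%E) -> False.
Proof.
move=> Kex e0 qK qnK qc qe; have [cK KS KT] := Kex; have Kmono := compact_exhaustion_mono Kex.
have [G [UG nG]] := @ultraFilterLemma nat \oo _.
have /choice[p pP] j : exists p, K j p /\ q j @ G --> p.
  by have [p Kp qp] := compact_ultra_cvg UG (cK j) (nG _ (qK j)); exists p.
(* [q j.+1 k] avoids the interior of [K j.+1], an open set containing [K j]. Its limit therefore
   avoids [K j], together with a neighbourhood because [K j] is closed. *)
have pn j : nbhs (p j.+1) (~` K j).
  apply: open_nbhs_nbhs; split.
    by apply: closed_openC; exact: compact_closed (space_hausdorff S) (cK j).
  move=> /KS /= Kp; have n1 : \forall k \near G, (K j.+1)^° (q j.+1 k).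
    by apply: (pP j.+1).2; apply: open_nbhs_nbhs; split=> //; exact: open_interior.
  by have [k []] := filter_ex (@filterI _ _ _ _ _ (nG _ (qnK j.+1)) n1).
have [z0 _ pz0] := (chr_near S (filterT : nbhs (p 0%N) setT)).1.
have /choice[F FP] (jz : nat * M) : exists z', chr S (p jz.1) jz.2 ->
    [/\ ~ K jz.1 z', chr S (p jz.1.+1) z' & chr S z' jz.2].
  have [h|h] := pselect (chr S (p jz.1) jz.2); last by exists z0.
  have [z' zP] := limit_below_intermediate _ (pP _).2 (pP _).2 (nG _ (qc jz.1)) (pn jz.1) h.
  by exists z'.
pose z := fix z (m : nat) : M := if m is m'.+1 then F (m', z m') else z0.
have pz m : chr S (p m) (z m).
  by elim: m => // m ih; have [] := FP (m, z m) ih.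
have zz m : chr S (z m.+1) (z m) by have [] := FP (m, z m) (pz m).
have Kz m : ~ K m (z m.+1) by have [] := FP (m, z m) (pz m).
have ze m : (eps%:E <= cosmological_time S (z m))%E.
  have n1 : \forall k \near G, chr S (q m k) (z m) := (pP m).2 _ (chr_openl (pz m)).
  have [k [k1 k2]] := filter_ex (@filterI _ _ _ _ _ (nG _ (qe m)) n1).
  exact: le_trans k1 (cosmological_time_mono Hsc k2).
have [g [gp gz]] := chr_chain_curve zz.
have natinf (A : set R) : (\forall t \near +oo, A t) -> \forall m \near \oo, A m%:R.
  move=> nA; exact: (cvgr_idn nA).
have gi : past_inextendible S +oo g.
  split=> // -[r gr].
  have [j _ Kj] : (\bigcup_j K j) r by rewrite KT.
  (* A limit in [K j] has [K j.+1] as a neighbourhood. But [z m.+1] avoids [K m], which contains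
     [K j.+1] as soon as [m] exceeds [j]. *)
  have n1 : \forall m \near \oo, K j.+1 (g m%:R).
    apply: (natinf (fun t => K j.+1 (g t))); apply: gr.
    exact: KS.
  have n2 : \forall m \near \oo, (j.+2 <= m)%N by exact: nbhs_infty_ge.
  have [m []] := filter_ex (@filterI _ _ _ _ _ n1 n2).
  rewrite gz; case: m => // m h jm; apply: (Kz m); exact: Kmono h.
have nb : nbhs 0%E [set l | (l < eps%:E)%E].
  by apply: open_nbhs_nbhs; split; [exact: open_ereal_lt_ereal|rewrite /= lte_fin].
have n1 : \forall t \near +oo, (cosmological_time S (g t) < eps%:E)%E.
  exact: (time_vanishes (ltry 0) gi nb).
have [m /= h] := filter_ex (natinf _ n1).
by move: (ze m); rewrite -gz leNgt h.
Qed.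

Lemma past_curve_cau (b : \bar R) g (u v : R) : past_causal_curve S (ico0 b) g ->
  0 <= u -> u <= v -> (v%:E < b)%E -> cau S (g v) (g u).
Proof.
move=> /past_causal_curve_opp/(future_causal_locally Hsc) lc u0 uv vb.
have sub : `[- v, - u]%classic `<=` (fun t : R => - t) @^-1` ico0 b.
  move=> t; rewrite /= in_itv /= => /andP[t1 t2]; split.
    by rewrite lerNr oppr0 (le_trans t2)// oppr_le0.
  by apply: le_lt_trans vb; rewrite lee_fin lerNl.
have := locally_causal_cau (locally_causal_sub sub lc) (t := - u).
by rewrite /= !opprK; apply; rewrite lexx lerN2 uv.
Qed.

Lemma past_length_le (a b : \bar R) g s z : (0 < b)%E -> past_causal_curve S (ico0 b) g ->
  change_of_parameter (ico0 a) (ico0 b) s -> chr S (g 0) z ->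
  (lorentz_length S (ico0 a) (g \o s) <= cosmological_time S z)%E.
Proof.
move=> b0 gp sP gz; apply: ge_ereal_sup => l [u [v [[u0 ua] [v0 va] uv gl]]].
have sub : `[u, v]%classic `<=` ico0 a.
  move=> t; rewrite /= in_itv /= => /andP[t1 t2]; split; first exact: le_trans t1.
  by apply: le_lt_trans va; rewrite lee_fin.
have Bc (x y w : R) : ico0 b x -> ico0 b y -> x <= w <= y -> ico0 b w.
  move=> [x0 _] [_ yb] /andP[xw wy]; split; first exact: le_trans xw.
  by apply: le_lt_trans yb; rewrite lee_fin.
have sP' := change_of_parameter_itv sP sub (ltW uv) Bc.
have [[sf _ _] sm] := sP.
by apply: (past_length_bound Hsc gp gz (sf u _) (sf v _) (sm u v _ _ uv) (is_length_comp sP' gl));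
  rewrite ?inE.
Qed.

(** Triangle inequality for a telescoping sum; where no alternating curve exists, the infimum [+oo]
    respects the bound. *)
Lemma null_dist_ge (tau : M -> R) p q : (`|tau p - tau q|%:E <= null_dist S tau p q)%E.
Proof.
apply: le_ereal_inf_tmp => _ [u [v [c [k [t [[_ [t0 tk _] _] <- <- ->]]]]]].
rewrite lee_fin -t0 -tk distrC -(telescope_sumr (fun m => tau (c (t m))) (leq0n k)) big_mkord.
exact: ler_norm_sum.
Qed.

(** From an interior point the curve would continue inside [K] and enlarge the component beyond [L].
    As [s] is given only as an increasing bijection, the continuation is found in the parameter of
    [g] and pulled back. *)
Lemma exit_not_interior (K : set M) (a b : \bar R) g (s : R -> R) (L : R) :
  {within ico0 b, continuous g} -> change_of_parameter (ico0 a) (ico0 b) s -> ico0 a 0 ->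
  K (g (s 0)) ->
  connected_component (ico0 a `&` (g \o s) @^-1` K) 0 = `[0, L]%classic ->
  [/\ 0 <= L, ico0 a L, K (g (s L)) & ~ K^° (g (s L))].
Proof.
move=> gc [[sf si ss] sm] a0 K0 cE.
have L0 : 0 <= L.
  have : `[0, L]%classic 0 by rewrite -cE; exact: connected_component_refl (conj a0 K0).
  by rewrite /= in_itv /= lexx.
have cs : `[0, L]%classic `<=` ico0 a `&` (g \o s) @^-1` K.
  by rewrite -cE; exact: connected_component_sub.
have [aL KL] : (ico0 a `&` (g \o s) @^-1` K) L by apply: cs; rewrite /= in_itv /= L0 lexx.
split=> // iK.
have nK : nbhs (g (s L)) K by exact: iK.
have H : \forall u \near s L, ico0 b u -> K (g u) := (within_contP _ _).1 gc _ (sf _ aL) _ nK.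
have [e /= e0 He] := (nbhs_ballP _ _).1 H.
have [L1 aL1 LL1] : exists2 L1, ico0 a L1 & L < L1.
  case: aL => _; case: (a) => [r| |] //; rewrite ?lte_fin => La.
    by exists ((L + r) / 2); [split; [|rewrite lte_fin]|]; lra.
  by exists (L + 1)%R; [split; [lra|exact: ltry]|lra].
have sL1 := sm _ _ (mem_set aL) (mem_set aL1) LL1.
have mono (x y : R) : ico0 a x -> ico0 a y -> x <= y -> s x <= s y.
  move=> ax ay; rewrite le_eqVlt => /orP[/eqP ->//|xy]; apply: ltW.
  by apply: sm => //; exact/mem_set.
(* A parameter in the range of [s], beyond [s L], and so close to it that [g] stays in [K] in
   between. *)
pose w := Num.min (s L1) (s L + e / 2).
have Lw : s L < w by rewrite lt_min sL1 ltrDl divr_gt0.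
have bw : ico0 b w.
  split; first by apply: le_trans (ltW Lw); case: (sf _ aL).
  by apply: (@le_lt_trans _ _ (s L1)%:E); [rewrite lee_fin ge_min lexx|case: (sf _ aL1)].
have [L' aL' L'E] := ss _ bw.
have LL' : L < L'.
  by rewrite ltNge; apply/negP => h; have := mono _ _ aL' aL h; rewrite L'E leNgt Lw.
have : `[0, L]%classic L'; last by rewrite /= in_itv /= => /andP[_]; rewrite leNgt LL'.
have h1 : `[0, L']%classic 0 by rewrite /= in_itv /= lexx (le_trans L0)// ltW.
have h2 : `[0, L']%classic L' by rewrite /= in_itv /= (le_trans L0 (ltW LL')) lexx.
suff h3 : `[0, L']%classic `<=` ico0 a `&` (g \o s) @^-1` K.
  by have := connected_component_max h1 h3 (@segment_connected R 0 L') h2; rewrite cE.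
move=> t; rewrite /= in_itv /= => /andP[t0 tL'].
have [tL|/ltW Lt] := leP t L; first by apply: cs; rewrite /= in_itv /= t0.
have at' : ico0 a t.
  by split=> //; apply: le_lt_trans aL'.2; rewrite lee_fin.
split=> //; apply: He (sf _ at'); have := mono _ _ aL at' Lt.
have := mono _ _ at' aL' tL'; rewrite L'E /w le_min => /andP[_ h3] h4.
rewrite /ball /= ltr_distl; apply/andP; split; lra.
Qed.

End EscapingCurves.

(** For [k] at least [j] the row [h k] is a subsequence of the row [h j], and a strictly increasing
    reindexing never lowers an index; so [h k k] is [h j m'] for some [m'] with [k <= m']. *)
Lemma diagonal_subsequence (h : nat -> nat -> nat) :
  (forall j, exists2 psi, strictly_increasing psi & h j.+1 = h j \o psi) ->
  forall j (P : nat -> Prop), (\forall i \near \oo, P (h j i)) -> \forall k \near \oo, P (h k k).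
Proof.
move=> hP j P [N _ NP].
have sub d m : exists2 m', (m <= m')%N & h (d + j)%N m = h j m'.
  elim: d m => [|d ih] m; first by exists m.
  have [psi psiP ->] := hP (d + j)%N.
  have pm i : (i <= psi i)%N by elim: i => // i ih'; exact: leq_ltn_trans ih' (psiP _ _ (ltnSn i)).
  by have [m' mm' /= ->] := ih (psi m); exists m' => //; exact: leq_trans (pm m) mm'.
exists (maxn N j) => // k /= ; rewrite geq_max => /andP[Nk jk].
have [m' km' hE] := sub (k - j)%N k; rewrite subnK// in hE.
by rewrite hE; apply: NP; exact: leq_trans Nk km'.
Qed.

Lemma at_end_proper_filter (R : realType) (b : \bar R) : (0 < b)%E -> ProperFilter (at_end b).
Proof.
by case: b => [r _|_|] //=; [exact: at_left_proper_filter|exact: proper_pinfty_nbhs].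
Qed.

Theorem theorem4p5 (R : realType) (n : nat) (M : topologicalType)
    (S : spacetime R n M)
    (Hgh : globally_hyperbolic S)
    (Hreg : regular_cosmological_time S)
    (tau : M -> R) (Htau : forall p, tau p = fine (cosmological_time S p))
    (gam : nat -> R -> M) (b : nat -> \bar R)
    (Hb : forall i, (0 < b i)%E)
    (Hgam : forall i, past_inextendible S (b i) (gam i))
    (x : M) (Hx : gam i 0 @[i --> \oo] --> x)
    (a_ : nat -> R)
    (Ha_ : forall i,
       tau (gam i 0) - tau (gam i t) @[t --> at_end (b i)] --> a_ i)
    (s : nat -> R -> R)
    (Hs : forall i,
       change_of_parameter (ico0 (a_ i)%:E) (ico0 (b i)) (s i))
    (Hstau : forall i t, ico0 (a_ i)%:E t ->
       tau (gam i (s i t)) = tau (gam i 0) - t)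
    (gamma : R -> M) (a : \bar R) (idx : nat -> nat)
    (Hlim : limit_curve_construction (null_dist S tau)
       (fun i => gam i \o s i) a_ x gamma a idx) :
  ((exists C : R, forall k,
      (lorentz_length S (ico0 (a_ (idx k))%:E) (gam (idx k) \o s (idx k))
       <= C%:E)%E) /\
   (exists C : R, forall k, a_ (idx k) <= C)) /\
  limn_esup (fun k => (a_ (idx k))%:E) = a.
Proof.
have [Hsc Hc] := Hgh; have [Hfin Hvan] := Hreg.
have tauE p : cosmological_time S p = (tau p)%:E.
  by rewrite Htau fineK// cosmological_time_fin_num.
have aE i : a_ i = tau (gam i 0).
  have F := at_end_proper_filter (Hb i).
  have h : tau (gam i t) @[t --> at_end (b i)] --> (0 : R).
    have -> : (fun t => tau (gam i t)) = fine \o (fun t => cosmological_time S (gam i t)).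
      by apply/funext => t; rewrite /= -Htau.
    exact: (fine_cvg (Hvan _ _ (Hb i) (Hgam i))).
  have h' := cvgB (cvg_cst (tau (gam i 0))) h; rewrite subr0 in h'.
  exact: (norm_cvg_unique (Ha_ i) (h' _ _)).
pose P i C := a_ i <= C /\ (lorentz_length S (ico0 (a_ i)%:E) (gam i \o s i) <= C%:E)%E.
have Pchr i z : chr S (gam i 0) z -> P i (tau z).
  move=> iz; rewrite /P -tauE; split; last exact: past_length_le (Hb i) (Hgam i).1 (Hs i) iz.
  by rewrite aE -lee_fin -!tauE; exact: cosmological_time_mono.
have Ple i C C' : C <= C' -> P i C -> P i C'.
  move=> CC [h1 h2]; split; first exact: le_trans h1 CC.
  by apply: le_trans h2 _; rewrite lee_fin.
have above p : exists z, chr S p z.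
  by have [[z _ pz] _] := chr_near S (filterT : nbhs p setT); exists z.
have [C CP] : exists C, forall i, P i C.
  have [z0 xz0] := above x.
  have n0 : \forall i \near \oo, chr S (gam i 0) z0 := Hx _ (chr_openl xz0).
  have [N _ HN] := n0.
  (* The bounds are claimed for every index, so each of the finitely many early curves gets a point
     [z] of its own. *)
  have [C HC] : exists C, forall i, (i < N)%N -> P i C.
    elim: (N) => [|m [C HC]]; first by exists 0.
    have [z mz] := above (gam m 0).
    exists (Num.max C (tau z)) => i; rewrite ltnS leq_eqVlt => /orP[/eqP ->|im].
      by apply: Ple (Pchr _ _ mz); rewrite le_max lexx orbT.
    by apply: Ple (HC _ im); rewrite le_max lexx.
  exists (Num.max C (tau z0)) => i; have [iN|Ni] := ltnP i N.
    by apply: Ple (HC _ iN); rewrite le_max lexx.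
  by apply: Ple (Pchr i z0 (HN _ Ni)); rewrite le_max lexx orbT.
split; first by split; exists C => k; case: (CP (idx k)).
(* In the contained case the construction itself provides [a_ (idx k) --> a], and the limit superior
   is that limit. *)
have [K [Kex K1x [[_ [_ _ _ ha _]]|[_ esc]]]] := Hlim; first exact: (cvg_limn_einf_sup ha).2.
case: esc => e [alev [h [alim [gm [[_ eK eKj _ ecomp] [h0 [hP [ha _ hidx]]]]]]]].
have ea i : ico0 (a_ (e i))%:E 0.
  have [t [t0 ta] _] := eKj i 1%N isT; split; first exact: lexx.
  by apply: le_lt_trans ta; rewrite lee_fin.
have Kmono := compact_exhaustion_mono Kex.
(* The level is [j.+1] because the construction supplies data from level 1 on, and the curves start
   in [K 1]. *)
have exitP i j := exit_not_interior (Hgam (e i)).1.1 (Hs (e i)) (ea i)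
  (Kmono 1%N j.+1 isT _ (eK i)) (ecomp i j.+1 isT).
have levtau i j : tau (gam (e i) (s (e i) (alev j.+1 i))) = a_ (e i) - alev j.+1 i.
  by have [_ al _ _] := exitP i j; rewrite Hstau// -aE.
have psiP j : exists2 psi, strictly_increasing psi & h j.+1 = h j \o psi by case: (hP j).
have diag := diagonal_subsequence psiP.
pose T := tau (gm 1%N 0).
pose dl j k := alev j.+1 (h k k).
have aT : a_ (idx k) @[k --> \oo] --> T.
  apply/cvgrPdist_lt => eps e0.
  have [_ _ av gu _] := hP 0%N.
  have al0 : 0 <= alim 1%N.
    by apply: (ler_cvg_to (cvg_cst 0) av); apply: nearW => i; case: (exitP (h 1%N i) 0%N).
  have n1 := gu eps e0.
  (* Uniform convergence is evaluated at parameter 0, which the rescaling fixes and where [tau]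
     equals [a_]; [null_dist_ge] turns it into convergence of [tau]. *)
  have n2 : \forall i \near \oo, `|T - a_ (e (h 1%N i))| < eps.
    apply: filterS n1 => i /(_ 0); rewrite /= in_itv /= lexx al0 mulr0 mul0r => /(_ isT) hd.
    have := le_lt_trans (null_dist_ge _ _ _ _) hd.
    by rewrite lte_fin Hstau// subr0 -aE distrC.
  have n3 := diag 1%N (fun m => `|T - a_ (e m)| < eps) n2.
  by apply: filterS n3 => k; rewrite hidx.
have alimT j : dl j k @[k --> \oo] --> alim j.+1.
  have [_ _ av _ _] := hP j => A nA; exact: (diag j.+1 (fun m => A (alev j.+1 m)) (av _ nA)).
have alim_le j : alim j.+1 <= T.
  apply: (ler_cvg_to (alimT j) aT); apply: nearW => k; rewrite hidx.
  by have [_ [_ al] _ _] := exitP (h k k) j; rewrite -lee_fin ltW.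
have aT' : (a_ (idx k))%:E @[k --> \oo] --> T%:E.
  by apply: cvg_EFin aT; apply: nearW.
rewrite (cvg_limn_einf_sup aT').2.
have n1 : \forall j \near \oo, (0 < j)%N by exact: nbhs_infty_ge.
apply/eqP; rewrite eq_le; apply/andP; split; last first.
  by apply: (cvge_to_le ha); apply: filterS n1 => -[//|j] _; rewrite lee_fin.
rewrite leNgt; apply/negP => aT1.
(* A number strictly between [a] and [T] leaves the fixed margin [T - c] as lower bound for [tau] at
   the exit points. *)
have [c ac cT] : exists2 c : R, (a < c%:E)%E & c < T.
  case: (a) aT1 => [r| |] //; rewrite ?lte_fin => rT.
    by exists ((r + T) / 2); rewrite ?lte_fin; lra.
  by exists (T - 1); [exact: ltNyr|lra].
have n2 : \forall j \near \oo, ((alim j)%:E < c%:E)%E.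
  have na : nbhs a [set l | (l < c%:E)%E].
    by apply: open_nbhs_nbhs; split; [exact: open_ereal_lt_ereal|].
  exact: ha na.
have [N _ HN] := n2.
have Tc : 0 < T - c by rewrite subr_gt0.
(* Only levels beyond [N] are kept, where [alim] is below [c]; the additional successor skips level
   0. *)
pose K' j := K (j + N).+1.
pose q j k := gam (e (h k k)) (s (e (h k k)) (alev (j + N).+1 (h k k))).
apply: (@escaping_sequence_time _ _ _ S Hsc Hc Hvan K' q (T - c)) => //.
- have [cK KS KT] := Kex; split=> [j|j|]; [exact: cK|exact: KS|].
  apply/seteqP; split=> // p _; have [j _ Kj] : (\bigcup_j K j) p by rewrite KT.
  by exists j => //; apply: Kmono Kj; rewrite leqW// leq_addr.
- by move=> j; apply: nearW => k; case: (exitP (h k k) (j + N)%N).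
- by move=> j; apply: nearW => k; case: (exitP (h k k) (j + N)%N).
- move=> j; apply: nearW => k.
  set i := h k k; have [l0 al Kl _] := exitP i (j + N)%N.
  have [l0' al' Kl' _] := exitP i (j.+1 + N)%N.
  (* Exit times increase with the level: the component for the smaller compact set is a connected
     subset of the preimage of the larger one. *)
  have le : alev (j + N).+1 i <= alev (j.+1 + N).+1 i.
    have h1 : `[0, alev (j + N).+1 i]%classic 0 by rewrite /= in_itv /= lexx l0.
    have h2 : `[0, alev (j + N).+1 i]%classic (alev (j + N).+1 i) by rewrite /= in_itv /= lexx l0.
    have h3 : `[0, alev (j + N).+1 i]%classic `<=`
        ico0 (a_ (e i))%:E `&` (gam (e i) \o s (e i)) @^-1` K (j.+1 + N).+1.
      rewrite -(ecomp i (j + N).+1 isT); apply: subset_trans (@connected_component_sub _ _ _) _.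
      by move=> t [at' Kt]; split=> //; apply: Kmono Kt.
    have := connected_component_max h1 h3 (@segment_connected R 0 _) h2.
    by rewrite (ecomp i (j.+1 + N).+1 isT) /= in_itv /= => /andP[].
  have [[sf _ _] sm] := Hs (e i).
  have [sl0 _] := sf _ al; have [_ sb] := sf _ al'.
  apply: (past_curve_cau Hsc (Hgam (e i)).1 sl0 _ sb).
  move: le; rewrite le_eqVlt => /orP[/eqP ->//|lt]; apply: ltW.
  by apply: sm => //; exact/mem_set.
(* At the exit point [tau] is [a_] minus the exit time, by [levtau]. Along the diagonal this tends
   to [T] minus [alim], which exceeds [T - c]. *)
- move=> j; have n3 := cvgB aT (alimT (j + N)%N).
  have al : T - c < T - alim (j + N).+1.
    by rewrite ltrD2l ltrN2 -lte_fin; apply: HN; rewrite /= leqW// leq_addl.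
  have n4 : \forall k \near \oo, T - c < a_ (idx k) - dl (j + N)%N k.
    exact: (cvgr_gt _ (n3 _) _ al).
  apply: filterS n4 => k hk; rewrite tauE lee_fin levtau -hidx; exact: ltW.
Qed.
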